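(* Let $f_{\mathrm{in}}\in X_{0,1}$ be nonnegative. For every $n\in\mathbb{N}$ let $u_n\in\mathcal{U}$ and let $K_n$, $\alpha_n(x)=\alpha_0^nx^{\lambda_n}$, $b_n(x,y)=\frac{2+\nu_n}{y}\left(\frac{x}{y}\right)^{\nu_n}\mathbf{1}_{(0,y)}(x)$ be coefficients satisfying the structural assumptions given in the context; let $f_n$ be the solution of the controlled coagulation-fragmentation equation with control $u_n$, coefficients $(K_n,\alpha_n,b_n)$ and initial condition $f_{\mathrm{in}}$. Assume: (C1) $u_n\rightharpoonup u^\star$ weakly in $L^2(0,T)$; (C2) $K_n\to K^\star$ uniformly on compact subsets of $(0,\infty)^2$, and there exist $\hat\mu>0$, $\hat K_0>0$ such that $K_n(x,y),K^\star(x,y)\le\hat K_0(1+x)^{\hat\mu}(1+y)^{\hat\mu}$ for all $(x,y)\in(0,\infty)^2$ and all $n\in\mathbb{N}$; (C3) $\alpha_0^n\to\alpha_0^\star>0$ and $\lambda_n\to\lambda^\star\in(0,1)$ with $\lambda^\star>\hat\mu$; (C4) $\nu_n\to\nu^\star\in(-1,0]$. Put $\alpha^\star(x)=\alpha_0^\star x^{\lambda^\star}$ and $b^\star(x,y)=\frac{2+\nu^\star}{y}\left(\frac{x}{y}\right)^{\nu^\star}\mathbf{1}_{(0,y)}(x)$, and let $f^\star$ be the unique solution of the controlled coagulation-fragmentation equation with control $u^\star$, coefficients $(K^\star,\alpha^\star,b^\star)$ and the same initial condition $f_{\mathrm{in}}$. Then $f_n\to f^\star$ in $C([0,T],X_{0,\mathrm{w}})$,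 i.e. uniformly in time in the weak topology of $X_0$: for every $\varphi\in L^\infty(0,\infty)$, $$\sup_{t\in[0,T]}\left|\int_0^\infty\bigl(f_n(t,x)-f^\star(t,x)\bigr)\varphi(x)\,dx\right|\to0\quad\text{as }n\to\infty.$$
   Context: Fix $T>0$ and $0<u_{\min}\le 1\le u_{\max}<\infty$. The set of controls is $\mathcal{U}=\{u\in L^2(0,T): u(t)\in[u_{\min},u_{\max}]\text{ for a.e. }t\}$. Spaces: $X_0=L^1(0,\infty)$ with norm $\|\cdot\|_0$; $X_{0,1}=L^1((0,\infty),(1+x)\,dx)$ with norm $\|f\|_{0,1}=\int_0^\infty(1+x)|f(x)|\,dx$. $C([0,T],X_{0,\mathrm{w}})$ is the space of maps $f\colon[0,T]\to X_0$ such that $t\mapsto\int_0^\infty f(t,x)\varphi(x)\,dx$ is continuous for every $\varphi\in L^\infty(0,\infty)$. Structural assumptions on $(K,\alpha,b)$: (1) $K\colon(0,\infty)^2\to\mathbb{R}$ is measurable with $K(x,y)=K(y,x)\ge 0$; (2) there are $K_0\ge 0$ and $0\le\mu<1$ with $K(x,y)\le K_0(1+x)^\mu(1+y)^\mu$ for all $x,y>0$; (3) $\alpha(x)=\alpha_0x^\lambda$ with $\alpha_0\ge 0$ and $1>\lambda>\mu$; (4) there is $\nu\in(-1,0]$ with $b(x,y)=\frac{2+\nu}{y}\left(\frac{x}{y}\right)^{\nu}\mathbf{1}_{(0,y)}(x)$. Operators: $\mathcal{C}f(x)=\frac12\int_0^xK(y,x-y)f(y)f(x-y)\,dy-f(x)\int_0^\infty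 K(x,y)f(y)\,dy$ and $\mathcal{F}f(x)=-\alpha(x)f(x)+\int_x^\infty\alpha(y)b(x,y)f(y)\,dy$. The controlled coagulation-fragmentation equation is $\partial_tf(t,x)=u(t)\,\mathcal{C}f(t,x)+\mathcal{F}f(t,x)$. Solution: given $u\in\mathcal{U}$ and $0\le f_{\mathrm{in}}\in X_{0,1}$, a solution is $f\colon[0,T]\to X_{0,1}$ such that for a.e. $x>0$: $f(0,x)=f_{\mathrm{in}}(x)$; $f(t,x)\ge 0$ for all $t\in[0,T]$; $t\mapsto f(t,x)$ is continuous; for all $t\in[0,T]$, $\int_0^t\int_0^\infty K(x,y)f(\tau,y)\,dy\,d\tau<\infty$ and $\int_0^t\int_x^\infty b(x,y)\alpha(y)f(\tau,y)\,dy\,d\tau<\infty$; and for all $t\in[0,T]$, $f(t,x)=f_{\mathrm{in}}(x)+\int_0^t[u(\tau)\mathcal{C}f(\tau,x)+\mathcal{F}f(\tau,x)]\,d\tau$. Standing well-posedness fact (known, from the literature): if $(K,\alpha,b)$ satisfies the structural assumptions, then for every $u\in\mathcal{U}$ and every nonnegative $f_{\mathrm{in}}\in X_{0,1}$ there is a unique solution $f_u$; it conserves mass, $\int_0^\infty xf_u(t,x)\,dx=\int_0^\infty xf_{\mathrm{in}}(x)\,dx$ for all $t\in[0,T]$, and $\|f_u(t)\|_{0,1}\le\|f_{\mathrm{in}}\|_{0,1}\,C e^{Ct}$ with $C>0$ depending only on $\alpha,b$. *)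

(* Defs.v *)
From HB Require Import structures.
From mathcomp Require Import all_boot all_order all_algebra.
From mathcomp Require Import all_classical all_reals all_analysis.

Set Implicit Arguments.
Unset Strict Implicit.
Unset Printing Implicit Defensive.

Import Order.TTheory GRing.Theory Num.Theory.
Import numFieldNormedType.Exports.

Local Open Scope classical_set_scope.
Local Open Scope ring_scope.

Notation leb := (@lebesgue_measure _).
Definition Rpos {R : realType} : set R := `]0, +oo[%classic.

(* Elements of L^p spaces are represented by functions R -> R; only their
   values on the underlying interval, up to null sets, are relevant. *)

Definition in_L2 (R : realType) (T : R) (u : R -> R) : Prop :=
  measurable_fun `]0, T[ u /\
  leb.-integrable `]0, T[ (fun t => ((u t) ^+ 2)%:E).

Definition weakly_cvg_L2 (R : realType) (T : R) (u : nat -> R -> R)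
    (v : R -> R) : Prop :=
  [/\ (forall n, in_L2 T (u n)), in_L2 T v &
      forall g, in_L2 T g ->
        \int[leb]_(t in `]0, T[) (u n t * g t) @[n --> \oo] -->
        \int[leb]_(t in `]0, T[) (v t * g t)].

Definition control (R : realType) (T umin umax : R) (u : R -> R) : Prop :=
  in_L2 T u /\
  {ae leb, forall t, 0 < t < T -> umin <= u t <= umax}.

Definition in_Linfty (R : realType) (phi : R -> R) : Prop :=
  measurable_fun Rpos phi /\
  exists M : R, {ae leb, forall x, 0 < x -> `|phi x| <= M}.

Definition in_X0 (R : realType) (g : R -> R) : Prop :=
  leb.-integrable Rpos (fun x => (g x)%:E).

Definition in_X01 (R : realType) (g : R -> R) : Prop :=
  measurable_fun Rpos g /\
  leb.-integrable Rpos (fun x => ((1 + x) * g x)%:E).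

Definition in_C_X0w (R : realType) (T : R) (f : R -> R -> R) : Prop :=
  (forall t, 0 <= t <= T -> in_X0 (f t)) /\
  (forall phi, in_Linfty phi ->
    {within `[0, T], continuous
      (fun t => \int[leb]_(x in Rpos) (f t x * phi x))}).

Definition cvg_C_X0w (R : realType) (T : R) (f : nat -> R -> R -> R)
    (g : R -> R -> R) : Prop :=
  [/\ (forall n, in_C_X0w T (f n)), in_C_X0w T g &
      forall phi, in_Linfty phi ->
        ereal_sup [set `| \int[leb]_(x in Rpos)
                            ((f n t x - g t x) * phi x)%:E |%E
                  | t in `[0, T]] @[n --> \oo] --> 0%E].

Definition frag_rate (R : realType) (alpha0 lambda : R) (x : R) : R :=
  alpha0 * x `^ lambda.

Definition daughter (R : realType) (nu : R) (x y : R) : R :=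
  (2 + nu) / y * (x / y) `^ nu * \1_(`]0, y[ : set R) x.

Record structural (R : realType) (K : R * R -> R) (alpha0 lambda nu : R)
    : Prop := Structural {
  structural_meas : measurable_fun (Rpos `*` Rpos) K;
  structural_sym : forall x y, 0 < x -> 0 < y -> K (x, y) = K (y, x);
  structural_ge0 : forall x y, 0 < x -> 0 < y -> 0 <= K (x, y);
  structural_growth : exists K0 mu : R,
    [/\ 0 <= K0, 0 <= mu < 1,
        (forall x y, 0 < x -> 0 < y ->
           K (x, y) <= K0 * (1 + x) `^ mu * (1 + y) `^ mu) &
        mu < lambda];
  structural_alpha0 : 0 <= alpha0;
  structural_lambda : lambda < 1;
  structural_nu : -1 < nu <= 0
}.

(* The operators take extended real values, so that no finiteness of the
   integrals is presupposed. *)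

Definition coag (R : realType) (K : R * R -> R) (g : R -> R) (x : R) : \bar R :=
  ((2^-1)%:E * \int[leb]_(y in `]0%R, x[) (K (y, x - y) * g y * g (x - y))%:E
   - (g x)%:E * \int[leb]_(y in Rpos) (K (x, y) * g y)%:E)%E.

Definition frag (R : realType) (alpha : R -> R) (b : R -> R -> R)
    (g : R -> R) (x : R) : \bar R :=
  (- (alpha x * g x)%:E
   + \int[leb]_(y in `]x, +oo[) (alpha y * b x y * g y)%:E)%E.

(* The integral equation is an equality in \bar R.  Its two other terms are
   finite and oo - oo is never finite in \bar R, hence it entails that the
   positive and negative parts of the integrand have finite integrals. *)
Definition is_solution (R : realType) (T : R) (u : R -> R) (K : R * R -> R)
    (alpha : R -> R) (b : R -> R -> R) (fin : R -> R) (f : R -> R -> R)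
    : Prop :=
  (forall t, 0 <= t <= T -> in_X01 (f t)) /\
  {ae leb, forall x, 0 < x ->
    [/\ f 0 x = fin x,
        (forall t, 0 <= t <= T -> 0 <= f t x),
        {within `[0, T], continuous (fun t => f t x)},
        (forall t, 0 <= t <= T ->
          (\int[leb]_(tau in `]0%R, t[)
             \int[leb]_(y in Rpos) (K (x, y) * f tau y)%:E < +oo)%E /\
          (\int[leb]_(tau in `]0%R, t[)
             \int[leb]_(y in `]x, +oo[)
               (b x y * alpha y * f tau y)%:E < +oo)%E) &
        (forall t, 0 <= t <= T ->
          ((f t x)%:E = (fin x)%:E
            + \int[leb]_(tau in `]0%R, t[)
                ((u tau)%:E * coag K (f tau) x + frag alpha b (f tau) x))%E)]}.

Definition conserves_mass (R : realType) (T : R) (fin : R -> R)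
    (f : R -> R -> R) : Prop :=
  forall t, 0 <= t <= T ->
    \int[leb]_(x in Rpos) (x * f t x) = \int[leb]_(x in Rpos) (x * fin x).

(* "The" solution is the mass-conserving one.  [is_solution] alone does not
   determine f: for K = 0, alpha x = x^lambda, 0 < lambda and s > 0,
     f t x = exp (s t) * x^nu * (s + x^lambda)^(-(2 + nu + lambda) / lambda)
   satisfies it although its mass grows, and a mass-conserving solution with
   the same initial value exists as well. *)
Definition the_solution (R : realType) (T : R) (u : R -> R) (K : R * R -> R)
    (alpha : R -> R) (b : R -> R -> R) (fin : R -> R) (f : R -> R -> R)
    : Prop :=
  is_solution T u K alpha b fin f /\ conserves_mass T fin f.

(* Main.v *)
(** The proof is a direct stability estimate for [f_n - f*] in [L^1], without any
    compactness argument.  A mass-conserving solution has bounded particle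
    number: coagulation does not increase the moment of [min (x / e) 1], uniformly
    in [e], and a nested interval argument excludes a blow-up.  Hence it is
    Lipschitz in time with values in [L^1].  Since [lambda > muhat], fragmentation
    dominates coagulation for large sizes: testing with truncated powers bounds
    the time integral of the moment of order [1 + muhat], and testing with
    [min x r] makes the mass dissipated beyond [2 r] of order [o(1 / r)], both
    uniformly in [n].

    The control converges only weakly, so one subtracts from [f_n - f*] the
    remainder [r_n], the time integral of [(u_n - u* ) C* f*], which tends to 0 in
    [L^1 ((1 + x) dx)] uniformly in time.  What is left is integrated against its
    sign and the weight [1 + min x L]; the loss terms are then damping, and
    Gronwall's inequality bounds it by [r_n], by the differences of the
    coefficients acting on [f*], and by tails beyond [L]. *)
Require Import Defs.
From HB Require Import structures.
From mathcomp Require Import all_boot all_order all_algebra.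
From mathcomp Require Import all_classical all_reals all_analysis.
From mathcomp Require Import measurable_realfun.
From mathcomp Require Import ring lra.
Import Order.TTheory GRing.Theory Num.Theory.
Import numFieldNormedType.Exports.
Local Open Scope classical_set_scope.
Local Open Scope ring_scope.

Set Implicit Arguments.
Unset Strict Implicit.
Unset Printing Implicit Defensive.

(** * Measurability of parameter integrals *)

(** The obstacle is that nothing in the definition of a solution bounds the particle number
    uniformly in time: it is finite at each single time, no more. Integrated balances could then
    read oo - oo, so loss and gain stay on opposite sides throughout, and a term is cancelled only
    after its integral has been shown to be finite.

    The initial datum has a first moment only. The weight 1 + x would call for a moment of order 1 +
    lambda, for which no bound is at hand, hence the truncation at L. Its price is that fragments of
    a particle beyond L may carry up to a constant times 1 + L, which is why the dissipated tails
    have to be o(1 / L). The moment of order 1 + muhat is bounded only after integration in time, so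
    Gronwall's inequality is needed with an integrable coefficient.

    The remainder is subtracted before absolute values are taken, because weakly converging controls
    cancel by oscillation and multiplication by the sign of the difference would destroy this. After
    the subtraction the coagulation terms of both solutions carry the same control u_n. *)

Definition jointly_measurable {R : realType} (f : R -> R -> R) :=
  measurable_fun [set: R * R] (fun z => f z.1 z.2).

Section Measurability.
Context {R : realType}.
Local Notation mu := (@lebesgue_measure R).

Lemma jm_comp d (X : measurableType d) (f : R -> R -> R) (a b : X -> R) :
  jointly_measurable f -> measurable_fun setT a -> measurable_fun setT b ->
  measurable_fun setT (fun w => f (a w) (b w)).
Proof.
by move=> mf ma mb; exact: (measurableT_comp mf (measurable_fun_pair ma mb)).
Qed.

Lemma ejm_comp d (X : measurableType d) (f : R -> R -> \bar R) (a b : X -> R) :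
  measurable_fun [set: R * R] (fun z => f z.1 z.2) ->
  measurable_fun setT a -> measurable_fun setT b ->
  measurable_fun setT (fun w => f (a w) (b w)).
Proof.
by move=> mf ma mb; exact: (measurableT_comp mf (measurable_fun_pair ma mb)).
Qed.

Lemma measurable_slice (f : R -> R -> R) (t : R) :
  jointly_measurable f -> measurable_fun setT (f t).
Proof.
by move=> mf; apply: (jm_comp mf); [exact: measurable_cst|exact: measurable_id].
Qed.

Lemma measurable_comp1 d (X : measurableType d) (f : R -> R) (a : X -> R) :
  measurable_fun setT f -> measurable_fun setT a ->
  measurable_fun setT (fun w => f (a w)).
Proof. by move=> mf ma; exact: (measurableT_comp mf). Qed.

Lemma measurable_ecomp1 d (X : measurableType d) (f : R -> \bar R) (a : X -> R) :
  measurable_fun setT f -> measurable_fun setT a ->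
  measurable_fun setT (fun w => f (a w)).
Proof. by move=> mf ma; exact: (measurableT_comp mf). Qed.

Lemma measurable_comp_fst d1 d2 d3 (X : measurableType d1)
    (Y : measurableType d2) (Z : measurableType d3) (g : X -> Y * Z) :
  measurable_fun setT g -> measurable_fun setT (fun w => (g w).1).
Proof. by move=> mg; exact: (measurableT_comp measurable_fst). Qed.

Lemma measurable_comp_snd d1 d2 d3 (X : measurableType d1)
    (Y : measurableType d2) (Z : measurableType d3) (g : X -> Y * Z) :
  measurable_fun setT g -> measurable_fun setT (fun w => (g w).2).
Proof. by move=> mg; exact: (measurableT_comp measurable_snd). Qed.

Lemma measurable_comp_indic d (X : measurableType d) (A : set R) (a : X -> R) :
  measurable A -> measurable_fun setT a ->
  measurable_fun setT (fun w => \1_A (a w) : R).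
Proof. by move=> mA ma; apply: measurable_comp1 => //; exact: measurable_indic. Qed.

Lemma measurable_comp_powR d (X : measurableType d) (s : R) (a : X -> R) :
  measurable_fun setT a -> measurable_fun setT (fun w => a w `^ s).
Proof. by move=> ma; apply: (measurableT_comp (measurable_powR s)). Qed.

Lemma measurable_inv : measurable_fun setT (fun x : R => x^-1).
Proof.
(* Both sides vanish at 0, where the inverse is 0 by convention. The right side is a monotone
   function times a power of the absolute value. *)
have -> : (fun x : R => x^-1) =
    (fun x => Num.sg x * `|x| `^ (-1)) :> (R -> R).
  apply/funext => x; rewrite powR_inv1//.
  have [->|x0] := eqVneq x 0; first by rewrite sgr0 mul0r invr0.
  by apply: (mulIf x0); rewrite mulVf// {3}[x]numEsg mulrACA mulVf ?normr_eq0// mulr1 -expr2 sqr_sg x0.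
apply: measurable_funM.
  apply: nondecreasing_measurable => // x y xy.
  by case: (sgrP x) => [x0|x0|x0]; case: (sgrP y) => [y0|y0|y0]; lra.
by apply: measurable_comp_powR; exact: normr_measurable.
Qed.

Lemma measurable_comp_inv d (X : measurableType d) (a : X -> R) :
  measurable_fun setT a -> measurable_fun setT (fun w => (a w)^-1).
Proof. by move=> ma; apply: measurable_comp1 => //; exact: measurable_inv. Qed.

Lemma measurable_comp_normr d (X : measurableType d) (a : X -> R) :
  measurable_fun setT a -> measurable_fun setT (fun w => `|a w|).
Proof. by move=> ma; apply: measurable_comp1 => //; exact: normr_measurable. Qed.

Lemma measurable_fine d (X : measurableType d) (a : X -> \bar R) :
  measurable_fun setT a -> measurable_fun setT (fun w => fine (a w)).
Proof. by move=> ma; exact: (measurableT_comp (fine_measurable _)). Qed.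

Lemma measurable_integral d (X : measurableType d) (D : set R)
    (F : X -> R -> \bar R) : measurable D ->
  measurable_fun setT (fun z : X * R => F z.1 z.2) ->
  (forall x y, 0 <= F x y)%E ->
  measurable_fun setT (fun x => \int[mu]_(y in D) F x y)%E.
Proof.
move=> mD mF F0.
have -> : (fun x => \int[mu]_(y in D) F x y)%E =
    (fun x => \int[mu]_y (F x y * (\1_D y)%:E))%E.
  by apply/funext => x; rewrite integral_mkcond epatch_indic.
apply: (@measurable_fun_fubini_tonelli_F _ _ _ _ _ mu
  (fun z : X * R => F z.1 z.2 * (\1_D z.2)%:E)%E).
- apply: emeasurable_funM => //; apply/measurable_EFinP.
  by apply: measurable_comp_indic => //; exact: measurable_snd.
- by move=> z; apply: mule_ge0; rewrite ?lee_fin.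
Qed.

End Measurability.

(** Descends along the syntax of the function. The goals that it leaves are the measurability of
    sets and the nonnegativity of the integrands of parameter integrals, which Tonelli's theorem
    asks for. *)
Ltac mfun1 := lazymatch goal with
  | |- measurable_fun _ (fun w => w) => refine (@measurable_id _ _ _)
  | |- measurable_fun _ (fun w => w.1) => refine measurable_fst
  | |- measurable_fun _ (fun w => w.2) => refine measurable_snd
  | |- measurable_fun _ fst => refine measurable_fst
  | |- measurable_fun _ snd => refine measurable_snd
  | |- measurable_fun _ (fun _ => ?c) => refine (@measurable_cst _ _ _ _ _ c)
  | H : measurable_fun setT ?f |- measurable_fun _ ?f => exact H
  | H : forall t, measurable_fun setT (?f t) |- measurable_fun _ (?f _) =>
      refine (H _)
  | H : jointly_measurable ?f |- measurable_fun _ (?f ?t) =>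
      refine (measurable_slice t H)
  | |- measurable_fun _ (fun w => (@?a w).1) => apply: (@measurable_comp_fst _ _ _ _ _ _ a)
  | |- measurable_fun _ (fun w => (@?a w).2) => apply: (@measurable_comp_snd _ _ _ _ _ _ a)
  | |- measurable_fun _ (fun w => (@?a w)%:E) => apply/(@measurable_EFinP _ _ _ _ a)
  | |- measurable_fun _ (fun w => (@?a w + @?b w)%R) => first [apply: (@measurable_funD _ _ _ _ a b) | apply: (@emeasurable_funD _ _ _ _ a b)]
  | |- measurable_fun _ (fun w => (- @?a w)%R) => apply: (@measurable_funN _ _ _ _ a)
  | |- measurable_fun _ (fun w => (@?a w * @?b w)%R) => apply: (@measurable_funM _ _ _ _ a b)
  | |- measurable_fun _ (fun w => (@?a w + @?b w)%E) => apply: (@emeasurable_funD _ _ _ _ a b)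
  | |- measurable_fun _ (fun w => (@?a w * @?b w)%E) => apply: (@emeasurable_funM _ _ _ _ a b)
  | |- measurable_fun _ (fun w => (@?a w)^-1) => apply: (@measurable_comp_inv _ _ _ a)
  | |- measurable_fun _ (fun w => powR (@?a w) _) => apply: (@measurable_comp_powR _ _ _ _ a)
  | |- measurable_fun _ (fun w => `|@?a w|%R) => apply: (@measurable_comp_normr _ _ _ a)
  | |- measurable_fun _ (fun w => Order.max (@?a w) (@?b w)) => apply: (@measurable_maxr _ _ _ _ a b)
  | |- measurable_fun _ (fun w => Order.min (@?a w) (@?b w)) => apply: (@measurable_minr _ _ _ _ a b)
  | |- measurable_fun _ (fun w => \int[_]_(y in _) _)%E => apply: measurable_integral
  | |- measurable_fun _ (fun w => indic ?A (@?a w)) => apply: (@measurable_comp_indic _ _ _ A a)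
  | |- measurable_fun _ (fun w => fine (@?a w)) => apply: (@measurable_fine _ _ _ a)
  | H : jointly_measurable ?f |- measurable_fun _ (fun w => ?f (@?a w) (@?b w)) =>
      apply: (@jm_comp _ _ _ f a b H)
  | H : forall t, jointly_measurable (?f t) |- measurable_fun _ (fun w => ?f ?t (@?a w) (@?b w)) =>
      apply: (@jm_comp _ _ _ (f t) a b (H t))
  | H : measurable_fun _ (fun z => ?f z.1 z.2) |- measurable_fun _ (fun w => ?f (@?a w) (@?b w)) =>
      apply: (@ejm_comp _ _ _ f a b H)
  | H : forall t, measurable_fun setT (?f t) |- measurable_fun _ (fun w => ?f ?t (@?a w)) =>
      first [apply: (@measurable_comp1 _ _ _ (f t) a (H t))
            |apply: (@measurable_ecomp1 _ _ _ (f t) a (H t))]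
  | H : measurable_fun setT ?f |- measurable_fun _ (fun w => ?f (@?a w)) =>
      first [apply: (@measurable_comp1 _ _ _ f a H)
            |apply: (@measurable_ecomp1 _ _ _ f a H)]
  end.

Ltac mfun := repeat mfun1.

(** * Tonelli, translation invariance and functions of Caratheodory type *)

Section Integrals.
Context {R : realType}.
Local Notation mu := (@lebesgue_measure R).

Lemma ge0_integral_indic (D : set R) (F : R -> \bar R) : measurable D ->
  (\int[mu]_(x in D) F x = \int[mu]_x ((\1_D x)%:E * F x))%E.
Proof.
move=> mD; rewrite integral_mkcond epatch_indic.
by apply: eq_integral => x _; rewrite muleC.
Qed.

Lemma tonelli (D E : set R) (F : R -> R -> \bar R) :
  measurable D -> measurable E ->
  measurable_fun setT (fun z : R * R => F z.1 z.2) ->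
  (forall x y, 0 <= F x y)%E ->
  (\int[mu]_(x in D) \int[mu]_(y in E) F x y =
   \int[mu]_(y in E) \int[mu]_(x in D) F x y)%E.
Proof.
move=> mD mE mF F0.
have H (A B : set R) (G : R -> R -> \bar R) : measurable A -> measurable B ->
    measurable_fun setT (fun z : R * R => G z.1 z.2) ->
    (forall x y, 0 <= G x y)%E ->
    (\int[mu]_(x in A) \int[mu]_(y in B) G x y =
     \int[mu]_x \int[mu]_y ((\1_A x * \1_B y)%:E * G x y))%E.
  move=> mA mB mG G0; rewrite ge0_integral_indic//; apply: eq_integral => x _.
  rewrite ge0_integral_indic// -ge0_integralZl//.
  - by apply: eq_integral => y _; rewrite muleA EFinM.
  - apply: emeasurable_funM.
      by apply/measurable_EFinP; exact: measurable_indic.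
    exact: (measurable_fun_pair2 _ mG).
  - by move=> y _; rewrite mule_ge0// lee_fin.
have mF' : measurable_fun setT (fun z : R * R => F z.2 z.1).
  exact: (ejm_comp mF measurable_snd measurable_fst).
rewrite (H D E F mD mE mF F0).
rewrite (H E D (fun x y => F y x) mE mD mF' (fun x y => F0 y x)).
have mG : measurable_fun setT
    (fun z : R * R => (\1_D z.1 * \1_E z.2)%:E * F z.1 z.2)%E.
  by mfun.
have G0 (z : R * R) : (0 <= (\1_D z.1 * \1_E z.2)%:E * F z.1 z.2)%E.
  by apply: mule_ge0; rewrite // lee_fin mulr_ge0.
rewrite (@fubini_tonelli _ _ _ _ _ mu mu _ mG G0)/=.
by apply: eq_integral => x _; apply: eq_integral => y _; rewrite [(_ * \1_D _)%R]mulrC.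
Qed.

(** The image of Lebesgue measure under a translation gives every half-open interval its length, so
    it is Lebesgue measure by uniqueness. *)
Lemma integral_translate (c : R) (F : R -> \bar R) :
  measurable_fun setT F -> (forall x, 0 <= F x)%E ->
  (\int[mu]_x F (x + c)%R = \int[mu]_x F x)%E.
Proof.
move=> mF F0.
pose phi := (fun x => x + c) : measurableTypeR R -> measurableTypeR R.
have mphi : measurable_fun setT phi by exact: measurable_funD.
have /= <- := @ge0_integral_pushforward _ _ _ _ _ _ mphi
  lebesgue_measure setT F measurableT mF
  (fun x _ => F0 x).
apply: eq_measure_integral => A mA _; apply/esym/lebesgue_measure_unique => //.
move=> _ [[a b]] _ <-; have E : phi @^-1` `]a, b]%classic = `]a - c, b - c]%classic.
  by apply/seteqP; split=> x /=; rewrite !in_itv/= /phi ltrBlDr lerBrDr.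
transitivity (mu `]a - c, b - c]%classic); last by rewrite -E.
rewrite !lebesgue_measure_itv/= !lte_fin ltrD2r.
by case: ifPn => //_; congr (_%:E); ring.
Qed.

(** Replacing [t] by [q n t], the multiple of 1 / (n + 1) just below it, gives a countable union of
    measurable rectangles over each measurable set; continuity in [t] yields the limit. [Num.truncn]
    is 0 at negative numbers, so for [t <= 0] the approximation is [f 0 x]: hence the last
    hypothesis. *)
Lemma caratheodory_measurable (f : R -> R -> R) :
  (forall t, measurable_fun setT (f t)) -> (forall x, continuous (f^~ x)) ->
  (forall t x, t <= 0 -> f t x = f 0 x) -> jointly_measurable f.
Proof.
move=> mf cf f0.
pose q n (t : R) := (Num.truncn (t * n.+1%:R))%:R / n.+1%:R : R.
apply: (@measurable_fun_cvg _ _ _ _ (fun n z => f (q n z.1) z.2)) => //.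
- move=> n; have mq : measurable_fun setT (fun t : R => (Num.truncn (t * n.+1%:R))%:R : R).
    apply: nondecreasing_measurable => // x y xy.
    rewrite ler_nat; apply: le_truncn; rewrite ler_pM2r//.
  move=> _ A mA; rewrite setTI.
  have -> : (fun z : R * R => f (q n z.1) z.2) @^-1` A =
    \bigcup_k ((fun t : R => (Num.truncn (t * n.+1%:R))%:R : R) @^-1` [set k%:R] `*`
      (f (k%:R / n.+1%:R) @^-1` A)).
    apply/seteqP; split => [[t x]/= Atx|[t x]/= [k _ /= [+ Afx]]].
      by exists (Num.truncn (t * n.+1%:R)) => //=.
    by rewrite /q => ->.
  apply: bigcup_measurable => k _; apply: measurableX.
    by rewrite -[X in measurable X]setTI; apply: mq => //.
  by rewrite -[X in measurable X]setTI; apply: mf => //.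
- move=> [t x] _ /=; have [t0|t0] := leP t 0.
    rewrite f0//; apply: cvg_near_cst; apply: nearW => n.
    rewrite /q (_ : Num.truncn _ = 0%N) ?mul0r//; apply/eqP.
    by rewrite -leqn0 truncn_le_nat (le_lt_trans _ (@ltr01 R))// mulr_le0_ge0.
  apply: (cvg_comp (q ^~ t) (f^~ x)) _ (cf x t).
  apply/cvgrPdist_le => e e0; near=> n.
  rewrite ger0_norm; last first.
    rewrite subr_ge0 /q ler_pdivrMr//; rewrite truncn_le.
    by rewrite mulr_ge0// ltW.
  apply: (@le_trans _ _ n.+1%:R^-1).
    rewrite /q lerBlDr -[X in X + _]mul1r -mulrDl ler_pdivlMr// addrC natr1.
    apply/ltW; exact: truncnS_gt.
  by apply: ltW; near: n; exact: (near_infty_natSinv_lt (PosNum e0)).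
Unshelve. all: by end_near. Qed.

End Integrals.

(** * Time integrals *)

Section TimeIntegrals.
Context {R : realType}.
Local Notation mu := (@lebesgue_measure R).
Implicit Types (b F G : R -> \bar R) (k h : R -> R).

Lemma aeS (P Q : R -> Prop) : (forall x, P x -> Q x) ->
  {ae mu, forall x, P x} -> {ae mu, forall x, Q x}.
Proof. by move=> PQ; apply: negligibleS => x /= nQ /PQ. Qed.

Lemma aeI (P Q : R -> Prop) : {ae mu, forall x, P x} ->
  {ae mu, forall x, Q x} -> {ae mu, forall x, P x /\ Q x}.
Proof.
move=> nP nQ; apply: negligibleS (negligibleU nP nQ) => x /=.
by move=> nPQ; case: (pselect (P x)) => [Px|]; [right=> Qx; exact: nPQ|left].
Qed.

(** The epsilon-delta form mentions values on [0, T] only, so that continuity passes between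
    functions that agree there. *)
Lemma within_itv_continuousP (T : R) h :
  {within `[0, T], continuous h} <->
  forall s e : R, 0 <= s <= T -> 0 < e ->
    exists2 d, 0 < d & forall s' : R, 0 <= s' <= T -> `|s' - s| < d -> `|h s' - h s| < e.
Proof.
split=> [/subspace_continuousP ch s e sT e0 | H].
  have /ch/cvgrPdist_lt/(_ e e0) : `[0, T]%classic s by rewrite /= in_itv.
  rewrite near_withinE => /nbhs_ballP[d d0 dh]; exists d => // s' s'T ss'.
  rewrite distrC; apply: dh => /=; last by rewrite in_itv.
  by rewrite -ball_normE /= distrC.
apply/subspace_continuousP => s; rewrite /= in_itv/= => sT.
apply/cvgrPdist_lt => e e0; have [d d0 dh] := H s e sT e0.
rewrite near_withinE; apply/nbhs_ballP; exists d => // s' /= ss' s'T.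
by rewrite distrC; apply: dh; [move: s'T; rewrite in_itv|move: ss'; rewrite -ball_normE /= distrC].
Qed.

(** [IA] and [IG] stand for coagulation loss and gain, [Ia] and [IF] for fragmentation loss and
    gain. In the extended reals [IA] may be cancelled because it is finite. *)
Lemma cancel_upper (X Y IA Ia IG IF Ic : \bar R) : IA \is a fin_num ->
  (IG <= IA)%E -> (IF <= Ic)%E -> (X + (IA + Ia) = Y + (IG + IF))%E ->
  (X + Ia <= Y + Ic)%E.
Proof.
move=> Afin GA Fc bal; rewrite -(@leeD2lE _ IA)// addeCA bal addeCA [leRHS]addeCA.
by rewrite [leLHS]addeCA; apply: leeD2l; exact: leeD.
Qed.

(** The counterpart for lower bounds: coagulation may now decrease the moment, by at most the defect
    [IV]. *)
Lemma cancel_lower (X Y IA Ia IG IF Ic IV : \bar R) : IG \is a fin_num ->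
  (IA <= IG + IV)%E -> (Ic <= IF)%E -> (X + (IA + Ia) = Y + (IG + IF))%E ->
  (Y + Ic <= X + (Ia + IV))%E.
Proof.
move=> Gfin AG cF bal; rewrite -(@leeD2lE _ IG)//.
apply: (@le_trans _ _ (Y + (IG + IF))%E); first by rewrite addeCA; apply: leeD2l; exact: leeD2l.
by rewrite -bal [leRHS]addeCA; apply: leeD2l; rewrite addeCA [leLHS]addeC; apply: leeD2l.
Qed.

Lemma lee_cancel (X Y I Z : \bar R) : I \is a fin_num ->
  (X + I <= Y + (I + Z))%E -> (X <= Y + Z)%E.
Proof. by move=> Ifin; rewrite addeC addeCA leeD2lE. Qed.

Lemma ge0_integralDT (D : set R) F G : measurable D ->
  measurable_fun setT F -> measurable_fun setT G ->
  (forall x, 0 <= F x)%E -> (forall x, 0 <= G x)%E ->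
  (\int[mu]_(x in D) (F x + G x) =
   \int[mu]_(x in D) F x + \int[mu]_(x in D) G x)%E.
Proof.
move=> mD mF mG F0 G0; apply: ge0_integralD => //.
  exact: measurable_funS mF.
exact: measurable_funS mG.
Qed.

Lemma ge0_le_integralT (D : set R) F G : measurable D ->
  measurable_fun setT F -> measurable_fun setT G -> (forall x, 0 <= F x)%E ->
  (forall x, D x -> F x <= G x)%E ->
  (\int[mu]_(x in D) F x <= \int[mu]_(x in D) G x)%E.
Proof.
move=> mD mF mG F0 FG; apply: ge0_le_integral => //.
  exact: measurable_funS mF.
exact: measurable_funS mG.
Qed.

Lemma ge0_integralZlT (D : set R) (c : R) F : measurable D -> 0 <= c ->
  measurable_fun setT F -> (forall x, 0 <= F x)%E ->
  (\int[mu]_(x in D) (c%:E * F x) = c%:E * \int[mu]_(x in D) F x)%E.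
Proof.
move=> mD c0 mF F0; apply: ge0_integralZl => //.
exact: measurable_funS mF.
Qed.

Lemma integral_oc_split (r s t : R) F : r <= s -> s <= t ->
  measurable_fun setT F -> (forall x, 0 <= F x)%E ->
  (\int[mu]_(x in `]r, t]) F x =
   \int[mu]_(x in `]r, s]) F x + \int[mu]_(x in `]s, t]) F x)%E.
Proof.
move=> rs st mF F0; rewrite -ge0_integral_setU//=.
- by rewrite -itv_bndbnd_setU// bnd_simp.
- exact: measurable_funS mF.
- by apply/disj_setPS => x [/=]; rewrite !in_itv/= => /andP[_ /le_lt_trans xs] /andP[/xs]; rewrite ltxx.
Qed.

Lemma ge0_integral_oc_mono (r s r' s' : R) F : r' <= r -> s <= s' ->
  measurable_fun setT F -> (forall x, 0 <= F x)%E ->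
  (\int[mu]_(x in `]r, s]) F x <= \int[mu]_(x in `]r', s']) F x)%E.
Proof.
move=> rr ss mF F0; apply: ge0_subset_integral => //.
  exact: measurable_funS mF.
by apply: subset_itv; rewrite bnd_simp.
Qed.

(** A finite integral makes the integrand finite almost everywhere, so the value 0 that [fine] takes
    at infinity matters on a null set only. *)
Lemma integral_fine (D : set R) F : measurable D -> measurable_fun setT F ->
  (forall x, 0 <= F x)%E -> (\int[mu]_(x in D) F x < +oo)%E ->
  (\int[mu]_(x in D) F x = \int[mu]_(x in D) (fine (F x))%:E)%E.
Proof.
move=> mD mF F0 Foo.
have iF : mu.-integrable D F.
  apply/integrableP; split; first exact: measurable_funS mF.
  by under eq_integral do rewrite gee0_abs//.
apply: ge0_ae_eq_integral => //.
- exact: measurable_funS mF.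
- by apply: (@measurable_funS _ _ _ _ setT) => //; mfun.
- by move=> x _; rewrite lee_fin fine_ge0.
- by have := @integrable_ae _ _ _ mu D mD F iF; apply: filterS => x H Dx; rewrite fineK ?H.
Qed.

Lemma ge0_integrable (D : set R) k : measurable D -> measurable_fun setT k ->
  (forall x, 0 <= k x) -> (\int[mu]_(x in D) (k x)%:E < +oo)%E ->
  mu.-integrable D (EFin \o k).
Proof.
move=> mD mk k0 koo; apply/integrableP; split.
  by apply/measurable_EFinP; exact: measurable_funS mk.
by under eq_integral do rewrite /= ger0_norm//.
Qed.

Lemma Rintegral_oc_continuous (T : R) k : 0 <= T ->
  mu.-integrable `]0, T] (EFin \o k) ->
  {within `[0, T], continuous (fun t => \int[mu]_(x in `]0, t]) k x)}.
Proof.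
move=> T0 ik; pose k' := k \_ `]0, T].
have ik' : mu.-integrable `[0, T] (EFin \o k').
  have : mu.-integrable setT ((EFin \o k) \_ `]0, T]).
    by apply/(integrable_mkcond (mu := mu) _ (measurable_itv _)).
  rewrite -restrict_EFin => H.
  exact: (@integrableS _ _ _ mu setT _ _ measurableT _ (@subsetT _ _) H).
have := parameterized_integral_continuous T0 ik'.
move=> /within_itv_continuousP H; apply/within_itv_continuousP => s e sT e0.
have [d d0 dh] := H s e sT e0; exists d => // s' s'T ss'.
have E r : 0 <= r <= T -> \int[mu]_(x in `]0, r]) k x = \int[mu]_(x in `[0, r]) k' x.
  move=> /andP[r0 rT]; rewrite -Rintegral_itv_obnd_cbnd; last first.
    apply: (@integrableS _ _ _ mu `[0, T]%classic) ik' => //.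
    by apply: subset_itv; rewrite bnd_simp.
  apply: eq_Rintegral => x; rewrite inE/= in_itv/= => /andP[x0 xr].
  by rewrite /k' patchE mem_set//= in_itv/= x0 (le_trans xr).
rewrite !E//; exact: dh.
Qed.

Lemma fine_integral_oc_continuous (T : R) F : 0 <= T ->
  measurable_fun setT F -> (forall x, 0 <= F x)%E ->
  (\int[mu]_(x in `]0%R, T]) F x < +oo)%E ->
  {within `[0, T], continuous (fun t => fine (\int[mu]_(x in `]0%R, t]) F x)%E)}.
Proof.
move=> T0 mF F0 Foo.
have /within_itv_continuousP H : {within `[0, T], continuous
    (fun t => \int[mu]_(x in `]0, t]) fine (F x))}.
  apply: Rintegral_oc_continuous => //.
  apply: ge0_integrable => //; first by mfun.
    by move=> x; rewrite fine_ge0.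
  by rewrite -integral_fine.
apply/within_itv_continuousP => s e sT e0.
have [d d0 dh] := H s e sT e0; exists d => // s' s'T ss'.
have E r : 0 <= r <= T ->
    fine (\int[mu]_(x in `]0%R, r]) F x)%E = \int[mu]_(x in `]0, r]) fine (F x).
  move=> /andP[r0 rT]; rewrite /Rintegral -integral_fine//.
  by apply: le_lt_trans Foo; exact: ge0_integral_oc_mono.
rewrite !E//; exact: dh.
Qed.

(* An intermediate value argument cuts [0, t] into n pieces on each of which b has
   integral at most 1/2, and each piece at most doubles the bound. *)
Lemma gronwall_half (T A C : R) (Y b : R -> \bar R) (n : nat) :
  0 <= A -> 0 <= C -> measurable_fun setT Y -> measurable_fun setT b ->
  (forall t, 0 <= Y t)%E -> (forall t, 0 <= b t)%E ->
  (forall t : R, (0 <= t <= T)%R -> Y t <= C%:E)%E ->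
  (forall t : R, (0 <= t <= T)%R -> Y t <= A%:E + \int[mu]_(s in `]0%R, t]) (Y s * b s))%E ->
  forall t : R, 0 <= t <= T -> (\int[mu]_(s in `]0%R, t]) b s <= (n%:R / 2)%:E)%E ->
  (Y t <= (2 ^+ n * A)%:E)%E.
Proof.
move=> A0 C0 mY mb Y0 b0 YC YA.
have mYb : measurable_fun setT (fun s => Y s * b s)%E by mfun.
have Yb0 s : (0 <= Y s * b s)%E by exact: mule_ge0.
(* Unlike [Y], its majorant [Z] is monotone, so that [Z t] bounds [Y] on all of [0, t]. *)
pose Z (t : R) : \bar R := (A%:E + \int[mu]_(s in `]0%R, t]) (Y s * b s))%E.
suff ZA : forall t : R, 0 <= t <= T ->
    (\int[mu]_(s in `]0%R, t]) b s <= (n%:R / 2)%:E)%E -> (Z t <= (2 ^+ n * A)%:E)%E.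
  by move=> t tT bt; apply: le_trans (YA t tT) _; exact: ZA.
have YbC t : 0 <= t <= T -> (\int[mu]_(s in `]0%R, t]) (Y s * b s) <=
    C%:E * \int[mu]_(s in `]0%R, t]) b s)%E.
  move=> /andP[t0 tT]; rewrite -ge0_integralZl//; last exact: measurable_funS mb.
  apply: ge0_le_integral => //.
  - exact: measurable_funS mYb.
  - by apply: (@measurable_funS _ _ _ _ setT) => //; mfun.
  - move=> s /=; rewrite in_itv/= => /andP[s0 st]; apply: lee_wpmul2r => //.
    by apply: YC; rewrite ltW//= (le_trans st).
elim: n => [|n IH] t tT; rewrite /Z.
  rewrite mul0r expr0 mul1r => bt; rewrite -[leRHS]adde0 leeD2l//.
  apply: le_trans (YbC t tT) _; rewrite -(mule0 C%:E) lee_wpmul2l//.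
move=> bt; have [t0 tT'] := andP tT.
have boo : (\int[mu]_(s in `]0%R, t]) b s < +oo)%E by rewrite (le_lt_trans bt)// ltry.
pose M s := fine (\int[mu]_(x in `]0%R, s]) b x)%E.
have ME s : 0 <= s <= t -> (\int[mu]_(x in `]0%R, s]) b x)%E = (M s)%:E.
  move=> /andP[s0 st]; rewrite /M fineK// ge0_fin_numE ?integral_ge0//.
  by apply: le_lt_trans boo; exact: ge0_integral_oc_mono.
have Mt0 : 0 <= M t by rewrite /M fine_ge0// integral_ge0.
have M0 : M 0 = 0 by rewrite /M set_itv_ge ?bnd_simp ?ltxx// integral_set0.
(* Here [s] is a time at which the primitive of [b] has reached n / 2, or has its final value if
   that is smaller. The induction hypothesis applies at [s], and at most 1 / 2 of the integral is
   left on ]s, t]. *)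
have [s st Ms] : exists2 s, s \in `[0, t] & M s = Num.min (M t) (n%:R / 2).
  apply: IVT => //; first exact: fine_integral_oc_continuous.
  rewrite M0 min_l// max_r// le_min ge_min lexx Mt0/= andbT.
  by rewrite divr_ge0.
move: st; rewrite in_itv/= => st; have [s0 st'] := andP st.
have sT : 0 <= s <= T by rewrite s0 (le_trans st').
have Zs : (Z s <= (2 ^+ n * A)%:E)%E.
  by apply: IH => //; rewrite ME// lee_fin Ms ge_min lexx orbT.
have b12 : (\int[mu]_(x in `]s, t]) b x <= (2^-1)%:E)%E.
  have := integral_oc_split s0 st' mb b0; rewrite !ME ?lexx ?t0//.
  move: bt; rewrite ME ?lexx ?t0// lee_fin => bt.
  have : (0 <= \int[mu]_(x in `]s, t]) b x)%E by exact: integral_ge0.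
  case: (\int[mu]_(x in `]s, t]) b x)%E => // r r0 [] Mr.
  rewrite lee_fin; have : M t - M s <= 2^-1.
    rewrite Ms; have [] := leP (M t) (n%:R / 2); rewrite ?subrr//.
    by move=> _; move: bt; rewrite -natr1; lra.
  by rewrite Mr; lra.
(* Finiteness, which comes from the a priori bound [C], is what allows half of [Z t] to be absorbed
   on the left below. *)
have Zt : (\int[mu]_(x in `]0%R, t]) (Y x * b x) < +oo)%E.
  apply: le_lt_trans (YbC t tT) _; rewrite ME ?lexx ?t0//= ltry//.
have Ztfin : (Z t)%E \is a fin_num.
  rewrite ge0_fin_numE; first by apply: lte_add_pinfty => //; rewrite ltry.
  by apply: adde_ge0 => //; exact: integral_ge0.
have Zmono x : 0 <= x -> x <= t -> (Z x <= Z t)%E.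
  by move=> x0 xt; apply: leeD2l; exact: ge0_integral_oc_mono.
have step : (Z t <= Z s + Z t * (2^-1)%:E)%E.
  rewrite {1}/Z (integral_oc_split s0 st')// addeA -/(Z s); apply: leeD2l.
  apply: (@le_trans _ _ (\int[mu]_(x in `]s, t]) (Z t * b x))%E).
    apply: ge0_le_integral => //.
    - exact: measurable_funS mYb.
    - by apply: (@measurable_funS _ _ _ _ setT) => //; mfun.
    - move=> x /=; rewrite in_itv/= => /andP[sx xt]; apply: lee_wpmul2r => //.
      have x0 : 0 <= x by rewrite (le_trans s0)// ltW.
      by apply: le_trans (Zmono x x0 xt); apply: YA; rewrite x0 (le_trans xt).
  rewrite ge0_integralZl//; [|exact: measurable_funS mb|].
    by rewrite lee_wpmul2l// adde_ge0 ?integral_ge0.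
  by rewrite adde_ge0 ?integral_ge0.
have Zsfin : (Z s)%E \is a fin_num.
  rewrite ge0_fin_numE; first by rewrite (le_lt_trans Zs)// ltry.
  by apply: adde_ge0 => //; exact: integral_ge0.
move: step Zs; rewrite -/(Z t) -(fineK Ztfin) -(fineK Zsfin) -EFinM -EFinD !lee_fin.
by rewrite exprS; lra.
Qed.

Lemma dominated_cvg0 (D : set R) (F_ : nat -> R -> \bar R) G :
  measurable D -> (forall n, measurable_fun setT (F_ n)) ->
  measurable_fun setT G -> (forall n x, 0 <= F_ n x)%E ->
  (forall n x, D x -> F_ n x <= G x)%E -> (\int[mu]_(x in D) G x < +oo)%E ->
  {ae mu, forall x, D x -> F_ n x @[n --> \oo] --> 0%E} ->
  (\int[mu]_(x in D) F_ n x)%E @[n --> \oo] --> 0%E.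
Proof.
move=> mD mF mG F0 FG Goo Fcvg.
have G0 x : D x -> (0 <= G x)%E by move=> Dx; exact: le_trans (F0 0%N x) (FG 0%N x Dx).
have iG : mu.-integrable D G.
  apply/integrableP; split; first exact: measurable_funS mG.
  by under eq_integral => x /set_mem Dx do rewrite gee0_abs ?G0//.
have [] := @dominated_convergence _ _ _ mu D mD F_ (cst 0%E) G.
- by move=> n; exact: measurable_funS (mF n).
- exact: measurable_cst.
- exact: Fcvg.
- exact: iG.
- by apply: aeW => x n Dx; rewrite gee0_abs ?FG.
- by move=> _ _; rewrite integral0.
Qed.

End TimeIntegrals.

(** * The absolute value of an indefinite integral *)

Section SignBalance.
Context {R : realType}.
Local Notation mu := (@lebesgue_measure R).

(** The set of times [s] with [S 0 <= S s] contains its supremum by local monotonicity to the left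
    of it, and local monotonicity to the right would push a supremum smaller than [t] further. *)
Lemma locally_nondecreasing_le (t : R) (S : R -> R) : 0 <= t ->
  (forall s : R, 0 <= s <= t -> exists2 d : R, 0 < d &
    forall s1 s2 : R, 0 <= s1 -> s1 <= s2 -> s2 <= t ->
      `|s1 - s| < d -> `|s2 - s| < d -> S s1 <= S s2) ->
  S 0 <= S t.
Proof.
move=> t0 loc; pose E := [set s : R | 0 <= s <= t /\ S 0 <= S s].
have E0 : E 0 by split; rewrite ?lexx.
have hE : has_sup E by split; [exists 0|exists t => s [/andP[]]].
set c := sup E.
have c0 : 0 <= c by apply: sup_upper_bound E0.
have ct : c <= t by apply: ge_sup => //; [exists 0|move=> s [/andP[]]].
have [|d d0 H] := loc c; first by rewrite c0.
have [s [/andP[s0 st] Ss] cs] := sup_adherent d0 hE.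
have sc : s <= c by apply: sup_upper_bound => //; split; rewrite ?s0.
have Sc : S 0 <= S c.
  apply: le_trans Ss (H s c _ _ _ _ _) => //.
    by rewrite distrC ger0_norm ?subr_ge0//; rewrite -/c in cs; lra.
  by rewrite subrr normr0.
have [<-//|ct'] := eqVneq c t.
have {ct'} ct' : c < t by rewrite lt_neqAle ct'.
have : Num.min t (c + d / 2) <= c.
  apply: sup_upper_bound => //; split.
    by rewrite le_min t0 ge_min lexx/= addr_ge0// divr_ge0// ltW.
  apply: le_trans Sc (H _ _ _ _ _ _ _) => //.
  - by rewrite le_min ct lerDl divr_ge0// ltW.
  - by rewrite ge_min lexx.
  - by rewrite subrr normr0.
  - rewrite ger0_norm; last by rewrite subr_ge0 le_min ct lerDl divr_ge0// ltW.
    by rewrite ltrBlDr gt_min; apply/orP; right; rewrite addrC ltrD2r; lra.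
by rewrite ge_min; lra.
Qed.

Lemma integrable_le_scale (D : set R) (k g : R -> R) (c : R) : measurable D ->
  mu.-integrable D (EFin \o k) -> measurable_fun D g ->
  (forall s, D s -> `|g s| <= c * `|k s|) -> mu.-integrable D (EFin \o g).
Proof.
move=> mD ik mg gk.
have ick : mu.-integrable D (fun s => c%:E * (EFin \o k) s)%E by exact: integrableZl.
apply: (@le_integrable _ _ _ mu D mD) ick; first exact/measurable_EFinP.
move=> s Ds /=; rewrite lee_fin normrM (le_trans (gk s Ds))//.
by apply: ler_wpM2r => //; exact: ler_norm.
Qed.

(** A Lipschitz approximation of the sign, to which it tends as [e] tends to 0. *)
Definition clamp (e b : R) := Num.max (-1) (Num.min 1 (b / e)).

Lemma clamp_norm_le1 (e b : R) : `|clamp e b| <= 1.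
Proof.
rewrite ler_norml /clamp le_max lexx/= ge_max ge_min lexx/= andbT.
by apply: le_trans (@ler01 R); lra.
Qed.

Lemma clamp_lipschitz (e a b : R) : 0 < e ->
  `|clamp e a - clamp e b| <= `|a - b| / e.
Proof.
move=> e0; have -> : `|a - b| / e = `|a / e - b / e|.
  by rewrite -mulrBl normrM [`|e^-1|]gtr0_norm ?invr_gt0.
rewrite /clamp; move: (a / e) (b / e) => x y.
have [x1|x1] := leP 1 x; have [y1|y1] := leP 1 y;
have [x2|x2] := leP x (-1); have [y2|y2] := leP y (-1);
  rewrite ?(min_l x1) ?(min_r (ltW x1)) ?(min_l y1) ?(min_r (ltW y1));
  rewrite ?(max_l x2) ?(max_r (ltW x2)) ?(max_l y2) ?(max_r (ltW y2)); try lra;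
  rewrite ?[Num.max _ 1]max_r ?subrr ?normr0//; try lra;
  rewrite ler_norml; (have [xy|xy] := lerP 0 (x - y);
    [rewrite (ger0_norm xy) | rewrite (ltr0_norm xy)]); lra.
Qed.

(* A convex C^1 approximation of the absolute value, with derivative clamp e. *)
Definition huber (e b : R) := clamp e b * b - e * clamp e b ^+ 2 / 2.

Lemma clampE (e a : R) : 0 < e ->
  [\/ e <= a /\ clamp e a = 1, a <= - e /\ clamp e a = -1
    | a = e * clamp e a /\ -1 <= clamp e a <= 1].
Proof.
move=> e0; have := clamp_norm_le1 e a; rewrite /clamp.
have aE : a = e * (a / e) by rewrite mulrC divfK// gt_eqF.
have [x1|x1] := leP 1 (a / e).
  rewrite ler_pdivlMr ?mul1r// in x1.
  by rewrite max_r; [constructor 1|lra].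
have [x2|x2] := leP (a / e) (-1).
  by rewrite ler_pdivrMr ?mulN1r// in x2; constructor 2.
by rewrite ler_norml; constructor 3.
Qed.

(** [huber e a] is the maximum of [p * a - e * p ^+ 2 / 2] over |p| <= 1, attained at
    [p = clamp e a]. The competitor [p = clamp e b] gives the inequality. *)
Lemma huber_convex (e a b : R) : 0 < e ->
  huber e b - huber e a <= clamp e b * (b - a).
Proof.
move=> e0; rewrite /huber.
have : `|clamp e b| <= 1 by exact: clamp_norm_le1.
move: (clamp e b) => p; rewrite ler_norml => /andP[p1 p2].
case: (clampE a e0) => [[ea ->]|[ea ->]|[]].
- have : 0 <= (1 - p) * (a - e) by rewrite mulr_ge0// subr_ge0.
  have : 0 <= e * (1 - p) ^+ 2 by rewrite mulr_ge0 ?sqr_ge0// ltW.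
  by nra.
- have : 0 <= (1 + p) * (- a - e) by rewrite mulr_ge0//; lra.
  have : 0 <= e * (1 + p) ^+ 2 by rewrite mulr_ge0 ?sqr_ge0// ltW.
  by nra.
- move: (clamp e a) => q -> _.
  have : 0 <= e * (p - q) ^+ 2 by rewrite mulr_ge0 ?sqr_ge0// ltW.
  by nra.
Qed.

Lemma huber_ge (e a : R) : 0 < e -> `|a| - e / 2 <= huber e a.
Proof.
move=> e0; rewrite /huber.
case: (clampE a e0) => [[ea ->]|[ea ->]|[]].
- by rewrite ger0_norm; lra.
- by rewrite ler0_norm; lra.
- move: (clamp e a) => q -> /andP[q1 q2]; rewrite normrM (gtr0_norm e0).
  have : 0 <= e * (1 - `|q|) ^+ 2 by rewrite mulr_ge0 ?sqr_ge0// ltW.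
  have -> : q ^+ 2 = `|q| ^+ 2 by rewrite real_normK ?num_real.
  have -> : q * (e * q) = e * `|q| ^+ 2 by rewrite real_normK ?num_real//; ring.
  by nra.
Qed.

Lemma measurable_clamp (e : R) : measurable_fun setT (clamp e).
Proof. rewrite /clamp; mfun. Qed.

(** A chain rule for [huber e] without differentiating [h]. On a short interval, convexity bounds
    the increment of [huber e (h s)] by the clamp at the right end times the integral of [k], and
    the clamp varies by at most eta there. So the integral of [clamp e (h s) * k s + eta * |k s|]
    minus [huber e (h s)] is locally nondecreasing, for every eta > 0. *)
Lemma clamp_balance (t e : R) (k h : R -> R) : 0 <= t -> 0 < e ->
  mu.-integrable `]0, t] (EFin \o k) -> measurable_fun setT h ->
  (forall s : R, 0 <= s <= t -> h s = \int[mu]_(x in `]0, s]) k x) ->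
  `|h t| <= e / 2 + \int[mu]_(s in `]0, t]) (clamp e (h s) * k s).
Proof.
move=> t0 e0 ik mh hk.
have mk : measurable_fun `]0, t] k.
  by apply/measurable_EFinP; exact: (@measurable_int _ _ _ mu _ _ ik).
have mc : measurable_fun setT (fun s => clamp e (h s)).
  by apply: measurable_comp1 => //; exact: measurable_clamp.
have mck : measurable_fun `]0, t] (fun s => clamp e (h s) * k s).
  by apply: measurable_funM => //; exact: measurable_funS mc.
have ick : mu.-integrable `]0, t] (EFin \o (fun s => clamp e (h s) * k s)).
  apply: (@integrable_le_scale _ k _ 1) => // s _.
  by rewrite normrM ler_wpM2r// clamp_norm_le1.
have iak : mu.-integrable `]0, t] (EFin \o (fun s => `|k s|)).
  by apply: integrable_norm.
have ch : {within `[0, t], continuous h}.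
  have := Rintegral_oc_continuous t0 ik.
  move=> /within_itv_continuousP H; apply/within_itv_continuousP => s r st r0.
  have [d d0 dh] := H s r st r0; exists d => // s' s't ss'.
  by rewrite !hk//; exact: dh.
have sub s1 s2 : 0 <= s1 -> s2 <= t -> `]s1, s2]%classic `<=` `]0, t]%classic.
  by move=> ? ?; apply: subset_itv; rewrite bnd_simp.
have Fh eta : 0 < eta ->
    huber e (h t) <= \int[mu]_(s in `]0, t]) (clamp e (h s) * k s)
       + eta * \int[mu]_(s in `]0, t]) `|k s|.
  move=> eta0; pose g s := clamp e (h s) * k s + eta * `|k s|.
  have ig : mu.-integrable `]0, t] (EFin \o g).
    apply: (@integrable_le_scale _ k _ (1 + eta)) => //.
      apply: measurable_funD => //; apply: measurable_funM => //.
      by apply: measurableT_comp => //; exact: normr_measurable.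
    move=> s _; apply: le_trans (ler_normD _ _) _; rewrite mulrDl lerD//.
      by rewrite normrM ler_wpM2r// clamp_norm_le1.
    by rewrite normrM normr_id (gtr0_norm eta0).
  pose S s := \int[mu]_(x in `]0, s]) g x - huber e (h s).
  have h0 : h 0 = 0.
    by rewrite hk ?lexx// set_itv_ge ?bnd_simp ?ltxx// Rintegral_set0.
  have S0 : S 0 = 0.
    rewrite /S set_itv_ge ?bnd_simp ?ltxx// Rintegral_set0 h0 /huber.
    by rewrite /clamp mul0r mulr0 min_r// max_r; [ring|lra].
  have : S 0 <= S t.
    apply: locally_nondecreasing_le => // s st.
    (* The clamp has Lipschitz constant 1 / e. With this bound on the variation of [h] it stays
       within eta / 2 of its value at [s], hence within eta between two points. *)
    have ee : 0 < e * (eta / 2) by rewrite mulr_gt0// divr_gt0.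
    move/within_itv_continuousP: ch => /(_ s _ st ee)[d d0 dh].
    exists d => // s1 s2 s10 s12 s2t s1d s2d.
    have cl x : 0 <= x <= t -> `|x - s| < d -> `|clamp e (h x) - clamp e (h s)| <= eta / 2.
      move=> xt xs; apply: le_trans (clamp_lipschitz _ _ e0) _.
      by rewrite ler_pdivrMr// mulrC ltW// dh.
    have iS k' : mu.-integrable `]0, t] (EFin \o k') ->
        mu.-integrable `]s1, s2] (EFin \o k').
      exact: (@integrableS _ _ _ mu `]0, t]%classic _ _ _ _ (sub _ _ s10 s2t)).
    have split k' : mu.-integrable `]0, t] (EFin \o k') ->
        \int[mu]_(x in `]0, s2]) k' x - \int[mu]_(x in `]0, s1]) k' x =
        \int[mu]_(x in `]s1, s2]) k' x.
      move=> ik'; apply: Rintegral_itvB; rewrite ?bnd_simp//.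
      exact: (@integrableS _ _ _ mu `]0, t]%classic _ _ _ _ (sub _ _ (lexx 0) s2t)).
    rewrite /S -subr_ge0.
    have -> : \int[mu]_(x in `]0, s2]) g x - huber e (h s2) -
        (\int[mu]_(x in `]0, s1]) g x - huber e (h s1)) =
        \int[mu]_(x in `]s1, s2]) g x - (huber e (h s2) - huber e (h s1)).
      by rewrite -split//; ring.
    rewrite subr_ge0; apply: le_trans (huber_convex _ _ e0) _.
    have s2t' : 0 <= s2 <= t by rewrite s2t (le_trans s10).
    have s1t' : 0 <= s1 <= t by rewrite s10 (le_trans s12).
    rewrite (hk s2)// (hk s1)// split// -hk// -RintegralZl//; last exact: iS.
    apply: le_Rintegral => //.
    - apply: iS; apply: (@integrable_le_scale _ k _ 1) => //.
        by apply: measurable_funM.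
      by move=> x _; rewrite normrM ler_wpM2r// clamp_norm_le1.
    - exact: iS.
    - move=> x; rewrite /= in_itv/= => /andP[s1x xs2].
      have x0 : 0 <= x by rewrite (le_trans s10)// ltW.
      have xd : `|x - s| < d.
        by move: s1d s2d; rewrite !ltr_norml => /andP[? ?] /andP[? ?]; apply/andP; split; lra.
      have := cl x _ xd; rewrite x0 (le_trans xs2)// => /(_ isT).
      have := cl s2 s2t' s2d; rewrite !ler_norml => /andP[? ?] /andP[? ?].
      rewrite /g -lerBlDl -mulrBl; apply: le_trans (ler_norm _) _.
      rewrite normrM ler_wpM2r// ler_norml; apply/andP; split; lra.
  rewrite S0 /S subr_ge0 => /le_trans; apply.
  rewrite /g RintegralD//; first by rewrite RintegralZl.
  apply: (@integrable_le_scale _ k _ eta) => //.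
    apply: measurable_funM => //.
    by apply: measurableT_comp => //; exact: normr_measurable.
  by move=> x _; rewrite normrM normr_id (gtr0_norm eta0).
apply: (@le_trans _ _ (e / 2 + huber e (h t))).
  by have := huber_ge (h t) e0; lra.
rewrite lerD2l; apply/ler_addgt0Pr => r r0.
pose I := \int[mu]_(s in `]0, t]) `|k s|.
have I0 : 0 <= I by exact: Rintegral_ge0.
have rI : 0 < r / (I + 1) by rewrite divr_gt0// ltr_wpDl.
apply: le_trans (Fh _ rI) _; rewrite lerD2l -/I.
by rewrite mulrAC ler_pdivrMr ?ltr_wpDl// ler_wpM2l ?ltW//; lra.
Qed.

(** The limit of [clamp_balance] along e = 1 / (n + 1), by dominated convergence with majorant |k|.
    At each point the clamp equals the sign from some index on. *)
Lemma abs_le_integral_sg (t : R) (k h : R -> R) : 0 <= t ->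
  mu.-integrable `]0, t] (EFin \o k) -> measurable_fun setT h ->
  (forall s : R, 0 <= s <= t -> h s = \int[mu]_(x in `]0, s]) k x) ->
  `|h t| <= \int[mu]_(s in `]0, t]) (Num.sg (h s) * k s).
Proof.
move=> t0 ik mh hk.
have mk : measurable_fun `]0, t] k.
  by apply/measurable_EFinP; exact: (@measurable_int _ _ _ mu _ _ ik).
have msg : measurable_fun setT (fun s => Num.sg (h s)).
  apply: measurable_comp1 => //; apply: nondecreasing_measurable => // x y xy.
  by case: (sgrP x) => [x0|x0|x0]; case: (sgrP y) => [y0|y0|y0]; lra.
pose e n : R := n.+1%:R^-1.
have e0 n : 0 < e n by rewrite invr_gt0.
have clsg b : clamp (e n) b @[n --> \oo] --> Num.sg b.
  apply: cvg_near_cst; have [->|b0] := eqVneq b 0.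
    apply: nearW => n; rewrite sgr0 /clamp mul0r min_r// max_r//; lra.
  have nb : 0 < `|b| by rewrite normr_gt0.
  near=> n; have : e n < `|b| by near: n; exact: (near_infty_natSinv_lt (PosNum nb)).
  case: (clampE b (e0 n)) => [[eb ->]|[eb ->]|[-> /andP[b1 b2]]].
  - by rewrite gtr0_sg// (lt_le_trans (e0 n)).
  - by rewrite ltr0_sg//; have := e0 n; lra.
  - rewrite normrM (gtr0_norm (e0 n)) -[ltLHS]mulr1 ltr_pM2l// => /lt_le_trans.
    by move=> /(_ _ (clamp_norm_le1 _ _)); rewrite ltxx.
have [] := @dominated_convergence _ _ _ mu _ (measurable_itv `]0, t])
  (fun n s => (clamp (e n) (h s) * k s)%:E) (fun s => (Num.sg (h s) * k s)%:E)
  (fun s => `|k s|%:E).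
- move=> n; apply/measurable_EFinP; apply: measurable_funM => //.
  apply: (@measurable_funS _ _ _ _ setT) => //.
  by apply: measurable_comp1 => //; exact: measurable_clamp.
- apply/measurable_EFinP; apply: measurable_funM => //.
  exact: measurable_funS msg.
- apply: aeW => s _; apply/cvg_EFin; first by apply: nearW.
  by apply: cvgMl; exact: clsg.
- exact: integrable_norm.
- apply: aeW => s n _; rewrite lee_fin normrM -[leRHS]mul1r ler_wpM2r//.
  exact: clamp_norm_le1.
move=> isg _; rewrite /=.
have E : (\int[mu]_(x in `]0%R, t]) (Num.sg (h x) * k x)%:E)%E \is a fin_num.
  exact: integrable_fin_num isg.
rewrite -(fineK E) => /fine_cvg cI.
have lim : e n / 2 + \int[mu]_(s in `]0, t]) (clamp (e n) (h s) * k s) @[n --> \oo]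
    --> 0 / 2 + \int[mu]_(s in `]0, t]) (Num.sg (h s) * k s).
  apply: cvgD => //; apply: cvgMl.
  apply/cvgrPdist_lt => r r0; near=> n.
  rewrite sub0r normrN gtr0_norm//.
  by near: n; exact: (near_infty_natSinv_lt (PosNum r0)).
rewrite mul0r add0r in lim; rewrite -(cvg_lim (@Rhausdorff R) lim).
apply: limr_ge; first by apply/cvg_ex; eexists; exact: lim.
by apply: nearW => n; exact: clamp_balance.
Unshelve. all: by end_near. Qed.

(** The integrals of [l] and [g] may be infinite. Therefore the negative part of
    [Num.sg (h s) * k s], which is integrable, is moved to the right before integrating, and only
    nonnegative functions are integrated. *)
Lemma abs_balance (t : R) (k h : R -> R) (l g : R -> \bar R) : 0 <= t ->
  mu.-integrable `]0, t] (EFin \o k) -> measurable_fun setT h ->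
  (forall s : R, 0 <= s <= t -> h s = \int[mu]_(x in `]0, s]) k x) ->
  measurable_fun setT l -> measurable_fun setT g ->
  (forall s, 0 <= l s)%E -> (forall s, 0 <= g s)%E ->
  {ae mu, forall s, `]0, t]%classic s -> ((Num.sg (h s) * k s)%:E + l s <= g s)%E} ->
  (`|h t|%:E + \int[mu]_(s in `]0%R, t]) l s <= \int[mu]_(s in `]0%R, t]) g s)%E.
Proof.
move=> t0 ik mh hk ml mg l0 g0 lg.
have mk : measurable_fun `]0, t] k.
  by apply/measurable_EFinP; exact: (@measurable_int _ _ _ mu _ _ ik).
have msg : measurable_fun setT (fun s => Num.sg (h s)).
  apply: measurable_comp1 => //; apply: nondecreasing_measurable => // x y xy.
  by case: (sgrP x) => [x0|x0|x0]; case: (sgrP y) => [y0|y0|y0]; lra.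
pose q s := Num.sg (h s) * k s.
have mq : measurable_fun `]0, t] q.
  by apply: measurable_funM => //; exact: measurable_funS msg.
have iq : mu.-integrable `]0, t] (EFin \o q).
  apply: (@integrable_le_scale _ k _ 1) => // s _; rewrite normrM ler_wpM2r//.
  by rewrite normr_sg; case: (_ == _).
have htq := abs_le_integral_sg t0 ik mh hk.
pose qp s := Num.max (q s) 0; pose qn s := Num.max (- q s) 0.
have qE s : q s = qp s - qn s.
  by rewrite /qp /qn; have [?|?] := leP (q s) 0; have [?|?] := leP (- q s) 0; lra.
have qp0 s : 0 <= qp s by rewrite le_max lexx orbT.
have qn0 s : 0 <= qn s by rewrite le_max lexx orbT.
have mqp : measurable_fun `]0, t] qp by apply: measurable_maxr.
have mqn : measurable_fun `]0, t] qn.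
  by apply: measurable_maxr => //; exact: measurable_funN.
have iqp : mu.-integrable `]0, t] (EFin \o qp).
  apply: (@integrable_le_scale _ q _ 1) => // s _; rewrite mul1r ger0_norm// ge_max.
  by rewrite ler_norm normr_ge0.
have iqn : mu.-integrable `]0, t] (EFin \o qn).
  apply: (@integrable_le_scale _ q _ 1) => // s _; rewrite mul1r ger0_norm// ge_max.
  by rewrite -normrN ler_norm normr_ge0.
have mS (F : R -> \bar R) : measurable_fun setT F -> measurable_fun `]0, t] F.
  exact: measurable_funS.
have : (\int[mu]_(s in `]0%R, t]) ((qp s)%:E + l s) <=
    \int[mu]_(s in `]0%R, t]) (g s + (qn s)%:E))%E.
  apply: ae_ge0_le_integral => //.
  - by move=> s _; apply: adde_ge0; rewrite ?lee_fin.
  - by apply: emeasurable_funD; [exact/measurable_EFinP|exact: mS].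
  - by move=> s _; apply: adde_ge0; rewrite ?lee_fin.
  - by apply: emeasurable_funD; [exact: mS|exact/measurable_EFinP].
  apply: aeS lg => s /[apply]; rewrite -/(q s) qE.
  move=> /(leeD2r (qn s)%:E); apply: le_trans.
  by rewrite addeAC -EFinD subrK.
rewrite !ge0_integralD//; [|exact: mS|by move=> s _; rewrite lee_fin|
  exact/measurable_EFinP|by move=> s _; rewrite lee_fin|exact/measurable_EFinP
  |exact: mS].
pose P := (\int[mu]_(s in `]0%R, t]) (qp s)%:E)%E.
pose N := (\int[mu]_(s in `]0%R, t]) (qn s)%:E)%E.
have fp : P \is a fin_num by exact: integrable_fin_num iqp.
have fn : N \is a fin_num by exact: integrable_fin_num iqn.
have PN : `|h t| <= fine P - fine N.
  rewrite (le_trans htq)// -[leRHS]/(\int[mu]_(s in `]0, t]) qp s - \int[mu]_(s in `]0, t]) qn s).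
  by rewrite -RintegralB//; under eq_Rintegral do rewrite -/(q _) qE.
move=> H; have {}H : (P + \int[mu]_(s in `]0%R, t]) l s <=
  \int[mu]_(s in `]0%R, t]) g s + N)%E := H.
clearbody P N; case: P fp PN H => // P _; case: N fn => // N _ /= PN H.
rewrite -(@leeD2rE _ N%:E)//; apply: le_trans H.
by rewrite addeAC -EFinD; apply: leeD2r; rewrite lee_fin; lra.
Qed.

End SignBalance.

(** * Moments and bilinear forms *)

Section BilinearForms.
Context {R : realType}.
Local Notation mu := (@lebesgue_measure R).
Implicit Types (w v p q : R -> R) (k : R -> R -> R).

(** All integrals run over the whole line. When [p] and [q] vanish on the nonpositive half-line,
    [conv] is the integral over ]0, x[ in the coagulation gain. Values in the extended reals
    dispense with integrability conditions. *)
Definition mom w p : \bar R := (\int[mu]_x (w x * p x)%:E)%E.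
Definition lin k p (x : R) : \bar R := (\int[mu]_y (k x y * p y)%:E)%E.
Definition conv k p q (x : R) : \bar R :=
  (\int[mu]_y (k y (x - y) * (p y * q (x - y)))%:E)%E.
Definition bil k p q : \bar R :=
  (\int[mu]_x \int[mu]_y (k x y * (p x * q y))%:E)%E.

Definition nonneg1 p := forall x, 0 <= p x.
Definition nonneg2 k := forall x y, 0 <= k x y.

Lemma mom_ge0 w p : nonneg1 w -> nonneg1 p -> (0 <= mom w p)%E.
Proof. by move=> w0 p0; apply: integral_ge0 => x _; rewrite lee_fin mulr_ge0. Qed.

Lemma lin_ge0 k p x : nonneg2 k -> nonneg1 p -> (0 <= lin k p x)%E.
Proof. by move=> k0 p0; apply: integral_ge0 => y _; rewrite lee_fin mulr_ge0. Qed.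

Lemma conv_ge0 k p q x : nonneg2 k -> nonneg1 p -> nonneg1 q ->
  (0 <= conv k p q x)%E.
Proof.
by move=> k0 p0 q0; apply: integral_ge0 => y _; rewrite lee_fin !mulr_ge0.
Qed.

Lemma bil_ge0 k p q : nonneg2 k -> nonneg1 p -> nonneg1 q -> (0 <= bil k p q)%E.
Proof.
move=> k0 p0 q0; apply: integral_ge0 => x _; apply: integral_ge0 => y _.
by rewrite lee_fin !mulr_ge0.
Qed.

Lemma mom_le w v p q : measurable_fun setT w -> measurable_fun setT p ->
  measurable_fun setT v -> measurable_fun setT q ->
  nonneg1 w -> nonneg1 p -> (forall x, w x * p x <= v x * q x) ->
  (mom w p <= mom v q)%E.
Proof.
move=> mw mp mv mq w0 p0 wv; apply: ge0_le_integral => //.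
- by move=> x _; rewrite lee_fin mulr_ge0.
- by mfun.
- by mfun.
- by move=> x _; rewrite lee_fin.
Qed.

Lemma momD w v p : measurable_fun setT w -> measurable_fun setT p ->
  measurable_fun setT v -> nonneg1 w -> nonneg1 v -> nonneg1 p ->
  mom (fun x => w x + v x) p = (mom w p + mom v p)%E.
Proof.
move=> mw mp mv w0 v0 p0; rewrite /mom -ge0_integralD//.
- by apply: eq_integral => x _; rewrite mulrDl EFinD.
- by move=> x _; rewrite lee_fin mulr_ge0.
- by mfun.
- by move=> x _; rewrite lee_fin mulr_ge0.
- by mfun.
Qed.

Lemma momDr w p q : measurable_fun setT w -> measurable_fun setT p ->
  measurable_fun setT q -> nonneg1 w -> nonneg1 p -> nonneg1 q ->
  mom w (fun x => p x + q x) = (mom w p + mom w q)%E.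
Proof.
move=> mw mp mq w0 p0 q0; rewrite /mom -ge0_integralD//.
- by apply: eq_integral => x _; rewrite mulrDr EFinD.
- by move=> x _; rewrite lee_fin mulr_ge0.
- by mfun.
- by move=> x _; rewrite lee_fin mulr_ge0.
- by mfun.
Qed.

Lemma momZ (c : R) w p : 0 <= c -> measurable_fun setT w ->
  measurable_fun setT p -> nonneg1 w -> nonneg1 p ->
  mom (fun x => c * w x) p = (c%:E * mom w p)%E.
Proof.
move=> c0 mw mp w0 p0; rewrite /mom -ge0_integralZl//.
- by apply: eq_integral => x _; rewrite -EFinM mulrA.
- by mfun.
- by move=> x _; rewrite lee_fin mulr_ge0.
Qed.

Lemma bil_measurable_inner k p q : jointly_measurable k ->
  measurable_fun setT p -> measurable_fun setT q ->
  nonneg2 k -> nonneg1 p -> nonneg1 q ->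
  measurable_fun setT (fun x => \int[mu]_y (k x y * (p x * q y))%:E)%E.
Proof.
move=> mk mp mq k0 p0 q0; mfun => //.
by move=> x y; rewrite lee_fin !mulr_ge0.
Qed.

Lemma bil_le k k' p q p' q' : jointly_measurable k -> jointly_measurable k' ->
  measurable_fun setT p -> measurable_fun setT q ->
  measurable_fun setT p' -> measurable_fun setT q' ->
  nonneg2 k -> nonneg2 k' -> nonneg1 p -> nonneg1 q -> nonneg1 p' -> nonneg1 q' ->
  (forall x y, k x y * (p x * q y) <= k' x y * (p' x * q' y)) ->
  (bil k p q <= bil k' p' q')%E.
Proof.
move=> mk mk' mp mq mp' mq' k0 k0' p0 q0 p0' q0' kk; apply: ge0_le_integral => //.
- by move=> x _; apply: integral_ge0 => y _; rewrite lee_fin !mulr_ge0.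
- exact: bil_measurable_inner.
- exact: bil_measurable_inner.
- move=> x _; apply: ge0_le_integral => //.
  + by move=> y _; rewrite lee_fin !mulr_ge0.
  + by mfun.
  + by mfun.
  + by move=> y _; rewrite lee_fin.
Qed.

Lemma bilD k k' p q : jointly_measurable k -> jointly_measurable k' ->
  measurable_fun setT p -> measurable_fun setT q ->
  nonneg2 k -> nonneg2 k' -> nonneg1 p -> nonneg1 q ->
  bil (fun x y => k x y + k' x y) p q = (bil k p q + bil k' p q)%E.
Proof.
move=> mk mk' mp mq k0 k0' p0 q0; rewrite /bil -ge0_integralD//.
- apply: eq_integral => x _; rewrite -ge0_integralD//.
  + by apply: eq_integral => y _; rewrite mulrDl EFinD.
  + by move=> y _; rewrite lee_fin !mulr_ge0.
  + by mfun.
  + by move=> y _; rewrite lee_fin !mulr_ge0.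
  + by mfun.
- by move=> x _; apply: integral_ge0 => y _; rewrite lee_fin !mulr_ge0.
- exact: bil_measurable_inner.
- by move=> x _; apply: integral_ge0 => y _; rewrite lee_fin !mulr_ge0.
- exact: bil_measurable_inner.
Qed.

Lemma bilDr k p q1 q2 : jointly_measurable k -> measurable_fun setT p ->
  measurable_fun setT q1 -> measurable_fun setT q2 ->
  nonneg2 k -> nonneg1 p -> nonneg1 q1 -> nonneg1 q2 ->
  bil k p (fun y => q1 y + q2 y) = (bil k p q1 + bil k p q2)%E.
Proof.
move=> mk mp mq1 mq2 k0 p0 q10 q20; rewrite /bil -ge0_integralD//.
- apply: eq_integral => x _; rewrite -ge0_integralD//.
  + by apply: eq_integral => y _; rewrite !mulrDr EFinD.
  + by move=> y _; rewrite lee_fin !mulr_ge0.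
  + by mfun.
  + by move=> y _; rewrite lee_fin !mulr_ge0.
  + by mfun.
- by move=> x _; apply: integral_ge0 => y _; rewrite lee_fin !mulr_ge0.
- exact: bil_measurable_inner.
- by move=> x _; apply: integral_ge0 => y _; rewrite lee_fin !mulr_ge0.
- exact: bil_measurable_inner.
Qed.

Lemma bil_swap k p q : jointly_measurable k ->
  measurable_fun setT p -> measurable_fun setT q ->
  nonneg2 k -> nonneg1 p -> nonneg1 q ->
  bil k p q = bil (fun x y => k y x) q p.
Proof.
move=> mk mp mq k0 p0 q0; rewrite /bil (tonelli measurableT measurableT).
- by apply: eq_integral => y _; apply: eq_integral => x _; rewrite (mulrC (p _)).
- by mfun.
- by move=> x y; rewrite lee_fin !mulr_ge0.
Qed.

Lemma bil_prod w v p q : measurable_fun setT w -> measurable_fun setT p ->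
  measurable_fun setT v -> measurable_fun setT q ->
  nonneg1 w -> nonneg1 v -> nonneg1 p -> nonneg1 q ->
  bil (fun x y => w x * v y) p q = (mom w p * mom v q)%E.
Proof.
move=> mw mp mv mq w0 v0 p0 q0; rewrite /bil /mom -ge0_integralZr//.
- apply: eq_integral => x _; rewrite -ge0_integralZl//.
  + by apply: eq_integral => y _; rewrite -EFinM; congr (_%:E); ring.
  + by mfun.
  + by move=> y _; rewrite lee_fin mulr_ge0.
  + by rewrite lee_fin mulr_ge0.
- by mfun.
- by move=> x _; rewrite lee_fin mulr_ge0.
- exact: mom_ge0.
Qed.

(** Tonelli followed by the translation of the inner variable by [y]: two particles [x] and [y]
    merge into one of size [x + y], where the weight is taken. *)
Lemma mom_conv w k p q : measurable_fun setT w -> jointly_measurable k ->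
  measurable_fun setT p -> measurable_fun setT q ->
  nonneg1 w -> nonneg2 k -> nonneg1 p -> nonneg1 q ->
  (\int[mu]_x ((w x)%:E * conv k p q x) =
   bil (fun x y => w (x + y)%R * k x y)%R p q)%E.
Proof.
move=> mw mk mp mq w0 k0 p0 q0.
transitivity (\int[mu]_x \int[mu]_y
    (w x * (k y (x - y) * (p y * q (x - y))))%:E)%E.
  apply: eq_integral => x _; rewrite /conv -ge0_integralZl//.
  - by mfun.
  - by move=> y _; rewrite lee_fin !mulr_ge0.
  - by rewrite lee_fin.
rewrite (tonelli measurableT measurableT); last 2 first.
- by mfun.
- by move=> x y; rewrite lee_fin !mulr_ge0.
apply: eq_integral => y _.
rewrite -[LHS](@integral_translate _ y); last 2 first.
- by mfun.
- by move=> x; rewrite lee_fin !mulr_ge0.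
by apply: eq_integral => x _; rewrite addrK [in w _]addrC mulrA.
Qed.

Lemma mom_lin w k p q : measurable_fun setT w -> jointly_measurable k ->
  measurable_fun setT p -> measurable_fun setT q ->
  nonneg1 w -> nonneg2 k -> nonneg1 p -> nonneg1 q ->
  (\int[mu]_x ((w x)%:E * ((p x)%:E * lin k q x)) =
   bil (fun x y => w x * k x y)%R p q)%E.
Proof.
move=> mw mk mp mq w0 k0 p0 q0; apply: eq_integral => x _.
rewrite muleA -EFinM /lin -ge0_integralZl//.
- by apply: eq_integral => y _; rewrite -EFinM; congr (_%:E); ring.
- by mfun.
- by move=> y _; rewrite lee_fin mulr_ge0.
- by rewrite lee_fin mulr_ge0.
Qed.

(** Duality: the weight of what is gained at [x] becomes the weight of what a particle of size [y]
    breaks into. *)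
Lemma mom_gain w k p : measurable_fun setT w -> jointly_measurable k ->
  measurable_fun setT p -> nonneg1 w -> nonneg2 k -> nonneg1 p ->
  (\int[mu]_x ((w x)%:E * lin k p x) =
   \int[mu]_y ((p y)%:E * lin (fun y x => k x y) w y))%E.
Proof.
move=> mw mk mp w0 k0 p0.
transitivity (\int[mu]_x \int[mu]_y (w x * (k x y * p y))%:E)%E.
  apply: eq_integral => x _; rewrite /lin -ge0_integralZl//.
  - by mfun.
  - by move=> y _; rewrite lee_fin mulr_ge0.
  - by rewrite lee_fin.
rewrite (tonelli measurableT measurableT); last 2 first.
- by mfun.
- by move=> x y; rewrite lee_fin !mulr_ge0.
apply: eq_integral => y _; rewrite /lin -ge0_integralZl//.
- by apply: eq_integral => x _; rewrite -EFinM; congr (_%:E); ring.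
- by mfun.
- by move=> x _; rewrite lee_fin mulr_ge0.
- by rewrite lee_fin.
Qed.

(** With only nonnegative terms on each side, Tonelli exchanges the two integrations whether or not
    they are finite. *)
Lemma integrate_balance (D : set R) w p q (L G : R -> R -> \bar R) :
  measurable D -> measurable_fun setT w -> measurable_fun setT p ->
  measurable_fun setT q -> nonneg1 w -> nonneg1 p -> nonneg1 q ->
  measurable_fun setT (fun z : R * R => L z.1 z.2) ->
  measurable_fun setT (fun z : R * R => G z.1 z.2) ->
  (forall t x, 0 <= L t x)%E -> (forall t x, 0 <= G t x)%E ->
  {ae mu, forall x, ((p x)%:E + \int[mu]_(t in D) L t x <=
                     (q x)%:E + \int[mu]_(t in D) G t x)%E} ->
  (mom w p + \int[mu]_(t in D) \int[mu]_x ((w x)%:E * L t x) <=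
   mom w q + \int[mu]_(t in D) \int[mu]_x ((w x)%:E * G t x))%E.
Proof.
move=> mD mw mp mq w0 p0 q0 mL mG L0 G0 ineq.
have H r (F : R -> R -> \bar R) : measurable_fun setT r -> nonneg1 r ->
    measurable_fun setT (fun z : R * R => F z.1 z.2) ->
    (forall t x, 0 <= F t x)%E ->
    (mom w r + \int[mu]_(t in D) \int[mu]_x ((w x)%:E * F t x) =
     \int[mu]_x ((w x)%:E * ((r x)%:E + \int[mu]_(t in D) F t x)))%E /\
    measurable_fun setT (fun x => (w x)%:E * ((r x)%:E + \int[mu]_(t in D) F t x))%E.
  move=> mr r0 mF F0.
  have mI : measurable_fun setT (fun x => \int[mu]_(t in D) F t x)%E.
    apply: measurable_integral => //; mfun.
  split; last first.
    by apply: emeasurable_funM; [mfun|apply: emeasurable_funD => //; mfun].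
  rewrite (tonelli mD measurableT); last 2 first.
  - by mfun.
  - by move=> x y; rewrite mule_ge0// lee_fin.
  rewrite /mom -ge0_integralD//.
  - apply: eq_integral => x _; rewrite ge0_muleDr ?lee_fin ?integral_ge0//.
    rewrite EFinM; congr (_ + _)%E; rewrite ge0_integralZl//.
    + by apply: (@measurable_funS _ _ _ _ setT) => //; mfun.
    + by rewrite lee_fin.
  - by move=> x _; rewrite lee_fin mulr_ge0.
  - by mfun.
  - by move=> x _; apply: integral_ge0 => t _; rewrite mule_ge0// lee_fin.
  - apply: measurable_integral => //; first by mfun.
    by move=> x y; rewrite mule_ge0// lee_fin.
have [-> m1] := H p L mp p0 mL L0; have [-> m2] := H q G mq q0 mG G0.
apply: ae_ge0_le_integral => //.
- move=> x _; apply: mule_ge0; first by rewrite lee_fin.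
  by apply: adde_ge0; [rewrite lee_fin|exact: integral_ge0].
- move=> x _; apply: mule_ge0; first by rewrite lee_fin.
  by apply: adde_ge0; [rewrite lee_fin|exact: integral_ge0].
- by apply: aeS ineq => x + _; apply: lee_wpmul2l; rewrite lee_fin.
Qed.

End BilinearForms.

(** * Weak formulation *)

Section Evolution.
Context {R : realType}.
Local Notation mu := (@lebesgue_measure R).

(** Weights are written in terms of [pos x], which makes them nonnegative on the whole line. *)
Definition pos (x : R) : R := Num.max x 0.

Lemma pos_ge0 (x : R) : 0 <= pos x.
Proof. by rewrite le_max lexx orbT. Qed.

Lemma pos_id (x : R) : 0 <= x -> pos x = x.
Proof. by move=> x0; rewrite /pos max_l. Qed.

Lemma pos_add (x y : R) : pos (x + y) <= pos x + pos y.
Proof.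
have := pos_ge0 x; have := pos_ge0 y; rewrite {3}/pos ge_max => *.
apply/andP; split; last exact: addr_ge0.
by rewrite lerD// le_max lexx.
Qed.

Lemma measurable_pos : measurable_fun setT pos.
Proof. by rewrite /pos; mfun. Qed.

(** For a fragmentation kernel, [lin (flip g) w y] is the total weight, per unit of time, of the
    fragments of one particle of size [y]. *)
Definition flip (g : R -> R -> R) := fun y x => g x y.

Definition loss (k : R -> R -> R) (a : R -> R) (c : R) (p : R -> R) (x : R) : \bar R :=
  (c%:E * ((p x)%:E * lin k p x) + (a x * p x)%:E)%E.

Definition gain (k g : R -> R -> R) (c : R) (p : R -> R) (x : R) : \bar R :=
  ((c / 2)%:E * conv k p p x + lin g p x)%E.

(** The product bound [coag_le] serves to make coagulation integrals finite. The sharper growth with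
    exponent [muh], and the number and mass of the fragments, enter as separate hypotheses where
    they matter. *)
Record coefficients (B K0 : R) (k g : R -> R -> R) (a u : R -> R) : Prop := {
  coag_meas : jointly_measurable k;
  coag_ge0 : nonneg2 k;
  coag_sym : forall x y, k x y = k y x;
  coag_le : forall x y, k x y <= K0 * ((1 + pos x) * (1 + pos y));
  frag_meas : jointly_measurable g;
  frag_ge0 : nonneg2 g;
  rate_meas : measurable_fun setT a;
  rate_ge0 : nonneg1 a;
  ctrl_meas : measurable_fun setT u;
  ctrl_ge0 : nonneg1 u;
  ctrl_le : forall t, u t <= B;
  coag_const_ge0 : 0 <= K0 }.

(* Meant for the representative of a solution that vanishes for x <= 0 and on a null
   set of x, and is frozen in time outside [0, T].  Loss and gain stand on opposite sides of the
   equation, so that only integrals of nonnegative functions occur. *)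
Record evolution (T m : R) (k g : R -> R -> R) (a u : R -> R)
    (f : R -> R -> R) : Prop := {
  evo_meas : jointly_measurable f;
  evo_ge0 : nonneg2 f;
  evo_le0 : forall t x, x <= 0 -> f t x = 0;
  evo_cont : forall x, continuous (f^~ x);
  evo_num : forall t, (mom (fun=> 1%R) (f t) < +oo)%E;
  evo_mass : forall t, mom pos (f t) = m%:E;
  evo_eq : {ae mu, forall x,
    [/\ (\int[mu]_(s in `]0%R, T]) loss k a (u s) (f s) x < +oo)%E,
        (\int[mu]_(s in `]0%R, T]) gain k g (u s) (f s) x < +oo)%E &
        forall t : R, 0 <= t <= T ->
          ((f t x)%:E + \int[mu]_(s in `]0%R, t]) loss k a (u s) (f s) x =
           (f 0%R x)%:E + \int[mu]_(s in `]0%R, t]) gain k g (u s) (f s) x)%E]} }.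

Section Balance.
Variables (T m B K0 : R) (k g : R -> R -> R) (a u : R -> R) (f : R -> R -> R).
Hypothesis C : coefficients B K0 k g a u.
Hypothesis E : evolution T m k g a u f.

Let mk := coag_meas C.
Let k0 := coag_ge0 C.
Let mg := frag_meas C.
Let g0 := frag_ge0 C.
Let ma := rate_meas C.
Let a0 := rate_ge0 C.
Let mu_ := ctrl_meas C.
Let u0 := ctrl_ge0 C.
Let mf := evo_meas E.
Let f0 := evo_ge0 E.
Let mpos := measurable_pos.

Let mft t : measurable_fun setT (f t) := measurable_slice t mf.

Lemma loss_ge0 t x : (0 <= loss k a (u t) (f t) x)%E.
Proof.
apply: adde_ge0; last by rewrite lee_fin mulr_ge0.
apply: mule_ge0; first by rewrite lee_fin; exact: u0.
by apply: mule_ge0; [rewrite lee_fin; exact: f0|exact: lin_ge0].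
Qed.

Lemma gain_ge0 t x : (0 <= gain k g (u t) (f t) x)%E.
Proof.
apply: adde_ge0; last exact: lin_ge0.
apply: mule_ge0; first by rewrite lee_fin divr_ge0//; exact: u0.
exact: conv_ge0.
Qed.

Lemma loss_measurable :
  measurable_fun setT (fun z : R * R => loss k a (u z.1) (f z.1) z.2).
Proof.
rewrite /loss /lin; mfun => //.
by move=> z y; rewrite lee_fin mulr_ge0.
Qed.

Lemma gain_measurable :
  measurable_fun setT (fun z : R * R => gain k g (u z.1) (f z.1) z.2).
Proof.
rewrite /gain /lin /conv; mfun => //.
- by move=> z y; rewrite lee_fin !mulr_ge0.
- by move=> z y; rewrite lee_fin mulr_ge0.
Qed.

(** The equations at [t] and at [s] are subtracted, which is legitimate because the loss up to [s]
    is finite. One null set of sizes serves for all pairs of times. *)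
Lemma pointwise_balance : {ae mu, forall x, forall s t : R, 0 <= s -> s <= t -> t <= T ->
  ((f t x)%:E + \int[mu]_(r in `]s, t]) loss k a (u r) (f r) x =
   (f s x)%:E + \int[mu]_(r in `]s, t]) gain k g (u r) (f r) x)%E}.
Proof.
apply: aeS (evo_eq E) => x [Loo Goo H] s t s0 st tT.
have mL : measurable_fun setT (fun r => loss k a (u r) (f r) x).
  have mL := loss_measurable.
  exact: (@ejm_comp _ _ _ (fun r x => loss k a (u r) (f r) x) id (fun=> x)).
have mG : measurable_fun setT (fun r => gain k g (u r) (f r) x).
  have mG := gain_measurable.
  exact: (@ejm_comp _ _ _ (fun r x => gain k g (u r) (f r) x) id (fun=> x)).
have Lr r := loss_ge0 r x; have Gr r := gain_ge0 r x.
have Hs := H s; have Ht := H t.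
move: Ht; rewrite (integral_oc_split s0 st mL Lr) (integral_oc_split s0 st mG Gr).
rewrite (le_trans s0 st) tT => /(_ isT).
have Lfin : (\int[mu]_(r in `]0%R, s]) loss k a (u r) (f r) x)%E \is a fin_num.
  rewrite ge0_fin_numE ?integral_ge0//; apply: le_lt_trans Loo.
  by apply: ge0_integral_oc_mono => //; exact: le_trans tT.
rewrite addeCA addeA [(_ + (f t x)%:E)%E]addeC.
move: Hs; rewrite s0 (le_trans st tT) => /(_ isT) Hs.
rewrite [RHS]addeA -Hs -addeA addeCA -[RHS]addeA [in RHS]addeCA.
move=> /(congr1 (fun y => y - \int[mu]_(r in `]0%R, s]) loss k a (u r) (f r) x)%E).
by rewrite ![(\int[mu]_(r in `]0%R, s]) _ + _)%E]addeC !addeK.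
Qed.

Lemma integral_loss (w : R -> R) (r : R) : measurable_fun setT w -> nonneg1 w ->
  (\int[mu]_x ((w x)%:E * loss k a (u r) (f r) x) =
    (u r)%:E * bil (fun x y => w x * k x y)%R (f r) (f r) +
    mom (fun x => w x * a x)%R (f r))%E.
Proof.
move=> mw w0.
have mI : measurable_fun setT (fun x => lin k (f r) x).
  rewrite /lin; mfun => //.
  by move=> z y; rewrite lee_fin mulr_ge0.
rewrite -mom_lin//.
rewrite /mom -ge0_integralZl//; last 3 first.
- by mfun.
- move=> x _; apply: mule_ge0; first by rewrite lee_fin.
  by apply: mule_ge0; [rewrite lee_fin; exact: f0|apply: lin_ge0 => //; exact: f0].
- by rewrite lee_fin; exact: u0.
rewrite -ge0_integralD//.
- apply: eq_integral => x _; rewrite /loss ge0_muleDr; last 2 first.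
  + apply: mule_ge0; first by rewrite lee_fin; exact: u0.
    by apply: mule_ge0; [rewrite lee_fin; exact: f0|apply: lin_ge0 => //; exact: f0].
  + by rewrite lee_fin mulr_ge0.
  by rewrite muleCA -EFinM mulrA.
- move=> x _; apply: mule_ge0; first by rewrite lee_fin; exact: u0.
  apply: mule_ge0; first by rewrite lee_fin.
  by apply: mule_ge0; [rewrite lee_fin; exact: f0|apply: lin_ge0 => //; exact: f0].
- by mfun.
- by move=> x _; rewrite lee_fin !mulr_ge0.
- by mfun.
Qed.

Lemma integral_gain (w : R -> R) (r : R) : measurable_fun setT w -> nonneg1 w ->
  (\int[mu]_x ((w x)%:E * gain k g (u r) (f r) x) =
    (u r / 2)%:E * bil (fun x y => w (x + y) * k x y)%R (f r) (f r) +
    \int[mu]_y ((f r y)%:E * lin (flip g) w y))%E.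
Proof.
move=> mw w0.
have mI : measurable_fun setT (fun x => lin g (f r) x).
  rewrite /lin; mfun => //.
  by move=> z y; rewrite lee_fin mulr_ge0.
have mI' : measurable_fun setT (fun x => conv k (f r) (f r) x).
  rewrite /conv; mfun => //.
  by move=> z y; rewrite lee_fin !mulr_ge0.
rewrite -mom_gain//.
rewrite -mom_conv//.
rewrite -ge0_integralZl//; last 3 first.
- by mfun.
- move=> x _; apply: mule_ge0; first by rewrite lee_fin.
  by apply: conv_ge0 => //; exact: f0.
- by rewrite lee_fin divr_ge0//; exact: u0.
rewrite -ge0_integralD//.
- apply: eq_integral => x _; rewrite /gain ge0_muleDr; last 2 first.
  + apply: mule_ge0; first by rewrite lee_fin divr_ge0//; exact: u0.
    by apply: conv_ge0 => //; exact: f0.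
  + by apply: lin_ge0 => //; exact: f0.
  by rewrite muleCA.
- move=> x _; apply: mule_ge0; first by rewrite lee_fin divr_ge0//; exact: u0.
  apply: mule_ge0; first by rewrite lee_fin.
  by apply: conv_ge0 => //; exact: f0.
- by mfun.
- move=> x _; apply: mule_ge0; first by rewrite lee_fin.
  by apply: lin_ge0 => //; exact: f0.
- by mfun.
Qed.

Lemma weak_balance (w : R -> R) (s t : R) : measurable_fun setT w -> nonneg1 w ->
  0 <= s -> s <= t -> t <= T ->
  (mom w (f t) + \int[mu]_(r in `]s, t])
     ((u r)%:E * bil (fun x y => w x * k x y)%R (f r) (f r) +
      mom (fun x => w x * a x)%R (f r)) =
   mom w (f s) + \int[mu]_(r in `]s, t])
     ((u r / 2)%:E * bil (fun x y => w (x + y) * k x y)%R (f r) (f r) +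
      \int[mu]_y ((f r y)%:E * lin (flip g) w y)))%E.
Proof.
move=> mw w0 s0 st tT.
rewrite -(funext (fun r => integral_loss r mw w0)) -(funext (fun r => integral_gain r mw w0)).
have mL := loss_measurable; have mG := gain_measurable.
apply/eqP; rewrite eq_le; apply/andP; split; apply: integrate_balance => //.
- exact: loss_ge0.
- exact: gain_ge0.
- by apply: aeS pointwise_balance => x ->.
- exact: gain_ge0.
- exact: loss_ge0.
- by apply: aeS pointwise_balance => x ->.
Qed.

Lemma mom_add1pos t : mom (fun x => 1 + pos x) (f t) = (mom (fun=> 1%R) (f t) + m%:E)%E.
Proof.
rewrite momD//; last exact: pos_ge0.
by rewrite (evo_mass E).
Qed.

Lemma bil_bounded (v : R -> R -> R) (c M r : R) :
  jointly_measurable v -> nonneg2 v -> 0 <= c -> 0 <= m -> 0 <= M ->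
  (forall x y, v x y <= c) -> (mom (fun=> 1%R) (f r) <= M%:E)%E ->
  (bil (fun x y => v x y * k x y)%R (f r) (f r) <= (c * K0 * (M + m) ^+ 2)%:E)%E.
Proof.
move=> mv v0 c0 m0 M0 vc num.
have K00 := coag_const_ge0 C; have fr0 : nonneg1 (f r) by exact: f0.
have p1 : nonneg1 (fun x => 1 + pos x).
  by move=> x; rewrite addr_ge0// pos_ge0.
have num1 : (mom (fun x => 1 + pos x)%R (f r) <= (M + m)%:E)%E.
  by rewrite mom_add1pos EFinD leeD2r.
apply: (@le_trans _ _ (bil (fun x y => (c * K0 * (1 + pos x)) * (1 + pos y))%R (f r) (f r))).
  apply: bil_le => //.
  - by rewrite /jointly_measurable; mfun.
  - by rewrite /jointly_measurable; mfun.
  - by move=> x y; rewrite mulr_ge0.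
  - by move=> x y; rewrite mulr_ge0 ?p1// mulr_ge0 ?p1// mulr_ge0.
  - move=> x y; rewrite ler_wpM2r ?mulr_ge0//.
    apply: le_trans (ler_wpM2r (k0 x y) (vc x y)) _.
    by rewrite -!mulrA ler_wpM2l//; exact: coag_le C x y.
rewrite bil_prod//; [|by mfun|by mfun|by move=> x; rewrite mulr_ge0 ?p1// mulr_ge0].
rewrite momZ//; [|by rewrite mulr_ge0|by mfun].
rewrite -muleA (EFinM (c * K0)) lee_wpmul2l ?lee_fin ?mulr_ge0//.
by rewrite expr2 EFinM lee_pmul// mom_ge0.
Qed.

Let A w r := ((u r)%:E * bil (fun x y => w x * k x y)%R (f r) (f r))%E.
Let G w r := ((u r / 2)%:E * bil (fun x y => w (x + y) * k x y)%R (f r) (f r))%E.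

Lemma measurable_mom (w : R -> R) : measurable_fun setT w -> nonneg1 w ->
  measurable_fun setT (fun r => mom w (f r)).
Proof.
move=> mw w0; rewrite /mom; mfun => //.
by move=> x y; rewrite lee_fin mulr_ge0.
Qed.

Lemma measurable_bil (v : R -> R -> R) : jointly_measurable v -> nonneg2 v ->
  measurable_fun setT (fun r => bil (fun x y => v x y * k x y)%R (f r) (f r)).
Proof.
move=> mv v0; rewrite /bil; mfun => //.
- by move=> x y; rewrite lee_fin !mulr_ge0.
- by move=> x y; apply: integral_ge0 => z _; rewrite lee_fin !mulr_ge0.
Qed.

Let bil_fst_ge0 w r : nonneg1 w -> (0 <= A w r)%E.
Proof.
move=> w0; apply: mule_ge0; first by rewrite lee_fin; exact: u0.
by apply: bil_ge0 => // x y; rewrite mulr_ge0.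
Qed.

Let bil_add_ge0 w r : nonneg1 w -> (0 <= G w r)%E.
Proof.
move=> w0; apply: mule_ge0; first by rewrite lee_fin divr_ge0.
by apply: bil_ge0 => // x y; rewrite mulr_ge0.
Qed.

Let mA w : measurable_fun setT w -> nonneg1 w -> measurable_fun setT (A w).
Proof.
move=> mw w0; have mb := @measurable_bil (fun x _ => w x) _ (fun x _ => w0 x).
rewrite /A; apply: emeasurable_funM; first by mfun.
by apply: mb; rewrite /jointly_measurable; mfun.
Qed.

Let mG w : measurable_fun setT w -> nonneg1 w -> measurable_fun setT (G w).
Proof.
move=> mw w0; have mb := @measurable_bil (fun x y => w (x + y)) _ (fun x y => w0 (x + y)).
rewrite /G; apply: emeasurable_funM; first by mfun.
by apply: mb; rewrite /jointly_measurable; mfun.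
Qed.

Let bounded_finite (F : R -> \bar R) (c s t : R) : s <= t ->
  measurable_fun setT F -> (forall r, 0 <= F r)%E ->
  (forall r : R, `]s, t]%classic r -> F r <= c%:E)%E ->
  (\int[mu]_(r in `]s, t]) F r)%E \is a fin_num.
Proof.
move=> st mF F0 Fc; rewrite ge0_fin_numE; last exact: integral_ge0.
apply: (@le_lt_trans _ _ (\int[mu]_(r in `]s, t]) c%:E)%E).
  apply: ge0_le_integral => //.
  exact: measurable_funS mF.
rewrite integral_cst//= lebesgue_measure_itv/= lte_fin.
by case: ifPn => _; rewrite -?EFinB -?EFinM ?mule0 ltry.
Qed.

Let bil_sym (w : R -> R) (r : R) : measurable_fun setT w -> nonneg1 w ->
  (bil (fun x y => (w x + w y) * k x y)%R (f r) (f r) =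
   bil (fun x y => w x * k x y)%R (f r) (f r) +
   bil (fun x y => w x * k x y)%R (f r) (f r))%E.
Proof.
move=> mw w0.
have -> : (fun x y => (w x + w y) * k x y) =
    (fun x y => w x * k x y + w y * k x y).
  by apply/funext => x; apply/funext => y; rewrite mulrDl.
have mw1 : jointly_measurable (fun x y => w x * k x y) by rewrite /jointly_measurable; mfun.
have mw2 : jointly_measurable (fun x y => w y * k x y) by rewrite /jointly_measurable; mfun.
have w10 : nonneg2 (fun x y => w x * k x y) by move=> x y; rewrite mulr_ge0.
have w20 : nonneg2 (fun x y => w y * k x y) by move=> x y; rewrite mulr_ge0.
have fr0 : nonneg1 (f r) by exact: f0.
rewrite (bilD mw1 mw2 (mft r) (mft r) w10 w20 fr0 fr0).
rewrite (bil_swap mw2 (mft r) (mft r) w20 fr0 fr0).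
have -> : (fun x y => w x * k y x) = (fun x y => w x * k x y).
  by apply/funext => x; apply/funext => y; rewrite (coag_sym C).
reflexivity.
Qed.

(** By the symmetry of [k], half the integral of [w x + w y] is that of [w x]; so subadditivity of
    [w] makes the coagulation gain at most the coagulation loss. The loss is finite, since [w] is
    bounded and the particle number is bounded on ]s, t], and can be cancelled. *)
Lemma weak_upper (w c : R -> R) (s t M cw : R) :
  measurable_fun setT w -> nonneg1 w -> measurable_fun setT c -> nonneg1 c ->
  0 <= m -> 0 <= M -> 0 <= cw -> 0 <= B ->
  (forall x y, w (x + y) <= w x + w y) -> (forall x, w x <= cw) ->
  (forall y, lin (flip g) w y <= (c y)%:E)%E ->
  0 <= s -> s <= t -> t <= T ->
  (forall r : R, (s < r <= t)%R -> mom (fun=> 1%R) (f r) <= M%:E)%E ->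
  (mom w (f t) + \int[mu]_(r in `]s, t]) mom (fun x => w x * a x)%R (f r) <=
   mom w (f s) + \int[mu]_(r in `]s, t]) mom c (f r))%E.
Proof.
move=> mw w0 mc c0 m0 M0 cw0 B0 wadd wle gc s0 st tT num.
have := weak_balance mw w0 s0 st tT.
have mlin : measurable_fun setT (fun r => \int[mu]_y ((f r y)%:E * lin (flip g) w y))%E.
  rewrite /lin /flip; mfun => //.
  - by move=> x y; rewrite lee_fin mulr_ge0.
  - by move=> x y; rewrite mule_ge0 ?lee_fin//; apply: integral_ge0 => z _; rewrite lee_fin mulr_ge0.
have lin0 r : (0 <= \int[mu]_y ((f r y)%:E * lin (flip g) w y))%E.
  apply: integral_ge0 => y _; rewrite mule_ge0 ?lee_fin//; apply: lin_ge0 => //.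
  by move=> ? ?; exact: g0.
have ma' : measurable_fun setT (fun r => mom (fun x => w x * a x)%R (f r)).
  by apply: measurable_mom; [mfun|move=> x; rewrite mulr_ge0].
have a0' r : (0 <= mom (fun x => w x * a x)%R (f r))%E.
  by apply: mom_ge0 => // x; rewrite mulr_ge0.
have mAw := mA mw w0; have mGw := mG mw w0.
have A0 r := bil_fst_ge0 r w0; have G0 r := bil_add_ge0 r w0.
rewrite (ge0_integralDT (measurable_itv _) mAw ma' A0 a0').
rewrite (ge0_integralDT (measurable_itv _) mGw mlin G0 lin0).
have Afin : (\int[mu]_(r in `]s, t]) A w r)%E \is a fin_num.
  apply: (@bounded_finite _ (B * (cw * K0 * (M + m) ^+ 2))) => // r; rewrite /= in_itv/= => rst.
  rewrite /A (EFinM B); apply: lee_pmul.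
  - by rewrite lee_fin; exact: u0.
  - by apply: bil_ge0 => // x y; rewrite mulr_ge0.
  - by rewrite lee_fin; exact: ctrl_le C r.
  - apply: (@bil_bounded (fun x _ => w x)) => //.
    + by rewrite /jointly_measurable; mfun.
    + exact: num.
have GA : (\int[mu]_(r in `]s, t]) G w r <= \int[mu]_(r in `]s, t]) A w r)%E.
  apply: (ge0_le_integralT (measurable_itv _) mGw mAw G0) => r _; rewrite /G /A.
  have -> : ((u r)%:E = (u r / 2)%:E * 2%:E)%E by rewrite -EFinM divfK.
  rewrite -muleA lee_wpmul2l ?lee_fin ?divr_ge0//.
  rewrite mule_natl mule2n -bil_sym//; apply: bil_le => //.
  - by rewrite /jointly_measurable; mfun.
  - by rewrite /jointly_measurable; mfun.
  - by move=> x y; rewrite mulr_ge0.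
  - by move=> x y; rewrite mulr_ge0 ?addr_ge0.
  - by move=> x y; rewrite ler_wpM2r ?mulr_ge0// ler_wpM2r.
have gc' : (\int[mu]_(r in `]s, t]) \int[mu]_y ((f r y)%:E * lin (flip g) w y) <=
    \int[mu]_(r in `]s, t]) mom c (f r))%E.
  apply: (ge0_le_integralT (measurable_itv _) mlin (measurable_mom mc c0) lin0).
  move=> r _; apply: ge0_le_integral => //.
  - move=> y _; rewrite mule_ge0 ?lee_fin//; apply: lin_ge0 => //.
    by move=> ? ?; exact: g0.
  - rewrite /lin /flip; mfun => //.
    by move=> x y; rewrite lee_fin mulr_ge0.
  - by mfun.
  - by move=> y _; rewrite muleC EFinM lee_wpmul2r ?lee_fin.
exact: cancel_upper Afin GA gc'.
Qed.

(** Symmetrization as in [weak_upper], for a weight that is superadditive up to [2 * v x y]; the 2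
    cancels the 1 / 2 in front of the coagulation gain. Here it is the gain that has to be
    finite. *)
Lemma weak_lower (w c : R -> R) (v : R -> R -> R) (s t M cw : R) :
  measurable_fun setT w -> nonneg1 w -> measurable_fun setT c -> nonneg1 c ->
  jointly_measurable v -> nonneg2 v ->
  0 <= m -> 0 <= M -> 0 <= cw -> 0 <= B ->
  (forall x y, 0 < x -> 0 < y -> w x + w y <= w (x + y) + 2 * v x y) ->
  (forall x, w x <= cw) ->
  (forall y, (c y)%:E <= lin (flip g) w y)%E ->
  0 <= s -> s <= t -> t <= T ->
  (forall r : R, (s < r <= t)%R -> mom (fun=> 1%R) (f r) <= M%:E)%E ->
  (mom w (f s) + \int[mu]_(r in `]s, t]) mom c (f r) <=
   mom w (f t) + \int[mu]_(r in `]s, t]) (mom (fun x => w x * a x)%R (f r) +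
      (u r)%:E * bil (fun x y => v x y * k x y)%R (f r) (f r)))%E.
Proof.
move=> mw w0 mc c0 mv v0 m0 M0 cw0 B0 wadd wle gc s0 st tT num.
have := weak_balance mw w0 s0 st tT.
have mlin : measurable_fun setT (fun r => \int[mu]_y ((f r y)%:E * lin (flip g) w y))%E.
  rewrite /lin /flip; mfun => //.
  - by move=> x y; rewrite lee_fin mulr_ge0.
  - by move=> x y; rewrite mule_ge0 ?lee_fin//; apply: integral_ge0 => z _; rewrite lee_fin mulr_ge0.
have lin0 r : (0 <= \int[mu]_y ((f r y)%:E * lin (flip g) w y))%E.
  apply: integral_ge0 => y _; rewrite mule_ge0 ?lee_fin//; apply: lin_ge0 => //.
  by move=> ? ?; exact: g0.
have ma' : measurable_fun setT (fun r => mom (fun x => w x * a x)%R (f r)).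
  by apply: measurable_mom; [mfun|move=> x; rewrite mulr_ge0].
have a0' r : (0 <= mom (fun x => w x * a x)%R (f r))%E.
  by apply: mom_ge0 => // x; rewrite mulr_ge0.
have mAw := mA mw w0; have mGw := mG mw w0.
have A0 r := bil_fst_ge0 r w0; have G0 r := bil_add_ge0 r w0.
pose V r := ((u r)%:E * bil (fun x y => v x y * k x y)%R (f r) (f r))%E.
have V0 r : (0 <= V r)%E.
  apply: mule_ge0; first by rewrite lee_fin; exact: u0.
  by apply: bil_ge0 => // x y; rewrite mulr_ge0.
have mV : measurable_fun setT V.
  by apply: emeasurable_funM; [mfun|exact: measurable_bil].
rewrite (ge0_integralDT (measurable_itv _) mAw ma' A0 a0').
rewrite (ge0_integralDT (measurable_itv _) mGw mlin G0 lin0).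
rewrite (ge0_integralDT (measurable_itv _) ma' mV a0' V0).
have Gfin : (\int[mu]_(r in `]s, t]) G w r)%E \is a fin_num.
  apply: (@bounded_finite _ (B * (cw * K0 * (M + m) ^+ 2))) => // r; rewrite /= in_itv/= => rst.
  rewrite /G (EFinM B); apply: lee_pmul.
  - by rewrite lee_fin divr_ge0.
  - by apply: bil_ge0 => // x y; rewrite mulr_ge0.
  - rewrite lee_fin; apply: le_trans (ctrl_le C r).
    by have := u0 r; lra.
  - apply: (@bil_bounded (fun x y => w (x + y))) => //.
    + by rewrite /jointly_measurable; mfun.
    + exact: num.
have AG : (\int[mu]_(r in `]s, t]) A w r <=
    \int[mu]_(r in `]s, t]) G w r + \int[mu]_(r in `]s, t]) V r)%E.
  rewrite -(ge0_integralDT (measurable_itv _) mGw mV G0 V0).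
  have mGV : measurable_fun setT (fun r => G w r + V r)%E by apply: emeasurable_funD; [exact: mGw|exact: mV].
  apply: (ge0_le_integralT (measurable_itv _) mAw mGV A0).
  - move=> r _; rewrite /G /A /V.
    have E2 : ((u r)%:E = (u r / 2)%:E * 2%:E)%E by rewrite -EFinM divfK.
    rewrite E2 -!muleA -ge0_muleDr ?lee_fin ?divr_ge0//; last 2 first.
    + by apply: bil_ge0 => // x y; rewrite mulr_ge0.
    + by apply: mule_ge0 => //; apply: bil_ge0 => // x y; rewrite mulr_ge0.
    rewrite lee_wpmul2l ?lee_fin ?divr_ge0//.
    rewrite !mule_natl mule2n -bil_sym// mule2n -bilD//; last 4 first.
    + by rewrite /jointly_measurable; mfun.
    + by rewrite /jointly_measurable; mfun.
    + by move=> x y; rewrite mulr_ge0.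
    + by move=> x y; rewrite mulr_ge0.
    rewrite -bilD//; last 4 first.
    + by rewrite /jointly_measurable; mfun.
    + by rewrite /jointly_measurable; mfun.
    + by move=> x y; rewrite mulr_ge0.
    + by move=> x y; rewrite addr_ge0// mulr_ge0.
    apply: bil_le => //.
    + by rewrite /jointly_measurable; mfun.
    + by rewrite /jointly_measurable; mfun.
    + by move=> x y; rewrite mulr_ge0 ?addr_ge0.
    + by move=> x y; rewrite !addr_ge0// mulr_ge0.
    + move=> x y; have [x0|x0] := leP x 0; first by rewrite (evo_le0 E r x0) !mul0r !mulr0.
      have [y0|y0] := leP y 0; first by rewrite (evo_le0 E r y0) !mulr0.
      rewrite ler_wpM2r ?mulr_ge0//.
      by rewrite -!mulrDl ler_wpM2r//; have := wadd x y x0 y0; lra.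
have gc' : (\int[mu]_(r in `]s, t]) mom c (f r) <=
    \int[mu]_(r in `]s, t]) \int[mu]_y ((f r y)%:E * lin (flip g) w y))%E.
  apply: (ge0_le_integralT (measurable_itv _) (measurable_mom mc c0) mlin).
    by move=> r; exact: mom_ge0.
  move=> r _; apply: ge0_le_integral => //.
  - by move=> y _; rewrite lee_fin mulr_ge0.
  - by mfun.
  - rewrite /lin /flip; mfun => //.
    by move=> x y; rewrite lee_fin mulr_ge0.
  - by move=> y _; rewrite EFinM muleC lee_wpmul2l ?lee_fin.
exact: cancel_lower Gfin AG gc'.
Qed.

End Balance.
End Evolution.

(** * Power-law fragments *)

Section PowerLawFragments.
Context {R : realType}.
Local Notation mu := (@lebesgue_measure R).

Lemma powR_continuous_gt0 (s x : R) : 0 < x -> {for x, continuous (@powR R ^~ s)}.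
Proof.
move=> x0; apply: differentiable_continuous; apply/derivable1_diffP.
by apply: derivable_powR; rewrite in_itv/= x0.
Qed.

Lemma integral_powR_itv (s a b : R) : -1 < s -> 0 < a -> a < b ->
  (\int[mu]_(x in `[a, b]) (x `^ s)%:E =
   ((b `^ (s + 1) - a `^ (s + 1)) / (s + 1))%:E)%E.
Proof.
move=> s1 a0 ab; have s10 : 0 < s + 1 by lra.
pose F (x : R) := x `^ (s + 1) / (s + 1).
have cF x : 0 < x -> {for x, continuous F}.
  by move=> x0; apply: cvgMl; exact: powR_continuous_gt0.
have dF (x : R) : 0 < x -> is_derive x 1 F (x `^ s).
  move=> x0; have := is_derive1_powR (s + 1) x0; rewrite addrK => D.
  rewrite /F; have -> : (fun x : R => x `^ (s + 1) / (s + 1)) =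
      ((s + 1)^-1 \*: (@powR R ^~ (s + 1))).
    by apply/funext => z; rewrite /= mulrC.
  have -> : x `^ s = (s + 1)^-1 *: ((s + 1) * x `^ s).
    by rewrite /GRing.scale /= mulKf// gt_eqF.
  exact: is_deriveZ.
rewrite (@continuous_FTC2 _ _ F)//.
- by rewrite -EFinB -mulrBl.
- apply: continuous_in_subspaceT => x; rewrite inE/= in_itv/= => /andP[ax _].
  by apply: powR_continuous_gt0; exact: lt_le_trans ax.
- split.
  + move=> x; rewrite in_itv/= => /andP[ax _].
    by have [] := dF x (lt_trans a0 ax).
  + by apply: cvg_at_right_filter; exact: cF.
  + by apply: cvg_at_left_filter; apply: cF; exact: lt_trans ab.
- move=> x; rewrite in_itv/= => /andP[ax _].
  by rewrite derive1E; have [] := dF x (lt_trans a0 ax).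
Qed.

Lemma integral_powR (s y : R) : -1 < s -> 0 < y ->
  (\int[mu]_(x in `]0%R, y[) (x `^ s)%:E = (y `^ (s + 1) / (s + 1))%:E)%E.
Proof.
move=> s1 y0; have s10 : 0 < s + 1 by lra.
have mpow : measurable_fun setT (fun x : R => (x `^ s)%:E) by mfun.
rewrite integral_itv_bndo_bndc; last exact: measurable_funS mpow.
(* The power may be singular at 0, so the fundamental theorem is used away from 0 and ]0, y] is
   exhausted. The denominator starts at 2 to keep the left end strictly below [y]. *)
pose S n := `[y / n.+2%:R, y]%classic.
have ySn n : 0 < y / n.+2%:R < y.
  by rewrite divr_gt0//= ltr_pdivrMr// ltr_pMr// ltr1n.
have US : \bigcup_n S n = `]0, y]%classic.
  apply/seteqP; split => [x [n _]|x]; rewrite /S /= !in_itv/=.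
    by move=> /andP[yx ->]; rewrite (lt_le_trans _ yx)//; have /andP[] := ySn n.
  move=> /andP[x0 xy]; have xy0 : 0 < x / y by rewrite divr_gt0.
  have [n _ H] := near_infty_natSinv_lt (PosNum xy0).
  exists n => //=; rewrite in_itv/= xy andbT.
  have /= /ltW := H n (leqnn n); rewrite ler_pdivlMr// => H1.
  apply: le_trans H1; rewrite mulrC ler_pM2r// lef_pV2 ?posrE//.
  by rewrite ler_nat.
have cvgI : (\int[mu]_(x in S i) (x `^ s)%:E)%E @[i --> \oo] -->
    (\int[mu]_(x in `]0%R, y]) (x `^ s)%:E)%E.
  rewrite -US; apply: ge0_nondecreasing_set_cvg_integral.
  - apply/nondecreasing_seqP => n; rewrite subsetEset /S; apply: subset_itv.
      by rewrite bnd_simp ler_pM2l// lef_pV2 ?posrE// ler_nat.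
    by rewrite bnd_simp.
  - by move=> n; exact: measurable_itv.
  - by move=> n; exact: measurable_funS mpow.
  - by move=> n x _; rewrite lee_fin powR_ge0.
have H : ((y `^ (s + 1) - (y / n.+2%:R) `^ (s + 1)) / (s + 1))%:E @[n --> \oo] -->
    (y `^ (s + 1) / (s + 1))%:E.
  apply: cvg_EFin; first by apply: nearW.
  have -> : y `^ (s + 1) / (s + 1) = (y `^ (s + 1) - 0) / (s + 1) by rewrite subr0.
  apply: cvgMl; apply: cvgB; first exact: cvg_cst.
  have L1 : (fun n : nat => y / n.+2%:R) @ \oo --> (0 : R)^'+.
    move=> A /nbhs_ballP[e e0 eA]; exists (Num.truncn (y / e)) => // n /= le_n.
    have /andP[yn0 _] := ySn n; apply: eA => //.
    rewrite -ball_normE /= sub0r normrN gtr0_norm// ltr_pdivrMr// mulrC -ltr_pdivrMr//.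
    by apply: lt_le_trans (truncnS_gt _) _; rewrite ler_nat ltnS (leq_trans le_n).
  exact: (cvg_comp _ _ L1 (powR_cvg0 s10)).
apply/esym; apply: (cvg_unique (@ereal_hausdorff R) H).
apply: cvg_trans cvgI; apply: near_eq_cvg; apply: nearW => n.
by have /andP[yn0 yny] := ySn n; rewrite /S integral_powR_itv.
Unshelve. all: by end_near. Qed.

Lemma daughter_ge0 (nu x y : R) : -1 < nu -> 0 <= daughter nu x y.
Proof.
move=> nu1; rewrite /daughter indicE; case: (boolP (x \in _)) => [|_]; last by rewrite mulr0.
rewrite inE /= in_itv/= => /andP[x0 xy]; rewrite mulr1 mulr_ge0 ?powR_ge0// divr_ge0//.
  by lra.
by rewrite ltW// (lt_trans x0).
Qed.

Lemma daughter_jm (nu : R) : jointly_measurable (daughter nu).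
Proof.
rewrite /jointly_measurable /daughter.
(* The interval ]0, y[ varies with [y]; membership is rewritten as positivity of [x] and of [y - x],
   that is, by the indicator of a fixed half-line. *)
have -> : (fun z : R * R => (2 + nu) / z.2 * (z.1 / z.2) `^ nu * \1_(`]0%R, z.2[ : set R) z.1) =
    (fun z : R * R => (2 + nu) / z.2 * (z.1 / z.2) `^ nu *
      (\1_(`]0%R, +oo[ : set R) z.1 * \1_(`]0%R, +oo[ : set R) (z.2 - z.1))).
  apply/funext => z; congr (_ * _); rewrite !indicE -natrM mulnb.
  have E1 (b c : R) : (c \in `]0, b[%classic) = (0 < c < b).
    by apply/idP/idP; rewrite inE/= in_itv.
  have E2 (c : R) : (c \in `]0, +oo[%classic) = (0 < c).
    by apply/idP/idP; rewrite inE/= in_itv/= andbT.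
  by rewrite E1 !E2 subr_gt0.
mfun => //.
Qed.

(** The moment of order [s] of the relative fragment size x / y, which does not depend on [y] by
    scaling. For s = 0 it is the number of fragments, and for s = 1 it equals 1, the conservation of
    mass. *)
Lemma integral_daughter_powR (nu s y : R) : -1 < nu -> 0 <= s -> 0 < y ->
  (\int[mu]_x (daughter nu x y * (x / y) `^ s)%:E = ((2 + nu) / (1 + nu + s))%:E)%E.
Proof.
move=> nu1 s0 y0; have ns1 : -1 < nu + s by lra.
transitivity (\int[mu]_(x in `]0%R, y[) (((2 + nu) / y * y `^ (- (nu + s)))%:E * (x `^ (nu + s))%:E))%E.
  rewrite [RHS]integral_mkcond epatch_indic; apply: eq_integral => x _ /=.
  rewrite /daughter indicE; case: (boolP (x \in _)) => [|_]; last by rewrite mulr0 mul0r mule0.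
  rewrite inE /= in_itv/= => /andP[x0 xy]; rewrite mule1 mulr1 -EFinM; congr (_%:E).
  rewrite -mulrA -powRD; last by apply/implyP => _; rewrite gt_eqF// divr_gt0.
  have invE : y^-1 `^ (nu + s) = y `^ (- (nu + s)).
    by rewrite -powR_inv1 ?(ltW y0)// -powRrM mulN1r.
  rewrite powRM ?invr_ge0 ?(ltW x0) ?(ltW y0)// invE.
  by rewrite -!mulrA; congr (_ * (_ * _)); rewrite mulrC.
rewrite ge0_integralZl//; last 3 first.
- by apply: (@measurable_funS _ _ _ _ setT) => //; mfun.
- by move=> x _; rewrite lee_fin powR_ge0.
- by rewrite lee_fin mulr_ge0 ?powR_ge0// divr_ge0 ?(ltW y0)//; lra.
rewrite integral_powR// -EFinM; congr (_%:E).
have yy : y `^ (- (nu + s)) * y `^ (nu + s + 1) = y.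
  rewrite -powRD; last by apply/implyP => _; rewrite gt_eqF.
  by rewrite (_ : _ + _ = 1) ?powRr1 ?(ltW y0)//; ring.
rewrite mulrA -(mulrA ((2 + nu) / y)) yy divfK ?gt_eqF//.
by congr (_ / _); ring.
Qed.

Definition rate (alpha0 lambda x : R) : R := alpha0 * pos x `^ lambda.

Definition frag_kernel (alpha0 lambda nu x y : R) : R :=
  rate alpha0 lambda y * daughter nu x y.

Lemma fragment_number_ge0 (nu : R) : -1 < nu -> 0 <= (2 + nu) / (1 + nu).
Proof. by move=> nu1; apply: divr_ge0; lra. Qed.

Lemma fragment_mass (nu : R) : -1 < nu -> (2 + nu) / (1 + nu + 1) = 1.
Proof. by move=> nu1; rewrite (_ : 1 + nu + 1 = 2 + nu) ?divff//; [lra|ring]. Qed.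

Lemma fragment_second_moment_le (nu : R) : -1 < nu -> nu <= 0 ->
  (2 + nu) / (1 + nu + 2) <= 2 / 3.
Proof. by move=> nu1 nu0; rewrite ler_pdivrMr; lra. Qed.

Section FragKernel.
Variables (alpha0 lambda nu : R).
Hypotheses (alpha0_ge0 : 0 <= alpha0) (nu_gt : -1 < nu) (nu_le0 : nu <= 0).

Lemma rate_nonneg : nonneg1 (rate alpha0 lambda).
Proof. by move=> x; rewrite mulr_ge0 ?powR_ge0. Qed.

Lemma rate_measurable : measurable_fun setT (rate alpha0 lambda).
Proof. by have mpos := @measurable_pos R; rewrite /rate; mfun. Qed.

Lemma rate_le x : 0 < lambda <= 1 -> rate alpha0 lambda x <= alpha0 * (1 + pos x).
Proof.
move=> /andP[l0 l1]; rewrite ler_wpM2l//; have p0 := pos_ge0 x.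
apply: le_trans (_ : (1 + pos x) `^ lambda <= _).
  by apply: ge0_ler_powR; rewrite ?nnegrE ?(ltW l0) ?addr_ge0// lerDr.
by apply: ler1_powR => //; rewrite lerDl.
Qed.

Lemma frag_kernel_jm : jointly_measurable (frag_kernel alpha0 lambda nu).
Proof.
have m1 := rate_measurable; have m2 := daughter_jm nu.
by rewrite /jointly_measurable /frag_kernel; mfun.
Qed.

Lemma frag_kernel_ge0 : nonneg2 (frag_kernel alpha0 lambda nu).
Proof. by move=> x y; rewrite mulr_ge0 ?rate_nonneg ?daughter_ge0. Qed.

Let D (y s x : R) := daughter nu x y * (x / y) `^ s.

Let mD y s : measurable_fun setT (D y s).
Proof. by have m2 := daughter_jm nu; rewrite /D; mfun. Qed.

Let D0 y s x : 0 <= D y s x.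
Proof. by rewrite mulr_ge0 ?daughter_ge0 ?powR_ge0. Qed.

Let mlin (w : R -> R) (y : R) : measurable_fun setT w ->
  measurable_fun setT (fun x => (flip (frag_kernel alpha0 lambda nu) y x * w x)%:E).
Proof. by move=> mw; have mk := frag_kernel_jm; rewrite /flip; mfun. Qed.

Let integralDZ (y s c : R) : 0 < y -> 0 <= s -> 0 <= c ->
  (\int[mu]_x (c * D y s x)%:E = (c * ((2 + nu) / (1 + nu + s)))%:E)%E.
Proof.
move=> y0 s0 c0; under eq_integral do rewrite EFinM.
rewrite (ge0_integralZlT measurableT c0); [|exact/measurable_EFinP|by move=> x; rewrite lee_fin].
by rewrite integral_daughter_powR.
Qed.

(** The constant [c1] is charged to the number (2 + nu) / (1 + nu) of fragments, and [c2] to their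
    total mass, which is that of the parent. *)
Lemma lin_frag_le (w : R -> R) (c1 c2 y : R) : measurable_fun setT w ->
  nonneg1 w -> 0 <= c1 -> 0 <= c2 -> (forall x, w x <= c1 + c2 * pos x) ->
  (lin (flip (frag_kernel alpha0 lambda nu)) w y <=
   (rate alpha0 lambda y * (c1 * ((2 + nu) / (1 + nu)) + c2 * pos y))%:E)%E.
Proof.
move=> mw w0 c10 c20 wle; have r0 := rate_nonneg y; have p0 := pos_ge0 y.
have n0 : 0 <= (2 + nu) / (1 + nu) by exact: fragment_number_ge0.
have [y0|y0] := leP y 0.
  rewrite /lin integral0_eq.
    by rewrite lee_fin; apply: mulr_ge0 => //; apply: addr_ge0; exact: mulr_ge0.
  move=> x _.
  rewrite /flip /frag_kernel /daughter set_itv_ge ?indic0 ?mulr0 ?mul0r//.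
  by rewrite bnd_simp -leNgt.
have E0 := integralDZ y0 (lexx 0) (mulr_ge0 r0 c10).
have E1 := integralDZ y0 ler01 (mulr_ge0 (mulr_ge0 r0 c20) (ltW y0)).
have -> : rate alpha0 lambda y * (c1 * ((2 + nu) / (1 + nu)) + c2 * pos y) =
    rate alpha0 lambda y * c1 * ((2 + nu) / (1 + nu + 0)) +
    rate alpha0 lambda y * c2 * y * ((2 + nu) / (1 + nu + 1)).
  by rewrite addr0 fragment_mass// pos_id ?(ltW y0)//; ring.
have mD0 := mD y 0; have mD1 := mD y 1.
rewrite EFinD -E0 -E1 -ge0_integralDT//; last 4 first.
- by mfun.
- by mfun.
- by move=> x; rewrite lee_fin; apply: mulr_ge0; [exact: mulr_ge0|exact: D0].
- move=> x; rewrite lee_fin; apply: mulr_ge0; last exact: D0.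
  by apply: mulr_ge0; [exact: mulr_ge0|exact: ltW].
apply: ge0_le_integralT => //; first exact: mlin.
- by mfun.
- by move=> x; rewrite lee_fin mulr_ge0// /flip frag_kernel_ge0.
- move=> x _; rewrite -EFinD lee_fin /flip /frag_kernel /D powRr0 mulr1.
  have [x0|x0] := leP x 0.
    rewrite /daughter indicE memNset ?mulr0 ?mul0r ?mulr0 ?addr0//.
    by rewrite /= in_itv/= ltNge x0.
  rewrite powRr1 ?divr_ge0 ?(ltW x0) ?(ltW y0)//.
  have d0 := daughter_ge0 x y nu_gt.
  rewrite (_ : _ * c2 * y * _ = rate alpha0 lambda y * daughter nu x y * (c2 * x)); last first.
    by field; rewrite gt_eqF.
  rewrite (_ : _ * c1 * _ = rate alpha0 lambda y * daughter nu x y * c1); last by ring.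
  rewrite -mulrDr; apply: ler_wpM2l; first exact: mulr_ge0.
  by have := wle x; rewrite pos_id ?(ltW x0).
Qed.

Let daughter_supp (x y : R) : ~ (0 < x < y) -> daughter nu x y = 0.
Proof.
by move=> xy; rewrite /daughter indicE memNset ?mulr0//= in_itv.
Qed.

(** A lower bound for [w] by a power on ]0, y[ is integrated with the relative moment of order [s].
    That moment is 1 for s = 1 and larger for s < 1, so for s < 1 fragmentation strictly increases
    the weight. *)
Lemma lin_frag_ge_powR (w : R -> R) (s y : R) : measurable_fun setT w ->
  nonneg1 w -> 0 < y -> 0 <= s ->
  (forall x : R, 0 < x < y -> (x / y) `^ s * w y <= w x) ->
  ((rate alpha0 lambda y * w y * ((2 + nu) / (1 + nu + s)))%:E <=
   lin (flip (frag_kernel alpha0 lambda nu)) w y)%E.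
Proof.
move=> mw w0 y0 s0 wge; have r0 := rate_nonneg y.
rewrite -(integralDZ y0 s0 (mulr_ge0 r0 (w0 y))) /lin; have mDs := mD y s.
apply: ge0_le_integralT => //; [by mfun|exact: mlin| |].
  by move=> x; rewrite lee_fin; apply: mulr_ge0; [exact: mulr_ge0|exact: D0].
move=> x _; rewrite lee_fin /flip /frag_kernel /D.
have [xy|xy] := pselect (0 < x < y); last by rewrite daughter_supp// !(mul0r, mulr0).
rewrite [leLHS](_ : _ = rate alpha0 lambda y * daughter nu x y * ((x / y) `^ s * w y)).
  by apply: ler_wpM2l; [rewrite mulr_ge0 ?daughter_ge0|exact: wge].
by ring.
Qed.

(** With z = x / y the hypothesis bounds w(x) / w(y) below by 2 z - z^2. The first relative moment
    is 1 and the second at most 2 / 3 because [nu <= 0], whence 4 / 3 = 2 - 2 / 3. The square is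
    kept on the other side to avoid a subtraction of integrals. *)
Lemma lin_frag_ge_quad (w : R -> R) (y : R) : measurable_fun setT w ->
  nonneg1 w -> 0 < y ->
  (forall x : R, 0 < x < y -> 2 * (x / y) * w y <= w x + (x / y) ^+ 2 * w y) ->
  ((rate alpha0 lambda y * w y * (4 / 3))%:E <=
   lin (flip (frag_kernel alpha0 lambda nu)) w y)%E.
Proof.
move=> mw w0 y0 wge; have r0 := rate_nonneg y.
set c := rate alpha0 lambda y * w y; have c0 : 0 <= c by rewrite mulr_ge0.
have c20 : 0 <= c * 2 by rewrite mulr_ge0.
have E1 := integralDZ y0 ler01 c20.
have E2 := integralDZ y0 (ler0n _ 2) c0.
have mD1 := mD y 1; have mD2 := mD y 2.
have : (\int[mu]_x (c * 2 * D y 1 x)%:E <=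
    lin (flip (frag_kernel alpha0 lambda nu)) w y + \int[mu]_x (c * D y 2 x)%:E)%E.
  rewrite /lin -ge0_integralDT//; last 4 first.
  - exact: mlin.
  - by mfun.
  - by move=> x; rewrite lee_fin mulr_ge0// /flip frag_kernel_ge0.
  - by move=> x; rewrite lee_fin mulr_ge0.
  have ml := mlin y mw.
  apply: ge0_le_integralT => //; [by mfun|by mfun|by move=> x; rewrite lee_fin mulr_ge0|].
  move=> x _; rewrite -EFinD lee_fin /flip /frag_kernel /D.
  have [xy|xy] := pselect (0 < x < y); last by rewrite daughter_supp// !(mul0r, mulr0) addr0.
  have x0 : 0 < x by case/andP: xy.
  rewrite powRr1 ?divr_ge0 ?(ltW x0) ?(ltW y0)// powR_mulrn ?divr_ge0 ?(ltW x0) ?(ltW y0)//.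
  have d0 := daughter_ge0 x y nu_gt.
  rewrite (_ : c * 2 * _ = rate alpha0 lambda y * daughter nu x y * (2 * (x / y) * w y)); last first.
    by rewrite /c; ring.
  rewrite (_ : c * (_ * _) = rate alpha0 lambda y * daughter nu x y * ((x / y) ^+ 2 * w y)); last first.
    by rewrite /c; ring.
  by rewrite -mulrDr; apply: ler_wpM2l; [exact: mulr_ge0|exact: wge].
have : (0 <= lin (flip (frag_kernel alpha0 lambda nu)) w y)%E.
  by apply: lin_ge0 => // y1 x; exact: frag_kernel_ge0.
rewrite E1 E2 fragment_mass//.
case: (lin _ _ _) => [l| |]; [move=> _|by move=> _ _; rewrite leey|by rewrite leeNy_eq].
rewrite -EFinD !lee_fin mulr1 => H.
have := ler_wpM2l c0 (fragment_second_moment_le nu_gt nu_le0).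
move: H; move: ((2 + nu) / _) => q; move: (c) => c' H.
by lra.
Qed.

End FragKernel.

End PowerLawFragments.

(** * The particle number *)

Section MomentSemicontinuity.
Context {R : realType}.
Local Notation mu := (@lebesgue_measure R).

Lemma limn_einf_le (u : nat -> \bar R) (c : \bar R) :
  (forall n, u n <= c)%E -> (limn_einf u <= c)%E.
Proof.
move=> uc; rewrite limn_einf_lim; apply: lime_le; first exact: is_cvg_einfs.
apply: nearW => n; apply: le_trans (uc n); rewrite /einfs.
by apply: ereal_inf_lbound; exists n => /=.
Qed.

Lemma mom_fatou (w_ p_ : nat -> R -> R) (w p : R -> R) (c : \bar R) :
  (forall j, measurable_fun setT (w_ j)) -> (forall j, measurable_fun setT (p_ j)) ->
  (forall j, nonneg1 (w_ j)) -> (forall j, nonneg1 (p_ j)) ->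
  (forall x, w_ j x * p_ j x @[j --> \oo] --> w x * p x) ->
  (forall j, mom (w_ j) (p_ j) <= c)%E -> (mom w p <= c)%E.
Proof.
move=> mw mp w0 p0 wp momc.
pose F j x := (w_ j x * p_ j x)%:E.
have mF j : measurable_fun setT (F j) by have := mw j; have := mp j; rewrite /F => *; mfun.
have F0 j x : setT x -> (0 <= F j x)%E by rewrite lee_fin mulr_ge0 ?w0 ?p0.
apply: le_trans (le_trans (@fatou _ _ _ mu setT measurableT F mF F0) (limn_einf_le momc)).
rewrite le_eqVlt; apply/orP; left; apply/eqP; apply: eq_integral => x _.
have H : F j x @[j --> \oo] --> (w x * p x)%:E.
  by apply: cvg_EFin; [apply: nearW|exact: wp].
by rewrite is_cvg_limn_einfE; [apply/esym/cvg_lim|apply/cvg_ex; eexists; exact: H].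
Qed.

(** Continuity in time holds for each size separately, so that Fatou gives lower semicontinuity of
    moments; part of a moment may still be lost in the limit. *)
Lemma mom_lsc (w : R -> R) (f : R -> R -> R) (s : nat -> R) (t : R) (c : \bar R) :
  measurable_fun setT w -> jointly_measurable f -> nonneg1 w -> nonneg2 f ->
  (forall x, continuous (f^~ x)) -> s @ \oo --> t ->
  (forall j, mom w (f (s j)) <= c)%E -> (mom w (f t) <= c)%E.
Proof.
move=> mw mf w0 f0 cf st; apply: mom_fatou => //.
- by move=> j; mfun.
- by move=> j; exact: f0.
- by move=> x; apply: cvgMr; apply: (cvg_comp s (f^~ x) st); exact: cf.
Qed.

End MomentSemicontinuity.

Section ParticleNumber.
Context {R : realType}.
Local Notation mu := (@lebesgue_measure R).
Variables (T m B K0 A N : R) (k g : R -> R -> R) (a u : R -> R) (f : R -> R -> R).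
Hypothesis C : coefficients B K0 k g a u.
Hypothesis E : evolution T m k g a u f.
Hypothesis A_ge0 : 0 <= A.
Hypothesis N_ge0 : 0 <= N.
Hypothesis aA : forall y, a y <= A * (1 + pos y).
Hypothesis gN : forall (w : R -> R) (c1 c2 y : R), measurable_fun setT w ->
  nonneg1 w -> 0 <= c1 -> 0 <= c2 -> (forall x, w x <= c1 + c2 * pos x) ->
  (lin (flip g) w y <= (a y * (c1 * N + c2 * pos y))%:E)%E.

Let mf := evo_meas E.
Let f0 := evo_ge0 E.
Let mpos := @measurable_pos R.
Let ma := rate_meas C.
Let a0 := rate_ge0 C.
Let mft t : measurable_fun setT (f t) := measurable_slice t mf.
Let one0 : nonneg1 (fun=> 1 : R) := fun=> ler01.

(* A subadditive function below pos x / e: coagulation does not increase its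
   moment, which tends to the particle number as e tends to 0. *)
Definition cutoff (e x : R) : R := Num.min (pos x / e) 1.

Lemma cutoff_ge0 e : 0 < e -> nonneg1 (cutoff e).
Proof. by move=> e0 x; rewrite le_min ler01 divr_ge0 ?pos_ge0 ?(ltW e0). Qed.

Lemma cutoff_le1 e x : cutoff e x <= 1.
Proof. by rewrite ge_min lexx orbT. Qed.

Lemma cutoff_lepos e x : cutoff e x <= e^-1 * pos x.
Proof. by rewrite ge_min mulrC lexx. Qed.

Lemma cutoff_measurable e : measurable_fun setT (cutoff e).
Proof. by rewrite /cutoff; mfun. Qed.

Lemma min1_add (x y z : R) : 0 <= x -> 0 <= y -> z <= x + y ->
  Num.min z 1 <= Num.min x 1 + Num.min y 1.
Proof.
move=> x0 y0 zxy; have [z1|z1] := leP z 1; have [x1|x1] := leP x 1;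
  have [y1|y1] := leP y 1; lra.
Qed.

Lemma cutoff_add e x y : 0 < e -> cutoff e (x + y) <= cutoff e x + cutoff e y.
Proof.
move=> e0; apply: min1_add; rewrite ?divr_ge0 ?pos_ge0 ?(ltW e0)//.
by rewrite -mulrDl ler_wpM2r ?invr_ge0 ?(ltW e0)// pos_add.
Qed.

Lemma mass_ge0 : 0 <= m.
Proof.
have := mom_ge0 (@pos_ge0 R) (f0 0); rewrite (evo_mass E) lee_fin; exact.
Qed.

Lemma ctrl_bound_ge0 : 0 <= B.
Proof. exact: le_trans (ctrl_ge0 C 0) (ctrl_le C 0). Qed.

Lemma mom_fin w c1 c2 t : measurable_fun setT w -> nonneg1 w -> 0 <= c1 -> 0 <= c2 ->
  (forall x, w x <= c1 + c2 * pos x) ->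
  (mom w (f t) <= c1%:E * mom (fun=> 1%R) (f t) + (c2 * m)%:E)%E.
Proof.
move=> mw w0 c10 c20 wc.
have -> : (c2 * m)%:E = (c2%:E * mom pos (f t))%E by rewrite (evo_mass E) EFinM.
rewrite -!momZ//; [|exact: pos_ge0].
have m1 : measurable_fun (@setT R) (fun=> c1 * 1 : R) by mfun.
have m2 : measurable_fun setT (fun x => c2 * pos x : R) by mfun.
have n1 : nonneg1 (fun=> c1 * 1 : R) by move=> x; rewrite mulr1.
have n2 : nonneg1 (fun x => c2 * pos x : R) by move=> x; rewrite mulr_ge0 ?pos_ge0.
rewrite -(momD m1 (mft t) m2 n1 n2 (f0 t)).
apply: mom_le => //; first by mfun.
by move=> x; rewrite mulr1 ler_wpM2r//; exact: f0.
Qed.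

Lemma mom_cutoff_le e t : 0 < e -> (mom (cutoff e) (f t) <= (m / e)%:E)%E.
Proof.
move=> e0; have ei : 0 <= e^-1 by rewrite invr_ge0 ltW.
have := @mom_fin (cutoff e) 0 e^-1 t (cutoff_measurable e) (cutoff_ge0 e0) (lexx 0) ei.
rewrite mul0e add0e mulrC; apply => x.
by rewrite add0r cutoff_lepos.
Qed.

(** [evo_num] asserts finiteness at each time, whereas the weak balances need a bound on a time
    interval. The estimates are therefore conditional on this predicate until [num_bounded]. *)
Definition num_bounded_on (c d : R) :=
  exists2 M : R, 0 <= M & forall t : R, c <= t <= d -> (mom (fun=> 1%R) (f t) <= M%:E)%E.

(** The point is that the constant [A * N] is independent of [e]. Fragments of a particle with
    [pos y <= e] are estimated by their mass, which gives exactly the weighted rate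
    [cutoff e y * a y] of the loss; beyond [e], where the cutoff is 1, they are counted, and their
    number is at most N A (1 + y). The weighted rate then cancels, being integrable under the bound
    on the number. *)
Lemma cutoff_balance e s t : 0 < e -> 0 <= s -> s <= t -> t <= T ->
  num_bounded_on s t ->
  (mom (cutoff e) (f t) <= mom (cutoff e) (f s) +
   (A * N)%:E * \int[mu]_(r in `]s, t]) (mom (cutoff e) (f r) + m%:E))%E.
Proof.
move=> e0 s0 st tT [M M0 num].
have m0 := mass_ge0; have mc := cutoff_measurable e; have c0 := cutoff_ge0 e0.
have AN0 : 0 <= A * N by rewrite mulr_ge0.
pose c y := cutoff e y * a y + A * N * (cutoff e y + pos y).
have mc' : measurable_fun setT c by rewrite /c; mfun.
have ca0 : nonneg1 (fun y => cutoff e y * a y) by move=> y; rewrite mulr_ge0.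
have cp0 : nonneg1 (fun y => cutoff e y + pos y) by move=> y; rewrite addr_ge0 ?pos_ge0.
have c'0 : nonneg1 c by move=> y; rewrite addr_ge0// mulr_ge0.
have ei : 0 <= e^-1 by rewrite invr_ge0 ltW.
have linc y : (lin (flip g) (cutoff e) y <= (c y)%:E)%E.
  have [ye|ye] := leP (pos y) e.
    apply: le_trans (gN y mc c0 (lexx 0) ei _) _.
      by move=> x; rewrite add0r cutoff_lepos.
    rewrite lee_fin /c mul0r add0r; apply: ler_wpDr; first exact: mulr_ge0.
    by rewrite /cutoff min_l ?ler_pdivrMr ?mul1r// [leRHS]mulrC [e^-1 * _]mulrC.
  apply: le_trans (gN y mc c0 ler01 (lexx 0) _) _.
    by move=> x; rewrite mul0r addr0 cutoff_le1.
  rewrite lee_fin mul1r mul0r addr0 /c ler_wpDl//.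
  rewrite /cutoff min_r ?ler_pdivlMr ?mul1r ?(ltW ye)// mulrAC ler_wpM2r//.
have num' (r : R) : s < r <= t -> (mom (fun=> 1%R) (f r) <= M%:E)%E.
  by move=> /andP[sr rt]; apply: num; rewrite (ltW sr).
have bal := weak_upper C E mc c0 mc' c'0 m0 M0 ler01 ctrl_bound_ge0
  (fun x y => cutoff_add x y e0) (cutoff_le1 e) linc s0 st tT num'.
have mca : measurable_fun setT (fun y => cutoff e y * a y) by mfun.
have mcp : measurable_fun setT (fun y => cutoff e y + pos y) by mfun.
have momc r : mom c (f r) = (mom (fun y => cutoff e y * a y)%R (f r) +
    (A * N)%:E * (mom (cutoff e) (f r) + m%:E))%E.
  rewrite /c momD//; [|by mfun|by move=> y; rewrite mulr_ge0].
  by rewrite momZ// momD//; [rewrite (evo_mass E)|exact: pos_ge0].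
have m1 : measurable_fun setT (fun r => mom (fun y => cutoff e y * a y)%R (f r)).
  exact: measurable_mom E _ mca ca0.
have m2 : measurable_fun setT (fun r => mom (cutoff e) (f r)).
  exact: measurable_mom E _ mc c0.
have n1 r : (0 <= mom (fun y => cutoff e y * a y)%R (f r))%E by exact: mom_ge0.
have n2 r : (0 <= mom (cutoff e) (f r) + m%:E)%E.
  by apply: adde_ge0; [exact: mom_ge0|rewrite lee_fin].
have m3 : measurable_fun setT (fun r => mom (cutoff e) (f r) + m%:E)%E by mfun.
have m4 : measurable_fun setT (fun r => (A * N)%:E * (mom (cutoff e) (f r) + m%:E))%E by mfun.
have n4 r : (0 <= (A * N)%:E * (mom (cutoff e) (f r) + m%:E))%E by rewrite mule_ge0// lee_fin.
move: bal; rewrite (funext momc).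
rewrite (ge0_integralDT (measurable_itv _) m1 m4 n1 n4).
rewrite (ge0_integralZlT (measurable_itv _) AN0 m3 n2).
have Ifin : (\int[mu]_(r in `]s, t]) mom (fun y => cutoff e y * a y)%R (f r))%E \is a fin_num.
  rewrite ge0_fin_numE ?integral_ge0//.
  apply: (@le_lt_trans _ _ (\int[mu]_(r in `]s, t]) (A * M + A * m)%:E)%E).
    apply: ge0_le_integralT => //.
    move=> r /=; rewrite in_itv/= => /andP[sr rt].
    apply: le_trans (@mom_fin _ A A r mca ca0 A_ge0 A_ge0 _) _.
      move=> x; rewrite -[X in X + _]mulr1 -mulrDr; apply: le_trans (aA x).
      by rewrite ler_piMl ?cutoff_le1//; exact: a0.
    rewrite EFinD leeD2r// EFinM lee_wpmul2l// num// (ltW sr)//.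
  rewrite integral_cst//= lebesgue_measure_itv/= lte_fin.
  by case: ifPn => _; rewrite -?EFinB -?EFinM ?mule0 ltry.
exact: lee_cancel Ifin.
Qed.

Lemma mom_fin_num e t : 0 < e -> (mom (cutoff e) (f t))%E \is a fin_num.
Proof.
move=> e0; rewrite ge0_fin_numE; first by apply: le_lt_trans (mom_cutoff_le t e0) _; rewrite ltry.
by apply: mom_ge0; [exact: cutoff_ge0|exact: f0].
Qed.

Variable n : nat.
Hypothesis ANT : A * N * T <= n%:R / 2.

Lemma cutoff_gronwall e s t : 0 < e -> 0 <= s -> s <= t -> t <= T ->
  num_bounded_on s t ->
  fine (mom (cutoff e) (f t)) + m <= 2 ^+ n * (fine (mom (cutoff e) (f s)) + m).
Proof.
move=> e0 s0 st tT num; have m0 := mass_ge0.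
have mc := cutoff_measurable e; have c0 := cutoff_ge0 e0.
have AN0 : 0 <= A * N by rewrite mulr_ge0.
pose Nf r := mom (cutoff e) (f r).
have Nf0 r : (0 <= Nf r)%E by apply: mom_ge0 => //; exact: f0.
have mNf : measurable_fun setT Nf by exact: measurable_mom E _ mc c0.
have Nffin r : Nf r \is a fin_num by exact: mom_fin_num.
(* [gronwall_half] starts at time 0, so the moment and the coefficient are switched on at [s] by
   indicators. The a priori bound m / e + m depends on [e], but the conclusion does not involve
   it. *)
pose Y (r : R) := ((\1_(`[s, +oo[%classic) r)%:E * (Nf r + m%:E))%E.
pose b (r : R) := (A * N * \1_(`]s, +oo[%classic) r)%:E.
have mY : measurable_fun setT Y by rewrite /Y; mfun.
have mb : measurable_fun setT b by rewrite /b; mfun.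
have Nm0 r : (0 <= Nf r + m%:E)%E by rewrite adde_ge0// lee_fin.
have Y0 r : (0 <= Y r)%E by rewrite mule_ge0// lee_fin.
have b0 r : (0 <= b r)%E by rewrite lee_fin mulr_ge0.
have Y1 (r : R) : s <= r -> Y r = (Nf r + m%:E)%E.
  by move=> sr; rewrite /Y indicE mem_set ?mul1e//= in_itv/= sr.
have nm0 : 0 <= fine (Nf s) + m by rewrite addr_ge0// fine_ge0.
have C0 : 0 <= m / e + m by rewrite addr_ge0// divr_ge0// ltW.
have := gronwall_half (T := t) nm0 C0 mY mb Y0 b0.
have YC (r : R) : 0 <= r <= t -> (Y r <= (m / e + m)%:E)%E.
  move=> _; rewrite /Y indicE; case: (r \in _); last by rewrite mul0e lee_fin.
  by rewrite mul1e EFinD leeD2r// mom_cutoff_le.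
have YA (r : R) : 0 <= r <= t ->
    (Y r <= (fine (Nf s) + m)%:E + \int[mu]_(q in `]0%R, r]) (Y q * b q))%E.
  move=> /andP[r0 rt].
  have Yb0 q : (0 <= Y q * b q)%E by rewrite mule_ge0.
  have I0 : (0 <= \int[mu]_(q in `]0%R, r]) (Y q * b q))%E by exact: integral_ge0.
  have [sr|rs] := leP s r; last first.
    have -> : Y r = 0%E; last by rewrite adde_ge0.
    rewrite /Y indicE memNset ?mul0e//= in_itv/= andbT => /(lt_le_trans rs).
    by rewrite ltxx.
  have mYb : measurable_fun setT (fun q => Y q * b q)%E by mfun.
  rewrite Y1// (integral_oc_split s0 sr mYb Yb0).
  have numr : num_bounded_on s r.
    by have [M M0 H] := num; exists M => // q /andP[sq qr]; rewrite H// sq (le_trans qr).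
  have := cutoff_balance e0 s0 sr (le_trans rt tT) numr.
  rewrite -/(Nf r) -/(Nf s) -(fineK (Nffin s)) => bal.
  apply: le_trans (leeD2r m%:E bal) _; rewrite addeAC -EFinD; apply: leeD2l.
  rewrite -ge0_integralZlT//; last by mfun.
  rewrite (_ : (\int[mu]_(x in `]s, r]) _ = \int[mu]_(x in `]s, r]) (Y x * b x))%E); last first.
    apply: eq_integral => q; rewrite inE /= in_itv/= => /andP[sq qr].
    rewrite Y1 ?(ltW sq)// muleC /b indicE mem_set ?mulr1//= in_itv/= sq//.
  by rewrite leeDr// integral_ge0.
move=> /(_ n YC YA t); rewrite (le_trans s0 st) lexx => /(_ isT).
rewrite Y1// -(fineK (Nffin t)) -EFinD lee_fin; apply.
apply: (@le_trans _ _ (\int[mu]_(r in `]0%R, t]) (A * N)%:E)%E).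
  apply: ge0_le_integralT => //.
  by move=> r _; rewrite lee_fin ler_piMr// indicE; case: (_ \in _).
rewrite integral_cst//= lebesgue_measure_itv/= lte_fin.
case: ifPn => _; last by rewrite mule0 lee_fin divr_ge0.
rewrite -EFinB -EFinM lee_fin subr0; apply: le_trans ANT.
by rewrite ler_wpM2l.
Qed.

Lemma num_fin_num t : (mom (fun=> 1%R) (f t)) \is a fin_num.
Proof.
by rewrite ge0_fin_numE; [exact: evo_num E t|apply: mom_ge0 => //; exact: f0].
Qed.

(** The number is known to be bounded on [s, t] for s > c only, so the estimate from [s] has to pass
    to the limit as [s] decreases to [c]. This asks for upper semicontinuity of the cutoff moment,
    opposite to what Fatou gives; conservation of mass reverses the direction. Afterwards [e] tends
    to 0, again by Fatou. *)
Lemma num_propagate c t : 0 <= c -> c < t -> t <= T ->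
  (forall s : R, c < s -> s <= t -> num_bounded_on s t) ->
  fine (mom (fun=> 1%R) (f t)) + m <= 2 ^+ n * (fine (mom (fun=> 1%R) (f c)) + m).
Proof.
move=> c0 ct tT num; have m0 := mass_ge0.
have pow0 : 0 < 2 ^+ n :> R by rewrite exprn_gt0.
have claim e : 0 < e ->
    fine (mom (cutoff e) (f t)) + m <= 2 ^+ n * (fine (mom (cutoff e) (f c)) + m).
  move=> e0; set q := fine (mom (cutoff e) (f t)).
  have mc := cutoff_measurable e; have cu0 := cutoff_ge0 e0.
  (* A nonnegative weight whose moment is m / e minus the cutoff moment, since the mass is constant.
     Lower semicontinuity for [v] is upper semicontinuity for the cutoff. *)
  pose v x := e^-1 * pos x - cutoff e x.
  have ei : 0 <= e^-1 by rewrite invr_ge0 ltW.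
  have mv : measurable_fun setT v by rewrite /v; mfun.
  have v0 : nonneg1 v by move=> x; rewrite subr_ge0 cutoff_lepos.
  have vE r : (mom v (f r) + mom (cutoff e) (f r) = (m / e)%:E)%E.
    rewrite -momD//.
    have -> : (fun x => v x + cutoff e x) = (fun x => e^-1 * pos x).
      by apply/funext => x; rewrite /v subrK.
    rewrite momZ//; last exact: pos_ge0.
    by rewrite (evo_mass E) -EFinM mulrC.
  have vfin r : mom v (f r) = (m / e - fine (mom (cutoff e) (f r)))%:E.
    rewrite EFinB -(vE r) fineK ?mom_fin_num// addeK// mom_fin_num//.
  pose s j : R := c + (t - c) / j.+2%:R.
  have sj j : c < s j <= t.
    have tc : 0 < t - c by rewrite subr_gt0.
    apply/andP; split; first by rewrite ltrDl divr_gt0.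
    rewrite -lerBrDl ler_pdivrMr// ler_peMr ?(ltW tc)//.
    by rewrite ler1n.
  have scvg : s @ \oo --> c.
    rewrite -[X in _ --> X]addr0; apply: cvgD; first exact: cvg_cst.
    rewrite -(mulr0 (t - c)); apply: cvgMr.
    apply/cvgrPdist_lt => d d0; near=> j; rewrite sub0r normrN gtr0_norm//.
    apply: le_lt_trans (_ : j.+1%:R^-1 < d).
      by rewrite lef_pV2 ?posrE// ler_nat.
    by near: j; exact: (near_infty_natSinv_lt (PosNum d0)).
  have H : (mom v (f c) <= (m / e - ((q + m) / 2 ^+ n - m))%:E)%E.
    apply: (mom_lsc mv mf v0 f0 (evo_cont E) scvg) => j.
    have /andP[cs st] := sj j.
    have := cutoff_gronwall e0 (ltW (le_lt_trans c0 cs)) st tT (num _ cs st).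
    by rewrite vfin lee_fin lerD2l lerN2 lerBlDr ler_pdivrMr// mulrC.
  by move: H; rewrite vfin lee_fin lerD2l lerN2 lerBlDr ler_pdivrMr// mulrC.
have H : (mom (fun=> 1%R) (f t) <=
    (2 ^+ n * (fine (mom (fun=> 1%R) (f c)) + m) - m)%:E)%E.
  apply: (@mom_fatou _ (fun j => cutoff j.+1%:R^-1) (fun=> f t)) => //.
  - by move=> j; exact: cutoff_measurable.
  - by move=> j; exact: cutoff_ge0.
  - by move=> j; exact: f0.
  - move=> x; apply: cvg_near_cst; have [x0|x0] := leP x 0.
      by apply: nearW => j; rewrite (evo_le0 E)// !mulr0.
    near=> j; congr (_ * _); rewrite /cutoff min_r//.
    rewrite pos_id ?(ltW x0)// ler_pdivlMr// mul1r ltW//.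
    by near: j; exact: (near_infty_natSinv_lt (PosNum x0)).
  - move=> j; have ej : 0 < j.+1%:R^-1 :> R by rewrite invr_gt0.
    rewrite -(fineK (mom_fin_num t ej)) lee_fin lerBrDr.
    apply: le_trans (claim _ ej) _; rewrite ler_pM2l// lerD2r fine_le//.
    + exact: mom_fin_num.
    + exact: num_fin_num.
    + apply: mom_le => //; [exact: cutoff_measurable|exact: cutoff_ge0|].
      by move=> x; rewrite ler_wpM2r ?cutoff_le1//; exact: f0.
by move: H; rewrite -(fineK (num_fin_num t)) lee_fin lerBrDr.
Unshelve. all: by end_near. Qed.

Let M0 t := fine (mom (fun=> 1%R) (f t)).

Let M0E t : mom (fun=> 1%R) (f t) = (M0 t)%:E.
Proof. by rewrite fineK// num_fin_num. Qed.

Let M0_ge0 t : 0 <= M0 t.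
Proof. by rewrite fine_ge0// mom_ge0//; exact: f0. Qed.

(** Suppose the number is bounded on every subinterval where it stays above [K]. Given [t], let [q]
    be the last time up to [t] at which the number is at most L = max(K, M0 c); it is attained by
    lower semicontinuity. On ]q, t] the number exceeds [K], so [num_propagate] applies from [q] and
    bounds the number at [t] independently of [t]. *)
Lemma num_unbounded_subinterval (c d K : R) : 0 <= c -> c <= d -> d <= T -> 0 <= K ->
  ~ num_bounded_on c d ->
  exists p : R * R, [/\ c <= p.1, p.1 <= p.2, p.2 <= d,
    (forall t : R, p.1 <= t <= p.2 -> K < M0 t) & ~ num_bounded_on p.1 p.2].
Proof.
move=> c0 cd dT K0' nB; apply: contrapT => nex; apply: nB.
have m0 := mass_ge0.
have pow1 : 1 <= 2 ^+ n :> R by rewrite exprn_ege1// ler1n.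
pose L := Num.max K (M0 c).
have L0 : 0 <= L by rewrite le_max K0'.
have LL : L <= 2 ^+ n * (L + m).
  by apply: le_trans (_ : L + m <= _); [rewrite lerDl|rewrite ler_peMl ?addr_ge0].
have Bd (s t : R) : c <= s -> s <= t -> t <= d ->
    (forall r : R, s <= r <= t -> K < M0 r) -> num_bounded_on s t.
  move=> cs st td H; apply: contrapT => nB; apply: nex; exists (s, t).
  by split.
exists (2 ^+ n * (L + m)); first by rewrite mulr_ge0 ?addr_ge0// ltW// (lt_le_trans ltr01).
move=> t /andP[ct td]; rewrite M0E lee_fin.
pose S := [set s : R | c <= s <= t /\ M0 s <= L].
have Sc : S c by split; rewrite ?lexx ?ct// le_max lexx orbT.
have hS : has_sup S by split; [exists c|exists t => s [/andP[]]].
set q := sup S.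
have cq : c <= q by apply: sup_upper_bound Sc.
have qt : q <= t by apply: ge_sup => //; [exists c|move=> s [/andP[]]].
have Mq : M0 q <= L.
  have /choice[s sP] : forall j : nat, exists s : R, S s /\ q - j.+1%:R^-1 < s.
    move=> j; have ej : 0 < j.+1%:R^-1 :> R by rewrite invr_gt0.
    by have [s Ss qs] := sup_adherent ej hS; exists s.
  have scvg : s @ \oo --> q.
    apply/cvgrPdist_lt => e e0; near=> j.
    have [Ss qs] := sP j; have sq : s j <= q by apply: sup_upper_bound Ss.
    rewrite ger0_norm ?subr_ge0//.
    apply: lt_trans (_ : j.+1%:R^-1 < e).
      by move: qs; rewrite !ltrBlDr addrC.
    by near: j; exact: (near_infty_natSinv_lt (PosNum e0)).
  rewrite -lee_fin -M0E; apply: (mom_lsc _ mf one0 f0 (evo_cont E) scvg) => //.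
  by move=> j; rewrite M0E lee_fin; have [[]] := sP j.
have [<-|qt'] := eqVneq q t; first exact: le_trans LL.
have {qt'} qt' : q < t by rewrite lt_neqAle qt' qt.
have := num_propagate (le_trans c0 cq) qt' (le_trans td dT).
move=> H; apply: (@le_trans _ _ (M0 t + m)); first by rewrite lerDl.
apply: le_trans (H _) _; last by rewrite ler_pM2l ?exprn_gt0// lerD2r.
move=> s qs st; apply: Bd => //; first exact: le_trans (ltW qs).
move=> r /andP[sr rt]; rewrite ltNge; apply/negP => Mr.
have : r <= q.
  apply: sup_upper_bound => //; split; last by rewrite le_max Mr.
  by rewrite rt (le_trans cq)// (le_trans (ltW qs)).
by move=> /(lt_le_trans (lt_le_trans qs sr)); rewrite ltxx.
Unshelve. all: by end_near. Qed.

(* Nested intervals on which the number exceeds j = 0, 1, 2, ... would have a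
   common point, where the number is infinite. *)
Lemma num_bounded : 0 <= T -> num_bounded_on 0 T.
Proof.
move=> T0; apply: contrapT => nB.
pose good (p : R * R) := [/\ 0 <= p.1, p.1 <= p.2, p.2 <= T & ~ num_bounded_on p.1 p.2].
have /choice[phi phiP] : forall jp : nat * (R * R), exists q : R * R, good jp.2 ->
    [/\ good q, jp.2.1 <= q.1, q.2 <= jp.2.2 &
      forall t : R, q.1 <= t <= q.2 -> jp.1%:R < M0 t].
  move=> [j p] /=; have [gp|ngp] := pselect (good p); last by exists p.
  have [p0 p12 pT nBp] := gp.
  have [q [pq qq qp Mq nBq]] := num_unbounded_subinterval p0 p12 pT (ler0n R j) nBp.
  by exists q => _; split => //; split => //; [exact: le_trans pq|exact: le_trans pT].
pose p := fix p j := if j is i.+1 then phi (i, p i) else (0, T).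
have gp j : good (p j).
  by elim: j => [|j IH]; [split|have [] := phiP (j, p j) IH].
have pS j : [/\ (p j).1 <= (p j.+1).1, (p j.+1).2 <= (p j).2 &
    forall t : R, (p j.+1).1 <= t <= (p j.+1).2 -> j%:R < M0 t].
  by have [] := phiP (j, p j) (gp j).
have p1mono i j : (p i).1 <= (p (i + j)%N).1.
  by elim: j => [|j IH]; rewrite ?addn0// addnS; apply: le_trans IH _; have [] := pS (i + j)%N.
have p2mono i j : (p (i + j)%N).2 <= (p i).2.
  by elim: j => [|j IH]; rewrite ?addn0// addnS; apply: le_trans IH; have [] := pS (i + j)%N.
have p12 i j : (p i).1 <= (p j).2.
  have [_ H _ _] := gp (i + j)%N.
  by apply: le_trans (p1mono i j) (le_trans H _); rewrite addnC; exact: p2mono.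
pose S := range (fun j => (p j).1).
have S0 : S !=set0 by exists (p 0%N).1; exists 0%N.
have hS : has_sup S by split => //; exists T => _ [j _ <-]; exact: (p12 j 0%N).
pose x := sup S.
have Mx j : j%:R < M0 x.
  have [_ _] := pS j; apply; apply/andP; split.
    by apply: sup_upper_bound => //; exists j.+1.
  by apply: ge_sup => // _ [i _ <-]; exact: p12.
have := Mx (Num.truncn (M0 x)).+1.
by move=> /(lt_trans (truncnS_gt (M0 x))); rewrite ltxx.
Qed.

Lemma num_le t : 0 <= t <= T -> M0 t + m <= 2 ^+ n * (M0 0 + m).
Proof.
move=> /andP[t0 tT]; have m0 := mass_ge0.
have [->|t0'] := eqVneq t 0.
  by rewrite ler_peMl ?addr_ge0// exprn_ege1// ler1n.
apply: num_propagate => //; first by rewrite lt_neqAle eq_sym t0' t0.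
move=> s s0 st; have [M MM H] := num_bounded (le_trans t0 tT); exists M => // r /andP[sr rt].
by apply: H; rewrite (le_trans rt tT) (le_trans (ltW s0) sr).
Qed.

End ParticleNumber.

(** * Lipschitz continuity in time *)

Section Lipschitz.
Context {R : realType}.
Local Notation mu := (@lebesgue_measure R).
Variables (T m B K0 A N M : R) (k g : R -> R -> R) (a u : R -> R) (f : R -> R -> R).
Hypothesis C : coefficients B K0 k g a u.
Hypothesis E : evolution T m k g a u f.
Hypothesis A_ge0 : 0 <= A.
Hypothesis N_ge0 : 0 <= N.
Hypothesis aA : forall y, a y <= A * (1 + pos y).
Hypothesis gN : forall (w : R -> R) (c1 c2 y : R), measurable_fun setT w ->
  nonneg1 w -> 0 <= c1 -> 0 <= c2 -> (forall x, w x <= c1 + c2 * pos x) ->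
  (lin (flip g) w y <= (a y * (c1 * N + c2 * pos y))%:E)%E.
Hypothesis M_ge0 : 0 <= M.
Hypothesis num : forall t : R, 0 <= t <= T -> (mom (fun=> 1%R) (f t) <= M%:E)%E.

Let mf := evo_meas E.
Let f0 := evo_ge0 E.
Let ma := rate_meas C.
Let a0 := rate_ge0 C.
Let mft t : measurable_fun setT (f t) := measurable_slice t mf.
Let one0 : nonneg1 (fun=> 1 : R) := fun=> ler01.
Let mone : measurable_fun (@setT R) (fun=> 1 : R).
Proof. by mfun. Qed.

Lemma total_rate_le t : 0 <= t <= T ->
  (\int[mu]_x (loss k a (u t) (f t) x + gain k g (u t) (f t) x) <=
   (2 * (B * (K0 * (M + m) ^+ 2)) + (1 + N) * (A * M + A * m))%:E)%E.
Proof.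
move=> tT; have m0 := mass_ge0 E; have B0 := ctrl_bound_ge0 C.
have K00 := coag_const_ge0 C.
have ut0 := ctrl_ge0 C t; have utB := ctrl_le C t.
have mL : measurable_fun setT (fun x => loss k a (u t) (f t) x).
  have mL := loss_measurable C E.
  exact: (@ejm_comp _ _ _ (fun r x => loss k a (u r) (f r) x) (fun=> t) id).
have mG : measurable_fun setT (fun x => gain k g (u t) (f t) x).
  have mG := gain_measurable C E.
  exact: (@ejm_comp _ _ _ (fun r x => gain k g (u r) (f r) x) (fun=> t) id).
rewrite (ge0_integralDT measurableT mL mG (loss_ge0 C E t) (gain_ge0 C E t)).
have bil1 : (bil (fun x y => 1 * k x y)%R (f t) (f t) <= (K0 * (M + m) ^+ 2)%:E)%E.
  rewrite -[K0 in X in (_ <= X)%E]mul1r.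
  apply: (bil_bounded C E (v := fun _ _ => 1) _ _ ler01 m0 M_ge0) => //; last exact: num.
  by rewrite /jointly_measurable; mfun.
have uX (c : R) : 0 <= c -> c <= B ->
    (c%:E * bil (fun x y => 1 * k x y)%R (f t) (f t) <= (B * (K0 * (M + m) ^+ 2))%:E)%E.
  move=> c0 cB; rewrite EFinM; apply: lee_pmul; rewrite ?lee_fin//.
  by apply: bil_ge0 => // x y; rewrite mul1r; exact: coag_ge0 C x y.
have mom1a : (mom a (f t) <= (A * M + A * m)%:E)%E.
  have aA' y : a y <= A + A * pos y by apply: le_trans (aA y) _; rewrite mulrDr mulr1.
  apply: le_trans (mom_fin E t ma a0 A_ge0 A_ge0 aA') _.
  by rewrite EFinD leeD2r// EFinM lee_wpmul2l// num.
have EL := integral_loss C E t mone one0.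
have EG := integral_gain C E t mone one0.
rewrite (_ : (\int[mu]_x loss _ _ _ _ _)%E =
  (\int[mu]_x ((1 : R)%:E * loss k a (u t) (f t) x))%E); last first.
  by apply: eq_integral => x _; rewrite mul1e.
rewrite (_ : (\int[mu]_x gain _ _ _ _ _)%E =
  (\int[mu]_x ((1 : R)%:E * gain k g (u t) (f t) x))%E); last first.
  by apply: eq_integral => x _; rewrite mul1e.
rewrite EL EG.
have -> : (fun x => 1 * a x) = a by apply/funext => x; rewrite mul1r.
have linb : (\int[mu]_y ((f t y)%:E * lin (flip g) (fun=> 1%R) y) <= N%:E * mom a (f t))%E.
  rewrite -momZ//; apply: ge0_le_integralT => //.
  - have mgk := frag_meas C; have g0 := frag_ge0 C.
    rewrite /lin /flip; mfun => //.
    by move=> x y; rewrite lee_fin mulr_ge0//; exact: g0.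
  - by mfun.
  - move=> y; apply: mule_ge0; first by rewrite lee_fin; exact: f0.
    by apply: lin_ge0 => // ? ?; exact: frag_ge0 C _ _.
  - move=> y _; rewrite muleC EFinM; apply: lee_wpmul2r; first by rewrite lee_fin; exact: f0.
    apply: le_trans (@gN (fun=> 1) 1 0 y mone one0 ler01 (lexx 0) _) _.
      by move=> x; rewrite mul0r addr0.
    by rewrite mul1r mul0r addr0 mulrC.
apply: (@le_trans _ _ (((B * (K0 * (M + m) ^+ 2))%:E + (A * M + A * m)%:E) +
  ((B * (K0 * (M + m) ^+ 2))%:E + (N * (A * M + A * m))%:E))%E).
  apply: leeD; apply: leeD => //; [exact: uX| |].
    apply: uX; first exact: divr_ge0.
    by apply: le_trans utB; rewrite ler_pdivrMr// ler_peMr// ler1n.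
  by apply: le_trans linb _; rewrite EFinM lee_wpmul2l.
rewrite -!EFinD lee_fin le_eqVlt; apply/orP; left; apply/eqP; ring.
Qed.

Definition lipschitz_const := 2 * (B * (K0 * (M + m) ^+ 2)) + (1 + N) * (A * M + A * m).

(** For almost every size the increment is at most the loss plus the gain in between, and both have
    an integral over all sizes that is bounded uniformly in time. *)
Lemma evolution_lipschitz (s t : R) : 0 <= s -> s <= t -> t <= T ->
  (mom (fun=> 1%R) (fun x => `|f t x - f s x|)%R <= (lipschitz_const * (t - s))%:E)%E.
Proof.
move=> s0 st tT.
pose G r x := (loss k a (u r) (f r) x + gain k g (u r) (f r) x)%E.
have mL := loss_measurable C E; have mGn := gain_measurable C E.
have mG : measurable_fun setT (fun z : R * R => G z.1 z.2) by rewrite /G; mfun.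
have G0 r x : (0 <= G r x)%E by rewrite adde_ge0 ?(loss_ge0 C E) ?(gain_ge0 C E).
have m1 : measurable_fun setT (fun x => `|f t x - f s x|) by mfun.
have m2 : measurable_fun (@setT R) (fun=> 0 : R) by mfun.
have m3 : measurable_fun setT (fun z : R * R => (fun _ _ : R => 0%E : \bar R) z.1 z.2).
  exact: measurable_cst.
have n1 : nonneg1 (fun x => `|f t x - f s x|) by move=> x.
have := @integrate_balance _ _ _ _ _ (fun _ _ => 0%E) G (measurable_itv `]s, t]) mone m1 m2
  one0 n1 (fun=> lexx 0) m3 mG (fun _ _ => lexx 0%E) G0.
have H : {ae mu, forall x, (`|f t x - f s x|%:E + \int[mu]_(_ in `]s, t]) 0%E <=
      0%:E + \int[mu]_(r in `]s, t]) G r x)%E}.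
  apply: aeS (pointwise_balance C E) => x /(_ s t s0 st tT).
  have mLx : measurable_fun setT (fun r => loss k a (u r) (f r) x).
    exact: (@ejm_comp _ _ _ (fun r x => loss k a (u r) (f r) x) id (fun=> x)).
  have mGx : measurable_fun setT (fun r => gain k g (u r) (f r) x).
    exact: (@ejm_comp _ _ _ (fun r x => gain k g (u r) (f r) x) id (fun=> x)).
  rewrite (ge0_integralDT (measurable_itv _) mLx mGx); last 2 first.
  - by move=> r; exact: loss_ge0 C E r x.
  - by move=> r; exact: gain_ge0 C E r x.
  rewrite integral0 adde0 add0e.
  have : (0 <= \int[mu]_(r in `]s, t]) loss k a (u r) (f r) x)%E.
    by apply: integral_ge0 => r _; exact: loss_ge0 C E r x.
  have : (0 <= \int[mu]_(r in `]s, t]) gain k g (u r) (f r) x)%E.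
    by apply: integral_ge0 => r _; exact: gain_ge0 C E r x.
  move: (\int[mu]_(r in `]s, t]) loss k a (u r) (f r) x)%E
    (\int[mu]_(r in `]s, t]) gain k g (u r) (f r) x)%E.
  case=> [l| |]; case=> [q| |]//; rewrite ?leey// -!EFinD !lee_fin => q0 l0 [] H.
  rewrite ler_norml; apply/andP; split; lra.
move=> /(_ H); rewrite [X in (_ + X <= _)%E]integral0_eq; last first.
  by move=> r _; apply: integral0_eq => x _; rewrite mule0.
rewrite adde0 => /le_trans; apply.
rewrite [X in (X + _ <= _)%E]/mom integral0_eq; last by move=> x _; rewrite mulr0.
rewrite add0e; apply: (@le_trans _ _ (\int[mu]_(r in `]s, t]) lipschitz_const%:E)%E).
  apply: ge0_le_integral => //.
  - by move=> r _; apply: integral_ge0 => x _; rewrite mul1e.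
  - apply: (@measurable_funS _ _ _ _ setT) => //; apply: measurable_integral => //.
      by mfun.
    by move=> x y; rewrite mul1e.
  - move=> r /=; rewrite in_itv/= => /andP[sr rt].
    have rT : 0 <= r <= T by rewrite (le_trans s0 (ltW sr)) (le_trans rt).
    apply: le_trans (total_rate_le rT); rewrite le_eqVlt; apply/orP; left; apply/eqP.
    by apply: eq_integral => x _; rewrite mul1e.
rewrite integral_cst//= lebesgue_measure_itv/= lte_fin.
case: ifPn => [_|]; first by rewrite -EFinB -EFinM.
by rewrite -leNgt => ts; rewrite mule0 lee_fin (le_anti (_ : t <= s <= t)) ?subrr ?mulr0// ts.
Qed.

End Lipschitz.

(** * Moments and tails *)

Section Growth.
Context {R : realType}.
Local Notation mu := (@lebesgue_measure R).
Implicit Types x y s : R.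

Lemma powR_le1D (s y : R) : 0 <= s -> s <= 1 -> 0 <= y -> y `^ s <= 1 + y.
Proof.
move=> s0 s1 y0; apply: (@le_trans _ _ ((1 + y) `^ s)).
  by apply: ge0_ler_powR; rewrite ?nnegrE ?addr_ge0// lerDr.
by apply: ler1_powR => //; rewrite lerDl.
Qed.

Lemma powR1D_le (s y : R) : s <= 1 -> 0 <= y -> (1 + y) `^ s <= 1 + y.
Proof. by move=> s1 y0; apply: ler1_powR => //; rewrite lerDl. Qed.

Lemma powR_double (s y : R) : 0 <= s -> s <= 1 -> 1 <= y -> (1 + y) `^ s <= 2 * y `^ s.
Proof.
move=> s0 s1 y1; have y0 : 0 <= y by exact: le_trans y1.
apply: (@le_trans _ _ ((2 * y) `^ s)).
  by apply: ge0_ler_powR; rewrite ?nnegrE ?addr_ge0 ?mulr_ge0// mulr2n mulrDl mul1r lerD2r.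
by rewrite powRM// ler_wpM2r ?powR_ge0// ler1_powR// ler1n.
Qed.

Lemma powR_geD (lm lam y : R) : lm <= lam -> 1 <= y -> y `^ lm <= y `^ lam.
Proof. by move=> ll y1; apply: ler_powR. Qed.

(** Since [muh < lm], the power y^(lm - muh) exceeds 2 P / (e am) beyond some size X; the 2 comes
    from (1 + y)^muh <= 2 y^muh for y >= 1. Sizes up to X are covered by [C1]. Neither X nor [C1]
    depends on [al] and [lam], which makes later bounds uniform in n. *)
Lemma growth_absorb (P am lm muh e : R) : 0 <= P -> 0 < am -> 0 <= muh -> muh <= 1 ->
  muh < lm -> 0 < e -> exists2 C1 : R, 0 <= C1 & forall al lam x, am <= al -> lm <= lam ->
    P * (1 + pos x) `^ muh <= e * rate al lam x + C1.
Proof.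
move=> P0 am0 mh0 mh1 ml e0.
pose d := lm - muh; have d0 : 0 < d by rewrite subr_gt0.
pose q := 2 * P / (e * am); have q0 : 0 <= q by rewrite divr_ge0 ?mulr_ge0// ltW// mulr_gt0.
pose X := Num.max 1 (q `^ d^-1).
have X1 : 1 <= X by rewrite le_max lexx.
have Xq : q <= X `^ d.
  have -> : q = (q `^ d^-1) `^ d by rewrite -powRrM mulVf ?gt_eqF// powRr1.
  have X0 : 0 <= X by exact: le_trans X1.
  apply: ge0_ler_powR; rewrite ?nnegrE ?(ltW d0) ?powR_ge0//.
  by rewrite /X le_max lexx orbT.
have C0 : 0 <= P * (1 + X) by rewrite mulr_ge0// addr_ge0// (le_trans _ X1).
exists (P * (1 + X)) => // al lam x aml lml; rewrite /rate.
have y0 := pos_ge0 x; move: (pos x) y0 => y y0.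
have al0 : 0 < al by exact: lt_le_trans aml.
have [yX|Xy] := leP y X.
  apply: (@le_trans _ _ (P * (1 + X))).
    by rewrite ler_wpM2l//; apply: le_trans (powR1D_le mh1 y0) _; rewrite lerD2l.
  by rewrite lerDr mulr_ge0 ?(ltW e0)// mulr_ge0 ?(ltW al0)// powR_ge0.
have y1 : 1 <= y by rewrite (le_trans X1)// ltW.
apply: (@le_trans _ _ (e * (al * y `^ lam))); last by rewrite lerDl.
apply: (@le_trans _ _ (P * (2 * y `^ muh))); first by rewrite ler_wpM2l// powR_double.
have H : y `^ muh * q <= y `^ lam.
  apply: le_trans (powR_geD lml y1); rewrite (_ : lm = muh + d); last by rewrite /d addrC subrK.
  rewrite powRD; last by apply/implyP => _; rewrite gt_eqF// (lt_le_trans _ y1).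
  rewrite ler_wpM2l ?powR_ge0//; apply: le_trans Xq _.
  by apply: ge0_ler_powR; rewrite ?nnegrE ?(ltW d0) ?(ltW Xy)// (le_trans _ X1).
rewrite [leLHS](_ : _ = e * (am * (y `^ muh * q))); last first.
  by rewrite /q; field; rewrite !gt_eqF.
rewrite ler_wpM2l ?(ltW e0)//; apply: ler_pM => //; first exact: ltW.
by rewrite mulr_ge0 ?powR_ge0.
Qed.

Definition trunc (A x : R) : R := Num.min (pos x) A.

Lemma trunc_ge0 A : 0 <= A -> nonneg1 (trunc A).
Proof. by move=> A0 x; rewrite le_min pos_ge0. Qed.

Lemma trunc_le A x : trunc A x <= A.
Proof. by rewrite ge_min lexx orbT. Qed.

Lemma trunc_le_pos A x : trunc A x <= pos x.
Proof. by rewrite ge_min lexx. Qed.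

Lemma trunc_measurable A : measurable_fun setT (trunc A).
Proof. by have mpos := @measurable_pos R; rewrite /trunc; mfun. Qed.

Lemma trunc_ratio A x y : 0 <= A -> 0 < x -> x <= y -> x / y * trunc A y <= trunc A x.
Proof.
move=> A0 x0 xy; have y0 : 0 < y by exact: lt_le_trans xy.
rewrite /trunc !pos_id ?(ltW x0) ?(ltW y0)// le_min; apply/andP; split.
  apply: (@le_trans _ _ (x / y * y)); last by rewrite divfK// gt_eqF.
  by rewrite ler_wpM2l ?divr_ge0 ?(ltW x0) ?(ltW y0)// ge_min lexx.
apply: (@le_trans _ _ (1 * A)); last by rewrite mul1r.
apply: ler_pM; rewrite ?divr_ge0 ?(ltW x0) ?(ltW y0)//.
- by rewrite le_min (ltW y0) A0.
- by rewrite ler_pdivrMr// mul1r.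
- by rewrite ge_min lexx orbT.
Qed.

Definition truncpow (A s x : R) : R := trunc A x `^ s.

Lemma truncpow_measurable A s : measurable_fun setT (truncpow A s).
Proof. by have m := trunc_measurable A; rewrite /truncpow; mfun. Qed.

Lemma truncpow_ge0 A s : nonneg1 (truncpow A s).
Proof. by move=> x; exact: powR_ge0. Qed.

Lemma truncpow_bound A s x : 0 <= s -> 0 <= A -> truncpow A s x <= A `^ s.
Proof.
by move=> s0 A0; apply: ge0_ler_powR; rewrite ?nnegrE ?trunc_ge0// trunc_le.
Qed.

Lemma truncpow_le A s x : 0 <= s -> s <= 1 -> 0 <= A -> truncpow A s x <= 1 + pos x.
Proof.
move=> s0 s1 A0; apply: le_trans (powR_le1D s0 s1 (trunc_ge0 A0 x)) _.
by rewrite lerD2l trunc_le_pos.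
Qed.

Lemma truncpow_ratio A s x y : 0 <= s -> 0 <= A -> 0 < x -> x <= y ->
  (x / y) `^ s * truncpow A s y <= truncpow A s x.
Proof.
move=> s0 A0 x0 xy; have y0 : 0 < y by exact: lt_le_trans xy.
have xy0 : 0 <= x / y by rewrite divr_ge0 ?(ltW x0) ?(ltW y0).
rewrite /truncpow -powRM ?trunc_ge0//.
apply: ge0_ler_powR; rewrite ?nnegrE ?trunc_ratio ?trunc_ge0//.
by apply: mulr_ge0 => //; exact: trunc_ge0.
Qed.

Lemma rate_le0 al lam x : lam != 0 -> x <= 0 -> rate al lam x = 0.
Proof. by move=> l0 x0; rewrite /rate /pos max_r// powR0// mulr0. Qed.

(** The exponents add up: 1 + muh = (1 - d) + lm with d = lm - muh. So the moment of order 1 + muh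
    is what the dissipation of the moment of order 1 - d controls. The factor 4 is the value of the
    left side's bound at y = 1, and the product of two doublings for y > 1. *)
Lemma moment_le_dissipation (am al lm lam muh A x : R) : 0 < am -> am <= al -> lm <= lam ->
  0 <= muh -> muh <= 1 -> 0 <= A -> pos x <= A ->
  (1 + pos x) `^ (1 + muh) <=
    4 + 4 / am * (truncpow A (1 - (lm - muh)) x * rate al lam x).
Proof.
move=> am0 aml lml mh0 mh1 A0; rewrite /truncpow /rate /trunc => xA; rewrite min_l//.
have y0 := pos_ge0 x; move: (pos x) y0 xA => y y0 _.
have al0 : 0 < al by exact: lt_le_trans aml.
have r0 : 0 <= 4 / am * (y `^ (1 - (lm - muh)) * (al * y `^ lam)).
  by rewrite mulr_ge0 ?divr_ge0 ?(ltW am0)// mulr_ge0 ?powR_ge0// mulr_ge0 ?powR_ge0// ltW.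
rewrite powRD; last by apply/implyP => _; rewrite gt_eqF// ltr_wpDr.
rewrite powRr1 ?addr_ge0//.
have [y1|y1] := leP y 1.
  apply: (@le_trans _ _ 4); last by rewrite lerDl.
  have : (1 + y) `^ muh <= 1 + y by exact: powR1D_le.
  have : 0 <= (1 + y) `^ muh by exact: powR_ge0.
  by move: ((1 + y) `^ muh) => p p0 p1; nra.
apply: (@le_trans _ _ (4 / am * (y `^ (1 - (lm - muh)) * (al * y `^ lam)))); last by rewrite lerDr.
have y1' := ltW y1.
apply: (@le_trans _ _ (4 * (y * y `^ muh))).
  have := powR_double mh0 mh1 y1'; have := powR_ge0 (1 + y) muh; have := powR_ge0 y muh.
  by move: ((1 + y) `^ muh) (y `^ muh) => p q *; nra.
have -> : y * y `^ muh = y `^ (1 - (lm - muh)) * y `^ lm.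
  rewrite -powRD; last by apply/implyP => _; rewrite gt_eqF// (lt_le_trans _ y1').
  rewrite (_ : 1 - (lm - muh) + lm = 1 + muh); last by ring.
  by rewrite powRD ?powRr1//; apply/implyP => _; rewrite gt_eqF// (lt_le_trans _ y1').
rewrite [leLHS](_ : _ = 4 / am * (y `^ (1 - (lm - muh)) * (am * y `^ lm))); last first.
  by field; rewrite gt_eqF.
rewrite ler_wpM2l ?divr_ge0 ?(ltW am0)// ler_wpM2l ?powR_ge0//.
by apply: ler_pM; rewrite ?powR_ge0 ?(ltW am0)// powR_geD.
Qed.

Lemma mom_fatou_time (D : set R) (w_ : nat -> R -> R) (w : R -> R) (f : R -> R -> R)
    (c : \bar R) : measurable D ->
  (forall j, measurable_fun setT (w_ j)) -> (forall j, nonneg1 (w_ j)) ->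
  jointly_measurable f -> nonneg2 f ->
  (forall x, w_ j x @[j --> \oo] --> w x) ->
  (forall j, \int[mu]_(t in D) mom (w_ j) (f t) <= c)%E ->
  (\int[mu]_(t in D) mom w (f t) <= c)%E.
Proof.
move=> mD mw w0 mf f0 wlim H.
have mM j : measurable_fun setT (fun t => mom (w_ j) (f t)).
  have mwj := mw j; rewrite /mom; mfun => //.
  by move=> x y; rewrite lee_fin mulr_ge0 ?w0.
have mM' j : measurable_fun D (fun t => mom (w_ j) (f t)).
  exact: measurable_funS (mM j).
have M0 j t : D t -> (0 <= mom (w_ j) (f t))%E.
  by move=> _; apply: mom_ge0; [exact: w0|exact: f0].
apply: le_trans (le_trans (@fatou _ _ _ mu D mD (fun j t => mom (w_ j) (f t)) mM' M0)
  (limn_einf_le H)).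
have mLim : measurable_fun D (fun t => limn_einf (fun j => mom (w_ j) (f t))).
  rewrite /limn_einf; apply: measurableT_comp => //; apply: measurable_fun_limn_esup => j.
  exact: measurableT_comp (mM' j).
have wE t : (mom w (f t) <= limn_einf (fun j => mom (w_ j) (f t)))%E.
  have mF j : measurable_fun setT (fun x => (w_ j x * f t x)%:E).
    by have mwj := mw j; mfun.
  have F0 j x : setT x -> (0 <= (w_ j x * f t x)%:E)%E by rewrite lee_fin mulr_ge0 ?w0.
  apply: le_trans (@fatou _ _ _ mu setT measurableT (fun j x => (w_ j x * f t x)%:E) mF F0).
  rewrite le_eqVlt; apply/orP; left; apply/eqP; apply: eq_integral => x _.
  have C1 : (w_ j x * f t x)%:E @[j --> \oo] --> (w x * f t x)%:E.
    by apply: cvg_EFin; [apply: nearW|apply: cvgMl; exact: wlim].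
  by rewrite is_cvg_limn_einfE; [apply/esym/cvg_lim|apply/cvg_ex; eexists; exact: C1].
have mw' : measurable_fun setT w.
  by apply: (measurable_fun_cvg mw) => x _; exact: wlim.
have w0' : nonneg1 w.
  by move=> x; apply: cvgr_to_ge (wlim x) _; apply: nearW => j; exact: w0.
apply: ge0_le_integral => //.
- by move=> t _; apply: mom_ge0; [|exact: f0].
- apply: (@measurable_funS _ _ _ _ setT) => //; rewrite /mom; mfun => //.
  by move=> x y; rewrite lee_fin mulr_ge0.
Qed.

End Growth.

Section Tails.
Context {R : realType}.

(** The factor gained beyond size [r] when the power [s] of 1 + x is replaced by the first power; it
    tends to 0 as [r] grows if s < 1. *)
Definition decay (s r : R) : R := ((1 + r) `^ (1 - s))^-1.

Lemma decay_ge0 (s r : R) : 0 <= decay s r.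
Proof. by rewrite invr_ge0 powR_ge0. Qed.

Lemma powR_tail_le (s r y : R) : s <= 1 -> 0 <= r -> r <= y ->
  (1 + y) `^ s <= decay s r * (1 + y).
Proof.
move=> s1 r0 ry; have y0 : 0 <= y by exact: le_trans ry.
have r1 : 0 < 1 + r by exact: ltr_wpDr. have y1 : 0 < 1 + y by exact: ltr_wpDr.
rewrite /decay ler_pdivlMl ?powR_gt0//.
rewrite [leRHS](_ : _ = (1 + y) `^ (1 - s) * (1 + y) `^ s); last first.
  by rewrite -powRD ?subrK ?powRr1 ?(ltW y1)//; apply/implyP; rewrite gt_eqF.
apply: ler_wpM2r; first exact: powR_ge0.
by apply: ge0_ler_powR; rewrite ?nnegrE ?subr_ge0 ?(ltW r1) ?(ltW y1)// lerD2l.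
Qed.

Definition beyond (r x : R) : R := \1_[set y | r <= pos y] x.

Lemma beyondP (r x : R) : beyond r x = (if r <= pos x then 1 else 0).
Proof.
rewrite /beyond indicE; case: (boolP (x \in _)) => [|/negP H].
  by rewrite inE/= => ->.
by case: ifPn => // rx; exfalso; apply: H; rewrite inE.
Qed.

Lemma beyond_ge0 r : nonneg1 (beyond r).
Proof. by move=> x; rewrite beyondP; case: ifP. Qed.

Lemma beyond_measurable r : measurable_fun setT (beyond r).
Proof.
apply: measurable_indic; rewrite [X in measurable X](_ : _ = pos @^-1` `[r, +oo[).
  by rewrite -[X in measurable X]setTI; apply: measurable_pos.
by apply/seteqP; split => y /=; rewrite in_itv/= andbT.
Qed.

End Tails.

(** The truncated identity is additive as long as [x + y <= r]. Otherwise one partner has size at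
    least r / 2, and the defect is at most the size of the other. *)
Lemma min_defect_le {R : realType} (r x y : R) : 0 < x -> 0 < y ->
  Num.min x r + Num.min y r <= Num.min (x + y) r +
    2 * (x * (if r / 2 <= y then 1 else 0) + (if r / 2 <= x then 1 else 0) * y).
Proof.
move=> x0 y0.
have [xyr|xyr] := leP (x + y) r.
  have : Num.min x r <= x by rewrite ge_min lexx.
  have : Num.min y r <= y by rewrite ge_min lexx.
  by case: ifP => _; case: ifP => _; lra.
have [yr|yr] := leP (r / 2) y.
  have : Num.min x r <= x by rewrite ge_min lexx.
  have : Num.min y r <= r by rewrite ge_min lexx orbT.
  by case: ifP => _; lra.
have -> : r / 2 <= x by lra.
have : Num.min x r <= r by rewrite ge_min lexx orbT.
have : Num.min y r <= y by rewrite ge_min lexx.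
lra.
Qed.

(** With z = x / y, the parabola 2 z - z^2 stays below min(x, r) / r. For x <= r this holds because
    [2 * r <= y] makes 2 z r at most x; for larger x because the parabola never exceeds 1. *)
Lemma min_tangent_le {R : realType} (r x y : R) : 0 < r -> 2 * r <= y -> 0 < x -> x <= y ->
  2 * (x / y) * r <= Num.min x r + (x / y) ^+ 2 * r.
Proof.
move=> r0 ry x0 xy; have y0 : 0 < y by exact: lt_le_trans xy.
have [xr|xr] := leP x r.
  have : x / y * (2 * r) <= x.
    by apply: (@le_trans _ _ (x / y * y)); [rewrite ler_pM2l// divr_gt0|rewrite divfK// gt_eqF].
  have : 0 <= (x / y) ^+ 2 * r by rewrite mulr_ge0 ?sqr_ge0// ltW.
  lra.
have : 0 <= (1 - x / y) ^+ 2 * r by rewrite mulr_ge0 ?sqr_ge0// ltW.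
by move: (x / y) => p; lra.
Qed.

Section Moments.
Context {R : realType}.
Local Notation mu := (@lebesgue_measure R).
Variables (T m B K0 M Kh al am lam lm nu muh : R) (k : R -> R -> R) (u : R -> R).
Variable f : R -> R -> R.
Hypothesis C : coefficients B K0 k (frag_kernel al lam nu) (rate al lam) u.
Hypothesis E : evolution T m k (frag_kernel al lam nu) (rate al lam) u f.
Hypotheses (T_ge0 : 0 <= T) (M_ge0 : 0 <= M) (Kh_ge0 : 0 <= Kh).
Hypotheses (am_gt0 : 0 < am) (am_le : am <= al) (lm_le : lm <= lam) (lam_le1 : lam <= 1).
Hypotheses (muh_ge0 : 0 <= muh) (muh_lt : muh < lm) (nu_gt : -1 < nu) (nu_le0 : nu <= 0).
Hypothesis k_le : forall x y : R, k x y <= Kh * ((1 + pos x) `^ muh * (1 + pos y) `^ muh).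
Hypothesis num : forall t : R, 0 <= t <= T -> (mom (fun=> 1%R) (f t) <= M%:E)%E.

Let d := lm - muh.
Let a := rate al lam.
Let q (x : R) := (1 + pos x) `^ muh.
Let mf := evo_meas E.
Let f0 := evo_ge0 E.
Let mpos := @measurable_pos R.
Let ma := rate_meas C.
Let a0 := rate_ge0 C.
Let mk := coag_meas C.
Let k0 := coag_ge0 C.

Let d_gt0 : 0 < d. Proof. by rewrite subr_gt0. Qed.
Let lm_le1 : lm <= 1. Proof. exact: le_trans lm_le lam_le1. Qed.
Let d_le1 : d <= 1. Proof. by rewrite lerBlDr ler_wpDr. Qed.
Let muh_le1 : muh <= 1. Proof. by rewrite ltW// (lt_le_trans muh_lt). Qed.
Let lam_gt0 : 0 < lam. Proof. exact: le_lt_trans muh_ge0 (lt_le_trans muh_lt lm_le). Qed.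
Let al_ge0 : 0 <= al. Proof. exact: le_trans (ltW am_gt0) am_le. Qed.
Let m_ge0 : 0 <= m. Proof. exact: mass_ge0 E. Qed.
Let B_ge0 : 0 <= B. Proof. exact: ctrl_bound_ge0 C. Qed.
Let q_ge0 x : 0 <= q x. Proof. exact: powR_ge0. Qed.
Let mq : measurable_fun setT q. Proof. by rewrite /q; mfun. Qed.
Let q_le x : q x <= 1 + pos x. Proof. by apply: powR1D_le => //; exact: pos_ge0. Qed.

Let num1 (w : R -> R) t : 0 <= t <= T -> measurable_fun setT w -> nonneg1 w ->
  (forall x, w x <= 1 + pos x) -> (mom w (f t) <= (M + m)%:E)%E.
Proof.
move=> tT mw w0 wle.
have w1 x : w x <= 1 + 1 * pos x by rewrite mul1r.
apply: le_trans (mom_fin E t mw w0 ler01 ler01 w1) _.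
by rewrite mul1e mul1r EFinD leeD2r// num.
Qed.

Let bil_split (p1 p2 : R -> R) t : measurable_fun setT p1 -> measurable_fun setT p2 ->
  nonneg1 p1 -> nonneg1 p2 ->
  (bil (fun x y => (p1 x * p2 y) * k x y)%R (f t) (f t) <=
   Kh%:E * (mom (fun x => p1 x * q x)%R (f t) * mom (fun y => p2 y * q y)%R (f t)))%E.
Proof.
move=> m1 m2 p10 p20; have ft0 : nonneg1 (f t) by exact: f0.
have mft : measurable_fun setT (f t) by mfun.
have mq1 : measurable_fun setT (fun x => p1 x * q x) by mfun.
have mq2 : measurable_fun setT (fun x => p2 x * q x) by mfun.
have q10 : nonneg1 (fun x => p1 x * q x) by move=> x; exact: mulr_ge0.
have q20 : nonneg1 (fun x => p2 x * q x) by move=> x; exact: mulr_ge0.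
have mq1' : measurable_fun setT (fun x => Kh * (p1 x * q x)) by mfun.
have q10' : nonneg1 (fun x => Kh * (p1 x * q x)) by move=> x; exact: mulr_ge0.
rewrite muleA -(momZ Kh_ge0 mq1 mft q10 ft0) -(bil_prod mq1' mft mq2 mft q10' q20 ft0 ft0).
apply: bil_le => //.
- by rewrite /jointly_measurable; mfun.
- by rewrite /jointly_measurable; mfun.
- by move=> x y; apply: mulr_ge0; [exact: mulr_ge0|exact: k0].
- by move=> x y; exact: mulr_ge0.
move=> x y; apply: ler_wpM2r; first exact: mulr_ge0.
rewrite [leRHS](_ : _ = p1 x * p2 y * (Kh * (q x * q y))); last by ring.
by apply: ler_wpM2l; [exact: mulr_ge0|exact: k_le].
Qed.

Let bil_sum (p1 p2 : R -> R) t : measurable_fun setT p1 -> measurable_fun setT p2 ->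
  nonneg1 p1 -> nonneg1 p2 ->
  ((u t)%:E * bil (fun x y => (p1 x * p2 y + p2 x * p1 y) * k x y)%R (f t) (f t) <=
   (2 * B * Kh)%:E * (mom (fun x => p1 x * q x)%R (f t) * mom (fun y => p2 y * q y)%R (f t)))%E.
Proof.
move=> m1 m2 p10 p20; have ft0 : nonneg1 (f t) by exact: f0.
have mft : measurable_fun setT (f t) by mfun.
have q10 : nonneg1 (fun x => p1 x * q x) by move=> x; exact: mulr_ge0.
have q20 : nonneg1 (fun x => p2 x * q x) by move=> x; exact: mulr_ge0.
have M1 := mom_ge0 q10 ft0; have M2 := mom_ge0 q20 ft0.
have ut := ctrl_ge0 C t.
rewrite [X in bil X _ _](_ : _ =
    (fun x y => (p1 x * p2 y) * k x y + (p2 x * p1 y) * k x y)); last first.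
  by apply/funext => x; apply/funext => y; rewrite mulrDl.
rewrite bilD//.
- have b1 := bil_split t m1 m2 p10 p20; have b2 := bil_split t m2 m1 p20 p10.
  rewrite (muleC (mom (fun x => p2 x * q x)%R _)) in b2.
  apply: (@le_trans _ _ (B%:E * (2%:E * (Kh%:E * (mom (fun x => p1 x * q x)%R (f t) *
      mom (fun y => p2 y * q y)%R (f t)))))%E); last first.
    by rewrite !muleA -!EFinM (mulrC B).
  apply: lee_pmul; rewrite ?lee_fin//; last 2 first.
  + exact: ctrl_le C t.
  + by rewrite mule_natl mule2n; exact: leeD b1 b2.
  apply: adde_ge0; apply: bil_ge0 => // x y; (apply: mulr_ge0; [exact: mulr_ge0|exact: k0]).
- by rewrite /jointly_measurable; mfun.
- by rewrite /jointly_measurable; mfun.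
- by move=> x y; apply: mulr_ge0; [exact: mulr_ge0|exact: k0].
- by move=> x y; apply: mulr_ge0; [exact: mulr_ge0|exact: k0].
Qed.

Lemma weighted_rate_finite (w : R -> R) (cw : R) : measurable_fun setT w -> nonneg1 w ->
  0 <= cw -> (forall x, w x <= cw) ->
  (\int[mu]_(r in `]0%R, T]) mom (fun x => w x * a x)%R (f r) \is a fin_num)%E.
Proof.
move=> mw w0 cw0 wle.
have mm : measurable_fun setT (fun r => mom (fun x => w x * a x)%R (f r)).
  by apply: (measurable_mom E); [mfun|move=> x; exact: mulr_ge0].
rewrite ge0_fin_numE; last first.
  by apply: integral_ge0 => r _; apply: mom_ge0; [move=> x; exact: mulr_ge0|exact: f0].
apply: (@le_lt_trans _ _ (\int[mu]_(r in `]0%R, T]) (cw * al * (M + m))%:E)%E).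
  apply: ge0_le_integral => //.
  - by move=> r _; apply: mom_ge0; [move=> x; exact: mulr_ge0|exact: f0].
  - exact: measurable_funS mm.
  - move=> r /=; rewrite in_itv/= => /andP[r0 rT].
    have r0T : 0 <= r <= T by rewrite ltW.
    have c0 : 0 <= cw * al by exact: mulr_ge0.
    have wa x : w x * a x <= cw * al + cw * al * pos x.
      rewrite -[X in X + _]mulr1 -mulrDr -mulrA; apply: ler_pM => //.
      by apply: rate_le => //; rewrite lam_gt0.
    have mwa : measurable_fun setT (fun x => w x * a x) by mfun.
    have wa0 : nonneg1 (fun x => w x * a x) by move=> x; exact: mulr_ge0.
    apply: le_trans (mom_fin E r mwa wa0 c0 c0 wa) _.
    by rewrite mulrDr EFinD leeD2r// [X in (_ <= X)%E]EFinM lee_wpmul2l// num.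
rewrite integral_cst//= lebesgue_measure_itv/= lte_fin.
by case: ifP => _; rewrite -?EFinB -?EFinM ?ltry// mule0 ltry.
Qed.

(* Fragmentation increases the moment of order 1 - d < 1 in proportion to the same
   moment weighted by the rate, and absorb makes this dominate coagulation. *)
Lemma dissipation_bound (A C1 : R) : 0 <= A -> 0 <= C1 ->
  (forall x, 2 * B * Kh * (M + m) * q x <= d / 4 * a x + C1) ->
  (\int[mu]_(r in `]0%R, T]) mom (fun x => truncpow A (1 - d) x * a x)%R (f r) <=
   (4 / d * ((M + m) * (1 + C1 * T)))%:E)%E.
Proof.
move=> A0 C10 absorb; pose w := truncpow A (1 - d).
have d1 : 0 <= 1 - d by rewrite subr_ge0.
have d1' : 1 - d <= 1 by rewrite gerBl ltW.
have mw : measurable_fun setT w by exact: truncpow_measurable.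
have w0 : nonneg1 w by exact: truncpow_ge0.
have wle x : w x <= A `^ (1 - d) by exact: truncpow_bound.
have Xfin := weighted_rate_finite mw w0 (powR_ge0 A (1 - d)) wle.
(* The relative moment of order 1 - d is (2 + nu) / (2 + nu - d) = 1 + d / (2 + nu - d), and the
   last denominator is at most 2 because [nu <= 0]. *)
pose c x := (1 + d / 2) * (w x * a x).
have cd0 : 0 <= 1 + d / 2 by rewrite addr_ge0// divr_ge0// ltW.
have mwa : measurable_fun setT (fun x => w x * a x) by mfun.
have wa0 : nonneg1 (fun x => w x * a x) by move=> x; exact: mulr_ge0.
have mc : measurable_fun setT c by rewrite /c; mfun.
have c0 : nonneg1 c by move=> x; exact: mulr_ge0.
(* A crude choice: all of [w x + w y] is counted as defect, since [absorb] makes even this small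
   against the dissipation. The form is that of [bil_sum]. *)
pose v x y := w x * 1 + 1 * w y.
have mv : jointly_measurable v by rewrite /jointly_measurable /v; mfun.
have v0 : nonneg2 v by move=> x y; apply: addr_ge0; exact: mulr_ge0.
have wadd x y : 0 < x -> 0 < y -> w x + w y <= w (x + y) + 2 * v x y.
  move=> _ _; rewrite /v mulr1 mul1r; apply: ler_wpDl => //.
  by rewrite ler_peMl ?addr_ge0// ler1n.
have linc y : ((c y)%:E <= lin (flip (frag_kernel al lam nu)) w y)%E.
  have [y0|y0] := leP y 0.
    rewrite /c /a rate_le0 ?gt_eqF// mulr0 mulr0.
    by apply: lin_ge0 => // ? ?; exact: frag_ge0 C _ _.
  have wr (x : R) : 0 < x < y -> (x / y) `^ (1 - d) * w y <= w x.
    by move=> /andP[x0 xy]; apply: truncpow_ratio => //; exact: ltW.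
  apply: le_trans (lin_frag_ge_powR lam al_ge0 nu_gt mw w0 y0 d1 wr).
  rewrite lee_fin /c mulrC (mulrC (w y)); apply: ler_wpM2l; first exact: mulr_ge0.
  have nd : 0 < 1 + nu + (1 - d) by have := d_le1; have := nu_gt; lra.
  rewrite ler_pdivlMr//.
  by have := d_gt0; have := d_le1; have := nu_gt; have := nu_le0; move: d nd => dd; nra.
have T0 : 0 <= T <= T by rewrite T_ge0 lexx.
have numr (r : R) : (0 < r <= T)%R -> (mom (fun=> 1%R) (f r) <= M%:E)%E.
  by move=> /andP[r0 rT]; apply: num; rewrite ltW.
have := weak_lower C E mw w0 mc c0 mv v0 m_ge0 M_ge0 (powR_ge0 A (1 - d)) B_ge0 wadd wle linc
  (lexx 0) T_ge0 (lexx T) numr.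
set X := (\int[mu]_(r in `]0%R, T]) mom (fun x => w x * a x)%R (f r))%E in Xfin *.
have mft t : measurable_fun setT (f t) by mfun.
have ft0 t : nonneg1 (f t) by exact: f0.
have mX : measurable_fun setT (fun r => mom (fun x => w x * a x)%R (f r)).
  by apply: (measurable_mom E); [exact: mwa|exact: wa0].
have X0 r : (0 <= mom (fun x => w x * a x)%R (f r))%E by exact: mom_ge0.
have -> : (\int[mu]_(r in `]0%R, T]) mom c (f r) = (1 + d / 2)%:E * X)%E.
  under eq_integral => r _ do rewrite /c (momZ cd0 mwa (mft r) wa0 (ft0 r)).
  exact: ge0_integralZlT (measurable_itv _) cd0 mX X0.
(* Fragmentation gains d / 2 of the dissipation; coagulation takes at most d / 4 of it plus a
   constant, so that d / 4 survives and bounds the dissipation. *)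
have up : (\int[mu]_(r in `]0%R, T]) (mom (fun x => w x * a x)%R (f r) +
      (u r)%:E * bil (fun x y => v x y * k x y)%R (f r) (f r)) <=
    (1 + d / 4)%:E * X + (C1 * (M + m) * T)%:E)%E.
  have dd0 : 0 <= 1 + d / 4 by rewrite addr_ge0// divr_ge0// ltW.
  have cT : (\int[mu]_(r in `]0%R, T]) (C1 * (M + m))%:E = (C1 * (M + m) * T)%:E)%E.
    rewrite integral_cst//= lebesgue_measure_itv/= lte_fin.
    by case: ltgtP T_ge0 => // [_|<-] _; rewrite ?oppr0 ?adde0 ?mule0 ?mulr0// -EFinM.
  rewrite -cT -(ge0_integralZlT (measurable_itv _) dd0 mX X0).
  have mX' : measurable_fun setT (fun r => (1 + d / 4)%:E * mom (fun x => w x * a x)%R (f r))%E.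
    by mfun.
  have mcst : measurable_fun (@setT R) (fun=> (C1 * (M + m))%:E) by exact: measurable_cst.
  rewrite -(ge0_integralDT (measurable_itv _) mX' mcst); last 2 first.
  - by move=> r; apply: mule_ge0; rewrite ?lee_fin.
  - by move=> r; rewrite lee_fin; apply: mulr_ge0 => //; exact: addr_ge0.
  apply: ge0_le_integral => //.
  - move=> r _; apply: adde_ge0 => //; apply: mule_ge0; first by rewrite lee_fin; exact: ctrl_ge0 C r.
    by apply: bil_ge0 => // x y; apply: mulr_ge0; [exact: v0|exact: k0].
  - apply: (@measurable_funS _ _ _ _ setT) => //; have mbil := measurable_bil C E mv v0.
    have mu_ := ctrl_meas C; mfun.
  - by apply: (@measurable_funS _ _ _ _ setT) => //; exact: emeasurable_funD.
  move=> r /=; rewrite in_itv/= => /andP[r0 rT]; have r0T : 0 <= r <= T by rewrite ltW.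
  rewrite EFinD ge0_muleDl ?lee_fin ?divr_ge0 ?(ltW d_gt0)// mul1e -(addeA (mom (fun x => w x * a x)%R (f r))).
  apply: leeD2l.
  have mone : measurable_fun (@setT R) (fun=> 1 : R) by mfun.
  have one0 : nonneg1 (fun=> 1 : R) by move=> x; exact: ler01.
  apply: le_trans (bil_sum r mw mone w0 one0) _.
  have mwq : measurable_fun setT (fun x => w x * q x) by mfun.
  have wq0 : nonneg1 (fun x => w x * q x) by move=> x; exact: mulr_ge0.
  have P0 : 0 <= 2 * B * Kh by apply: mulr_ge0 => //; exact: mulr_ge0.
  have P1 : 0 <= 2 * B * Kh * (M + m) by apply: mulr_ge0 => //; exact: addr_ge0.
  apply: (@le_trans _ _ ((2 * B * Kh)%:E * ((M + m)%:E * mom (fun x => w x * q x)%R (f r)))%E).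
    rewrite muleC (muleC _%:E); apply: lee_wpmul2r; first by rewrite lee_fin.
    rewrite muleC; apply: lee_wpmul2r; first exact: mom_ge0.
    by apply: num1 => //; [mfun|move=> x; rewrite mul1r|move=> x; rewrite mul1r].
  rewrite muleA -EFinM -(momZ P1 mwq (mft r) wq0 (ft0 r)).
  have d40 : 0 <= d / 4 by rewrite divr_ge0// ltW.
  rewrite -(momZ d40 mwa (mft r) wa0 (ft0 r)) EFinM.
  apply: (@le_trans _ _ (mom (fun x => d / 4 * (w x * a x))%R (f r) + C1%:E * mom w (f r))%E).
    have n1 : nonneg1 (fun x => d / 4 * (w x * a x)) by move=> x; exact: mulr_ge0.
    have n2 : nonneg1 (fun x => C1 * w x) by move=> x; exact: mulr_ge0.
    have m1 : measurable_fun setT (fun x => d / 4 * (w x * a x)) by mfun.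
    have m2 : measurable_fun setT (fun x => C1 * w x) by mfun.
    rewrite -(momZ C10 mw (mft r) w0 (ft0 r)) -(momD m1 (mft r) m2 n1 n2 (ft0 r)).
    apply: mom_le => //; [by mfun|by mfun| |].
    - by move=> x; exact: mulr_ge0.
    - move=> x; apply: ler_wpM2r => //.
      by have := ler_wpM2l (w0 x) (absorb x); rewrite mulrDr; congr (_ <= _); ring.
  rewrite leeD2l// lee_wpmul2l//; apply: num1 => // x.
  exact: truncpow_le.
move=> /le_trans /(_ (leeD (lexx _) up)).
have wT : (mom w (f T) <= (M + m)%:E)%E.
  by apply: num1 => // x; exact: truncpow_le.
have w00 : (0 <= mom w (f 0))%E by exact: mom_ge0.
move=> /le_trans /(_ (leeD wT (lexx _))) /(le_trans (leeD w00 (lexx _))).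
rewrite add0e; clear up; case: X Xfin => // X _; rewrite -!EFinM -!EFinD !lee_fin => H.
have d0 := d_gt0; rewrite -[leLHS](@mulKf _ (d / 4)) ?gt_eqF ?divr_gt0//.
rewrite invf_div ler_wpM2l ?divr_ge0 ?(ltW d0)//.
rewrite (_ : (M + m) * (1 + C1 * T) = (M + m) + C1 * (M + m) * T); last by ring.
by move: H; rewrite !mulrDl !mul1r; move: (C1 * _ * T) => Y; lra.
Qed.

(** The weight is cut off beyond j, where truncation at j does not affect the power and
    [moment_le_dissipation] applies. The dissipation bound is uniform in j, and Fatou removes the
    cutoff. *)
Lemma moment_bound (C1 : R) : 0 <= C1 ->
  (forall x, 2 * B * Kh * (M + m) * q x <= d / 4 * a x + C1) ->
  (\int[mu]_(r in `]0%R, T]) mom (fun x => (1 + pos x) `^ (1 + muh))%R (f r) <=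
   (4 * M * T + 4 / am * (4 / d * ((M + m) * (1 + C1 * T))))%:E)%E.
Proof.
move=> C10 absorb; set X := 4 / d * _.
pose w_ (j : nat) x : R := (1 + pos x) `^ (1 + muh) * \1_[set y | pos y <= j%:R] x.
have mset (j : nat) : measurable [set y : R | pos y <= j%:R].
  rewrite [X in measurable X](_ : _ = pos @^-1` `]-oo, j%:R]).
    by rewrite -[X in measurable X]setTI; apply: mpos.
  by apply/seteqP; split => y /=; rewrite in_itv/=.
have mw_ j : measurable_fun setT (w_ j) by rewrite /w_; mfun.
have w0 j : nonneg1 (w_ j) by move=> x; rewrite mulr_ge0 ?powR_ge0.
have wlim x : w_ j x @[j --> \oo] --> (1 + pos x) `^ (1 + muh).
  apply: cvg_near_cst; near=> j; rewrite /w_ indicE mem_set ?mulr1//=.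
  by near: j; apply: nbhs_infty_ger.
apply: (mom_fatou_time (measurable_itv _) mw_ w0 mf f0 wlim) => j.
have mft t : measurable_fun setT (f t) by mfun.
have ft0 t : nonneg1 (f t) by exact: f0.
pose w := truncpow j%:R (1 - d).
have mw : measurable_fun setT w by exact: truncpow_measurable.
have mwa : measurable_fun setT (fun x => w x * a x) by mfun.
have wa0 : nonneg1 (fun x => w x * a x) by move=> x; apply: mulr_ge0 => //; exact: truncpow_ge0.
have c40 : 0 <= 4 / am by rewrite divr_ge0// ltW.
have mone : measurable_fun (@setT R) (fun=> 1 : R) by mfun.
have one0 : nonneg1 (fun=> 1 : R) by move=> x; exact: ler01.
have mX : measurable_fun setT (fun r => mom (fun x => w x * a x)%R (f r)).
  by apply: (measurable_mom E); [exact: mwa|exact: wa0].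
have X0 r : (0 <= mom (fun x => w x * a x)%R (f r))%E by exact: mom_ge0.
apply: (@le_trans _ _ (\int[mu]_(r in `]0%R, T])
    ((4 * M)%:E + (4 / am)%:E * mom (fun x => w x * a x)%R (f r)))%E).
  apply: ge0_le_integral => //.
  - by move=> r _; exact: mom_ge0.
  - by apply: (@measurable_funS _ _ _ _ setT) => //; exact: (measurable_mom E).
  - by apply: (@measurable_funS _ _ _ _ setT) => //; mfun.
  move=> r /=; rewrite in_itv/= => /andP[r0 rT]; have r0T : 0 <= r <= T by rewrite ltW.
  apply: (@le_trans _ _ (4%:E * mom (fun=> 1%R) (f r) +
      (4 / am)%:E * mom (fun x => w x * a x)%R (f r))%E); last first.
    by apply: leeD => //; rewrite EFinM lee_wpmul2l// num.
  have four : (0 : R) <= 4 by [].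
  have n1 : nonneg1 (fun=> 4 * 1 : R) by move=> x; rewrite mulr1.
  have m1 : measurable_fun (@setT R) (fun=> 4 * 1 : R) by mfun.
  have n2 : nonneg1 (fun x => 4 / am * (w x * a x)) by move=> x; apply: mulr_ge0.
  have m2 : measurable_fun setT (fun x => 4 / am * (w x * a x)) by mfun.
  rewrite -(momZ c40 mwa (mft r) wa0 (ft0 r)) -(momZ four mone (mft r) one0 (ft0 r)).
  rewrite -(momD m1 (mft r) m2 n1 n2 (ft0 r)).
  apply: mom_le => //; first by mfun.
  move=> x; apply: ler_wpM2r => //; rewrite mulr1.
  rewrite /w_ indicE; case: (boolP (x \in _)) => [|_]; last first.
    by rewrite mulr0 addr_ge0//; apply: mulr_ge0.
  rewrite inE/= mulr1 => xj; exact: moment_le_dissipation.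
have mcst : measurable_fun (@setT R) (fun=> (4 * M)%:E) by exact: measurable_cst.
have mX' : measurable_fun setT (fun r => (4 / am)%:E * mom (fun x => w x * a x)%R (f r))%E.
  by mfun.
rewrite (ge0_integralDT (measurable_itv _) mcst mX'); last 2 first.
- by move=> r; rewrite lee_fin mulr_ge0.
- by move=> r; apply: mule_ge0; rewrite ?lee_fin.
rewrite (ge0_integralZlT (measurable_itv _) c40 mX X0) EFinD; apply: leeD.
  rewrite integral_cst//= lebesgue_measure_itv/= lte_fin.
  by case: ltgtP T_ge0 => // [_|<-] _; rewrite ?oppr0 ?adde0 ?mule0 ?mulr0// -EFinM.
by rewrite [leRHS]EFinM lee_wpmul2l ?lee_fin//; exact: dissipation_bound.
Unshelve. all: by end_near. Qed.

(* Tested with the concave function min(x, r): fragments of a particle larger than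
   2 r gain r / 3 of it, and the total cannot exceed the conserved mass. *)
Lemma tail_bound (r C4 : R) : 0 < r -> 0 <= C4 ->
  (\int[mu]_(s in `]0%R, T]) mom (fun x => (1 + pos x) `^ (1 + muh))%R (f s) <= C4%:E)%E ->
  ((r / 3)%:E * \int[mu]_(s in `]0%R, T]) mom (fun x => beyond (2 * r) x * a x)%R (f s) <=
   mom (fun x => pos x - trunc r x)%R (f 0) +
   (2 * B * Kh * (decay muh (r / 2) * (M + m)) * C4)%:E)%E.
Proof.
move=> r0 C40 mom4; pose w := trunc r.
have r0' := ltW r0.
have mw : measurable_fun setT w by exact: trunc_measurable.
have w0 : nonneg1 w by exact: trunc_ge0.
have wle x : w x <= r by exact: trunc_le.
have mone : measurable_fun (@setT R) (fun=> 1 : R) by mfun.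
have Xfin := weighted_rate_finite mw w0 r0' wle.
have mb s := @beyond_measurable R s; have b0 s := @beyond_ge0 R s.
have mwa : measurable_fun setT (fun x => w x * a x) by mfun.
have wa0 : nonneg1 (fun x => w x * a x) by move=> x; exact: mulr_ge0.
have mba : measurable_fun setT (fun x => beyond (2 * r) x * a x) by have := mb (2 * r) => ?; mfun.
have ba0 : nonneg1 (fun x => beyond (2 * r) x * a x).
  by move=> x; apply: mulr_ge0 => //; exact: b0.
have r30 : 0 <= r / 3 by rewrite divr_ge0.
(* Beyond 2 r the weight is [r] and fragments carry at least 4 / 3 of it, an excess of r / 3. For
   smaller particles the relative moment of order 1 shows that fragmentation does not lower the
   weight. *)
pose c x := w x * a x + r / 3 * (beyond (2 * r) x * a x).
have mc : measurable_fun setT c by rewrite /c; mfun.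
have c0 : nonneg1 c by move=> x; apply: addr_ge0 => //; exact: mulr_ge0.
pose p2 := beyond (r / 2).
have mp2 : measurable_fun setT p2 by exact: mb.
have p20 : nonneg1 p2 by exact: b0.
have pos0 := @pos_ge0 R.
pose v x y := pos x * p2 y + p2 x * pos y.
have mv : jointly_measurable v by rewrite /jointly_measurable /v; mfun.
have v0 : nonneg2 v by move=> x y; apply: addr_ge0; apply: mulr_ge0.
have wadd x y : 0 < x -> 0 < y -> w x + w y <= w (x + y) + 2 * v x y.
  move=> x0 y0; rewrite /v /p2 !beyondP /w /trunc !pos_id ?addr_ge0 ?(ltW x0) ?(ltW y0)//.
  exact: min_defect_le.
have linc y : ((c y)%:E <= lin (flip (frag_kernel al lam nu)) w y)%E.
  have [y0|y0] := leP y 0.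
    rewrite /c /a rate_le0 ?gt_eqF// !mulr0 addr0.
    by apply: lin_ge0 => // ? ?; exact: frag_ge0 C _ _.
  rewrite /c beyondP; case: ifPn => [ry|_].
    have yr : 2 * r <= y by rewrite -(pos_id (ltW y0)).
    have wy : w y = r by rewrite /w /trunc min_r// pos_id ?(ltW y0)//; lra.
    apply: le_trans (lin_frag_ge_quad lam al_ge0 nu_gt nu_le0 mw w0 y0 _).
      by rewrite lee_fin wy /a le_eqVlt; apply/orP; left; apply/eqP; field.
    move=> x /andP[x0 xy]; rewrite wy /w /trunc pos_id ?(ltW x0)//.
    by apply: min_tangent_le; rewrite // ltW.
  have wr (x : R) : 0 < x < y -> (x / y) `^ 1 * w y <= w x.
    move=> /andP[x0 xy]; rewrite powRr1 ?divr_ge0 ?(ltW x0) ?(ltW y0)//.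
    by apply: trunc_ratio => //; exact: ltW.
  apply: le_trans (lin_frag_ge_powR lam al_ge0 nu_gt mw w0 y0 ler01 wr).
  by rewrite fragment_mass// mulr1 mul0r mulr0 addr0 lee_fin mulrC.
have numr (s : R) : (0 < s <= T)%R -> (mom (fun=> 1%R) (f s) <= M%:E)%E.
  by move=> /andP[s0 sT]; apply: num; rewrite ltW.
have := weak_lower C E mw w0 mc c0 mv v0 m_ge0 M_ge0 r0' B_ge0 wadd wle linc
  (lexx 0) T_ge0 (lexx T) numr.
set X := (\int[mu]_(s in `]0%R, T]) mom (fun x => w x * a x)%R (f s))%E in Xfin *.
set Y := (\int[mu]_(s in `]0%R, T]) mom (fun x => beyond (2 * r) x * a x)%R (f s))%E.
have mft t : measurable_fun setT (f t) by mfun.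
have ft0 t : nonneg1 (f t) by exact: f0.
have mX : measurable_fun setT (fun s => mom (fun x => w x * a x)%R (f s)).
  by apply: (measurable_mom E); [exact: mwa|exact: wa0].
have X0 s : (0 <= mom (fun x => w x * a x)%R (f s))%E by exact: mom_ge0.
have mY : measurable_fun setT (fun s => mom (fun x => beyond (2 * r) x * a x)%R (f s)).
  by apply: (measurable_mom E); [exact: mba|exact: ba0].
have Y0 s : (0 <= mom (fun x => beyond (2 * r) x * a x)%R (f s))%E by exact: mom_ge0.
have -> : (\int[mu]_(s in `]0%R, T]) mom c (f s) = X + (r / 3)%:E * Y)%E.
  rewrite -(ge0_integralZlT (measurable_itv _) r30 mY Y0).
  have mY' : measurable_fun setT
    (fun s => (r / 3)%:E * mom (fun x => beyond (2 * r) x * a x)%R (f s))%E by mfun.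
  rewrite -(ge0_integralDT (measurable_itv _) mX mY'); last 2 first.
  - exact: X0.
  - by move=> s; apply: mule_ge0; [rewrite lee_fin|exact: Y0].
  apply: eq_integral => s _; rewrite -(momZ r30 mba (mft s) ba0 (ft0 s)) momD//.
  - by mfun.
  - by move=> x; exact: mulr_ge0.
pose Q := 2 * B * Kh * (decay muh (r / 2) * (M + m)).
have D0 := decay_ge0 muh (r / 2).
have P0 : 0 <= 2 * B * Kh by apply: mulr_ge0 => //; exact: mulr_ge0.
have Mm0 : 0 <= M + m by exact: addr_ge0.
have Dm0 : 0 <= decay muh (r / 2) * (M + m) by exact: mulr_ge0.
have Q0 : 0 <= Q by apply: mulr_ge0.
pose q4 x : R := (1 + pos x) `^ (1 + muh).
have mq4 : measurable_fun setT q4 by rewrite /q4; mfun.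
have q40 : nonneg1 q4 by move=> x; exact: powR_ge0.
have m4 : measurable_fun setT (fun s => mom q4 (f s)) by exact: (measurable_mom E).
have M40 s : (0 <= mom q4 (f s))%E by exact: mom_ge0.
have up : (\int[mu]_(s in `]0%R, T]) (mom (fun x => w x * a x)%R (f s) +
      (u s)%:E * bil (fun x y => v x y * k x y)%R (f s) (f s)) <= X + (Q * C4)%:E)%E.
  apply: (@le_trans _ _ (X + Q%:E * \int[mu]_(s in `]0%R, T]) mom q4 (f s))%E); last first.
    by apply: leeD2l; rewrite (EFinM Q); apply: lee_wpmul2l.
  rewrite -(ge0_integralZlT (measurable_itv _) Q0 m4 M40).
  have m4' : measurable_fun setT (fun s => Q%:E * mom q4 (f s))%E by mfun.
  have M40' s : (0 <= Q%:E * mom q4 (f s))%E by apply: mule_ge0; [rewrite lee_fin|exact: M40].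
  rewrite -(ge0_integralDT (measurable_itv _) mX m4' X0 M40').
  have mbil := measurable_bil C E mv v0; have mu_ := ctrl_meas C.
  apply: ge0_le_integral => //.
  - move=> s _; apply: adde_ge0 => //; apply: mule_ge0; first by rewrite lee_fin; exact: ctrl_ge0 C s.
    by apply: bil_ge0 => // x y; apply: mulr_ge0; [exact: v0|exact: k0].
  - by apply: (@measurable_funS _ _ _ _ setT) => //; mfun.
  - by apply: (@measurable_funS _ _ _ _ setT) => //; exact: emeasurable_funD.
  move=> s /=; rewrite in_itv/= => /andP[s0 sT]; have s0T : 0 <= s <= T by rewrite ltW.
  apply: leeD2l; apply: le_trans (bil_sum s mpos mp2 pos0 p20) _.
  rewrite (EFinM (2 * B * Kh)) -muleA; apply: lee_wpmul2l; first by rewrite lee_fin.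
  rewrite muleC; apply: lee_pmul.
  - by apply: mom_ge0 => // x; apply: mulr_ge0.
  - by apply: mom_ge0 => // x; apply: mulr_ge0.
  (* In a pair with a defect one partner is larger than r / 2; there the power [muh] is traded for
     the first power with the gain [decay]. The other partner contributes its size times the power
     [muh], hence the moment of order 1 + muh. *)
  - apply: (@le_trans _ _ (mom (fun x => decay muh (r / 2) * (1 + pos x))%R (f s))).
      apply: mom_le => //; [by mfun|by mfun| |].
      + by move=> x; apply: mulr_ge0.
      + move=> x; apply: ler_wpM2r => //; rewrite /p2 beyondP; case: ifPn => [rx|_].
          by rewrite mul1r; apply: powR_tail_le => //; exact: divr_ge0.
        by rewrite mul0r; apply: mulr_ge0 => //; exact: addr_ge0.
    rewrite momZ//; last 2 first.
    + by mfun.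
    + by move=> x; exact: addr_ge0.
    rewrite EFinM; apply: lee_wpmul2l; first by rewrite lee_fin.
    by rewrite (mom_add1pos E) EFinD leeD2r// num.
  - apply: mom_le => //; [by mfun| |].
    + by move=> x; apply: mulr_ge0.
    + move=> x; apply: ler_wpM2r => //; rewrite /q4 powRD; last first.
        by apply/implyP => _; rewrite gt_eqF// ltr_wpDr.
      rewrite powRr1 ?addr_ge0//; apply: ler_wpM2r; first exact: q_ge0.
      by rewrite lerDr.
move=> /le_trans /(_ (leeD (lexx _) up)).
pose z x := pos x - w x.
have mz : measurable_fun setT z by rewrite /z; mfun.
have z0 : nonneg1 z by move=> x; rewrite subr_ge0; exact: trunc_le_pos.
(* The truncated mass at time [T] is at most the full mass, which is conserved; so it can have grown
   by no more than the part [z] truncated at time 0. *)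
have wT : (mom w (f T) <= mom w (f 0) + mom z (f 0))%E.
  rewrite -(momD mw (mft 0) mz w0 z0 (ft0 0)).
  rewrite (_ : (fun x => w x + z x) = pos); last by apply/funext => x; rewrite addrC subrK.
  rewrite (evo_mass E) -(evo_mass E T); apply: mom_le => // x.
  by apply: ler_wpM2r => //; exact: trunc_le_pos.
move=> /le_trans /(_ (leeD wT (lexx _))).
have w00 : (0 <= mom w (f 0))%E by exact: mom_ge0.
have wfin : (mom w (f 0) < +oo)%E.
  apply: (@le_lt_trans _ _ (M + m)%:E); last exact: ltry.
  have w1 x : w x <= 0 + 1 * pos x by rewrite add0r mul1r; exact: trunc_le_pos.
  apply: le_trans (mom_fin E 0 mw w0 (lexx 0) ler01 w1) _.
  by rewrite mul0e add0e mul1r lee_fin lerDr.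
have z00 : (0 <= mom z (f 0))%E by exact: mom_ge0.
have YY0 : (0 <= (r / 3)%:E * Y)%E.
  by apply: mule_ge0; [rewrite lee_fin|apply: integral_ge0 => s _; exact: Y0].
rewrite -/z -/Q; move: (Q * C4) => QC.
clear up; case: X Xfin => // X _; case: (mom w (f 0)) w00 wfin => [W| |] // W0 _.
case: (mom z (f 0)) z00 => [Z| |] // Z0; case: ((r / 3)%:E * Y)%E YY0 => [V| |] // V0.
- by rewrite -!EFinD !lee_fin; lra.
- by move=> _; rewrite leey.
Qed.

End Moments.

(** * Stability *)

Section SignEstimate.
Context {R : realType}.
Implicit Types x y : R.

Lemma ler_sgM (h x : R) : Num.sg h * x <= `|x|.
Proof.
apply: le_trans (ler_norm _) _; rewrite normrM normr_sg.
by case: (h != 0); rewrite ?mul1r ?mul0r.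
Qed.

(** The product of the sign with f - p is |f - p - r| plus the sign times [r]. Each of the two terms
    costs one |r|. *)
Lemma sg_sub_ge (f p r : R) : - (Num.sg (f - p - r) * (f - p)) <= 2 * `|r| - `|f - p|.
Proof.
have hE : Num.sg (f - p - r) * (f - p - r) = `|f - p - r| by rewrite [in RHS]normrEsg.
have : Num.sg (f - p - r) * - r <= `|- r| by exact: ler_sgM.
have : `|f - p| <= `|f - p - r| + `|r|.
  by rewrite -{1}(subrK r (f - p)) ler_normD.
rewrite normrN => H1 H2.
have -> : Num.sg (f - p - r) * (f - p) = `|f - p - r| + Num.sg (f - p - r) * r.
  by rewrite -hE -mulrDr subrK.
by move: H2; rewrite mulrN; lra.
Qed.

(* With g = f - p one has f lf - p lp = (g (lf + lp) + (f + p) (lf - lp)) / 2,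
   so that the sign of g - r makes the loss terms contribute - |g| up to |r|. *)
Lemma sign_estimate (u f p r a a' cf cp cs lf lp ls gf gp gs : R) :
  0 <= u -> 0 <= f -> 0 <= p -> 0 <= a -> 0 <= lf -> 0 <= lp ->
  Num.sg (f - p - r) * (u * (cf / 2 - f * lf - cs / 2 + p * ls) + gf - gs - a * f + a' * p) +
    (u / 2 * (`|f - p| * (lf + lp)) + a * `|f - p|) <=
  (u / 2 * `|cf - cp| + u / 2 * (f + p) * `|lf - lp|) +
  (u * `|r| * (lf + lp) + `|gf - gp| + 2 * a * `|r|) +
  (u / 2 * `|cp - cs| + u * p * `|lp - ls| + `|gp - gs| + `|a - a'| * p).
Proof.
move=> u0 f0 p0 a0 lf0 lp0; set s := Num.sg _.
have sM x : s * x <= `|x| by exact: ler_sgM.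
have H := sg_sub_ge f p r; rewrite -/s in H.
have l0 : 0 <= u / 2 * (lf + lp) + a by rewrite addr_ge0 ?mulr_ge0 ?addr_ge0.
have H1 := ler_wpM2l l0 H.
have u20 : 0 <= u / 2 by rewrite divr_ge0.
have H2 := ler_wpM2l u20 (sM (cf - cp)).
have H3 := ler_wpM2l u20 (sM (cp - cs)).
have H4 : u / 2 * (f + p) * (s * - (lf - lp)) <= u / 2 * (f + p) * `|lf - lp|.
  by rewrite ler_wpM2l ?mulr_ge0 ?addr_ge0// -normrN.
have H5 : u * p * (s * - (lp - ls)) <= u * p * `|lp - ls|.
  by rewrite ler_wpM2l ?mulr_ge0// -normrN.
have H6 := sM (gf - gp); have H7 := sM (gp - gs).
have H8 : s * - (a - a') * p <= `|a - a'| * p.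
  by rewrite ler_wpM2r// -[X in _ <= X]normrN.
move: H1 H2 H3 H4 H5 H6 H7 H8.
move: `|f - p| `|r| `|cf - cp| `|cp - cs| `|lf - lp| `|lp - ls| `|gf - gp| `|gp - gs| `|a - a'|.
clear; move=> *; lra.
Qed.

End SignEstimate.

Section DifferenceOfIntegrals.
Context {R : realType}.
Local Notation mu := (@lebesgue_measure R).

Lemma fine_lip (a b c : \bar R) : a \is a fin_num -> b \is a fin_num ->
  (a <= b + c)%E -> (b <= a + c)%E -> (`|fine a - fine b|%:E <= c)%E.
Proof.
case: a => // a _; case: b => // b _; case: c => [c| |] //=.
- by rewrite -!EFinD !lee_fin ler_norml => H1 H2; apply/andP; split; lra.
- by move=> _ _; rewrite leey.
Qed.

Lemma fine_diff_integral (T t : R) (A B : R -> \bar R) : 0 <= t <= T ->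
  measurable_fun setT A -> measurable_fun setT B ->
  (forall s, 0 <= A s)%E -> (forall s, 0 <= B s)%E ->
  (\int[mu]_(s in `]0%R, T]) A s < +oo)%E -> (\int[mu]_(s in `]0%R, T]) B s < +oo)%E ->
  mu.-integrable `]0, t] (EFin \o (fun s => fine (B s) - fine (A s))) /\
  \int[mu]_(s in `]0, t]) (fine (B s) - fine (A s)) =
    fine (\int[mu]_(s in `]0%R, t]) B s)%E - fine (\int[mu]_(s in `]0%R, t]) A s)%E.
Proof.
move=> /andP[t0 tT] mA mB A0 B0 Afin Bfin.
have H (F : R -> \bar R) : measurable_fun setT F -> (forall s, 0 <= F s)%E ->
    (\int[mu]_(s in `]0%R, T]) F s < +oo)%E ->
    mu.-integrable `]0, t] (EFin \o (fun s => fine (F s))) /\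
    \int[mu]_(s in `]0, t]) fine (F s) = fine (\int[mu]_(s in `]0%R, t]) F s)%E.
  move=> mF F0 Ffin.
  have Foo : (\int[mu]_(s in `]0%R, t]) F s < +oo)%E.
    by apply: le_lt_trans Ffin; exact: ge0_integral_oc_mono.
  have E := integral_fine (measurable_itv `]0, t]) mF F0 Foo.
  split; last by rewrite /Rintegral -E.
  apply: ge0_integrable => //; [by mfun|by move=> s; exact: fine_ge0|by rewrite -E].
have [iA EA] := H A mA A0 Afin; have [iB EB] := H B mB B0 Bfin.
split; last by rewrite (@RintegralB _ _ _ mu _ _ _ (measurable_itv _) iB iA) EA EB.
have -> : EFin \o (fun s => fine (B s) - fine (A s)) =
    ((EFin \o (fun s => fine (B s))) \- (EFin \o (fun s => fine (A s))))%E.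
  by apply/funext => s.
exact: (@integrableB _ _ _ mu).
Qed.

Lemma ae_fin_integral (D : set R) (F : R -> \bar R) : measurable D ->
  measurable_fun setT F -> (forall s, 0 <= F s)%E -> (\int[mu]_(s in D) F s < +oo)%E ->
  {ae mu, forall s, D s -> F s \is a fin_num}.
Proof.
move=> mD mF F0 Ffin; apply: (@integrable_ae _ _ _ mu D mD F).
apply/integrableP; split; first exact: measurable_funS mF.
by under eq_integral do rewrite gee0_abs//.
Qed.

Lemma ae_fin_double_integral (D : set R) (F : R -> R -> \bar R) : measurable D ->
  measurable_fun setT (fun z : R * R => F z.1 z.2) -> (forall s x, 0 <= F s x)%E ->
  (\int[mu]_(s in D) \int[mu]_x F s x < +oo)%E ->
  {ae mu, forall x, (\int[mu]_(s in D) F s x < +oo)%E}.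
Proof.
move=> mD mF F0; rewrite (tonelli mD measurableT mF F0) => Ffin.
have mI : measurable_fun setT (fun x => \int[mu]_(s in D) F s x)%E by mfun.
have I0 x : (0 <= \int[mu]_(s in D) F s x)%E by apply: integral_ge0.
have := ae_fin_integral measurableT mI I0 Ffin.
by apply: aeS => x /(_ Logic.I); rewrite ge0_fin_numE// integral_ge0.
Qed.

End DifferenceOfIntegrals.

(** * Comparison of the coagulation and fragmentation operators at two functions *)

Section OperatorComparison.
Context {R : realType}.
Local Notation mu := (@lebesgue_measure R).
Implicit Types (p q : R -> R) (k : R -> R -> R).

Lemma conv_measurable k p q : jointly_measurable k -> measurable_fun setT p ->
  measurable_fun setT q -> nonneg2 k -> nonneg1 p -> nonneg1 q ->
  measurable_fun setT (conv k p q).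
Proof.
move=> mk mp mq k0 p0 q0; rewrite /conv; mfun => //.
by move=> x y; rewrite lee_fin !mulr_ge0.
Qed.

Lemma lin_measurable k p : jointly_measurable k -> measurable_fun setT p ->
  nonneg2 k -> nonneg1 p -> measurable_fun setT (lin k p).
Proof.
move=> mk mp k0 p0; rewrite /lin; mfun => //.
by move=> x y; rewrite lee_fin mulr_ge0.
Qed.

Lemma lin_le k k' p p' x : jointly_measurable k -> jointly_measurable k' ->
  measurable_fun setT p -> measurable_fun setT p' -> nonneg2 k -> nonneg1 p ->
  (forall y, k x y * p y <= k' x y * p' y) -> (lin k p x <= lin k' p' x)%E.
Proof.
move=> mk mk' mp mp' k0 p0 H; apply: ge0_le_integralT => //; [by mfun|by mfun| |].
- by move=> y; rewrite lee_fin mulr_ge0.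
- by move=> y _; rewrite lee_fin.
Qed.

Lemma conv_le k k' p p' q q' x : jointly_measurable k -> jointly_measurable k' ->
  measurable_fun setT p -> measurable_fun setT p' ->
  measurable_fun setT q -> measurable_fun setT q' ->
  nonneg2 k -> nonneg1 p -> nonneg1 q ->
  (forall y z, k y z * (p y * q z) <= k' y z * (p' y * q' z)) ->
  (conv k p q x <= conv k' p' q' x)%E.
Proof.
move=> mk mk' mp mp' mq mq' k0 p0 q0 H.
apply: ge0_le_integralT => //; [by mfun|by mfun| |].
- by move=> y; rewrite lee_fin !mulr_ge0.
- by move=> y _; rewrite lee_fin.
Qed.

Lemma linD k p q x : jointly_measurable k -> measurable_fun setT p ->
  measurable_fun setT q -> nonneg2 k -> nonneg1 p -> nonneg1 q ->
  lin k (fun y => p y + q y) x = (lin k p x + lin k q x)%E.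
Proof.
move=> mk mp mq k0 p0 q0; rewrite /lin -ge0_integralDT//; [|by mfun|by mfun| |].
- by apply: eq_integral => y _; rewrite mulrDr EFinD.
- by move=> y; rewrite lee_fin mulr_ge0.
- by move=> y; rewrite lee_fin mulr_ge0.
Qed.

Lemma lin_leD k k1 k2 p p1 p2 x : jointly_measurable k ->
  jointly_measurable k1 -> jointly_measurable k2 -> measurable_fun setT p ->
  measurable_fun setT p1 -> measurable_fun setT p2 ->
  nonneg2 k -> nonneg2 k1 -> nonneg2 k2 -> nonneg1 p -> nonneg1 p1 -> nonneg1 p2 ->
  (forall y, k x y * p y <= k1 x y * p1 y + k2 x y * p2 y) ->
  (lin k p x <= lin k1 p1 x + lin k2 p2 x)%E.
Proof.
move=> mk mk1 mk2 mp mp1 mp2 k0 k10 k20 p0 p10 p20 H.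
have n1 y : (0 <= (k1 x y * p1 y)%:E)%E by rewrite lee_fin mulr_ge0.
have n2 y : (0 <= (k2 x y * p2 y)%:E)%E by rewrite lee_fin mulr_ge0.
have m1 : measurable_fun setT (fun y => (k1 x y * p1 y)%:E) by mfun.
have m2 : measurable_fun setT (fun y => (k2 x y * p2 y)%:E) by mfun.
rewrite /lin -(ge0_integralDT measurableT m1 m2 n1 n2).
apply: ge0_le_integralT => //; [by mfun|by mfun| |].
- by move=> y; rewrite lee_fin mulr_ge0.
- by move=> y _; rewrite -EFinD lee_fin.
Qed.

Lemma conv_leD k k1 k2 p p1 p2 q q1 q2 x : jointly_measurable k ->
  jointly_measurable k1 -> jointly_measurable k2 -> measurable_fun setT p ->
  measurable_fun setT p1 -> measurable_fun setT p2 -> measurable_fun setT q ->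
  measurable_fun setT q1 -> measurable_fun setT q2 ->
  nonneg2 k -> nonneg2 k1 -> nonneg2 k2 -> nonneg1 p -> nonneg1 p1 -> nonneg1 p2 ->
  nonneg1 q -> nonneg1 q1 -> nonneg1 q2 ->
  (forall y z, k y z * (p y * q z) <= k1 y z * (p1 y * q1 z) + k2 y z * (p2 y * q2 z)) ->
  (conv k p q x <= conv k1 p1 q1 x + conv k2 p2 q2 x)%E.
Proof.
move=> mk mk1 mk2 mp mp1 mp2 mq mq1 mq2 k0 k10 k20 p0 p10 p20 q0 q10 q20 H.
have n1 y : (0 <= (k1 y (x - y) * (p1 y * q1 (x - y)))%:E)%E by rewrite lee_fin !mulr_ge0.
have n2 y : (0 <= (k2 y (x - y) * (p2 y * q2 (x - y)))%:E)%E by rewrite lee_fin !mulr_ge0.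
have m1 : measurable_fun setT (fun y => (k1 y (x - y) * (p1 y * q1 (x - y)))%:E) by mfun.
have m2 : measurable_fun setT (fun y => (k2 y (x - y) * (p2 y * q2 (x - y)))%:E) by mfun.
rewrite /conv -(ge0_integralDT measurableT m1 m2 n1 n2).
apply: ge0_le_integralT => //; [by mfun|by mfun| |].
- by move=> y; rewrite lee_fin !mulr_ge0.
- by move=> y _; rewrite -EFinD lee_fin.
Qed.

(** From f f - p p = (f - p) f + p (f - p). In this form the two error terms recombine, by the
    symmetry of [k], into one bilinear form in the gap and in f + p. *)
Lemma conv_diff_le k f p d x : jointly_measurable k -> measurable_fun setT f ->
  measurable_fun setT p -> measurable_fun setT d ->
  nonneg2 k -> nonneg1 f -> nonneg1 p -> nonneg1 d ->
  (forall y, f y <= p y + d y) -> (forall y, p y <= f y + d y) ->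
  (conv k f f x <= conv k p p x + (conv k d f x + conv k p d x))%E /\
  (conv k p p x <= conv k f f x + (conv k d f x + conv k p d x))%E.
Proof.
move=> mk mf mp md k0 f0 p0 d0 fpd pfd.
have key (v1 v2 : R -> R) : measurable_fun setT v1 -> nonneg1 v1 ->
    (forall y z, v1 y * v1 z <= v2 y * v2 z + (d y * f z + p y * d z)) ->
    measurable_fun setT v2 -> nonneg1 v2 ->
    (conv k v1 v1 x <= conv k v2 v2 x + (conv k d f x + conv k p d x))%E.
  move=> m1 n1 H m2 n2.
  have nF y : (0 <= (k y (x - y) * (v2 y * v2 (x - y)))%:E)%E by rewrite lee_fin !mulr_ge0.
  have nG y : (0 <= (k y (x - y) * (d y * f (x - y)))%:E)%E by rewrite lee_fin !mulr_ge0.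
  have nH y : (0 <= (k y (x - y) * (p y * d (x - y)))%:E)%E by rewrite lee_fin !mulr_ge0.
  have mF : measurable_fun setT (fun y => (k y (x - y) * (v2 y * v2 (x - y)))%:E) by mfun.
  have mG : measurable_fun setT (fun y => (k y (x - y) * (d y * f (x - y)))%:E) by mfun.
  have mH : measurable_fun setT (fun y => (k y (x - y) * (p y * d (x - y)))%:E) by mfun.
  rewrite /conv -(ge0_integralDT measurableT mG mH nG nH).
  rewrite -(ge0_integralDT measurableT mF (emeasurable_funD mG mH) nF); last first.
    by move=> y; exact: adde_ge0.
  apply: ge0_le_integralT => //.
  - by mfun.
  - by apply: emeasurable_funD => //; exact: emeasurable_funD.
  - by move=> y; rewrite lee_fin !mulr_ge0.
  - move=> y _; rewrite -!EFinD lee_fin -!mulrDr ler_wpM2l//; exact: H.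
split; apply: key => // y z.
- have : f y * f z <= (p y + d y) * f z by rewrite ler_wpM2r.
  have : p y * f z <= p y * (p z + d z) by rewrite ler_wpM2l.
  by rewrite mulrDr mulrDl; lra.
- have : p y * p z <= p y * (f z + d z) by rewrite ler_wpM2l.
  have : p y * f z <= (f y + d y) * f z by rewrite ler_wpM2r.
  by rewrite mulrDr mulrDl; lra.
Qed.

Lemma mom_conv1 k p q : jointly_measurable k ->
  measurable_fun setT p -> measurable_fun setT q ->
  nonneg2 k -> nonneg1 p -> nonneg1 q ->
  (\int[mu]_x conv k p q x = bil k p q)%E.
Proof.
move=> mk mp mq k0 p0 q0; have one0 : nonneg1 (fun=> 1 : R) by move=> ?; exact: ler01.
have m1 : measurable_fun (@setT R) (fun=> 1 : R) by mfun.
have := mom_conv m1 mk mp mq one0 k0 p0 q0.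
rewrite (_ : (fun x y => 1 * k x y) = k); last first.
  by apply/funext => x; apply/funext => y; rewrite mul1r.
by move=> <-; apply: eq_integral => x _; rewrite mul1e.
Qed.

Lemma mom_lin1 k p q : jointly_measurable k ->
  measurable_fun setT p -> measurable_fun setT q ->
  nonneg2 k -> nonneg1 p -> nonneg1 q ->
  (\int[mu]_x ((p x)%:E * lin k q x) = bil k p q)%E.
Proof.
move=> mk mp mq k0 p0 q0; have one0 : nonneg1 (fun=> 1 : R) by move=> ?; exact: ler01.
have m1 : measurable_fun (@setT R) (fun=> 1 : R) by mfun.
have := mom_lin m1 mk mp mq one0 k0 p0 q0.
rewrite (_ : (fun x y => 1 * k x y) = k); last first.
  by apply/funext => x; apply/funext => y; rewrite mul1r.
by move=> <-; apply: eq_integral => x _; rewrite mul1e.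
Qed.

Lemma mom_gain1 k p : jointly_measurable k -> measurable_fun setT p ->
  nonneg2 k -> nonneg1 p ->
  (\int[mu]_x lin k p x = \int[mu]_y ((p y)%:E * lin (flip k) (fun=> 1%R) y))%E.
Proof.
move=> mk mp k0 p0; have one0 : nonneg1 (fun=> 1 : R) by move=> ?; exact: ler01.
have m1 : measurable_fun (@setT R) (fun=> 1 : R) by mfun.
rewrite -(mom_gain m1 mk mp one0 k0 p0).
by apply: eq_integral => x _; rewrite mul1e.
Qed.

Lemma bil_le_mom k (c : R) (w v p q : R -> R) : 0 <= c -> jointly_measurable k ->
  measurable_fun setT w -> measurable_fun setT v ->
  measurable_fun setT p -> measurable_fun setT q ->
  nonneg2 k -> nonneg1 w -> nonneg1 v -> nonneg1 p -> nonneg1 q ->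
  (forall x y, k x y <= c * (w x * v y)) ->
  (bil k p q <= c%:E * (mom w p * mom v q))%E.
Proof.
move=> c0 mk mw mv mp mq k0 w0 v0 p0 q0 kle.
have mcw : measurable_fun setT (fun x => c * w x) by mfun.
have cw0 : nonneg1 (fun x => c * w x) by move=> x; exact: mulr_ge0.
rewrite muleA -(momZ c0 mw mp w0 p0) -(bil_prod mcw mp mv mq cw0 v0 p0 q0).
apply: bil_le => //.
- by rewrite /jointly_measurable; mfun.
- by move=> x y; exact: mulr_ge0.
- by move=> x y; rewrite ler_wpM2r ?mulr_ge0// -mulrA.
Qed.

Lemma measurable_integral_oc (F : R -> R -> \bar R) :
  measurable_fun setT (fun z : R * R => F z.1 z.2) -> (forall s x, 0 <= F s x)%E ->
  measurable_fun setT (fun z : R * R => \int[mu]_(s in `]0%R, z.1]) F s z.2)%E.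
Proof.
move=> mF F0.
(* The variable upper limit is encoded by fixed half-lines: s > 0 and t - s >= 0. *)
pose H (z : R * R) s : \bar R :=
  ((\1_(`]0%R, +oo[ : set R) s * \1_(`[0%R, +oo[ : set R) (z.1 - s))%:E * F s z.2)%E.
rewrite (_ : (fun _ => _) = (fun z => \int[mu]_s H z s)%E); last first.
  apply/funext => z; rewrite ge0_integral_indic//; apply: eq_integral => s _.
  rewrite /H; congr (_%:E * _)%E; rewrite !indicE -natrM mulnb; congr (_%:R).
  have E1 (b c : R) : (c \in `]0, b]%classic) = (0 < c <= b).
    by apply/idP/idP; rewrite inE/= in_itv.
  have E2 (c : R) : (c \in `]0, +oo[%classic) = (0 < c).
    by apply/idP/idP; rewrite inE/= in_itv/= andbT.
  have E3 (c : R) : (c \in `[0, +oo[%classic) = (0 <= c).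
    by apply/idP/idP; rewrite inE/= in_itv/= andbT.
  by rewrite E1 E2 E3 subr_ge0.
rewrite /H; mfun => //.
by move=> z s; rewrite mule_ge0// lee_fin mulr_ge0.
Qed.

End OperatorComparison.

(** The weight [c] goes with the gain and [d] with the loss. Exchanging the weights and subtracting
    leaves c - d times the coagulation operator, although both terms of the difference are
    nonnegative. *)
Definition coag_parts {R : realType} (k : R -> R -> R) (p : R -> R -> R) (c d : R -> R)
    (s x : R) : \bar R :=
  ((c s / 2)%:E * conv k (p s) (p s) x + (d s * p s x)%:E * lin k (p s) x)%E.

(* The time integral of (u - us) times the coagulation operator at p, written as
   a difference of integrals of nonnegative functions. *)
Definition remainder {R : realType} (k : R -> R -> R) (p : R -> R -> R) (u us : R -> R)
    (t x : R) : R :=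
  fine (\int[@lebesgue_measure R]_(s in `]0%R, t]) coag_parts k p u us s x)%E -
  fine (\int[@lebesgue_measure R]_(s in `]0%R, t]) coag_parts k p us u s x)%E.

Section Remainder.
Context {R : realType}.
Local Notation mu := (@lebesgue_measure R).
Variables (k p : R -> R -> R).
Hypotheses (mk : jointly_measurable k) (k0 : nonneg2 k).
Hypotheses (mp : jointly_measurable p) (p0 : nonneg2 p).
Implicit Types c d : R -> R.

Lemma coag_parts_ge0 c d s x : nonneg1 c -> nonneg1 d -> (0 <= coag_parts k p c d s x)%E.
Proof.
move=> c0 d0; apply: adde_ge0; apply: mule_ge0.
- by rewrite lee_fin divr_ge0.
- by apply: conv_ge0 => //; exact: p0.
- by rewrite lee_fin; apply: mulr_ge0 => //; exact: p0.
- by apply: lin_ge0 => //; exact: p0.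
Qed.

Lemma coag_parts_measurable c d : measurable_fun setT c -> measurable_fun setT d ->
  measurable_fun setT (fun z : R * R => coag_parts k p c d z.1 z.2).
Proof.
move=> mc md; rewrite /coag_parts /conv /lin; mfun => //.
- by move=> z y; rewrite lee_fin; apply: mulr_ge0 => //; apply: mulr_ge0; exact: p0.
- by move=> z y; rewrite lee_fin; apply: mulr_ge0 => //; exact: p0.
Qed.

Lemma remainder_jm c d : measurable_fun setT c -> measurable_fun setT d ->
  nonneg1 c -> nonneg1 d -> jointly_measurable (remainder k p c d).
Proof.
move=> mc md c0 d0; rewrite /jointly_measurable /remainder.
have H1 := measurable_integral_oc (coag_parts_measurable mc md)
  (fun s x => coag_parts_ge0 s x c0 d0).
have H2 := measurable_integral_oc (coag_parts_measurable md mc)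
  (fun s x => coag_parts_ge0 s x d0 c0).
by apply: measurable_funB; apply: measurable_fine.
Qed.

End Remainder.

Lemma adde_pull {R : realType} (b m n l r : \bar R) :
  (b + (m + n + l) + r = m + (b + n + l + r))%E.
Proof. by rewrite -!addeA addeCA. Qed.

Lemma add_le_weighted {R : realType} (al N x c : R) : 0 <= al -> N * al <= c ->
  al * (N + x) <= (1 + x) * al + c.
Proof. by rewrite mulrDr mulrDl mul1r (mulrC N) (mulrC x); lra. Qed.

Lemma half_combine {R : realType} (c : R) (x a b : \bar R) : 0 <= c ->
  (0 <= a)%E -> (0 <= b)%E -> (x <= a + b)%E ->
  ((c / 2)%:E * (x + b) <= (c / 2)%:E * a + c%:E * b)%E.
Proof.
move=> c0 a0 b0 xab; have c20 : (0 <= (c / 2)%:E)%E by rewrite lee_fin divr_ge0.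
apply: (@le_trans _ _ ((c / 2)%:E * (a + (b + b)))%E).
  by apply: lee_wpmul2l => //; rewrite addeA; exact: leeD2r.
rewrite ge0_muleDr//; last exact: adde_ge0.
rewrite leeD2l// ge0_muleDr// -ge0_muleDl// -EFinD.
by rewrite (_ : c / 2 + c / 2 = c)//; lra.
Qed.

Lemma leeD3_swap {R : realType} (x1 x2 x3 d1 d2 z1 z2 z3 : \bar R) :
  (x1 <= d1 + z1)%E -> (x2 <= d2 + z2)%E -> (x3 <= z3)%E ->
  (x1 + x2 + x3 <= d1 + d2 + (z1 + z2 + z3))%E.
Proof. by move=> H1 H2 H3; rewrite addeA addeACA; apply: leeD => //; exact: leeD. Qed.

(** Bookkeeping for [growth_excess_le]: it isolates what is proportional to [Y], the unknown of
    Gronwall's inequality. *)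
Lemma excess_rearrange {R : realType} (Y Q t e : \bar R) (c n rho d l A W : R) :
  (0 <= Y)%E -> (0 <= Q)%E -> (0 <= t)%E -> (0 <= e)%E -> 0 <= c -> 0 <= n -> 0 <= rho ->
  0 <= d ->
  (c%:E * ((Y + rho%:E + d%:E) * Q) +
   ((c * (l * rho * W))%:E + n%:E * (Y + rho%:E) + t + 2%:E * (l * A * rho)%:E) + e <=
   Y * (c%:E * Q + n%:E) + (rho%:E * (c%:E * Q + n%:E) + (c * d)%:E * Q + t +
    (l * (c * W + 2 * A) * rho)%:E + e))%E.
Proof.
move=> Y0 Q0 t0 e0 c0 n0 rho0 d0.
have cQ : (0 <= c%:E * Q)%E by apply: mule_ge0; rewrite ?lee_fin.
have cQn : (0 <= c%:E * Q + n%:E)%E by apply: adde_ge0; rewrite ?lee_fin.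
have Yr : (0 <= Y + rho%:E)%E by apply: adde_ge0; rewrite ?lee_fin.
rewrite le_eqVlt; apply/orP; left; apply/eqP.
have -> : (c%:E * ((Y + rho%:E + d%:E) * Q) = (Y + rho%:E) * (c%:E * Q) + (c * d)%:E * Q)%E.
  rewrite muleCA ge0_muleDl ?lee_fin//; congr (_ + _)%E.
  by rewrite muleA -EFinM mulrC.
have -> : (Y * (c%:E * Q + n%:E) + (rho%:E * (c%:E * Q + n%:E) + (c * d)%:E * Q + t +
    (l * (c * W + 2 * A) * rho)%:E + e) =
  (Y + rho%:E) * (c%:E * Q + n%:E) + ((c * d)%:E * Q + t + (l * (c * W + 2 * A) * rho)%:E + e))%E.
  by rewrite [in RHS]ge0_muleDl ?lee_fin// -!addeA.
have n0e : (0 <= n%:E)%E by rewrite lee_fin.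
move: (Y + rho%:E)%E Yr => Z Z0; rewrite (ge0_muleDr Z cQ n0e) (muleC n%:E).
have -> : (l * (c * W + 2 * A) * rho)%:E = ((c * (l * rho * W))%:E + 2%:E * (l * A * rho)%:E)%E.
  by rewrite -EFinM -EFinD; congr (_%:E); ring.
move: (Z * (c%:E * Q))%E ((c * d)%:E * Q)%E (Z * n%:E)%E
  (c * (l * rho * W))%:E (2%:E * (l * A * rho)%:E)%E => x1 x2 x3 x4 x5.
rewrite -!addeA; congr (_ + _)%E.
by rewrite [RHS]addeCA; congr (_ + _)%E; rewrite [LHS]addeCA; congr (_ + _)%E; rewrite addeCA.
Qed.

(** * The difference of two evolutions with the same initial value *)

Section Pair.
Context {R : realType}.
Local Notation mu := (@lebesgue_measure R).
Variables (T m B A N Kh muh M K1 K2 : R) (k ks g gs : R -> R -> R) (a as_ u us : R -> R).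
Variables f p : R -> R -> R.
Hypothesis C1 : coefficients B K1 k g a u.
Hypothesis C2 : coefficients B K2 ks gs as_ us.
Hypothesis E1 : evolution T m k g a u f.
Hypothesis E2 : evolution T m ks gs as_ us p.
Hypothesis init : {ae mu, forall x, f 0 x = p 0 x}.
Hypotheses (T_ge0 : 0 <= T) (A_ge0 : 0 <= A) (N_ge0 : 0 <= N) (Kh_ge0 : 0 <= Kh).
Hypotheses (M_ge0 : 0 <= M) (muh_le1 : muh <= 1).
Let q (x : R) := (1 + pos x) `^ muh.
Hypothesis k_le : forall x y, k x y <= Kh * (q x * q y).
Hypothesis ks_le : forall x y, ks x y <= Kh * (q x * q y).
Hypothesis aA : forall y, a y <= A * (1 + pos y).
Hypothesis asA : forall y, as_ y <= A * (1 + pos y).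
Hypothesis gN : forall (w : R -> R) (c1 c2 y : R), measurable_fun setT w ->
  nonneg1 w -> 0 <= c1 -> 0 <= c2 -> (forall x, w x <= c1 + c2 * pos x) ->
  (lin (flip g) w y <= (a y * (c1 * N + c2 * pos y))%:E)%E.
Hypothesis gsN : forall (w : R -> R) (c1 c2 y : R), measurable_fun setT w ->
  nonneg1 w -> 0 <= c1 -> 0 <= c2 -> (forall x, w x <= c1 + c2 * pos x) ->
  (lin (flip gs) w y <= (as_ y * (c1 * N + c2 * pos y))%:E)%E.
Hypothesis numf : forall t : R, 0 <= t <= T -> (mom (fun=> 1%R) (f t) <= M%:E)%E.
Hypothesis nump : forall t : R, 0 <= t <= T -> (mom (fun=> 1%R) (p t) <= M%:E)%E.

Let mf := evo_meas E1. Let f0 := evo_ge0 E1.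
Let mp := evo_meas E2. Let p0 := evo_ge0 E2.
Let mk := coag_meas C1. Let k0 := coag_ge0 C1.
Let mks := coag_meas C2. Let ks0 := coag_ge0 C2.
Let mg := frag_meas C1. Let g0 := frag_ge0 C1.
Let mgs := frag_meas C2. Let gs0 := frag_ge0 C2.
Let ma := rate_meas C1. Let a0 := rate_ge0 C1.
Let mas := rate_meas C2. Let as0 := rate_ge0 C2.
Let mu1 := ctrl_meas C1. Let u0 := ctrl_ge0 C1. Let uB := ctrl_le C1.
Let mu2 := ctrl_meas C2. Let us0 := ctrl_ge0 C2. Let usB := ctrl_le C2.
Let mpos := @measurable_pos R.
Let m_ge0 : 0 <= m. Proof. exact: mass_ge0 E1. Qed.
Let B_ge0 : 0 <= B. Proof. exact: ctrl_bound_ge0 C1. Qed.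
Let q_ge0 : nonneg1 q. Proof. by move=> x; exact: powR_ge0. Qed.
Let mq : measurable_fun setT q. Proof. by rewrite /q; mfun. Qed.
Let q_le x : q x <= 1 + pos x. Proof. by apply: powR1D_le => //; exact: pos_ge0. Qed.
Let p1_ge0 : nonneg1 (fun x => 1 + pos x : R).
Proof. by move=> x; rewrite addr_ge0 ?pos_ge0. Qed.
Let mp1 : measurable_fun setT (fun x => 1 + pos x : R). Proof. by mfun. Qed.

Definition total (s x : R) := f s x + p s x.
Definition gap (s x : R) := `|f s x - p s x|.

Lemma total_ge0 : nonneg2 total. Proof. by move=> s x; exact: addr_ge0. Qed.
Lemma gap_ge0 : nonneg2 gap. Proof. by move=> s x; exact: normr_ge0. Qed.
Lemma total_jm : jointly_measurable total.
Proof. by rewrite /jointly_measurable /total; mfun. Qed.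
Lemma gap_jm : jointly_measurable gap.
Proof. by rewrite /jointly_measurable /gap; mfun. Qed.

Lemma gap_le_total s x : gap s x <= total s x.
Proof.
rewrite /gap /total; apply: le_trans (ler_normB _ _) _.
by rewrite (ger0_norm (f0 s x)) (ger0_norm (p0 s x)).
Qed.

Let W := 2 * (M + m).
Let W_ge0 : 0 <= W. Proof. by rewrite mulr_ge0// addr_ge0. Qed.

Let mS := total_jm. Let S0 := total_ge0. Let mG := gap_jm. Let G0 := gap_ge0.

Lemma mom_total_le (w : R -> R) s : 0 <= s <= T -> measurable_fun setT w -> nonneg1 w ->
  (forall x, w x <= 1 + pos x) -> (mom w (total s) <= W%:E)%E.
Proof.
move=> sT mw w0 w1.
have mft : measurable_fun setT (f s) by mfun.
have mpt : measurable_fun setT (p s) by mfun.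
apply: (@le_trans _ _ (mom (fun x => 1 + pos x)%R (total s))).
  have mSs : measurable_fun setT (total s) by mfun.
  apply: (mom_le mw mSs mp1 mSs w0 (S0 s)) => x.
  by apply: ler_wpM2r => //; exact: S0.
rewrite /total momDr//.
rewrite (mom_add1pos E1) (mom_add1pos E2) /W mulr2n mulrDl mul1r EFinD; apply: leeD.
- by rewrite EFinD leeD2r// numf.
- by rewrite EFinD leeD2r// nump.
Qed.

Let const_fin (c : R) : (\int[mu]_(s in `]0%R, T]) c%:E < +oo)%E.
Proof.
rewrite integral_cst//= lebesgue_measure_itv/= lte_fin.
by case: ifP => _; rewrite -?EFinB -?EFinM ?ltry// mule0 ltry.
Qed.

Lemma bil_total_le (kk : R -> R -> R) (K s : R) : 0 <= K -> jointly_measurable kk ->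
  nonneg2 kk -> (forall x y, kk x y <= K * ((1 + pos x) * (1 + pos y))) -> 0 <= s <= T ->
  (bil kk (total s) (total s) <= (K * (W * W))%:E)%E.
Proof.
move=> K0 mkk kk0 kkle sT.
have mSs : measurable_fun setT (total s) by mfun.
have Ss0 : nonneg1 (total s) by exact: S0.
apply: le_trans (bil_le_mom K0 mkk mp1 mp1 mSs mSs kk0 p1_ge0 p1_ge0 Ss0 Ss0 kkle) _.
rewrite (EFinM K) (EFinM W); apply: lee_wpmul2l; first by rewrite lee_fin.
by apply: lee_pmul; rewrite ?mom_ge0// mom_total_le.
Qed.

(** The sum f + p dominates f, p and their gap. Finiteness for it makes every gain and loss term of
    the comparison finite at once, for almost every size. *)
Lemma coag_total_fin (kk : R -> R -> R) (K : R) : 0 <= K -> jointly_measurable kk -> nonneg2 kk ->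
  (forall x y, kk x y <= K * ((1 + pos x) * (1 + pos y))) ->
  {ae mu, forall x, (\int[mu]_(s in `]0%R, T]) conv kk (total s) (total s) x < +oo)%E /\
    (\int[mu]_(s in `]0%R, T]) ((total s x)%:E * lin kk (total s) x) < +oo)%E}.
Proof.
move=> K0 mkk kk0 kkle.
have bilfin : (\int[mu]_(s in `]0%R, T]) bil kk (total s) (total s) < +oo)%E.
  apply: le_lt_trans (const_fin (K * (W * W))); apply: ge0_le_integral => //.
  - by move=> s _; apply: bil_ge0 => //; exact: S0.
  - apply: (@measurable_funS _ _ _ _ setT) => //; rewrite /bil; mfun => //.
      by move=> z y; rewrite lee_fin !mulr_ge0//; exact: S0.
    by move=> s x; apply: integral_ge0 => y _; rewrite lee_fin !mulr_ge0//; exact: S0.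
  - move=> s /=; rewrite in_itv/= => /andP[s0 sT]; apply: bil_total_le => //.
    by rewrite ltW.
have mSs s : measurable_fun setT (total s) by mfun.
have Ss0 s : nonneg1 (total s) by exact: S0.
have convfin : (\int[mu]_(s in `]0%R, T]) \int[mu]_x conv kk (total s) (total s) x < +oo)%E.
  rewrite (funext (fun s => mom_conv1 mkk (mSs s) (mSs s) kk0 (Ss0 s) (Ss0 s))).
  exact: bilfin.
have linfin : (\int[mu]_(s in `]0%R, T]) \int[mu]_x ((total s x)%:E * lin kk (total s) x) < +oo)%E.
  rewrite (funext (fun s => mom_lin1 mkk (mSs s) (mSs s) kk0 (Ss0 s) (Ss0 s))).
  exact: bilfin.
have mc : measurable_fun setT (fun z : R * R => conv kk (total z.1) (total z.1) z.2).
  by rewrite /conv; mfun => //; move=> z y; rewrite lee_fin !mulr_ge0//; exact: S0.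
have ml : measurable_fun setT (fun z : R * R => (total z.1 z.2)%:E * lin kk (total z.1) z.2)%E.
  by rewrite /lin; mfun => //; move=> z y; rewrite lee_fin !mulr_ge0//; exact: S0.
have nc s x : (0 <= conv kk (total s) (total s) x)%E by exact: conv_ge0.
have nl s x : (0 <= (total s x)%:E * lin kk (total s) x)%E.
  by apply: mule_ge0; [rewrite lee_fin; exact: S0|exact: lin_ge0].
exact: aeI (ae_fin_double_integral (measurable_itv _) mc nc convfin)
  (ae_fin_double_integral (measurable_itv _) ml nl linfin).
Qed.

Lemma lin_total_fin (kk : R -> R -> R) (K : R) s x : 0 <= K -> jointly_measurable kk ->
  nonneg2 kk -> (forall x y, kk x y <= K * ((1 + pos x) * (1 + pos y))) -> 0 <= s <= T ->
  (lin kk (total s) x < +oo)%E.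
Proof.
move=> K0 mkk kk0 kkle sT.
have mSs : measurable_fun setT (total s) by mfun.
have Ss0 : nonneg1 (total s) by exact: S0.
have c0 : 0 <= K * (1 + pos x) by exact: mulr_ge0.
apply: (@le_lt_trans _ _ (mom (fun y => (K * (1 + pos x)) * (1 + pos y))%R (total s))).
  apply: ge0_le_integralT => //; [by mfun|by mfun| |].
  - by move=> y; rewrite lee_fin mulr_ge0.
  - by move=> y _; rewrite lee_fin ler_wpM2r// -mulrA.
rewrite momZ//; apply: (@le_lt_trans _ _ ((K * (1 + pos x))%:E * W%:E)%E).
  by rewrite lee_wpmul2l ?lee_fin// mom_total_le.
by rewrite -EFinM ltry.
Qed.

Lemma frag_total_fin (gg : R -> R -> R) (aa : R -> R) : jointly_measurable gg -> nonneg2 gg ->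
  measurable_fun setT aa -> nonneg1 aa ->
  (forall y, aa y <= A * (1 + pos y)) ->
  (forall y, (lin (flip gg) (fun=> 1%R) y <= (aa y * N)%:E)%E) ->
  {ae mu, forall x, (\int[mu]_(s in `]0%R, T]) lin gg (total s) x < +oo)%E}.
Proof.
move=> mgg gg0 maa aa0 aale ggN; apply: ae_fin_double_integral => //.
- by rewrite /lin; mfun => //; move=> z y; rewrite lee_fin mulr_ge0//; exact: S0.
- by move=> s x; apply: lin_ge0 => //; exact: S0.
apply: (@le_lt_trans _ _ (\int[mu]_(s in `]0%R, T]) (N * A * W)%:E)%E); last first.
  rewrite integral_cst//= lebesgue_measure_itv/= lte_fin.
  by case: ifP => _; rewrite -?EFinB -?EFinM ?ltry// mule0 ltry.
apply: ge0_le_integral => //.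
- by move=> s _; apply: integral_ge0 => x _; apply: lin_ge0 => //; exact: S0.
- apply: (@measurable_funS _ _ _ _ setT) => //; rewrite /lin; mfun => //.
    by move=> z y; rewrite lee_fin mulr_ge0//; exact: S0.
  by move=> s x; apply: integral_ge0 => y _; rewrite lee_fin mulr_ge0//; exact: S0.
move=> s /=; rewrite in_itv/= => /andP[s0 sT]; have s0T : 0 <= s <= T by rewrite ltW.
have mSs : measurable_fun setT (total s) by mfun.
have Ss0 : nonneg1 (total s) by exact: S0.
have NA0 : 0 <= N * A by exact: mulr_ge0.
rewrite mom_gain1//; apply: (@le_trans _ _ (mom (fun y => (N * A) * (1 + pos y))%R (total s))).
  apply: ge0_le_integralT => //.
  - rewrite /lin /flip; mfun => //.
    by move=> x y; rewrite lee_fin mulr_ge0//; exact: gg0.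
  - by mfun.
  - move=> y; apply: mule_ge0; first by rewrite lee_fin.
    by apply: lin_ge0 => // ? ?; exact: gg0.
  - move=> y _; rewrite muleC EFinM; apply: lee_wpmul2r; first by rewrite lee_fin.
    apply: le_trans (ggN y) _; rewrite lee_fin mulrC -mulrA; exact: ler_wpM2l.
by rewrite momZ// (EFinM (N * A)) lee_wpmul2l ?lee_fin// mom_total_le.
Qed.

Let r := remainder ks p u us.
Let mr : jointly_measurable r. Proof. exact: remainder_jm. Qed.

Let kd x y := `|k x y - ks x y|.
Let gd x y := `|g x y - gs x y|.
Let mkd : jointly_measurable kd. Proof. by rewrite /jointly_measurable /kd; mfun. Qed.
Let mgd : jointly_measurable gd. Proof. by rewrite /jointly_measurable /gd; mfun. Qed.
Let kd0 : nonneg2 kd. Proof. by move=> x y; exact: normr_ge0. Qed.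
Let gd0 : nonneg2 gd. Proof. by move=> x y; exact: normr_ge0. Qed.
Let k_le1 x y : k x y <= Kh * ((1 + pos x) * (1 + pos y)).
Proof. by apply: le_trans (k_le x y) _; rewrite ler_wpM2l// ler_pM. Qed.
Let ks_le1 x y : ks x y <= Kh * ((1 + pos x) * (1 + pos y)).
Proof. by apply: le_trans (ks_le x y) _; rewrite ler_wpM2l// ler_pM. Qed.

Definition damping (s x : R) : \bar R :=
  ((u s / 2 * gap s x)%:E * lin k (total s) x + (a x * gap s x)%:E)%E.

(** The three groups are those of [sign_estimate]: differences of the coagulation terms;
    contributions of the remainder together with the fragments of the gap; differences of the
    coefficients acting on [p]. *)
Definition growth (s x : R) : \bar R :=
  ((u s / 2)%:E * (conv k (gap s) (f s) x + conv k (p s) (gap s) x) +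
   (u s / 2 * total s x)%:E * lin k (gap s) x +
   ((u s * `|r s x|)%:E * lin k (total s) x + lin g (gap s) x + (2 * a x * `|r s x|)%:E) +
   ((u s / 2)%:E * conv kd (p s) (p s) x + (u s * p s x)%:E * lin kd (p s) x +
    lin gd (p s) x + (`|a x - as_ x| * p s x)%:E))%E.

Lemma damping_ge0 s x : (0 <= damping s x)%E.
Proof.
apply: adde_ge0; last by rewrite lee_fin; apply: mulr_ge0; [exact: a0|exact: G0].
apply: mule_ge0; last by apply: lin_ge0 => //; exact: S0.
by rewrite lee_fin; apply: mulr_ge0; [exact: divr_ge0|exact: G0].
Qed.

Lemma growth_ge0 s x : (0 <= growth s x)%E.
Proof.
have fs0 : nonneg1 (f s) by exact: f0.
have ps0 : nonneg1 (p s) by exact: p0.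
have Ss0 : nonneg1 (total s) by exact: S0.
have Gs0 : nonneg1 (gap s) by exact: G0.
have u20 : 0 <= u s / 2 by exact: divr_ge0.
have us1 := u0 s.
rewrite /growth; apply: adde_ge0; first apply: adde_ge0; first apply: adde_ge0.
- by apply: mule_ge0 => //; apply: adde_ge0; exact: conv_ge0.
- by apply: mule_ge0; [rewrite lee_fin mulr_ge0|exact: lin_ge0].
- apply: adde_ge0; last by rewrite lee_fin; apply: mulr_ge0 => //; exact: mulr_ge0.
  apply: adde_ge0; last exact: lin_ge0.
  by apply: mule_ge0; [rewrite lee_fin mulr_ge0|exact: lin_ge0].
- apply: adde_ge0; last by rewrite lee_fin mulr_ge0.
  apply: adde_ge0; last exact: lin_ge0.
  apply: adde_ge0; first by apply: mule_ge0 => //; exact: conv_ge0.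
  by apply: mule_ge0; [rewrite lee_fin mulr_ge0|exact: lin_ge0].
Qed.

Lemma damping_measurable : measurable_fun setT (fun z : R * R => damping z.1 z.2).
Proof.
rewrite /damping /lin; mfun => //.
by move=> z y; rewrite lee_fin mulr_ge0//; exact: S0.
Qed.

Lemma growth_measurable : measurable_fun setT (fun z : R * R => growth z.1 z.2).
Proof.
rewrite /growth /lin /conv; mfun => //.
all: move=> z y; rewrite lee_fin.
all: repeat (apply: mulr_ge0 => //).
all: first [exact: f0|exact: p0|exact: S0|exact: G0].
Qed.

Lemma measurable_conv_slice (kk : R -> R -> R) x : jointly_measurable kk -> nonneg2 kk ->
  measurable_fun setT (fun s => conv kk (total s) (total s) x).
Proof.
by move=> mkk kk0; rewrite /conv; mfun => //; move=> z y; rewrite lee_fin !mulr_ge0//; exact: S0.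
Qed.

Lemma measurable_lin_slice (kk : R -> R -> R) x : jointly_measurable kk -> nonneg2 kk ->
  measurable_fun setT (fun s => lin kk (total s) x).
Proof.
by move=> mkk kk0; rewrite /lin; mfun => //; move=> z y; rewrite lee_fin !mulr_ge0//; exact: S0.
Qed.

Lemma conv_total_ge0 (kk : R -> R -> R) x : nonneg2 kk ->
  forall s, (0 <= conv kk (total s) (total s) x)%E.
Proof. by move=> kk0 s; apply: conv_ge0 => //; exact: S0. Qed.

Lemma lin_total_ge0 (kk : R -> R -> R) x : nonneg2 kk -> forall s, (0 <= lin kk (total s) x)%E.
Proof. by move=> kk0 s; apply: lin_ge0 => //; exact: S0. Qed.

(** The function f - p - r is the time integral of [inflow - outflow]. The equation of [p] and the
    negative half of [r] enter with exchanged roles, so that both flows consist of nonnegative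
    terms. *)
Definition outflow (s x : R) : \bar R :=
  (loss k a (u s) (f s) x + gain ks gs (us s) (p s) x + coag_parts ks p u us s x)%E.

Definition inflow (s x : R) : \bar R :=
  (gain k g (u s) (f s) x + loss ks as_ (us s) (p s) x + coag_parts ks p us u s x)%E.

Lemma sign_flow_le (s x : R) : 0 <= s <= T ->
  conv k (total s) (total s) x \is a fin_num -> conv ks (total s) (total s) x \is a fin_num ->
  lin g (total s) x \is a fin_num -> lin gs (total s) x \is a fin_num ->
  ((Num.sg (f s x - p s x - r s x) * (fine (inflow s x) - fine (outflow s x)))%:E +
   damping s x <= growth s x)%E.
Proof.
move=> sT ckS cksS lgS lgsS.
have mft : measurable_fun setT (f s) by mfun.
have mpt : measurable_fun setT (p s) by mfun.
have mSs : measurable_fun setT (total s) by mfun.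
have mGs : measurable_fun setT (gap s) by mfun.
have fs0 : nonneg1 (f s) by exact: f0.
have ps0 : nonneg1 (p s) by exact: p0.
have Ss0 : nonneg1 (total s) by exact: S0.
have Gs0 : nonneg1 (gap s) by exact: G0.
have fS y : f s y <= total s y by rewrite /total lerDl.
have pS y : p s y <= total s y by rewrite /total lerDr.
have fpG y : f s y <= p s y + gap s y.
  by rewrite /gap -lerBlDl ler_norm.
have pfG y : p s y <= f s y + gap s y.
  by rewrite /gap distrC -lerBlDl ler_norm.
have convS (kk : R -> R -> R) (v : R -> R) : jointly_measurable kk -> nonneg2 kk ->
    measurable_fun setT v -> nonneg1 v -> (forall y, v y <= total s y) ->
    conv kk (total s) (total s) x \is a fin_num -> conv kk v v x \is a fin_num.
  move=> mkk kk0 mv v0 vS; rewrite !ge0_fin_numE; [|exact: conv_ge0|exact: conv_ge0].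
  apply: le_lt_trans; apply: conv_le => // y z; apply: ler_wpM2l => //.
  by apply: ler_pM.
have linS (kk : R -> R -> R) (v : R -> R) : jointly_measurable kk -> nonneg2 kk ->
    measurable_fun setT v -> nonneg1 v -> (forall y, v y <= total s y) ->
    lin kk (total s) x \is a fin_num -> lin kk v x \is a fin_num.
  move=> mkk kk0 mv v0 vS; rewrite !ge0_fin_numE; [|exact: lin_ge0|exact: lin_ge0].
  by apply: le_lt_trans; apply: lin_le => // y; apply: ler_wpM2l.
have lkS : lin k (total s) x \is a fin_num.
  by rewrite ge0_fin_numE; [exact: lin_total_fin Kh_ge0 mk k0 k_le1 sT|exact: lin_ge0].
have lksS : lin ks (total s) x \is a fin_num.
  by rewrite ge0_fin_numE; [exact: lin_total_fin Kh_ge0 mks ks0 ks_le1 sT|exact: lin_ge0].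
have cf := convS _ _ mk k0 mft fs0 fS ckS; have cp := convS _ _ mk k0 mpt ps0 pS ckS.
have cs := convS _ _ mks ks0 mpt ps0 pS cksS.
have lf := linS _ _ mk k0 mft fs0 fS lkS; have lp := linS _ _ mk k0 mpt ps0 pS lkS.
have ls := linS _ _ mks ks0 mpt ps0 pS lksS.
have gf := linS _ _ mg g0 mft fs0 fS lgS; have gp := linS _ _ mg g0 mpt ps0 pS lgS.
have gs' := linS _ _ mgs gs0 mpt ps0 pS lgsS.
have [c1 c2] := conv_diff_le x mk mft mpt mGs k0 fs0 ps0 Gs0 fpG pfG.
have kks y z : k y z <= ks y z + kd y z by rewrite /kd -lerBlDl ler_norm.
have ksk y z : ks y z <= k y z + kd y z by rewrite /kd distrC -lerBlDl ler_norm.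
have ggs y z : g y z <= gs y z + gd y z by rewrite /gd -lerBlDl ler_norm.
have gsg y z : gs y z <= g y z + gd y z by rewrite /gd distrC -lerBlDl ler_norm.
have B1 := fine_lip cf cp c1 c2.
have B2 : (`|fine (conv k (p s) (p s) x) - fine (conv ks (p s) (p s) x)|%:E <=
    conv kd (p s) (p s) x)%E.
  apply: fine_lip => //; apply: conv_leD => // y z; rewrite -mulrDl ler_wpM2r ?mulr_ge0//.
have lin1 (kk : R -> R -> R) : jointly_measurable kk -> nonneg2 kk ->
    lin kk (f s) x \is a fin_num -> lin kk (p s) x \is a fin_num ->
    (`|fine (lin kk (f s) x) - fine (lin kk (p s) x)|%:E <= lin kk (gap s) x)%E.
  move=> mkk kk0 *; apply: fine_lip => //.
  - by apply: lin_leD => // y; rewrite -mulrDr ler_wpM2l.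
  - by apply: lin_leD => // y; rewrite -mulrDr ler_wpM2l.
have B3 := lin1 _ mk k0 lf lp; have B4 := lin1 _ mg g0 gf gp.
have B5 : (`|fine (lin k (p s) x) - fine (lin ks (p s) x)|%:E <= lin kd (p s) x)%E.
  by apply: fine_lip => //; apply: lin_leD => // y; rewrite -mulrDl ler_wpM2r.
have B6 : (`|fine (lin g (p s) x) - fine (lin gs (p s) x)|%:E <= lin gd (p s) x)%E.
  by apply: fine_lip => //; apply: lin_leD => // y; rewrite -mulrDl ler_wpM2r.
have lSE : lin k (total s) x = (fine (lin k (f s) x) + fine (lin k (p s) x))%:E.
  by rewrite /total linD// EFinD !fineK.
have lf0 : 0 <= fine (lin k (f s) x) by apply: fine_ge0; exact: lin_ge0.
have lp0 : 0 <= fine (lin k (p s) x) by apply: fine_ge0; exact: lin_ge0.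
have key := sign_estimate (r s x) (as_ x) (fine (conv k (f s) (f s) x))
  (fine (conv k (p s) (p s) x)) (fine (conv ks (p s) (p s) x)) (fine (lin ks (p s) x))
  (fine (lin g (f s) x)) (fine (lin g (p s) x)) (fine (lin gs (p s) x))
  (u0 s) (fs0 x) (ps0 x) (a0 x) lf0 lp0.
(* The subtracted remainder turns the control [us] in the coagulation term of [p] into [u], which
   becomes a common factor. *)
have flowE : fine (inflow s x) - fine (outflow s x) =
    u s * (fine (conv k (f s) (f s) x) / 2 - f s x * fine (lin k (f s) x) -
      fine (conv ks (p s) (p s) x) / 2 + p s x * fine (lin ks (p s) x)) +
    fine (lin g (f s) x) - fine (lin gs (p s) x) - a x * f s x + as_ x * p s x.
  rewrite /inflow /outflow /loss /gain /coag_parts.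
  rewrite -(fineK cf) -(fineK cs) -(fineK lf) -(fineK ls) -(fineK gf) -(fineK gs').
  rewrite -!EFinM -!EFinD /=; ring.
rewrite flowE /damping /growth lSE.
apply: le_trans (_ : (((u s / 2 * `|fine (conv k (f s) (f s) x) - fine (conv k (p s) (p s) x)| +
     u s / 2 * (f s x + p s x) * `|fine (lin k (f s) x) - fine (lin k (p s) x)|) +
  (u s * `|r s x| * (fine (lin k (f s) x) + fine (lin k (p s) x)) +
     `|fine (lin g (f s) x) - fine (lin g (p s) x)| + 2 * a x * `|r s x|) +
  (u s / 2 * `|fine (conv k (p s) (p s) x) - fine (conv ks (p s) (p s) x)| +
     u s * p s x * `|fine (lin k (p s) x) - fine (lin ks (p s) x)| +
     `|fine (lin g (p s) x) - fine (lin gs (p s) x)| + `|a x - as_ x| * p s x))%:E <= _)%E).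
  by rewrite -!EFinM -!EFinD lee_fin; apply: le_trans key; rewrite /gap mulrA.
have us20 : (0 <= (u s / 2)%:E)%E by rewrite lee_fin divr_ge0.
rewrite !EFinD; apply: leeD; first apply: leeD; first apply: leeD.
- by rewrite EFinM; apply: lee_wpmul2l.
- rewrite EFinM; apply: lee_wpmul2l => //; rewrite lee_fin; apply: mulr_ge0; last exact: Ss0.
  exact: divr_ge0.
- by apply: leeD => //; apply: leeD.
- apply: leeD => //; apply: leeD => //; apply: leeD.
    by rewrite EFinM; apply: lee_wpmul2l.
  by rewrite EFinM; apply: lee_wpmul2l => //; rewrite lee_fin mulr_ge0.
Qed.

(** [abs_balance] at a fixed size, outside the null set where one of the equations fails, the
    initial values differ or a dominating integral is infinite. Finiteness of those integrals gives
    the finite values that [sign_flow_le] needs at almost every time. *)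
Lemma gap_balance : {ae mu, forall x, forall t : R, 0 <= t <= T ->
  (`|f t x - p t x - r t x|%:E + \int[mu]_(s in `]0%R, t]) damping s x <=
   \int[mu]_(s in `]0%R, t]) growth s x)%E}.
Proof.
have K10 : 0 <= Kh by [].
have F1 := coag_total_fin K10 mk k0 k_le1.
have F2 := coag_total_fin K10 mks ks0 ks_le1.
have ggN y : (lin (flip g) (fun=> 1%R) y <= (a y * N)%:E)%E.
  have := gN (w := fun=> 1) (c1 := 1) (c2 := 0) y (@measurable_cst _ _ _ _ _ _).
  rewrite mul1r mul0r addr0; apply => //.
  by move=> x; rewrite mul0r addr0.
have gsgN y : (lin (flip gs) (fun=> 1%R) y <= (as_ y * N)%:E)%E.
  have := gsN (w := fun=> 1) (c1 := 1) (c2 := 0) y (@measurable_cst _ _ _ _ _ _).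
  rewrite mul1r mul0r addr0; apply => //.
  by move=> x; rewrite mul0r addr0.
have F3 := frag_total_fin mg g0 ma a0 aA ggN.
have F4 := frag_total_fin mgs gs0 mas as0 asA gsgN.
have F5 := aeI (evo_eq E1) (evo_eq E2).
have := aeI init (aeI (aeI F1 F2) (aeI (aeI F3 F4) F5)).
apply: aeS => x [fp0 [[[F1x F1x'] [F2x F2x']] [[F3x F4x] [[L1 G1 H1] [L2 G2 H2]]]]] t tT.
have mft s : measurable_fun setT (f s) by mfun.
have mpt s : measurable_fun setT (p s) by mfun.
have mSs s : measurable_fun setT (total s) by mfun.
have mGs s : measurable_fun setT (gap s) by mfun.
have mparts (c d : R -> R) : measurable_fun setT c -> measurable_fun setT d ->
    measurable_fun setT (fun s => coag_parts ks p c d s x).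
  move=> mc md; have H := coag_parts_measurable mks ks0 mp p0 mc md.
  exact: (@ejm_comp _ _ _ (coag_parts ks p c d) id (fun=> x)).
have partsfin (c d : R -> R) : measurable_fun setT c -> measurable_fun setT d ->
    nonneg1 c -> nonneg1 d -> (forall s, c s <= B) -> (forall s, d s <= B) ->
    (\int[mu]_(s in `]0%R, T]) coag_parts ks p c d s x < +oo)%E.
  move=> mc md c0 d0 cB dB.
  have mX : measurable_fun setT (fun s => conv ks (total s) (total s) x).
    by rewrite /conv; mfun => //; move=> z y; rewrite lee_fin !mulr_ge0//; exact: S0.
  have mY : measurable_fun setT (fun s => (total s x)%:E * lin ks (total s) x)%E.
    by rewrite /lin; mfun => //; move=> z y; rewrite lee_fin !mulr_ge0//; exact: S0.
  have X0 s : (0 <= conv ks (total s) (total s) x)%E by apply: conv_ge0 => //; exact: S0.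
  have Y0 s : (0 <= (total s x)%:E * lin ks (total s) x)%E.
    by apply: mule_ge0; [rewrite lee_fin; exact: S0|apply: lin_ge0 => //; exact: S0].
  have XY0 s : (0 <= conv ks (total s) (total s) x + (total s x)%:E * lin ks (total s) x)%E.
    by apply: adde_ge0.
  apply: (@le_lt_trans _ _ (\int[mu]_(s in `]0%R, T])
    (B%:E * (conv ks (total s) (total s) x + (total s x)%:E * lin ks (total s) x)))%E).
    apply: ge0_le_integralT => //; first exact: mparts.
    - by apply: emeasurable_funM; [exact: measurable_cst|exact: emeasurable_funD].
    - by move=> s; apply: coag_parts_ge0.
    move=> s _; have Ss0 : nonneg1 (total s) by exact: S0.
    have ps0 : nonneg1 (p s) by exact: p0.
    have pS y : p s y <= total s y by rewrite /total lerDr; exact: f0.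
    rewrite ge0_muleDr//; apply: leeD.
      apply: lee_pmul; [by rewrite lee_fin divr_ge0|exact: conv_ge0| |].
        by rewrite lee_fin; apply: le_trans (cB s); rewrite ler_pdivrMr// ler_peMr// ler1n.
      apply: conv_le => // y z; apply: ler_wpM2l => //.
      by apply: ler_pM.
    rewrite EFinM -muleA; apply: lee_pmul; [by rewrite lee_fin| |by rewrite lee_fin|].
      by apply: mule_ge0; [rewrite lee_fin; exact: ps0|exact: lin_ge0].
    apply: lee_pmul; [by rewrite lee_fin; exact: ps0|exact: lin_ge0|by rewrite lee_fin|].
    by apply: lin_le => // y; apply: ler_wpM2l.
  rewrite (ge0_integralZlT (measurable_itv _) B_ge0 (emeasurable_funD mX mY) XY0).
  rewrite (ge0_integralDT (measurable_itv _) mX mY X0 Y0).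
  have B0e : (0 <= B%:E)%E by rewrite lee_fin.
  by apply: (lte_mul_pinfty B0e _ (lte_add_pinfty F2x F2x')).
have Pfin := partsfin u us mu1 mu2 u0 us0 uB usB.
have Qfin := partsfin us u mu2 mu1 us0 u0 usB uB.
have mP := mparts u us mu1 mu2; have mQ := mparts us u mu2 mu1.
have P0 s : (0 <= coag_parts ks p u us s x)%E by exact: coag_parts_ge0.
have Q0 s : (0 <= coag_parts ks p us u s x)%E by exact: coag_parts_ge0.
have mL1 : measurable_fun setT (fun s => loss k a (u s) (f s) x).
  exact: (@ejm_comp _ _ _ (fun r x => loss k a (u r) (f r) x) id (fun=> x)
    (loss_measurable C1 E1)).
have mL2 : measurable_fun setT (fun s => loss ks as_ (us s) (p s) x).
  exact: (@ejm_comp _ _ _ (fun r x => loss ks as_ (us r) (p r) x) id (fun=> x)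
    (loss_measurable C2 E2)).
have mG1 : measurable_fun setT (fun s => gain k g (u s) (f s) x).
  exact: (@ejm_comp _ _ _ (fun r x => gain k g (u r) (f r) x) id (fun=> x)
    (gain_measurable C1 E1)).
have mG2 : measurable_fun setT (fun s => gain ks gs (us s) (p s) x).
  exact: (@ejm_comp _ _ _ (fun r x => gain ks gs (us r) (p r) x) id (fun=> x)
    (gain_measurable C2 E2)).
have L10 s := loss_ge0 C1 E1 s x; have L20 s := loss_ge0 C2 E2 s x.
have G10 s := gain_ge0 C1 E1 s x; have G20 s := gain_ge0 C2 E2 s x.
pose Af s := outflow s x; pose Bf s := inflow s x.
have mLG := emeasurable_funD mL1 mG2; have mGL := emeasurable_funD mG1 mL2.
have mA : measurable_fun setT Af by exact: emeasurable_funD mLG mP.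
have mB : measurable_fun setT Bf by exact: emeasurable_funD mGL mQ.
have LG0 s : (0 <= loss k a (u s) (f s) x + gain ks gs (us s) (p s) x)%E by exact: adde_ge0.
have GL0 s : (0 <= gain k g (u s) (f s) x + loss ks as_ (us s) (p s) x)%E by exact: adde_ge0.
have Af0 s : (0 <= Af s)%E by exact: adde_ge0.
have Bf0 s : (0 <= Bf s)%E by exact: adde_ge0.
have AE (s : R) : (\int[mu]_(s in `]0%R, s]) Af s = \int[mu]_(s in `]0%R, s]) loss k a (u s) (f s) x +
    \int[mu]_(s in `]0%R, s]) gain ks gs (us s) (p s) x +
    \int[mu]_(s in `]0%R, s]) coag_parts ks p u us s x)%E.
  by rewrite (ge0_integralDT _ mLG mP)// (ge0_integralDT _ mL1 mG2).
have BE (s : R) : (\int[mu]_(s in `]0%R, s]) Bf s = \int[mu]_(s in `]0%R, s]) gain k g (u s) (f s) x +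
    \int[mu]_(s in `]0%R, s]) loss ks as_ (us s) (p s) x +
    \int[mu]_(s in `]0%R, s]) coag_parts ks p us u s x)%E.
  by rewrite (ge0_integralDT _ mGL mQ)// (ge0_integralDT _ mG1 mL2).
have Afin : (\int[mu]_(s in `]0%R, T]) Af s < +oo)%E.
  by rewrite AE; exact: lte_add_pinfty (lte_add_pinfty L1 G2) Pfin.
have Bfin : (\int[mu]_(s in `]0%R, T]) Bf s < +oo)%E.
  by rewrite BE; exact: lte_add_pinfty (lte_add_pinfty G1 L2) Qfin.
pose h s := f s x - p s x - r s x.
have mh : measurable_fun setT h by rewrite /h; mfun.
have hE (s : R) : 0 <= s <= T -> h s = \int[mu]_(s in `]0, s]) (fine (Bf s) - fine (Af s)).
  move=> sT; have [_ ->] := fine_diff_integral sT mA mB Af0 Bf0 Afin Bfin.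
  have small (F : R -> \bar R) : measurable_fun setT F -> (forall s, 0 <= F s)%E ->
      (\int[mu]_(s in `]0%R, T]) F s < +oo)%E -> (\int[mu]_(s in `]0%R, s]) F s)%E \is a fin_num.
    move=> mF F0 Foo; rewrite ge0_fin_numE ?integral_ge0//.
    by apply: le_lt_trans Foo; apply: ge0_integral_oc_mono => //; have /andP[] := sT.
  have := H1 s sT; have := H2 s sT; rewrite AE BE /h /r /remainder fp0.
  move: (small _ mL1 L10 L1) (small _ mL2 L20 L2) (small _ mG1 G10 G1) (small _ mG2 G20 G2)
    (small _ mP P0 Pfin) (small _ mQ Q0 Qfin).
  case: (integral _ _ _) => [l1| |] //; case: (integral _ _ _) => [l2| |] //.
  case: (integral _ _ _) => [g1| |] //; case: (integral _ _ _) => [g2| |] //.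
  case: (integral _ _ _) => [pp| |] //; case: (integral _ _ _) => [qq| |] //.
  move=> _ _ _ _ _ _; rewrite -!EFinD /= => -[e1] [e2]; lra.
have /andP[t0 tT'] := tT.
have [ik _] := fine_diff_integral tT mA mB Af0 Bf0 Afin Bfin.
have hE' (s : R) : 0 <= s <= t -> h s = \int[mu]_(s in `]0, s]) (fine (Bf s) - fine (Af s)).
  by move=> /andP[s0 st]; apply: hE; rewrite s0 (le_trans st).
have md := damping_measurable; have mgr := growth_measurable.
have md' : measurable_fun setT (fun s => damping s x).
  exact: (@ejm_comp _ _ _ damping id (fun=> x)).
have mgr' : measurable_fun setT (fun s => growth s x).
  exact: (@ejm_comp _ _ _ growth id (fun=> x)).
have nd s := damping_ge0 s x; have ng s := growth_ge0 s x.
apply: (abs_balance t0 ik mh hE' md' mgr' nd ng).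
have mT := measurable_itv `]0, T].
have V1 := ae_fin_integral mT (measurable_conv_slice x mk k0) (conv_total_ge0 x k0) F1x.
have V2 := ae_fin_integral mT (measurable_conv_slice x mks ks0) (conv_total_ge0 x ks0) F2x.
have V3 := ae_fin_integral mT (measurable_lin_slice x mg g0) (lin_total_ge0 x g0) F3x.
have V4 := ae_fin_integral mT (measurable_lin_slice x mgs gs0) (lin_total_ge0 x gs0) F4x.
apply: aeS (aeI (aeI V1 V2) (aeI V3 V4)) => s [[v1 v2] [v3 v4]].
rewrite /= in_itv/= => /andP[s0 st].
have sT : `]0, T]%classic s by rewrite /= in_itv/= s0 (le_trans st).
apply: sign_flow_le; [by rewrite ltW//= (le_trans st)|exact: v1|exact: v2|exact: v3|exact: v4].
Qed.

Section Weighted.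
Variable L : R.
Hypothesis L_gt0 : 0 < L.

(** Truncation makes the weighted damping finite, since the rate grows at most linearly; it can then
    be cancelled. The summand 1 controls the number of particles, for which convergence is
    wanted. *)
Definition weight (x : R) : R := 1 + trunc L x.

Let w := weight.
Let mw : measurable_fun setT w.
Proof. by have mt := trunc_measurable L; rewrite /w /weight; mfun. Qed.
Let t0 : nonneg1 (trunc L). Proof. by apply: trunc_ge0; exact: ltW. Qed.
Let w1 x : 1 <= w x. Proof. by rewrite /w /weight lerDl. Qed.
Let w0 : nonneg1 w. Proof. by move=> x; apply: le_trans (w1 x). Qed.
Let w_le x : w x <= 1 + L. Proof. by rewrite /w /weight lerD2l trunc_le. Qed.
Let w_le_pos x : w x <= 1 + pos x. Proof. by rewrite /w /weight lerD2l trunc_le_pos. Qed.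
Let L1_ge0 : 0 <= 1 + L. Proof. by rewrite addr_ge0// ltW. Qed.

Lemma weight_add x y : w (x + y) <= w x + w y.
Proof.
rewrite /w /weight /trunc -addrA lerD2l.
have := pos_add x y; have := pos_ge0 x; have := pos_ge0 y; have := L_gt0.
move: (pos x) (pos y) (pos (x + y)) => X Y Z l y0 x0 zxy.
by have [?|?] := leP Z L; have [?|?] := leP X L; have [?|?] := leP Y L; lra.
Qed.

(** Up to [L] the weight is 1 + y; mass is conserved, so that only the number of fragments exceeds
    what the loss removes, by at most N A times the weight. Beyond [L] the truncation breaks this
    compensation, and N (1 + L) times the rate is left over; this term calls for tails of order o(1
    / L). *)
Lemma lin_frag_weight_le y : (lin (flip g) w y <=
  (w y * a y + N * A * w y + N * (1 + L) * (beyond L y * a y))%:E)%E.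
Proof.
have ay := a0 y; have y0 := pos_ge0 y.
have nonn : 0 <= w y * a y + N * A * w y.
  by apply: addr_ge0; apply: mulr_ge0 => //; exact: mulr_ge0.
have NL : 0 <= N * (1 + L) by exact: mulr_ge0.
rewrite beyondP; case: ifPn => [Ly|].
  have wL x : w x <= 1 + L + 0 * pos x by rewrite mul0r addr0.
  apply: le_trans (gN y mw w0 L1_ge0 (lexx 0) wL) _.
  rewrite lee_fin mul0r addr0 mul1r mulrC (mulrC (1 + L)).
  by apply: ler_wpDl.
rewrite -ltNge mul0r mulr0 addr0 => yL.
have wp x : w x <= 1 + 1 * pos x by rewrite mul1r.
apply: le_trans (gN y mw w0 ler01 ler01 wp) _; rewrite lee_fin !mul1r.
have wE : w y = 1 + pos y by rewrite /w /weight /trunc min_l// ltW.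
have : N * a y <= N * A * (1 + pos y) by rewrite -mulrA ler_wpM2l.
by rewrite wE; exact: add_le_weighted.
Qed.

(** Gain and loss of the kernel difference both integrate to [bil kd], with factors bounded by [B]:
    hence 2 B. *)
Definition err (s : R) : \bar R :=
  ((2 * B)%:E * bil kd (p s) (p s) +
   \int[mu]_y ((p s y)%:E * lin (flip gd) (fun=> 1%R) y) +
   mom (fun x => `|a x - as_ x|)%R (p s))%E.

Let I (F : R -> \bar R) := (\int[mu]_x ((w x)%:E * F x))%E.

Let ID (F G : R -> \bar R) : measurable_fun setT F -> measurable_fun setT G ->
  (forall x, 0 <= F x)%E -> (forall x, 0 <= G x)%E -> I (fun x => F x + G x)%E = (I F + I G)%E.
Proof.
move=> mF mG' F0 G0'; rewrite /I.
have n1 x : (0 <= (w x)%:E * F x)%E by apply: mule_ge0; rewrite ?lee_fin.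
have n2 x : (0 <= (w x)%:E * G x)%E by apply: mule_ge0; rewrite ?lee_fin.
have m1 : measurable_fun setT (fun x => (w x)%:E * F x)%E by mfun.
have m2 : measurable_fun setT (fun x => (w x)%:E * G x)%E by mfun.
rewrite -(ge0_integralDT measurableT m1 m2 n1 n2).
by apply: eq_integral => x _; rewrite ge0_muleDr.
Qed.

Let IZ (c : R) (F : R -> \bar R) : 0 <= c -> measurable_fun setT F ->
  (forall x, 0 <= F x)%E -> I (fun x => c%:E * F x)%E = (c%:E * I F)%E.
Proof.
move=> c0 mF F0; rewrite /I.
have n1 x : (0 <= (w x)%:E * F x)%E by apply: mule_ge0; rewrite ?lee_fin.
have m1 : measurable_fun setT (fun x => (w x)%:E * F x)%E by mfun.
rewrite -(ge0_integralZlT measurableT c0 m1 n1).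
by apply: eq_integral => x _; rewrite muleCA.
Qed.

Let wk x y := w x * k x y.
Let kw x y := w y * k x y.
Let mwk : jointly_measurable wk. Proof. by rewrite /jointly_measurable /wk; mfun. Qed.
Let mkw : jointly_measurable kw. Proof. by rewrite /jointly_measurable /kw; mfun. Qed.
Let wk0 : nonneg2 wk. Proof. by move=> x y; exact: mulr_ge0. Qed.
Let kw0 : nonneg2 kw. Proof. by move=> x y; exact: mulr_ge0. Qed.
Let ksym x y : k x y = k y x. Proof. exact: coag_sym C1 x y. Qed.

Section AtTime.
Variable s : R.
Let mfs : measurable_fun setT (f s). Proof. by mfun. Qed.
Let mps : measurable_fun setT (p s). Proof. by mfun. Qed.
Let mSs : measurable_fun setT (total s). Proof. by mfun. Qed.
Let mGs : measurable_fun setT (gap s). Proof. by mfun. Qed.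
Let fs0 : nonneg1 (f s). Proof. exact: f0. Qed.
Let ps0 : nonneg1 (p s). Proof. exact: p0. Qed.
Let Ss0 : nonneg1 (total s). Proof. exact: S0. Qed.
Let Gs0 : nonneg1 (gap s). Proof. exact: G0. Qed.
Let us20 : 0 <= u s / 2. Proof. exact: divr_ge0. Qed.

(** The convolutions combine into one form in gap and total with weight w(x + y) <= w x + w y. The
    part with [w x], on the gap, is exactly the coagulation damping. The part with [w y], on the
    total, appears with u / 2 from here and once more with u / 2 from the difference of the loss
    terms. *)
Lemma integral_coag_growth_le :
  (I (fun x => (u s / 2)%:E * (conv k (gap s) (f s) x + conv k (p s) (gap s) x) +
     (u s / 2 * total s x)%:E * lin k (gap s) x)%E <=
   (u s / 2)%:E * bil wk (gap s) (total s) + (u s)%:E * bil kw (gap s) (total s))%E.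
Proof.
have mc1 := conv_measurable mk mGs mfs k0 Gs0 fs0.
have mc2 := conv_measurable mk mps mGs k0 ps0 Gs0.
have ml := lin_measurable mk mGs k0 Gs0.
have c10 x : (0 <= conv k (gap s) (f s) x)%E by exact: conv_ge0.
have c20 x : (0 <= conv k (p s) (gap s) x)%E by exact: conv_ge0.
have l0 x : (0 <= (total s x)%:E * lin k (gap s) x)%E.
  by apply: mule_ge0; [rewrite lee_fin|exact: lin_ge0].
have mSl : measurable_fun setT (fun x => (total s x)%:E * lin k (gap s) x)%E by mfun.
have c120 x : (0 <= conv k (gap s) (f s) x + conv k (p s) (gap s) x)%E by exact: adde_ge0.
have mc12 := emeasurable_funD mc1 mc2.
have all0 x : (0 <= conv k (gap s) (f s) x + conv k (p s) (gap s) x +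
  (total s x)%:E * lin k (gap s) x)%E by exact: adde_ge0.
rewrite (_ : (fun x => _) = (fun x => (u s / 2)%:E * ((conv k (gap s) (f s) x +
    conv k (p s) (gap s) x) + (total s x)%:E * lin k (gap s) x))%E); last first.
  by apply/funext => x; rewrite (EFinM (u s / 2)) -muleA [RHS]ge0_muleDr.
rewrite (IZ us20 (emeasurable_funD mc12 mSl) all0) (ID mc12 mSl c120 l0) (ID mc1 mc2 c10 c20).
rewrite /I (mom_conv mw mk mGs mfs w0 k0 Gs0 fs0) (mom_conv mw mk mps mGs w0 k0 ps0 Gs0).
rewrite (mom_lin mw mk mSs mGs w0 k0 Ss0 Gs0).
pose wa x y := w (x + y) * k x y.
have mwa : jointly_measurable wa by rewrite /jointly_measurable /wa; mfun.
have wa0 : nonneg2 wa by move=> x y; exact: mulr_ge0.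
rewrite -/wa -/wk (bil_swap mwa mps mGs wa0 ps0 Gs0) (bil_swap mwk mSs mGs wk0 Ss0 Gs0).
rewrite (_ : (fun x y => wa y x) = wa); last first.
  by apply/funext => x; apply/funext => y; rewrite /wa addrC ksym.
rewrite (_ : (fun x y => wk y x) = kw); last first.
  by apply/funext => x; apply/funext => y; rewrite /wk /kw ksym.
rewrite -(bilDr mwa mGs mfs mps wa0 Gs0 fs0 ps0) -/(total s).
have wkw : (bil wa (gap s) (total s) <= bil wk (gap s) (total s) + bil kw (gap s) (total s))%E.
  rewrite -bilD//; apply: bil_le => //.
  - by rewrite /jointly_measurable; mfun.
  - by move=> x y; exact: addr_ge0.
  - by move=> x y; rewrite ler_wpM2r ?mulr_ge0// /wa /wk /kw -mulrDl ler_wpM2r// weight_add.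
have b10 : (0 <= bil wk (gap s) (total s))%E by exact: bil_ge0.
have b20 : (0 <= bil kw (gap s) (total s))%E by exact: bil_ge0.
exact: half_combine (u0 s) b10 b20 wkw.
Qed.

Let absr0 : nonneg1 (fun x => `|r s x|). Proof. by move=> x; exact: normr_ge0. Qed.
Let mrs : measurable_fun setT (fun x => `|r s x|). Proof. by mfun. Qed.

Lemma integral_frag_growth_le :
  (I (fun x => (u s * `|r s x|)%:E * lin k (total s) x + lin g (gap s) x +
      (2 * a x * `|r s x|)%:E) <=
   mom (fun x => w x * a x)%R (gap s) +
   ((u s)%:E * bil wk (fun x => `|r s x|)%R (total s) + (N * A)%:E * mom w (gap s) +
    (N * (1 + L))%:E * mom (fun x => beyond L x * a x)%R (gap s) +
    2%:E * mom (fun x => w x * a x)%R (fun x => `|r s x|)%R))%E.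
Proof.
have ml := lin_measurable mk mSs k0 Ss0; have mlg := lin_measurable mg mGs g0 Gs0.
have l0 x : (0 <= (`|r s x|)%:E * lin k (total s) x)%E.
  by apply: mule_ge0; [rewrite lee_fin|exact: lin_ge0].
have mrl : measurable_fun setT (fun x => (`|r s x|)%:E * lin k (total s) x)%E by mfun.
have F30 x : (0 <= (u s)%:E * ((`|r s x|)%:E * lin k (total s) x))%E.
  by apply: mule_ge0; rewrite ?lee_fin.
have mF3 : measurable_fun setT (fun x => (u s)%:E * ((`|r s x|)%:E * lin k (total s) x))%E by mfun.
have F40 x : (0 <= lin g (gap s) x)%E by exact: lin_ge0.
have F50 x : (0 <= (2 * a x * `|r s x|)%:E)%E.
  by rewrite lee_fin; apply: mulr_ge0 => //; exact: mulr_ge0.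
have mF5 : measurable_fun setT (fun x => (2 * a x * `|r s x|)%:E) by mfun.
rewrite (_ : (fun x => _) = (fun x => (u s)%:E * ((`|r s x|)%:E * lin k (total s) x) +
    lin g (gap s) x + (2 * a x * `|r s x|)%:E)%E); last first.
  by apply/funext => x; rewrite muleA -EFinM.
have F340 x : (0 <= (u s)%:E * ((`|r s x|)%:E * lin k (total s) x) + lin g (gap s) x)%E.
  exact: adde_ge0.
rewrite (ID (emeasurable_funD mF3 mlg) mF5 F340 F50) (ID mF3 mlg F30 F40).
rewrite (IZ (u0 s) mrl l0) /I (mom_lin mw mk mrs mSs w0 k0 absr0 Ss0) -/wk.
rewrite (mom_gain mw mg mGs w0 g0 Gs0).
have mba : measurable_fun setT (fun x => beyond L x * a x).
  by have mb := @beyond_measurable R L; mfun.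
have ba0 : nonneg1 (fun x => beyond L x * a x).
  by move=> x; apply: mulr_ge0; [exact: beyond_ge0|].
have mwa : measurable_fun setT (fun x => w x * a x) by mfun.
have wa0 : nonneg1 (fun x => w x * a x) by move=> x; exact: mulr_ge0.
have NA0 : 0 <= N * A by exact: mulr_ge0.
have NL0 : 0 <= N * (1 + L) by exact: mulr_ge0.
have H4 : (\int[mu]_y ((gap s y)%:E * lin (fun y x => g x y) w y) <=
   mom (fun x => w x * a x)%R (gap s) + (N * A)%:E * mom w (gap s) +
    (N * (1 + L))%:E * mom (fun x => beyond L x * a x)%R (gap s))%E.
  have n1 : nonneg1 (fun x => N * A * w x) by move=> x; exact: mulr_ge0.
  have m1 : measurable_fun setT (fun x => N * A * w x) by mfun.
  have n2 : nonneg1 (fun x => N * (1 + L) * (beyond L x * a x)) by move=> x; exact: mulr_ge0.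
  have m2 : measurable_fun setT (fun x => N * (1 + L) * (beyond L x * a x)) by mfun.
  have n12 : nonneg1 (fun x => w x * a x + N * A * w x) by move=> x; exact: addr_ge0.
  have m12 : measurable_fun setT (fun x => w x * a x + N * A * w x) by mfun.
  rewrite -(momZ NA0 mw mGs w0 Gs0) -(momZ NL0 mba mGs ba0 Gs0).
  rewrite -(momD mwa mGs m1 wa0 n1 Gs0) -(momD m12 mGs m2 n12 n2 Gs0).
  apply: ge0_le_integralT => //.
  - rewrite /lin; mfun => //.
    by move=> x y; rewrite lee_fin mulr_ge0//; exact: g0.
  - by mfun.
  - move=> y; apply: mule_ge0; first by rewrite lee_fin.
    by apply: lin_ge0 => // ? ?; exact: g0.
  - move=> y _; rewrite EFinM muleC; apply: lee_wpmul2r; first by rewrite lee_fin.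
    exact: lin_frag_weight_le.
have -> : (\int[mu]_x ((w x)%:E * (2 * a x * `|r s x|)%:E) =
    2%:E * mom (fun x => w x * a x)%R (fun x => `|r s x|)%R)%E.
  rewrite -momZ//; apply: eq_integral => x _.
  by rewrite -EFinM; congr (_%:E); ring.
apply: le_trans (leeD2r _ (leeD2l _ H4)) _.
by rewrite adde_pull.
Qed.

Lemma integral_err_le :
  (I (fun x => (u s / 2)%:E * conv kd (p s) (p s) x + (u s * p s x)%:E * lin kd (p s) x +
    lin gd (p s) x + (`|a x - as_ x| * p s x)%:E) <= (1 + L)%:E * err s)%E.
Proof.
have mc := conv_measurable mkd mps mps kd0 ps0 ps0.
have ml := lin_measurable mkd mps kd0 ps0; have mlg := lin_measurable mgd mps gd0 ps0.
have c0 x : (0 <= conv kd (p s) (p s) x)%E by exact: conv_ge0.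
have pl0 x : (0 <= (p s x)%:E * lin kd (p s) x)%E.
  by apply: mule_ge0; [rewrite lee_fin|exact: lin_ge0].
have mpl : measurable_fun setT (fun x => (p s x)%:E * lin kd (p s) x)%E by mfun.
have lg0 x : (0 <= lin gd (p s) x)%E by exact: lin_ge0.
have ap0 x : (0 <= (`|a x - as_ x| * p s x)%:E)%E by rewrite lee_fin mulr_ge0.
have map : measurable_fun setT (fun x => (`|a x - as_ x| * p s x)%:E) by mfun.
have cpl0 x : (0 <= conv kd (p s) (p s) x + (p s x)%:E * lin kd (p s) x)%E by exact: adde_ge0.
have mcpl := emeasurable_funD mc mpl.
have B1 : (0 <= B%:E)%E by rewrite lee_fin.
pose E x := (B%:E * (conv kd (p s) (p s) x + (p s x)%:E * lin kd (p s) x) +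
    lin gd (p s) x + (`|a x - as_ x| * p s x)%:E)%E.
have mB : measurable_fun setT (fun x => B%:E *
    (conv kd (p s) (p s) x + (p s x)%:E * lin kd (p s) x))%E.
  by apply: emeasurable_funM; [exact: measurable_cst|exact: mcpl].
have nB x : (0 <= B%:E * (conv kd (p s) (p s) x + (p s x)%:E * lin kd (p s) x))%E.
  exact: mule_ge0.
have mBl := emeasurable_funD mB mlg.
have nBl x : (0 <= B%:E * (conv kd (p s) (p s) x + (p s x)%:E * lin kd (p s) x) +
  lin gd (p s) x)%E by exact: adde_ge0.
have mE : measurable_fun setT E by exact: emeasurable_funD mBl map.
have E0 x : (0 <= E x)%E by exact: adde_ge0.
have mwE : measurable_fun setT (fun x => (1 + L)%:E * E x)%E by mfun.
have EE : (\int[mu]_x E x = err s)%E.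
  rewrite (ge0_integralDT measurableT mBl map nBl ap0) (ge0_integralDT measurableT mB mlg nB lg0).
  rewrite (ge0_integralZlT measurableT B_ge0 mcpl cpl0) (ge0_integralDT measurableT mc mpl c0 pl0).
  rewrite (mom_conv1 mkd mps mps kd0 ps0 ps0) (mom_lin1 mkd mps mps kd0 ps0 ps0).
  rewrite (mom_gain1 mgd mps gd0 ps0) /err; congr (_ + _ + _)%E.
  rewrite ge0_muleDr ?bil_ge0// -ge0_muleDl// -EFinD.
  by rewrite (_ : B + B = 2 * B)//; lra.
rewrite -EE -(ge0_integralZlT measurableT L1_ge0 mE E0).
apply: ge0_le_integralT => //.
- rewrite /conv /lin; mfun => //.
- move=> x; apply: mule_ge0; first by rewrite lee_fin.
  apply: adde_ge0 => //; apply: adde_ge0 => //; apply: adde_ge0.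
    by apply: mule_ge0.
  by apply: mule_ge0; [rewrite lee_fin mulr_ge0|exact: lin_ge0].
move=> x _; apply: lee_pmul; [by rewrite lee_fin| |by rewrite lee_fin|].
  apply: adde_ge0 => //; apply: adde_ge0 => //; apply: adde_ge0.
    by apply: mule_ge0.
  by apply: mule_ge0; [rewrite lee_fin mulr_ge0|exact: lin_ge0].
rewrite /E; apply: leeD => //; apply: leeD => //.
rewrite [X in (_ <= X)%E]ge0_muleDr//; apply: leeD.
  apply: lee_wpmul2r => //; rewrite lee_fin; apply: le_trans (uB s).
  by rewrite ler_pdivrMr// ler_peMr// ler1n.
by rewrite EFinM -muleA; apply: lee_wpmul2r => //; rewrite lee_fin.
Qed.

Lemma integral_damping :
  (I (damping s) = (u s / 2)%:E * bil wk (gap s) (total s) + mom (fun x => w x * a x)%R (gap s))%E.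
Proof.
have ml := lin_measurable mk mSs k0 Ss0.
have l0 x : (0 <= (gap s x)%:E * lin k (total s) x)%E.
  by apply: mule_ge0; [rewrite lee_fin|exact: lin_ge0].
have mgl : measurable_fun setT (fun x => (gap s x)%:E * lin k (total s) x)%E by mfun.
have n1 x : (0 <= (u s / 2)%:E * ((gap s x)%:E * lin k (total s) x))%E.
  by apply: mule_ge0; rewrite ?lee_fin.
have m1 : measurable_fun setT (fun x => (u s / 2)%:E * ((gap s x)%:E * lin k (total s) x))%E.
  by mfun.
have n2 x : (0 <= (a x * gap s x)%:E)%E by rewrite lee_fin mulr_ge0.
have m2 : measurable_fun setT (fun x => (a x * gap s x)%:E) by mfun.
rewrite (_ : damping s = (fun x => (u s / 2)%:E * ((gap s x)%:E * lin k (total s) x) +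
    (a x * gap s x)%:E)%E); last first.
  by apply/funext => x; rewrite /damping EFinM -muleA.
rewrite (ID m1 m2 n1 n2) (IZ us20 mgl l0) /I (mom_lin mw mk mGs mSs w0 k0 Gs0 Ss0) -/wk.
by congr (_ + _)%E; apply: eq_integral => x _; rewrite -EFinM mulrA.
Qed.

(** The coagulation terms with the weight on the gap and the fragmentation term w a are matched by
    the damping. Only the excess over the damping has to be estimated. *)
Lemma integral_growth_le :
  (I (growth s) <= I (damping s) + ((u s)%:E * bil kw (gap s) (total s) +
   ((u s)%:E * bil wk (fun x => `|r s x|)%R (total s) + (N * A)%:E * mom w (gap s) +
    (N * (1 + L))%:E * mom (fun x => beyond L x * a x)%R (gap s) +
    2%:E * mom (fun x => w x * a x)%R (fun x => `|r s x|)%R) + (1 + L)%:E * err s))%E.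
Proof.
have H1 := integral_coag_growth_le; have H2 := integral_frag_growth_le.
have H3 := integral_err_le.
have mc1 := conv_measurable mk mGs mfs k0 Gs0 fs0.
have mc2 := conv_measurable mk mps mGs k0 ps0 Gs0.
have ml := lin_measurable mk mGs k0 Gs0.
have ml' := lin_measurable mk mSs k0 Ss0; have mlg := lin_measurable mg mGs g0 Gs0.
have mcd := conv_measurable mkd mps mps kd0 ps0 ps0.
have mld := lin_measurable mkd mps kd0 ps0; have mlgd := lin_measurable mgd mps gd0 ps0.
set F1 := (fun x => _) in H1; set F2 := (fun x => _) in H2; set F3 := (fun x => _) in H3.
have mF1 : measurable_fun setT F1 by rewrite /F1; mfun.
have mF2 : measurable_fun setT F2 by rewrite /F2; mfun.
have mF3 : measurable_fun setT F3 by rewrite /F3; mfun.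
have us0' := u0 s.
have F10 x : (0 <= F1 x)%E.
  apply: adde_ge0; apply: mule_ge0; rewrite ?lee_fin//.
  - by apply: adde_ge0; exact: conv_ge0.
  - exact: mulr_ge0.
  - exact: lin_ge0.
have F20 x : (0 <= F2 x)%E.
  apply: adde_ge0; last by rewrite lee_fin; apply: mulr_ge0 => //; exact: mulr_ge0.
  apply: adde_ge0; last exact: lin_ge0.
  by apply: mule_ge0; [rewrite lee_fin mulr_ge0|exact: lin_ge0].
have F30 x : (0 <= F3 x)%E.
  apply: adde_ge0; last by rewrite lee_fin mulr_ge0.
  apply: adde_ge0; last exact: lin_ge0.
  apply: adde_ge0; first by apply: mule_ge0; [rewrite lee_fin|exact: conv_ge0].
  by apply: mule_ge0; [rewrite lee_fin mulr_ge0|exact: lin_ge0].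
have F120 x : (0 <= F1 x + F2 x)%E by exact: adde_ge0.
rewrite (_ : growth s = (fun x => F1 x + F2 x + F3 x)%E)//.
rewrite (ID (emeasurable_funD mF1 mF2) mF3 F120 F30) (ID mF1 mF2 F10 F20) integral_damping.
exact: leeD3_swap H1 H2 H3.
Qed.

Hypothesis s_itv : 0 <= s <= T.
Variable rho : R.
Hypothesis rho_ge0 : 0 <= rho.
Hypothesis r_le : (mom (fun x => 1 + pos x)%R (fun x => `|r s x|)%R <= rho%:E)%E.

Let D := decay muh L.
Let D0 : 0 <= D. Proof. exact: decay_ge0. Qed.
Let Q4 := mom (fun x => (1 + pos x) `^ (1 + muh))%R (total s).
Let Y := mom w (fun x => `|f s x - p s x - r s x|)%R.
Let mq4 : measurable_fun setT (fun x => (1 + pos x) `^ (1 + muh)).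
Proof. by mfun. Qed.
Let q40 : nonneg1 (fun x => (1 + pos x) `^ (1 + muh)).
Proof. by move=> x; exact: powR_ge0. Qed.
Let Q40 : (0 <= Q4)%E. Proof. exact: mom_ge0. Qed.
Let mh : measurable_fun setT (fun x => `|f s x - p s x - r s x|). Proof. by mfun. Qed.
Let h0 : nonneg1 (fun x => `|f s x - p s x - r s x|). Proof. by move=> x; exact: normr_ge0. Qed.
Let Y0 : (0 <= Y)%E. Proof. exact: mom_ge0. Qed.

Lemma mom_remainder_le (v : R -> R) (c : R) : 0 <= c -> measurable_fun setT v -> nonneg1 v ->
  (forall x, v x <= c * (1 + pos x)) -> (mom v (fun x => `|r s x|)%R <= (c * rho)%:E)%E.
Proof.
move=> c0 mv v0 vle.
have mc : measurable_fun setT (fun x => c * (1 + pos x)) by mfun.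
apply: (@le_trans _ _ (mom (fun x => c * (1 + pos x))%R (fun x => `|r s x|)%R)).
  by apply: (mom_le mv mrs mc mrs v0 absr0) => x; exact: ler_wpM2r.
rewrite (momZ c0 mp1 mrs p1_ge0 absr0) EFinM.
by apply: lee_wpmul2l; rewrite ?lee_fin.
Qed.

Lemma mom_gap_le : (mom w (gap s) <= Y + rho%:E)%E.
Proof.
have H := @mom_remainder_le w 1 ler01 mw w0.
rewrite mul1r in H; have {}H := H (fun x => eq_ind_r (fun z => w x <= z) (w_le_pos x) (mul1r _)).
apply: le_trans (leeD2l Y H); rewrite /Y -(momDr mw mh mrs w0 h0 absr0).
have mhr : measurable_fun setT (fun x => `|f s x - p s x - r s x| + `|r s x|) by mfun.
apply: (mom_le mw mGs mw mhr w0 Gs0) => x; apply: ler_wpM2l => //.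
by rewrite /gap -{1}(subrK (r s x) (f s x - p s x)) ler_normD.
Qed.

(** The weight [q] of the kernel bound is not truncated: up to [L] it is at most [w], and beyond [L]
    it is at most [decay muh L] times 1 + x, which is paid with the total. *)
Lemma mom_qgap_le : (mom q (gap s) <= Y + rho%:E + (D * W)%:E)%E.
Proof.
have mDp : measurable_fun setT (fun x => D * (1 + pos x)) by mfun.
have Dp0 : nonneg1 (fun x => D * (1 + pos x)) by move=> x; exact: mulr_ge0.
have mwD : measurable_fun setT (fun x => w x + D * (1 + pos x)) by mfun.
apply: (@le_trans _ _ (mom (fun x => w x + D * (1 + pos x))%R (gap s))).
  apply: (mom_le mq mGs mwD mGs q_ge0 Gs0) => x; apply: ler_wpM2r => //.
  have [xL|Lx] := leP (pos x) L.
    apply: ler_wpDr; first exact: Dp0.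
    by apply: le_trans (q_le x) _; rewrite /w /weight /trunc min_l.
  by apply: ler_wpDl => //; apply: powR_tail_le => //; exact: ltW.
rewrite (momD mw mGs mDp w0 Dp0 Gs0); apply: leeD; first exact: mom_gap_le.
apply: (@le_trans _ _ (mom (fun x => D * (1 + pos x))%R (total s))).
  by apply: (mom_le mDp mGs mDp mSs Dp0 Gs0) => x; apply: ler_wpM2l => //; exact: gap_le_total.
rewrite (momZ D0 mp1 mSs p1_ge0 Ss0) EFinM; apply: lee_wpmul2l; first by rewrite lee_fin.
exact: mom_total_le.
Qed.

(** With the weight on the total, the product of [w] and [q] yields the moment of order 1 + muh of f
    + p. It is integrable in time and becomes the coefficient in Gronwall's inequality, while the
    gap carries [q] alone. *)
Lemma bil_kw_le : ((u s)%:E * bil kw (gap s) (total s) <=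
  (B * Kh)%:E * ((Y + rho%:E + (D * W)%:E) * Q4))%E.
Proof.
have mwq : measurable_fun setT (fun x => w x * q x) by mfun.
have wq0 : nonneg1 (fun x => w x * q x) by move=> x; exact: mulr_ge0.
have kle x y : kw x y <= Kh * (q x * (w y * q y)).
  rewrite /kw mulrCA mulrC (mulrCA Kh) mulrC; have := ler_wpM2l (w0 y) (k_le x y).
  by congr (_ <= _); ring.
have H := bil_le_mom Kh_ge0 mkw mq mwq mGs mSs kw0 q_ge0 wq0 Gs0 Ss0 kle.
rewrite EFinM -muleA; apply: lee_pmul; [by rewrite lee_fin|exact: bil_ge0|by rewrite lee_fin|].
apply: le_trans H _; apply: lee_wpmul2l; first by rewrite lee_fin.
apply: lee_pmul; [exact: mom_ge0|exact: mom_ge0|exact: mom_qgap_le|].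
apply: (mom_le mwq mSs mq4 mSs wq0 Ss0) => x; apply: ler_wpM2r => //.
rewrite powRD ?powRr1 ?p1_ge0//; last by apply/implyP => _; rewrite gt_eqF// ltr_wpDr// pos_ge0.
by apply: ler_wpM2r => //; exact: q_ge0.
Qed.

Lemma bil_wk_remainder_le :
  ((u s)%:E * bil wk (fun x => `|r s x|)%R (total s) <= (B * Kh * ((1 + L) * rho * W))%:E)%E.
Proof.
have mwq : measurable_fun setT (fun x => w x * q x) by mfun.
have wq0 : nonneg1 (fun x => w x * q x) by move=> x; exact: mulr_ge0.
have kle x y : wk x y <= Kh * ((w x * q x) * q y).
  by have := ler_wpM2l (w0 x) (k_le x y); rewrite /wk; congr (_ <= _); ring.
have H := bil_le_mom Kh_ge0 mwk mwq mq mrs mSs wk0 wq0 q_ge0 absr0 Ss0 kle.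
rewrite -mulrA EFinM; apply: lee_pmul; [by rewrite lee_fin|exact: bil_ge0|by rewrite lee_fin|].
apply: le_trans H _; rewrite EFinM; apply: lee_wpmul2l; first by rewrite lee_fin.
rewrite EFinM; apply: lee_pmul; [exact: mom_ge0|exact: mom_ge0| |].
- apply: mom_remainder_le => // x; apply: ler_pM => //.
- by apply: mom_total_le => //; exact: q_le.
Qed.

Let b : \bar R := ((B * Kh)%:E * Q4 + (N * A)%:E)%E.

Lemma growth_excess_le :
  ((u s)%:E * bil kw (gap s) (total s) +
   ((u s)%:E * bil wk (fun x => `|r s x|)%R (total s) + (N * A)%:E * mom w (gap s) +
    (N * (1 + L))%:E * mom (fun x => beyond L x * a x)%R (gap s) +
    2%:E * mom (fun x => w x * a x)%R (fun x => `|r s x|)%R) + (1 + L)%:E * err s <=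
   Y * b + (rho%:E * b + (B * Kh * (D * W))%:E * Q4 +
     (N * (1 + L))%:E * mom (fun x => beyond L x * a x)%R (total s) +
     ((1 + L) * (B * Kh * W + 2 * A) * rho)%:E + (1 + L)%:E * err s))%E.
Proof.
have mba : measurable_fun setT (fun x => beyond L x * a x).
  by have mb := @beyond_measurable R L; mfun.
have ba0 : nonneg1 (fun x => beyond L x * a x).
  by move=> x; apply: mulr_ge0; [exact: beyond_ge0|].
have mwa : measurable_fun setT (fun x => w x * a x) by mfun.
have wa0 : nonneg1 (fun x => w x * a x) by move=> x; exact: mulr_ge0.
have e0 : (0 <= (1 + L)%:E * err s)%E.
  apply: mule_ge0; first by rewrite lee_fin.
  apply: adde_ge0; last by apply: mom_ge0 => // x; exact: normr_ge0.
  apply: adde_ge0; first by apply: mule_ge0; [rewrite lee_fin mulr_ge0|exact: bil_ge0].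
  apply: integral_ge0 => y _; apply: mule_ge0; first by rewrite lee_fin.
  by apply: lin_ge0 => // ? ?; exact: gd0.
have X1 := bil_kw_le; have X2 := bil_wk_remainder_le.
have NA0 : (0 <= (N * A)%:E)%E by rewrite lee_fin mulr_ge0.
have X3 := lee_wpmul2l NA0 mom_gap_le.
have X4 : (mom (fun x => beyond L x * a x)%R (gap s) <=
    mom (fun x => beyond L x * a x)%R (total s))%E.
  by apply: (mom_le mba mGs mba mSs ba0 Gs0) => x; apply: ler_wpM2l => //; exact: gap_le_total.
have NL0 : (0 <= (N * (1 + L))%:E)%E by rewrite lee_fin mulr_ge0.
have {}X4 := lee_wpmul2l NL0 X4.
have two0 : (0 <= 2%:E :> \bar R)%E by rewrite lee_fin.
have X5 : (mom (fun x => w x * a x)%R (fun x => `|r s x|)%R <= ((1 + L) * A * rho)%:E)%E.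
  apply: mom_remainder_le => //; first exact: mulr_ge0.
  by move=> x; rewrite -mulrA; apply: ler_pM.
have {}X5 := lee_wpmul2l two0 X5.
apply: le_trans (leeD (leeD X1 (leeD (leeD (leeD X2 X3) X4) X5)) (lexx _)) _.
have BK0 : 0 <= B * Kh by exact: mulr_ge0.
have NA0' : 0 <= N * A by exact: mulr_ge0.
have DW0 : 0 <= D * W by exact: mulr_ge0.
have tt : (0 <= (N * (1 + L))%:E * mom (fun x => beyond L x * a x)%R (total s))%E.
  by apply: mule_ge0 => //; exact: mom_ge0.
exact: (excess_rearrange _ _ _ Y0 Q40 tt e0 BK0 NA0' rho_ge0 DW0).
Qed.

End AtTime.
Variables (rho Qc tau eps : R) (n : nat).
Hypotheses (rho_ge0 : 0 <= rho) (Qc_ge0 : 0 <= Qc) (tau_ge0 : 0 <= tau) (eps_ge0 : 0 <= eps).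
Hypothesis r_le : forall s : R, 0 <= s <= T ->
  (mom (fun x => 1 + pos x)%R (fun x => `|r s x|)%R <= rho%:E)%E.
Let Q4 s := mom (fun x => (1 + pos x) `^ (1 + muh))%R (total s).
Let b s : \bar R := ((B * Kh)%:E * Q4 s + (N * A)%:E)%E.
Let tail s := mom (fun x => beyond L x * a x)%R (total s).
Hypothesis int_b : (\int[mu]_(s in `]0%R, T]) b s <= (n%:R / 2)%:E)%E.
Hypothesis int_Q4 : (\int[mu]_(s in `]0%R, T]) Q4 s <= Qc%:E)%E.
Hypothesis int_tail : (\int[mu]_(s in `]0%R, T]) tail s <= tau%:E)%E.
Hypothesis int_err : (\int[mu]_(s in `]0%R, T]) err s <= eps%:E)%E.

Let Y s := mom w (fun x => `|f s x - p s x - r s x|)%R.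
Let D := decay muh L.
Let c0 := (1 + L) * (B * Kh * W + 2 * A) * rho.
Let extra s : \bar R := (rho%:E * b s + (B * Kh * (D * W))%:E * Q4 s +
  (N * (1 + L))%:E * tail s + c0%:E + (1 + L)%:E * err s)%E.
Let A0 := rho * (n%:R / 2) + B * Kh * (D * W) * Qc + N * (1 + L) * tau + c0 * T + (1 + L) * eps.

Let D0 : 0 <= D. Proof. exact: decay_ge0. Qed.
Let BK0 : 0 <= B * Kh. Proof. exact: mulr_ge0. Qed.
Let NA0 : 0 <= N * A. Proof. exact: mulr_ge0. Qed.
Let NL0 : 0 <= N * (1 + L). Proof. exact: mulr_ge0. Qed.
Let BD0 : 0 <= B * Kh * (D * W). Proof. by apply: mulr_ge0 => //; exact: mulr_ge0. Qed.
Let c00 : 0 <= c0.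
Proof.
apply: mulr_ge0 => //; apply: mulr_ge0 => //; apply: addr_ge0; apply: mulr_ge0 => //.
Qed.
Let Q40 s : (0 <= Q4 s)%E.
Proof. by apply: mom_ge0; [move=> x; exact: powR_ge0|exact: S0]. Qed.
Let b0 s : (0 <= b s)%E.
Proof. by apply: adde_ge0; [apply: mule_ge0; rewrite ?lee_fin|rewrite lee_fin]. Qed.
Let ba0 : nonneg1 (fun x => beyond L x * a x).
Proof. by move=> x; apply: mulr_ge0; [exact: beyond_ge0|]. Qed.
Let tail0 s : (0 <= tail s)%E. Proof. by apply: mom_ge0; [|exact: S0]. Qed.
Let err0 s : (0 <= err s)%E.
Proof.
have ps0 : nonneg1 (p s) by exact: p0.
apply: adde_ge0; last by apply: mom_ge0 => // x; exact: normr_ge0.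
apply: adde_ge0; first by apply: mule_ge0; [rewrite lee_fin mulr_ge0|exact: bil_ge0].
apply: integral_ge0 => y _; apply: mule_ge0; first by rewrite lee_fin.
by apply: lin_ge0 => // ? ?; exact: gd0.
Qed.
Let mQ4 : measurable_fun setT Q4.
Proof.
rewrite /Q4 /mom; mfun => //.
by move=> x y; rewrite lee_fin mulr_ge0 ?powR_ge0//; exact: S0.
Qed.
Let mb : measurable_fun setT b. Proof. by rewrite /b; mfun. Qed.
Let mba : measurable_fun setT (fun x => beyond L x * a x).
Proof. by have mbe := @beyond_measurable R L; mfun. Qed.
Let mtail : measurable_fun setT tail.
Proof.
have mbe := @beyond_measurable R L; rewrite /tail /mom; mfun => //.
by move=> x y; rewrite lee_fin mulr_ge0//; exact: S0.
Qed.
Let merr : measurable_fun setT err.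
Proof.
rewrite /err /bil /lin /flip /mom; mfun => //.
- by move=> x y; rewrite lee_fin mulr_ge0// mulr_ge0//; exact: p0.
- move=> x y; apply: integral_ge0 => z _; rewrite lee_fin mulr_ge0// mulr_ge0//; exact: p0.
- by move=> x y; rewrite lee_fin mulr_ge0//; exact: gd0.
- move=> x y; apply: mule_ge0; first by rewrite lee_fin; exact: p0.
  by apply: integral_ge0 => z _; rewrite lee_fin mulr_ge0//; exact: gd0.
- by move=> x y; rewrite lee_fin mulr_ge0//; exact: p0.
Qed.
Let Y0 s : (0 <= Y s)%E. Proof. by apply: mom_ge0 => // x; exact: normr_ge0. Qed.
Let mY : measurable_fun setT Y.
Proof. by rewrite /Y /mom; mfun => //; move=> x y; rewrite lee_fin mulr_ge0. Qed.
Let mYb : measurable_fun setT (fun s => Y s * b s)%E. Proof. by mfun. Qed.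
Let extra0 s : (0 <= extra s)%E.
Proof.
apply: adde_ge0; last by apply: mule_ge0; rewrite ?lee_fin.
apply: adde_ge0; last by rewrite lee_fin.
apply: adde_ge0; last by apply: mule_ge0; rewrite ?lee_fin.
by apply: adde_ge0; apply: mule_ge0; rewrite ?lee_fin.
Qed.
Let mextra : measurable_fun setT extra. Proof. by rewrite /extra; mfun. Qed.

Let itv_const (c : R) : (\int[mu]_(s in `]0%R, T]) c%:E = (c * T)%:E)%E.
Proof.
rewrite integral_cst//= lebesgue_measure_itv/= lte_fin.
by case: ltgtP T_ge0 => // [_|<-] _; rewrite ?oppr0 ?adde0 ?mule0 ?mulr0// -EFinM.
Qed.

Let int_extra : (\int[mu]_(s in `]0%R, T]) extra s <= A0%:E)%E.
Proof.
have m1 : measurable_fun setT (fun s => rho%:E * b s)%E by mfun.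
have m2 : measurable_fun setT (fun s => (B * Kh * (D * W))%:E * Q4 s)%E by mfun.
have m3 : measurable_fun setT (fun s => (N * (1 + L))%:E * tail s)%E by mfun.
have m4 : measurable_fun setT (fun _ : R => c0%:E) by exact: measurable_cst.
have m5 : measurable_fun setT (fun s => (1 + L)%:E * err s)%E by mfun.
have n1 s : (0 <= rho%:E * b s)%E by apply: mule_ge0; rewrite ?lee_fin.
have n2 s : (0 <= (B * Kh * (D * W))%:E * Q4 s)%E by apply: mule_ge0; rewrite ?lee_fin.
have n3 s : (0 <= (N * (1 + L))%:E * tail s)%E by apply: mule_ge0; rewrite ?lee_fin.
have n4 (s : R) : (0 <= c0%:E)%E by rewrite lee_fin.
have n5 s : (0 <= (1 + L)%:E * err s)%E by apply: mule_ge0; rewrite ?lee_fin.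
have m12 := emeasurable_funD m1 m2; have n12 s := adde_ge0 (n1 s) (n2 s).
have m123 := emeasurable_funD m12 m3; have n123 s := adde_ge0 (n12 s) (n3 s).
have m1234 := emeasurable_funD m123 m4; have n1234 s := adde_ge0 (n123 s) (n4 s).
have mT := measurable_itv `]0, T].
rewrite (ge0_integralDT mT m1234 m5 n1234 n5) (ge0_integralDT mT m123 m4 n123 n4).
rewrite (ge0_integralDT mT m12 m3 n12 n3) (ge0_integralDT mT m1 m2 n1 n2).
rewrite (ge0_integralZlT mT rho_ge0 mb b0) (ge0_integralZlT mT BD0 mQ4 Q40).
rewrite (ge0_integralZlT mT NL0 mtail tail0) (ge0_integralZlT mT L1_ge0 merr err0) itv_const.
rewrite /A0 !EFinD; apply: leeD; last by rewrite EFinM; apply: lee_wpmul2l; rewrite ?lee_fin.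
apply: leeD; last exact: lexx.
apply: leeD; last by rewrite (EFinM _ tau); apply: lee_wpmul2l; rewrite ?lee_fin.
apply: leeD; first by rewrite (EFinM rho); apply: lee_wpmul2l; rewrite ?lee_fin.
by rewrite (EFinM _ Qc); apply: lee_wpmul2l; rewrite ?lee_fin.
Qed.

Let mID : measurable_fun setT (fun s => I (damping s)).
Proof.
have md := damping_measurable; rewrite /I; mfun => //.
by move=> x y; apply: mule_ge0; [rewrite lee_fin|exact: damping_ge0].
Qed.
Let ID0 s : (0 <= I (damping s))%E.
Proof.
by apply: integral_ge0 => x _; apply: mule_ge0; [rewrite lee_fin|exact: damping_ge0].
Qed.
Let mIG : measurable_fun setT (fun s => I (growth s)).
Proof.
have md := growth_measurable; rewrite /I; mfun => //.
by move=> x y; apply: mule_ge0; [rewrite lee_fin|exact: growth_ge0].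
Qed.
Let IG0 s : (0 <= I (growth s))%E.
Proof.
by apply: integral_ge0 => x _; apply: mule_ge0; [rewrite lee_fin|exact: growth_ge0].
Qed.

Lemma integral_damping_le s : 0 <= s <= T ->
  (I (damping s) <= (B * ((1 + L) * Kh * (W * W)) + (1 + L) * A * W)%:E)%E.
Proof.
move=> sT; rewrite integral_damping.
have mSs : measurable_fun setT (total s) by mfun.
have mGs : measurable_fun setT (gap s) by mfun.
have Ss0 : nonneg1 (total s) by exact: S0.
have Gs0 : nonneg1 (gap s) by exact: G0.
have LK0 : 0 <= (1 + L) * Kh by exact: mulr_ge0.
have LA0 : 0 <= (1 + L) * A by exact: mulr_ge0.
have momG : (mom (fun x => 1 + pos x)%R (gap s) <= W%:E)%E.
  apply: (@le_trans _ _ (mom (fun x => 1 + pos x)%R (total s))); last exact: mom_total_le.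
  by apply: (mom_le mp1 mGs mp1 mSs p1_ge0 Gs0) => x; apply: ler_wpM2l => //; exact: gap_le_total.
have kle x y : wk x y <= (1 + L) * Kh * ((1 + pos x) * (1 + pos y)).
  by rewrite /wk -mulrA; apply: ler_pM.
rewrite EFinD; apply: leeD.
  rewrite (EFinM B); apply: lee_pmul; [by rewrite lee_fin divr_ge0|exact: bil_ge0| |].
    by rewrite lee_fin; apply: le_trans (uB s); rewrite ler_pdivrMr// ler_peMr// ler1n.
  apply: le_trans (bil_le_mom LK0 mwk mp1 mp1 mGs mSs wk0 p1_ge0 p1_ge0 Gs0 Ss0 kle) _.
  rewrite (EFinM _ (W * W)); apply: lee_wpmul2l; first by rewrite lee_fin.
  rewrite (EFinM W); apply: lee_pmul; [exact: mom_ge0|exact: mom_ge0|exact: momG|].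
  exact: mom_total_le.
have mwa : measurable_fun setT (fun x => w x * a x) by mfun.
have wa0 : nonneg1 (fun x => w x * a x) by move=> x; exact: mulr_ge0.
have mc : measurable_fun setT (fun x => (1 + L) * A * (1 + pos x)) by mfun.
apply: (@le_trans _ _ (mom (fun x => (1 + L) * A * (1 + pos x))%R (gap s))).
  apply: (mom_le mwa mGs mc mGs wa0 Gs0) => x; apply: ler_wpM2r => //.
  by rewrite -mulrA; apply: ler_pM.
by rewrite (momZ LA0 mp1 mGs p1_ge0 Gs0) (EFinM _ W); apply: lee_wpmul2l; rewrite ?lee_fin.
Qed.

Lemma weighted_gap_integral_le (t : R) : 0 <= t <= T ->
  (Y t <= A0%:E + \int[mu]_(s in `]0%R, t]) (Y s * b s))%E.
Proof.
move=> tT; have /andP[t0' tT'] := tT; have mt := measurable_itv `]0, t].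
have mh : measurable_fun setT (fun x => `|f t x - p t x - r t x|) by mfun.
have h0 : nonneg1 (fun x => `|f t x - p t x - r t x|) by move=> x; exact: normr_ge0.
have mz : measurable_fun (@setT R) (fun=> 0 : R) by mfun.
have z0 : nonneg1 (fun=> 0 : R) by move=> x.
have H : {ae mu, forall x, (`|f t x - p t x - r t x|%:E + \int[mu]_(s in `]0%R, t]) damping s x <=
    (0 : R)%:E + \int[mu]_(s in `]0%R, t]) growth s x)%E}.
  by apply: aeS gap_balance => x /(_ t tT); rewrite add0e.
have := integrate_balance mt mw mh mz w0 h0 z0 damping_measurable growth_measurable
  damping_ge0 growth_ge0 H.
have -> : mom w (fun=> 0) = 0%E by apply: integral0_eq => x _; rewrite mulr0.
have small s : `]0, t]%classic s -> 0 <= s <= T.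
  by rewrite /= in_itv/= => /andP[s0 st]; rewrite (ltW s0) (le_trans st).
have up : (\int[mu]_(s in `]0%R, t]) I (growth s) <= \int[mu]_(s in `]0%R, t]) I (damping s) +
    (\int[mu]_(s in `]0%R, t]) (Y s * b s) + A0%:E))%E.
  have YE0 s : (0 <= Y s * b s + extra s)%E by apply: adde_ge0 => //; exact: mule_ge0.
  have mYE := emeasurable_funD mYb mextra.
  have Yb0 s : (0 <= Y s * b s)%E by exact: mule_ge0.
  have split3 : (\int[mu]_(s in `]0%R, t]) (I (damping s) + (Y s * b s + extra s)) =
      \int[mu]_(s in `]0%R, t]) I (damping s) + (\int[mu]_(s in `]0%R, t]) (Y s * b s) +
      \int[mu]_(s in `]0%R, t]) extra s))%E.
    by rewrite (ge0_integralDT mt mID mYE ID0 YE0) (ge0_integralDT mt mYb mextra Yb0 extra0).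
  have ext : (\int[mu]_(s in `]0%R, t]) extra s <= A0%:E)%E.
    by apply: le_trans int_extra; exact: ge0_integral_oc_mono.
  apply: (@le_trans _ _ (\int[mu]_(s in `]0%R, t]) (I (damping s) + (Y s * b s + extra s)))%E).
    apply: (ge0_le_integralT mt mIG _ IG0); first exact: emeasurable_funD mID mYE.
    move=> s /small sT; apply: le_trans (integral_growth_le s) _; apply: leeD2l.
    exact: growth_excess_le rho_ge0 (r_le sT).
  by rewrite split3; apply: leeD2l; exact: leeD2l.
(* The damping occurs on both sides of the balance and cancels because the truncated weight makes it
   finite. *)
have Ifin : (\int[mu]_(s in `]0%R, t]) I (damping s))%E \is a fin_num.
  rewrite ge0_fin_numE; last by apply: integral_ge0 => s _; exact: ID0.
  apply: le_lt_trans (const_fin (B * ((1 + L) * Kh * (W * W)) + (1 + L) * A * W)).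
  apply: (@le_trans _ _ (\int[mu]_(s in `]0%R, T]) I (damping s))%E).
    exact: ge0_integral_oc_mono.
  apply: (ge0_le_integralT (measurable_itv `]0, T]) mID (measurable_cst _) ID0).
  by move=> s; rewrite /= in_itv/= => /andP[s0 sT]; apply: integral_damping_le; rewrite ltW.
move=> /le_trans /(_ (leeD2l _ up)) /(lee_cancel Ifin).
by rewrite add0e addeC.
Qed.

Theorem stability (t : R) : 0 <= t <= T -> (mom (fun=> 1%R) (gap t) <= (2 ^+ n * A0 + rho)%:E)%E.
Proof.
move=> tT.
have A00 : 0 <= A0.
  rewrite /A0; apply: addr_ge0; last exact: mulr_ge0.
  apply: addr_ge0; last exact: mulr_ge0.
  apply: addr_ge0; last exact: mulr_ge0.
  by apply: addr_ge0; apply: mulr_ge0 => //; exact: divr_ge0.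
(* The a priori bound that [gronwall_half] asks for; it does not enter its conclusion. *)
have YC (s : R) : (0 <= s <= T)%R -> (Y s <= (W + rho)%:E)%E.
  move=> sT; have mSs : measurable_fun setT (total s) by mfun.
  have mrs : measurable_fun setT (fun x => `|r s x|) by mfun.
  have mh : measurable_fun setT (fun x => `|f s x - p s x - r s x|) by mfun.
  have h0 : nonneg1 (fun x => `|f s x - p s x - r s x|) by move=> x; exact: normr_ge0.
  have r0 : nonneg1 (fun x => `|r s x|) by move=> x; exact: normr_ge0.
  have mSr : measurable_fun setT (fun x => total s x + `|r s x|) by mfun.
  apply: (@le_trans _ _ (mom (fun x => 1 + pos x)%R (fun x => total s x + `|r s x|)%R)).
    apply: (mom_le mw mh mp1 mSr w0 h0) => x; apply: ler_pM => //.
    apply: le_trans (ler_normB _ _) _; rewrite lerD2r; exact: gap_le_total.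
  rewrite (momDr mp1 mSs mrs p1_ge0 (S0 s) r0) EFinD; apply: leeD; last exact: r_le.
  exact: mom_total_le.
have Wr0 : 0 <= W + rho by exact: addr_ge0.
have bt : (\int[mu]_(s in `]0%R, t]) b s <= (n%:R / 2)%:E)%E.
  by apply: le_trans int_b; apply: ge0_integral_oc_mono => //; have /andP[] := tT.
have Yt := gronwall_half A00 Wr0 mY mb Y0 b0 YC weighted_gap_integral_le tT bt.
have mGt : measurable_fun setT (gap t) by mfun.
have mone : measurable_fun (@setT R) (fun=> 1 : R) by mfun.
have one0 : nonneg1 (fun=> 1 : R) by move=> x; exact: ler01.
apply: (@le_trans _ _ (mom w (gap t))).
  by apply: (mom_le mone mGt mw mGt one0 (G0 t)) => x; apply: ler_wpM2r => //; exact: G0.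
apply: le_trans (mom_gap_le (r_le tT)) _.
by rewrite EFinD; apply: leeD2r.
Qed.

End Weighted.

End Pair.

(** * Weakly converging controls *)

Section UniformInTime.
Context {R : realType}.

(** The modulus of continuity [Phi] is common to all n; pointwise smallness at [s] spreads to a
    neighbourhood of [s], and [0, T] is compact. *)
Lemma uniform_in_time (T : R) (rho : nat -> R -> R) (Phi : R -> R) :
  {within `[0, T], continuous Phi} ->
  (forall t : R, 0 <= t <= T -> rho n t @[n --> \oo] --> 0) ->
  (forall n s t, 0 <= s <= T -> 0 <= t <= T -> rho n t <= rho n s + `|Phi t - Phi s|) ->
  forall e : R, 0 < e -> \forall n \near \oo, forall t : R, 0 <= t <= T -> rho n t <= e.
Proof.
move=> /within_itv_continuousP cPhi rho0 rhole e e0.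
have e2 : 0 < e / 2 by rewrite divr_gt0.
have cK : compact (`[0, T]%classic : set R) by exact: segment_compact.
have /compact_near_coveringP := cK => /(_ nat \oo (fun n t => 0 <= t <= T -> rho n t <= e)).
move=> cov; suff : \forall n \near \oo, (`[0, T] `<=` (fun t => 0 <= t <= T -> rho n t <= e)).
  by apply: filterS => n H t tT; apply: (H t) => //; rewrite /= in_itv.
apply: cov => s; rewrite /= in_itv/= => sT.
have [d d0 Hd] := cPhi s _ sT e2.
have /cvgrPdist_le/(_ _ e2) H := rho0 s sT.
exists ([set t | `|t - s| < d], [set n | rho n s <= e / 2]).
  split => /=.
    by exists d => //= t; rewrite /ball/= distrC.
  near=> n; have : `|0 - rho n s| <= e / 2 by near: n.
  by rewrite sub0r normrN; apply: le_trans; exact: ler_norm.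
move=> [t n] /= [ts rs] tT; apply: le_trans (rhole n s t sT tT) _.
rewrite [e]splitr; apply: lerD => //.
by apply: ltW; exact: Hd.
Unshelve. all: by end_near. Qed.


End UniformInTime.

Section WeakConvergence.
Context {R : realType}.
Local Notation mu := (@lebesgue_measure R).
Variables (T B : R) (u : nat -> R -> R) (us : R -> R).
Hypothesis mu_ : forall n, measurable_fun setT (u n).
Hypothesis u0 : forall n, nonneg1 (u n).
Hypothesis uB : forall n t, u n t <= B.
Hypothesis mus : measurable_fun setT us.
Hypothesis us0 : nonneg1 us.
Hypothesis usB : forall t, us t <= B.

(** Bounded test functions are in L^2 on the bounded interval; [weak_cvg_integrable] passes from
    them to integrable ones, the controls being uniformly bounded. *)
Definition weakly_cvg_bounded := forall k : R -> R, measurable_fun setT k ->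
  (exists c : R, forall t, `|k t| <= c) ->
  \int[mu]_(t in `]0, T]) (u n t * k t) @[n --> \oo] --> \int[mu]_(t in `]0, T]) (us t * k t).

Hypothesis weak : weakly_cvg_bounded.

Let B0 : 0 <= B. Proof. exact: le_trans (u0 0%N 0) (uB 0%N 0). Qed.

Let scaled_int (v k : R -> R) : measurable_fun setT v -> nonneg1 v -> (forall t, v t <= B) ->
  measurable_fun setT k -> mu.-integrable `]0, T] (EFin \o k) ->
  mu.-integrable `]0, T] (EFin \o (fun t => v t * k t)) /\
  `|\int[mu]_(t in `]0, T]) (v t * k t)| <= B * \int[mu]_(t in `]0, T]) `|k t|.
Proof.
move=> mv v0 vB mk ik.
have ivk : mu.-integrable `]0, T] (EFin \o (fun t => v t * k t)).
  apply: (@integrable_le_scale _ _ k _ B) => //.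
    by apply: (@measurable_funS _ _ _ _ setT) => //; mfun.
  by move=> s _; rewrite normrM ler_wpM2r// ger0_norm.
have ink : mu.-integrable `]0, T] (EFin \o (fun t => `|k t|)).
  apply: (@integrable_le_scale _ _ k _ 1) => //.
    by apply: (@measurable_funS _ _ _ _ setT) => //; mfun.
  by move=> s _; rewrite normr_id mul1r.
have iBk : mu.-integrable `]0, T] (EFin \o (fun t => B * `|k t|)).
  apply: (@integrable_le_scale _ _ k _ B) => //.
    by apply: (@measurable_funS _ _ _ _ setT) => //; mfun.
  by move=> s _; rewrite normrM normr_id (ger0_norm B0).
split => //; rewrite -(@RintegralZl _ _ _ mu)//.
apply: le_trans (@le_normr_Rintegral _ _ _ mu _ _ (measurable_itv _) ivk) _.
apply: (@le_Rintegral _ _ _ mu) => //.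
  apply: (@integrable_le_scale _ _ k _ B) => //.
    by apply: (@measurable_funS _ _ _ _ setT) => //; mfun.
  by move=> s _; rewrite normr_id normrM ler_wpM2r// ger0_norm.
by move=> s _; rewrite normrM ler_wpM2r// ger0_norm.
Qed.

(** The test function is cut where its absolute value exceeds j. What is cut off has small integral,
    uniformly against controls bounded by [B], and the rest is bounded. *)
Lemma weak_cvg_integrable (k : R -> R) : measurable_fun setT k ->
  mu.-integrable `]0, T] (EFin \o k) ->
  \int[mu]_(t in `]0, T]) (u n t * k t) @[n --> \oo] --> \int[mu]_(t in `]0, T]) (us t * k t).
Proof.
move=> mk ik.
pose kb (j : nat) t := k t * \1_[set x | `|x| <= j%:R] (k t).
pose kr (j : nat) t := k t - kb j t.
have mset (j : nat) : measurable [set x : R | `|x| <= j%:R].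
  rewrite [X in measurable X](_ : _ = `[- j%:R, j%:R]%classic)//.
  by apply/seteqP; split => x /=; rewrite in_itv/= ler_norml.
have mkb j : measurable_fun setT (kb j) by rewrite /kb; mfun.
have mkr j : measurable_fun setT (kr j) by rewrite /kr; mfun.
have kbB j t : `|kb j t| <= j%:R.
  rewrite /kb indicE; case: (boolP (k t \in _)) => [|_]; last by rewrite mulr0 normr0.
  by rewrite inE/= mulr1.
have krk j t : `|kr j t| <= `|k t|.
  rewrite /kr /kb indicE; case: (k t \in _); last by rewrite mulr0 subr0.
  by rewrite mulr1 subrr normr0.
have ikr j : mu.-integrable `]0, T] (EFin \o kr j).
  apply: (@integrable_le_scale _ _ k _ 1) => //; first exact: measurable_funS (mkr j).
  by move=> s _; rewrite mul1r.
have ikb j : mu.-integrable `]0, T] (EFin \o kb j).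
  apply: (@integrable_le_scale _ _ k _ 1) => //; first exact: measurable_funS (mkb j).
  move=> s _; rewrite mul1r /kb normrM ler_piMr// indicE.
  by case: (k s \in _); rewrite ?normr1 ?normr0.
have small : (\int[mu]_(t in `]0%R, T]) (`|kr j t|)%:E)%E @[j --> \oo] --> 0%E.
  have mnk : measurable_fun setT (fun t => (`|k t|)%:E) by mfun.
  have mnkr j : measurable_fun setT (fun t => (`|kr j t|)%:E).
    by have := mkr j => ?; mfun.
  apply: (dominated_cvg0 (measurable_itv _) mnkr mnk) => //.
  - by move=> j t; rewrite lee_fin.
  - by have /integrableP[_] := ik.
  apply: aeW => t _; apply: cvg_near_cst; near=> j.
  rewrite /kr /kb indicE mem_set ?mulr1 ?subrr ?normr0//=.
  by near: j; apply: nbhs_infty_ger.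
apply/cvgrPdist_le => e e0.
have B1 : 0 < B + 1 by exact: ltr_wpDl.
have e3 : 0 < e / 3 / (B + 1) by rewrite !divr_gt0.
have [j Hj] : exists j, \int[mu]_(t in `]0, T]) `|kr j t| <= e / 3 / (B + 1).
  have /fine_cvgP[_ /cvgrPdist_le/(_ _ e3)[j _ H]] := small.
  exists j; have := H j (leqnn j); rewrite /= sub0r normrN.
  by apply: le_trans; exact: ler_norm.
have Bsmall : B * \int[mu]_(t in `]0, T]) `|kr j t| <= e / 3.
  have I0 : 0 <= \int[mu]_(t in `]0, T]) `|kr j t| by apply: Rintegral_ge0.
  apply: (@le_trans _ _ ((B + 1) * (e / 3 / (B + 1)))).
    by apply: ler_pM => //; rewrite lerDl.
  by rewrite mulrC divfK// gt_eqF.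
have split_int (v : R -> R) : measurable_fun setT v -> nonneg1 v -> (forall t, v t <= B) ->
    \int[mu]_(t in `]0, T]) (v t * k t) =
    \int[mu]_(t in `]0, T]) (v t * kb j t) + \int[mu]_(t in `]0, T]) (v t * kr j t).
  move=> mv v0 vB; have [i1 _] := scaled_int mv v0 vB (mkb j) (ikb j).
  have [i2 _] := scaled_int mv v0 vB (mkr j) (ikr j).
  rewrite -(@RintegralD _ _ _ mu)//; apply: eq_Rintegral => t _.
  by rewrite -mulrDr /kr addrC subrK.
have rest (v : R -> R) : measurable_fun setT v -> nonneg1 v -> (forall t, v t <= B) ->
    `|\int[mu]_(t in `]0, T]) (v t * kr j t)| <= e / 3.
  move=> mv v0 vB; have [_ H] := scaled_int mv v0 vB (mkr j) (ikr j).
  exact: le_trans H Bsmall.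
have /cvgrPdist_le H : \int[mu]_(t in `]0, T]) (u n t * kb j t) @[n --> \oo] -->
    \int[mu]_(t in `]0, T]) (us t * kb j t).
  by apply: weak => //; exists j%:R.
have e30 : 0 < e / 3 by rewrite divr_gt0.
near=> n.
have Hn : `|\int[mu]_(t in `]0, T]) (us t * kb j t) - \int[mu]_(t in `]0, T]) (u n t * kb j t)| <= e / 3.
  by near: n; exact: H e30.
rewrite (split_int _ (mu_ n) (u0 n) (uB n)) (split_int _ mus us0 usB).
have Ru := rest _ (mu_ n) (u0 n) (uB n); have Rs := rest _ mus us0 usB.
move: Hn Ru Rs; rewrite !ler_norml.
move: (\int[mu]_(t in `]0, T]) _) => x1; move: (\int[mu]_(t in `]0, T]) _) => x2.
move: (\int[mu]_(t in `]0, T]) _) => x3; move: (\int[mu]_(t in `]0, T]) _) => x4.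
by move=> /andP[? ?] /andP[? ?] /andP[? ?]; apply/andP; split; lra.
Unshelve. all: by end_near. Qed.

Lemma weak_cvg_initial (k : R -> R) (t : R) : 0 <= t <= T -> measurable_fun setT k ->
  mu.-integrable `]0, T] (EFin \o k) ->
  \int[mu]_(s in `]0, t]) ((u n s - us s) * k s) @[n --> \oo] --> 0.
Proof.
move=> /andP[t0 tT] mk ik; pose kt s := k s * \1_`]0, t] s.
have mkt : measurable_fun setT kt by rewrite /kt; mfun.
have ikt : mu.-integrable `]0, T] (EFin \o kt).
  apply: (@integrable_le_scale _ _ k _ 1) => //; first exact: measurable_funS mkt.
  move=> s _; rewrite mul1r /kt normrM ler_piMr// indicE.
  by case: (s \in _); rewrite ?normr1 ?normr0.
have E n : \int[mu]_(s in `]0, t]) ((u n s - us s) * k s) =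
    \int[mu]_(s in `]0, T]) (u n s * kt s) - \int[mu]_(s in `]0, T]) (us s * kt s).
  have [i1 _] := scaled_int (mu_ n) (u0 n) (uB n) mkt ikt.
  have [i2 _] := scaled_int mus us0 usB mkt ikt.
  rewrite -(@RintegralB _ _ _ mu)//.
  have -> : `]0, t]%classic = `]0, T]%classic `&` `]0, t]%classic :> set R.
    by rewrite setIidr//; apply: subset_itvl; rewrite bnd_simp.
  rewrite Rintegral_mkcondr; apply: eq_Rintegral => s _.
  by rewrite /kt patchE indicE; case: (s \in _); rewrite ?mulr1 ?mulr0 ?subrr// mulrBl.
rewrite (_ : (fun n => _) = (fun n => \int[mu]_(s in `]0, T]) (u n s * kt s) -
    \int[mu]_(s in `]0, T]) (us s * kt s))); last by apply/funext => n; exact: E.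
rewrite -[X in _ --> X](subrr (\int[mu]_(s in `]0, T]) (us s * kt s))).
by apply: cvgB; [exact: weak_cvg_integrable|exact: cvg_cst].
Qed.

End WeakConvergence.

Lemma half_sum_le {R : realType} (x b1 b2 c : \bar R) : (x <= b1 + b2)%E ->
  (b1 <= c)%E -> (b2 <= c)%E -> ((2^-1)%:E * x + b1 <= c + c)%E.
Proof.
move=> xb b1c b2c; apply: leeD => //.
apply: (@le_trans _ _ ((2^-1)%:E * (2%:E * c))%E).
  apply: lee_wpmul2l; first by rewrite lee_fin invr_ge0.
  by apply: le_trans xb _; rewrite mule_natl mule2n; apply: leeD.
by rewrite muleA -EFinM mulVf// mul1e.
Qed.

Lemma adde0_le {R : realType} (a b : \bar R) : (a + 0 <= b)%E -> (a <= b)%E.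
Proof. by rewrite adde0. Qed.

Section RemainderConvergence.
Context {R : realType}.
Local Notation mu := (@lebesgue_measure R).
Variables (T B W Kh muh Q : R) (k p : R -> R -> R) (u : nat -> R -> R) (us : R -> R).
Hypotheses (T_ge0 : 0 <= T) (W_ge0 : 0 <= W) (Kh_ge0 : 0 <= Kh).
Hypotheses (muh_le1 : muh <= 1).
Hypotheses (mk : jointly_measurable k) (k0 : nonneg2 k).
Hypotheses (mp : jointly_measurable p) (p0 : nonneg2 p).
Hypothesis k_le : forall x y, k x y <= Kh * ((1 + pos x) `^ muh * (1 + pos y) `^ muh).
Hypothesis p_mom : forall s : R, 0 <= s <= T -> (mom (fun x => 1 + pos x)%R (p s) <= W%:E)%E.
Hypothesis p_high : (\int[mu]_(s in `]0%R, T]) mom (fun x => (1 + pos x) `^ (1 + muh))%R (p s) <= Q%:E)%E.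
Hypothesis mu_ : forall n, measurable_fun setT (u n).
Hypothesis u0 : forall n, nonneg1 (u n).
Hypothesis uB : forall n t, u n t <= B.
Hypothesis mus : measurable_fun setT us.
Hypothesis us0 : nonneg1 us.
Hypothesis usB : forall t, us t <= B.

Let B0 : 0 <= B. Proof. exact: le_trans (u0 0%N 0) (uB 0%N 0). Qed.
Let q (x : R) := (1 + pos x) `^ muh.
Let mpos := @measurable_pos R.
Let mp1 : measurable_fun setT (fun x => 1 + pos x : R). Proof. by mfun. Qed.
Let p10 : nonneg1 (fun x => 1 + pos x : R).
Proof. by move=> x; rewrite addr_ge0 ?pos_ge0. Qed.
Let mq : measurable_fun setT q. Proof. by rewrite /q; mfun. Qed.
Let q0 : nonneg1 q. Proof. by move=> x; exact: powR_ge0. Qed.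
Let q_le x : q x <= 1 + pos x. Proof. by apply: powR1D_le => //; exact: pos_ge0. Qed.
Let q4 (x : R) := (1 + pos x) `^ (1 + muh).
Let mq4 : measurable_fun setT q4. Proof. by rewrite /q4; mfun. Qed.
Let q40 : nonneg1 q4. Proof. by move=> x; exact: powR_ge0. Qed.
Let q4E x : q4 x = (1 + pos x) * q x.
Proof.
rewrite /q4 powRD ?powRr1 ?p10//.
by apply/implyP => _; rewrite gt_eqF// ltr_wpDr// pos_ge0.
Qed.

Let X s x : \bar R := ((2^-1)%:E * conv k (p s) (p s) x)%E.
Let Y s x : \bar R := ((p s x)%:E * lin k (p s) x)%E.
Let XY s x : \bar R := (X s x + Y s x)%E.

Let ps0 s : nonneg1 (p s). Proof. exact: p0. Qed.
Let mps s : measurable_fun setT (p s). Proof. by mfun. Qed.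
Let X0 s x : (0 <= X s x)%E.
Proof. by apply: mule_ge0; [rewrite lee_fin invr_ge0|exact: conv_ge0]. Qed.
Let Y0 s x : (0 <= Y s x)%E.
Proof. by apply: mule_ge0; [rewrite lee_fin; exact: p0|exact: lin_ge0]. Qed.
Let XY0 s x : (0 <= XY s x)%E. Proof. exact: adde_ge0. Qed.
Let mX : measurable_fun setT (fun z : R * R => X z.1 z.2).
Proof.
by rewrite /X /conv; mfun => //; move=> z y; rewrite lee_fin !mulr_ge0//; exact: p0.
Qed.
Let mY : measurable_fun setT (fun z : R * R => Y z.1 z.2).
Proof.
by rewrite /Y /lin; mfun => //; move=> z y; rewrite lee_fin !mulr_ge0//; exact: p0.
Qed.
Let mXY : measurable_fun setT (fun z : R * R => XY z.1 z.2).
Proof. by rewrite /XY; mfun. Qed.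

Let partsE (c d : R -> R) s x : coag_parts k p c d s x = ((c s)%:E * X s x + (d s)%:E * Y s x)%E.
Proof. by rewrite /coag_parts /X /Y !muleA -!EFinM. Qed.

Let parts_le (c d : R -> R) s x : (forall t, c t <= B) -> (forall t, d t <= B) ->
  (coag_parts k p c d s x <= B%:E * XY s x)%E.
Proof.
move=> cB dB; rewrite partsE ge0_muleDr//.
by apply: leeD; apply: lee_wpmul2r => //; rewrite lee_fin.
Qed.

(** The weight 1 + x + y is split between the two partners; the partner that receives it carries the
    moment of order 1 + muh, the other one at most the first moment. *)
Lemma moment_coag_le s : 0 <= s <= T ->
  (\int[mu]_x ((1 + pos x)%:E * XY s x) <= (2 * Kh * W)%:E * mom q4 (p s))%E.
Proof.
move=> sT.
have mc := conv_measurable mk (mps s) (mps s) k0 (ps0 s) (ps0 s).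
have ml := lin_measurable mk (mps s) k0 (ps0 s).
have c0 x : (0 <= conv k (p s) (p s) x)%E by exact: conv_ge0.
have mXs : measurable_fun setT (fun x => (1 + pos x)%:E * X s x)%E by rewrite /X; mfun.
have mYs : measurable_fun setT (fun x => (1 + pos x)%:E * Y s x)%E by rewrite /Y; mfun.
have X1 x : (0 <= (1 + pos x)%:E * X s x)%E by apply: mule_ge0 => //; rewrite lee_fin; exact: p10.
have Y1 x : (0 <= (1 + pos x)%:E * Y s x)%E by apply: mule_ge0 => //; rewrite lee_fin; exact: p10.
have -> : (\int[mu]_x ((1 + pos x)%:E * XY s x) =
    \int[mu]_x ((1 + pos x)%:E * X s x) + \int[mu]_x ((1 + pos x)%:E * Y s x))%E.
  rewrite -(ge0_integralDT measurableT mXs mYs X1 Y1).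
  by apply: eq_integral => x _; rewrite /XY ge0_muleDr.
have qW : (mom q (p s) <= W%:E)%E.
  apply: le_trans (p_mom sT); apply: (mom_le mq (mps s) mp1 (mps s) q0 (ps0 s)) => x.
  by apply: ler_wpM2r; [exact: ps0|exact: q_le].
pose k1 x y := (1 + pos x) * k x y; pose k2 x y := (1 + pos y) * k x y.
have mk1 : jointly_measurable k1 by rewrite /jointly_measurable /k1; mfun.
have mk2 : jointly_measurable k2 by rewrite /jointly_measurable /k2; mfun.
have k10 : nonneg2 k1 by move=> x y; apply: mulr_ge0; [exact: p10|exact: k0].
have k20 : nonneg2 k2 by move=> x y; apply: mulr_ge0; [exact: p10|exact: k0].
have k1le x y : k1 x y <= Kh * (q4 x * q y).
  rewrite /k1 q4E; have := ler_wpM2l (p10 x) (k_le x y); rewrite -/(q x) -/(q y).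
  by congr (_ <= _); ring.
have k2le x y : k2 x y <= Kh * (q x * q4 y).
  rewrite /k2 q4E; have := ler_wpM2l (p10 y) (k_le x y); rewrite -/(q x) -/(q y).
  by congr (_ <= _); ring.
have Q0 : (0 <= mom q4 (p s))%E by exact: mom_ge0.
have b1 : (bil k1 (p s) (p s) <= (Kh * W)%:E * mom q4 (p s))%E.
  apply: le_trans (bil_le_mom Kh_ge0 mk1 mq4 mq (mps s) (mps s) k10 q40 q0 (ps0 s) (ps0 s) k1le) _.
  rewrite EFinM -muleA (muleC W%:E); apply: lee_wpmul2l; first by rewrite lee_fin.
  exact: lee_wpmul2l.
have b2 : (bil k2 (p s) (p s) <= (Kh * W)%:E * mom q4 (p s))%E.
  apply: le_trans (bil_le_mom Kh_ge0 mk2 mq mq4 (mps s) (mps s) k20 q0 q40 (ps0 s) (ps0 s) k2le) _.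
  rewrite EFinM -muleA; apply: lee_wpmul2l; first by rewrite lee_fin.
  exact: lee_wpmul2r.
have H0 : 0 <= 2^-1 :> R by rewrite invr_ge0.
have E1 : (\int[mu]_x ((1 + pos x)%:E * X s x) =
    (2^-1)%:E * bil (fun x y => (1 + pos (x + y)) * k x y)%R (p s) (p s))%E.
  rewrite -(mom_conv mp1 mk (mps s) (mps s) p10 k0 (ps0 s) (ps0 s)).
  have m1 : measurable_fun setT (fun x => (1 + pos x)%:E * conv k (p s) (p s) x)%E by mfun.
  have n1 x : (0 <= (1 + pos x)%:E * conv k (p s) (p s) x)%E.
    by apply: mule_ge0 => //; rewrite lee_fin; exact: p10.
  rewrite -(ge0_integralZlT measurableT H0 m1 n1).
  by apply: eq_integral => x _; rewrite /X muleCA.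
have E2 : (\int[mu]_x ((1 + pos x)%:E * Y s x) = bil k1 (p s) (p s))%E.
  by rewrite (mom_lin mp1 mk (mps s) (mps s) p10 k0 (ps0 s) (ps0 s)).
have KW0 : 0 <= Kh * W by exact: mulr_ge0.
have b12 : (bil (fun x y => (1 + pos (x + y)) * k x y)%R (p s) (p s) <=
    bil k1 (p s) (p s) + bil k2 (p s) (p s))%E.
  rewrite -bilD//; apply: bil_le => //.
  - by rewrite /jointly_measurable; mfun.
  - by rewrite /jointly_measurable; mfun.
  - by move=> x y; apply: mulr_ge0; [exact: p10|exact: k0].
  - by move=> x y; apply: addr_ge0; [exact: k10|exact: k20].
  - move=> x y; apply: ler_wpM2r; first by apply: mulr_ge0; exact: ps0.
    rewrite /k1 /k2 -mulrDl; apply: ler_wpM2r; first exact: k0.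
    by have := pos_add x y; lra.
rewrite E1 E2; apply: le_trans (half_sum_le b12 b1 b2) _.
by rewrite -ge0_muleDl ?lee_fin// -EFinD -mulrA mulr2n mulrDl mul1r.
Qed.

Let mI : measurable_fun setT (fun s => \int[mu]_x ((1 + pos x)%:E * XY s x))%E.
Proof. by mfun => //; move=> s x; apply: mule_ge0 => //; rewrite lee_fin; exact: p10. Qed.
Let I0 s : (0 <= \int[mu]_x ((1 + pos x)%:E * XY s x))%E.
Proof. by apply: integral_ge0 => x _; apply: mule_ge0 => //; rewrite lee_fin; exact: p10. Qed.

Lemma moment_coag_fin :
  (\int[mu]_(s in `]0%R, T]) \int[mu]_x ((1 + pos x)%:E * XY s x) < +oo)%E.
Proof.
have KW0 : 0 <= 2 * Kh * W by apply: mulr_ge0 => //; exact: mulr_ge0.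
have mM : measurable_fun setT (fun s => mom q4 (p s)).
  by rewrite /mom; mfun => //; move=> s x; rewrite lee_fin mulr_ge0//; exact: p0.
have M0 s : (0 <= mom q4 (p s))%E by exact: mom_ge0.
apply: (@le_lt_trans _ _ ((2 * Kh * W)%:E * Q%:E)%E); last by rewrite -EFinM ltry.
apply: le_trans (lee_wpmul2l _ p_high); last by rewrite lee_fin.
rewrite -(ge0_integralZlT (measurable_itv `]0, T]) KW0 mM M0).
apply: (ge0_le_integralT (measurable_itv _) mI _ I0); first by mfun.
move=> s; rewrite /= in_itv/= => /andP[s0 sT]; apply: moment_coag_le.
by rewrite (ltW s0).
Qed.

Let H x : \bar R := (\int[mu]_(s in `]0%R, T]) XY s x)%E.

Lemma coag_integral_fin : {ae mu, forall x, (H x < +oo)%E}.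
Proof.
apply: (ae_fin_double_integral (measurable_itv _) mXY XY0).
apply: le_lt_trans moment_coag_fin.
have mJ : measurable_fun setT (fun s => \int[mu]_x XY s x)%E by mfun.
apply: (ge0_le_integralT (measurable_itv _) mJ mI).
  by move=> s; apply: integral_ge0 => x _.
move=> s _; have m1 : measurable_fun setT (fun x => XY s x) by mfun.
have m2 : measurable_fun setT (fun x => (1 + pos x)%:E * XY s x)%E by mfun.
apply: (ge0_le_integralT measurableT m1 m2 (fun x => XY0 s x)) => x _; rewrite -[X in (X <= _)%E]mul1e; apply: lee_wpmul2r => //.
by rewrite lee_fin lerDl pos_ge0.
Qed.

Let r n := remainder k p (u n) us.

Let slice (F : R -> R -> \bar R) x : measurable_fun setT (fun z : R * R => F z.1 z.2) ->
  measurable_fun setT (F^~ x).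
Proof. by move=> mF; exact: (@ejm_comp _ _ _ F id (fun=> x)). Qed.

Let mparts (c d : R -> R) x : measurable_fun setT c -> measurable_fun setT d ->
  measurable_fun setT (fun s => coag_parts k p c d s x).
Proof. by move=> mc md; apply: slice; apply: coag_parts_measurable. Qed.

Let parts_int_le (c d : R -> R) (s t x : R) : measurable_fun setT c -> measurable_fun setT d ->
  nonneg1 c -> nonneg1 d -> (forall t, c t <= B) -> (forall t, d t <= B) ->
  (\int[mu]_(z in `]s, t]) coag_parts k p c d z x <= B%:E * \int[mu]_(z in `]s, t]) XY z x)%E.
Proof.
move=> mc md c0 d0 cB dB; have mXYx := slice x mXY.
rewrite -(ge0_integralZlT (measurable_itv `]s, t]) B0 mXYx (XY0^~ x)).
apply: ge0_le_integralT => //; [exact: mparts|by mfun| |].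
- by move=> z; apply: coag_parts_ge0.
- by move=> z _; exact: parts_le.
Qed.

Lemma remainder_lip n (s t x : R) : 0 <= s -> s <= t -> t <= T -> (H x < +oo)%E ->
  (`|r n t x - r n s x|%:E <= (2 * B)%:E * \int[mu]_(z in `]s, t]) XY z x)%E.
Proof.
move=> s0 st tT Hx.
have mXYx := slice x mXY.
have fin_of (c d : R -> R) (a b : R) : measurable_fun setT c -> measurable_fun setT d ->
    nonneg1 c -> nonneg1 d -> (forall t, c t <= B) -> (forall t, d t <= B) ->
    0 <= a -> b <= T -> (\int[mu]_(z in `]a, b]) coag_parts k p c d z x)%E \is a fin_num.
  move=> mc md c0 d0 cB dB a0 bT; rewrite ge0_fin_numE; last first.
    by apply: integral_ge0 => z _; exact: coag_parts_ge0.
  apply: le_lt_trans (parts_int_le _ _ _ mc md c0 d0 cB dB) _.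
  apply: lte_mul_pinfty; [by rewrite lee_fin|by []|].
  by apply: le_lt_trans Hx; apply: ge0_integral_oc_mono => // z; exact: XY0.
have sT : s <= T by exact: le_trans tT.
have split_int (c d : R -> R) : measurable_fun setT c -> measurable_fun setT d ->
    nonneg1 c -> nonneg1 d ->
    (\int[mu]_(z in `]0%R, t]) coag_parts k p c d z x =
     \int[mu]_(z in `]0%R, s]) coag_parts k p c d z x +
     \int[mu]_(z in `]s, t]) coag_parts k p c d z x)%E.
  move=> mc md c0 d0; apply: integral_oc_split => //; first exact: mparts.
  by move=> z; exact: coag_parts_ge0.
have f1 := fin_of (u n) us 0 s (mu_ n) mus (u0 n) us0 (uB n) usB (lexx 0) sT.
have f2 := fin_of (u n) us s t (mu_ n) mus (u0 n) us0 (uB n) usB s0 tT.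
have f3 := fin_of us (u n) 0 s mus (mu_ n) us0 (u0 n) usB (uB n) (lexx 0) sT.
have f4 := fin_of us (u n) s t mus (mu_ n) us0 (u0 n) usB (uB n) s0 tT.
have g2 := parts_int_le s t x (mu_ n) mus (u0 n) us0 (uB n) usB.
have g4 := parts_int_le s t x mus (mu_ n) us0 (u0 n) usB (uB n).
have n2 : (0 <= \int[mu]_(z in `]s, t]) coag_parts k p (u n) us z x)%E.
  by apply: integral_ge0 => z _; exact: coag_parts_ge0.
have n4 : (0 <= \int[mu]_(z in `]s, t]) coag_parts k p us (u n) z x)%E.
  by apply: integral_ge0 => z _; exact: coag_parts_ge0.
rewrite /r /remainder (split_int _ _ (mu_ n) mus (u0 n) us0) (split_int _ _ mus (mu_ n) us0 (u0 n)).
rewrite EFinM -muleA; move: f1 f2 f3 f4 g2 g4 n2 n4.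
case: (integral _ _ _) => [x1| |] //; case: (integral _ _ _) => [x2| |] //.
case: (integral _ _ _) => [x3| |] //; case: (integral _ _ _) => [x4| |] //.
move=> _ _ _ _; move: (B%:E * _)%E => z g2 g4; rewrite !lee_fin => x20 x40.
apply: (@le_trans _ _ (x2 + x4)%:E).
  by rewrite -!EFinD /= lee_fin ler_norml; apply/andP; split; lra.
by rewrite mule_natl mule2n EFinD; exact: leeD.
Qed.

Let mr n : jointly_measurable (r n).
Proof. exact: (remainder_jm mk k0 mp p0 (mu_ n) mus (u0 n) us0). Qed.
Let V n t := mom (fun x => 1 + pos x)%R (fun x => `|r n t x|)%R.
Let J (s t : R) : \bar R :=
  (\int[mu]_(z in `]s, t]) ((2 * B)%:E * \int[mu]_x ((1 + pos x)%:E * XY z x)))%E.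

(** The disjunction yields the estimate in both time directions, so that the difference of [V] at
    two times is bounded by [J] in absolute value. *)
Let V_lip n (s t s' t' : R) : 0 <= s -> s <= t -> t <= T ->
  (s' = s /\ t' = t) \/ (s' = t /\ t' = s) -> (V n t' <= V n s' + J s t)%E.
Proof.
move=> s0 st tT st'; have B20 : 0 <= 2 * B by exact: mulr_ge0.
have mG : measurable_fun setT (fun z : R * R => ((2 * B)%:E * XY z.1 z.2)%E).
  by apply: emeasurable_funM => //; exact: measurable_cst.
have G0 z x : (0 <= (2 * B)%:E * XY z x)%E by apply: mule_ge0; rewrite ?lee_fin.
have mL : measurable_fun setT (fun z : R * R => (fun _ _ : R => 0%E : \bar R) z.1 z.2).
  exact: measurable_cst.
have mrn (z : R) : measurable_fun setT (fun x => `|r n z x|) by have := mr n => ?; mfun.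
have rn0 z : nonneg1 (fun x => `|r n z x|) by move=> x; exact: normr_ge0.
have A : {ae mu, forall x, (`|r n t' x|%:E + \int[mu]_(z in `]s, t]) (0%E : \bar R) <=
    `|r n s' x|%:E + \int[mu]_(z in `]s, t]) ((2 * B)%:E * XY z x))%E}.
  apply: aeS coag_integral_fin => x Hx; rewrite integral0 adde0.
  rewrite (ge0_integralZlT (measurable_itv _) B20 (slice x mXY) (XY0^~ x)).
  apply: le_trans (leeD2l _ (remainder_lip n s0 st tT Hx)).
  rewrite -EFinD lee_fin.
  have rr : `|r n t x - r n s x| = `|r n t' x - r n s' x|.
    by case: st' => -[-> ->] //; rewrite distrC.
  by rewrite rr -{1}(subrK (r n s' x) (r n t' x)) addrC ler_normD.
have JE : (\int[mu]_(z in `]s, t]) \int[mu]_x ((1 + pos x)%:E * ((2 * B)%:E * XY z x)) = J s t)%E.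
  apply: eq_integral => z _.
  have m1 : measurable_fun setT (fun x => (1 + pos x)%:E * XY z x)%E by mfun.
  have n1 x : (0 <= (1 + pos x)%:E * XY z x)%E.
    by apply: mule_ge0 => //; rewrite lee_fin; exact: p10.
  by rewrite -(ge0_integralZlT measurableT B20 m1 n1); apply: eq_integral => x _; rewrite muleCA.
have := integrate_balance (measurable_itv `]s, t]) mp1 (mrn t') (mrn s') p10 (rn0 t') (rn0 s')
  mL mG (fun _ _ => lexx 0%E) G0 A.
rewrite JE [X in (_ + X <= _)%E -> _]integral0_eq; last first.
  by move=> z _; apply: integral0_eq => x _; rewrite mule0.
exact: adde0_le.
Qed.

Let r_at0 n x : r n 0 x = 0.
Proof. by rewrite /r /remainder set_itvoc0 !integral_set0 subr0. Qed.

Let J_fin : (J 0 T < +oo)%E.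
Proof.
have B20 : 0 <= 2 * B by exact: mulr_ge0.
rewrite /J (ge0_integralZlT (measurable_itv _) B20 mI I0).
by apply: lte_mul_pinfty; [rewrite lee_fin|by []|exact: moment_coag_fin].
Qed.

Let mJ : measurable_fun setT (fun z => (2 * B)%:E * \int[mu]_x ((1 + pos x)%:E * XY z x))%E.
Proof. by mfun. Qed.
Let J0 z : (0 <= (2 * B)%:E * \int[mu]_x ((1 + pos x)%:E * XY z x))%E.
Proof. by apply: mule_ge0; rewrite ?lee_fin ?mulr_ge0. Qed.

Let V0 n t : (0 <= V n t)%E.
Proof. by apply: mom_ge0 => // x; exact: normr_ge0. Qed.

Let V_fin n (t : R) : 0 <= t <= T -> V n t \is a fin_num.
Proof.
move=> /andP[t0 tT]; rewrite ge0_fin_numE//.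
have Vz : V n 0 = 0%E.
  by apply: integral0_eq => x _; rewrite r_at0 normr0 mulr0.
apply: le_lt_trans (V_lip n (lexx 0) t0 tT (or_introl (conj erefl erefl))) _.
rewrite Vz add0e; apply: le_lt_trans J_fin.
by apply: ge0_integral_oc_mono => //; exact: mJ.
Qed.

Hypothesis weak : weakly_cvg_bounded T u us.

(** For almost every size the coagulation operator at [p] is an integrable function of time, hence
    an admissible test function against the controls. *)
Lemma remainder_cvg_pointwise (t : R) : 0 <= t <= T ->
  {ae mu, forall x, r n t x @[n --> \oo] --> 0}.
Proof.
move=> tT; apply: aeS coag_integral_fin => x Hx.
have mXx := slice x mX; have mYx := slice x mY.
have Xfin : (\int[mu]_(s in `]0%R, T]) X s x < +oo)%E.
  apply: le_lt_trans Hx; apply: (ge0_le_integralT (measurable_itv _) mXx (slice x mXY)) => //.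
  by move=> s _; rewrite /XY leeDl.
have Yfin : (\int[mu]_(s in `]0%R, T]) Y s x < +oo)%E.
  apply: le_lt_trans Hx; apply: (ge0_le_integralT (measurable_itv _) mYx (slice x mXY)) => //.
  by move=> s _; rewrite /XY leeDr.
have T0T : 0 <= T <= T by rewrite T_ge0 lexx.
have [ik _] := fine_diff_integral T0T mYx mXx (Y0^~ x) (X0^~ x) Yfin Xfin.
pose kk s := fine (X s x) - fine (Y s x).
have mkk : measurable_fun setT kk by rewrite /kk; mfun.
have := weak_cvg_initial mu_ u0 uB mus us0 usB weak tT mkk ik.
suff -> : (fun n => r n t x) = (fun n => \int[mu]_(s in `]0, t]) ((u n s - us s) * kk s)) by [].
apply/funext => n; symmetry.
have fin1 (c d : R -> R) : measurable_fun setT c -> measurable_fun setT d ->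
    nonneg1 c -> nonneg1 d -> (forall t, c t <= B) -> (forall t, d t <= B) ->
    (\int[mu]_(z in `]0%R, T]) coag_parts k p c d z x < +oo)%E.
  move=> mc md c0 d0 cB dB; apply: le_lt_trans (parts_int_le _ _ _ mc md c0 d0 cB dB) _.
  by apply: lte_mul_pinfty; [rewrite lee_fin|by []|].
have [ir Er] := fine_diff_integral tT (mparts x mus (mu_ n)) (mparts x (mu_ n) mus)
  (fun s => coag_parts_ge0 k0 p0 s x us0 (u0 n)) (fun s => coag_parts_ge0 k0 p0 s x (u0 n) us0)
  (fin1 _ _ mus (mu_ n) us0 (u0 n) usB (uB n)) (fin1 _ _ (mu_ n) mus (u0 n) us0 (uB n) usB).
rewrite /r /remainder -Er; congr fine; apply: ae_eq_integral => //.
- apply/measurable_EFinP; apply: (@measurable_funS _ _ _ _ setT) => //.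
  by have m1 := mu_ n; mfun.
- by have /integrableP[] := ir.
have FX := ae_fin_integral (measurable_itv `]0, T]) mXx (X0^~ x) Xfin.
have FY := ae_fin_integral (measurable_itv `]0, T]) mYx (Y0^~ x) Yfin.
apply: aeS (aeI FX FY) => s [fx fy] st.
have sT : `]0, T]%classic s.
  move: st; rewrite /= !in_itv/= => /andP[-> st] /=.
  by apply: le_trans st _; have /andP[] := tT.
have {}fx := fx sT; have {}fy := fy sT.
rewrite !partsE /kk -(fineK fx) -(fineK fy) -!EFinM -!EFinD /=; congr (_%:E); ring.
Qed.

(** At a fixed time, pointwise convergence in the size becomes convergence of the first moment by
    dominated convergence, the majorant being the time integral of gain plus loss. It becomes
    uniform in time because [J] is a common modulus of continuity. *)
Lemma remainder_cvg (e : R) : 0 < e -> \forall n \near \oo, forall t : R, 0 <= t <= T ->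
  (mom (fun x => 1 + pos x)%R (fun x => `|remainder k p (u n) us t x|)%R <= e%:E)%E.
Proof.
move=> e0.
have Jc : {within `[0, T], continuous (fun t => fine (J 0 t))}.
  exact: (fine_integral_oc_continuous T_ge0 mJ J0 J_fin).
have Jsub (s t : R) : (0 <= s -> s <= t -> t <= T ->
    [/\ J s t \is a fin_num & fine (J s t) = fine (J 0 t) - fine (J 0 s)])%R.
  move=> s0 st tT.
  have Jf (a b : R) : 0 <= a -> b <= T -> J a b \is a fin_num.
    move=> a0 bT; rewrite ge0_fin_numE; last by apply: integral_ge0 => z _; exact: J0.
    by apply: le_lt_trans J_fin; apply: ge0_integral_oc_mono.
  have f1 := Jf 0 s (lexx 0) (le_trans st tT); have f2 := Jf s t s0 tT.
  split=> //; have -> : J 0 t = (J 0 s + J s t)%E by exact: integral_oc_split s0 st mJ J0.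
  by rewrite (fineD f1 f2) addrC addKr.
have pt (t : R) : 0 <= t <= T -> fine (V n t) @[n --> \oo] --> 0.
  move=> tT; have /andP[t0 tT'] := tT.
  suff : V n t @[n --> \oo] --> 0%E by move=> /fine_cvgP[].
  have mF n : measurable_fun setT (fun x => ((1 + pos x) * `|r n t x|)%:E).
    by have := mr n => ?; mfun.
  have mH : measurable_fun setT H by rewrite /H; mfun.
  have mG : measurable_fun setT (fun x => (1 + pos x)%:E * ((2 * B + 1)%:E * H x))%E by mfun.
  (* A positive factor, even if B = 0, keeps the majorant infinite where [H x] is infinite and no
     estimate of the remainder is available. *)
  have B21 : 0 < 2 * B + 1 by apply: ltr_wpDl => //; exact: mulr_ge0.
  have H0 x : (0 <= H x)%E by apply: integral_ge0.
  have mwXY : measurable_fun setT (fun z : R * R => ((1 + pos z.2)%:E * XY z.1 z.2)%E) by mfun.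
  have wXY0 s x : (0 <= (1 + pos x)%:E * XY s x)%E.
    by apply: mule_ge0 => //; rewrite lee_fin; exact: p10.
  have GI : (\int[mu]_x ((1 + pos x)%:E * ((2 * B + 1)%:E * H x)) < +oo)%E.
    have E : (fun x => (1 + pos x)%:E * ((2 * B + 1)%:E * H x))%E =
        (fun x => (2 * B + 1)%:E * \int[mu]_(s in `]0%R, T]) ((1 + pos x)%:E * XY s x))%E.
      apply/funext => x; rewrite muleCA; congr (_ * _)%E.
      by rewrite (ge0_integralZlT (measurable_itv _) (p10 x) (slice x mXY) (XY0^~ x)).
    have mwI : measurable_fun setT (fun x => \int[mu]_(s in `]0%R, T]) ((1 + pos x)%:E * XY s x))%E.
      by mfun.
    have wI0 x : (0 <= \int[mu]_(s in `]0%R, T]) ((1 + pos x)%:E * XY s x))%E.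
      by apply: integral_ge0 => s _; exact: wXY0.
    rewrite E (ge0_integralZlT measurableT (ltW B21) mwI wI0).
    apply: lte_mul_pinfty; [by rewrite lee_fin ltW|by []|].
    by rewrite -(tonelli (measurable_itv _) measurableT mwXY wXY0); exact: moment_coag_fin.
  apply: (dominated_cvg0 measurableT mF mG) => //.
  - by move=> n x; rewrite lee_fin; apply: mulr_ge0 => //; exact: p10.
  - move=> n x _; have [Hx|Hx] := ltP (H x) +oo%E; last first.
      have -> : H x = +oo%E by apply/eqP; rewrite eq_le Hx leey.
      by rewrite gt0_muley ?lte_fin// gt0_muley ?leey// lte_fin ltr_wpDr// pos_ge0.
    rewrite EFinM; apply: lee_wpmul2l; first by rewrite lee_fin; exact: p10.
    have := remainder_lip n (lexx 0) t0 tT' Hx; rewrite r_at0 subr0 => /le_trans; apply.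
    apply: lee_pmul.
    - by rewrite lee_fin mulr_ge0.
    - by apply: integral_ge0.
    - by rewrite lee_fin lerDl.
    - by apply: ge0_integral_oc_mono => //; exact: slice.
  - apply: aeS (remainder_cvg_pointwise tT) => x rx _.
    rewrite -[X in _ --> X%:E](mulr0 (1 + pos x)); apply: cvg_EFin; first exact: nearW.
    apply: cvgMr; rewrite -(normr0 R); exact: cvg_norm.
have lip n (s t : R) : 0 <= s <= T -> 0 <= t <= T ->
    fine (V n t) <= fine (V n s) + `|fine (J 0 t) - fine (J 0 s)|.
  move=> sT tT; have := V_fin n sT; have := V_fin n tT.
  have /andP[s0 sT'] := sT; have /andP[t0 tT'] := tT.
  have [st|/ltW ts] := leP s t.
    have [f1 <-] := Jsub s t s0 st tT'.
    have := V_lip n s0 st tT' (or_introl (conj erefl erefl)).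
    rewrite -(fineK f1) => H1 f2 f3; move: H1; rewrite -(fineK f2) -(fineK f3) -EFinD lee_fin /=.
    by move=> /le_trans; apply; rewrite lerD2l ler_norm.
  have [f1 Je] := Jsub t s t0 ts sT'; rewrite distrC -Je.
  have := V_lip n t0 ts sT' (or_intror (conj erefl erefl)).
  rewrite -(fineK f1) => H1 f2 f3; move: H1; rewrite -(fineK f2) -(fineK f3) -EFinD lee_fin /=.
  by move=> /le_trans; apply; rewrite lerD2l ler_norm.
have := uniform_in_time Jc pt lip e0; apply: filterS => n Hn t tT.
by rewrite -/(r n) -/(V n t) -(fineK (V_fin n tT)) lee_fin; exact: Hn.
Qed.

End RemainderConvergence.

(** * Converging coefficients *)

Section ErrorConvergence.
Context {R : realType}.
Local Notation mu := (@lebesgue_measure R).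
Variables (T B W K A N : R) (k g : nat -> R -> R -> R) (ks gs : R -> R -> R).
Variables (a : nat -> R -> R) (as_ : R -> R) (p : R -> R -> R).
Hypotheses (B_ge0 : 0 <= B) (W_ge0 : 0 <= W) (K_ge0 : 0 <= K).
Hypotheses (A_ge0 : 0 <= A) (N_ge0 : 0 <= N).
Hypotheses (mk : forall n, jointly_measurable (k n)) (k0 : forall n, nonneg2 (k n)).
Hypotheses (mks : jointly_measurable ks) (ks0 : nonneg2 ks).
Hypotheses (mg : forall n, jointly_measurable (g n)) (g0 : forall n, nonneg2 (g n)).
Hypotheses (mgs : jointly_measurable gs) (gs0 : nonneg2 gs).
Hypotheses (ma : forall n, measurable_fun setT (a n)) (a0 : forall n, nonneg1 (a n)).
Hypotheses (mas : measurable_fun setT as_) (as0 : nonneg1 as_).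
Hypotheses (mp : jointly_measurable p) (p0 : nonneg2 p).
Hypothesis k_le : forall n x y, k n x y <= K * ((1 + pos x) * (1 + pos y)).
Hypothesis ks_le : forall x y, ks x y <= K * ((1 + pos x) * (1 + pos y)).
Hypothesis k_cvg : forall x y, k n x y @[n --> \oo] --> ks x y.
Hypothesis a_le : forall n y, a n y <= A * (1 + pos y).
Hypothesis as_le : forall y, as_ y <= A * (1 + pos y).
Hypothesis a_cvg : forall y, a n y @[n --> \oo] --> as_ y.
Hypothesis g_le : forall n y, (lin (flip (g n)) (fun=> 1%R) y <= (a n y * N)%:E)%E.
Hypothesis gs_le : forall y, (lin (flip gs) (fun=> 1%R) y <= (as_ y * N)%:E)%E.
Hypothesis g_cvg : forall y,
  (lin (flip (fun x y => `|g n x y - gs x y|%R)) (fun=> 1%R) y)%E @[n --> \oo] --> 0%E.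
Hypothesis p_mom : forall s : R, 0 <= s <= T -> (mom (fun x => 1 + pos x)%R (p s) <= W%:E)%E.

Let mpos := @measurable_pos R.
Let mp1 : measurable_fun setT (fun x => 1 + pos x : R). Proof. by mfun. Qed.
Let p10 : nonneg1 (fun x => 1 + pos x : R).
Proof. by move=> x; rewrite addr_ge0 ?pos_ge0. Qed.
Let ps0 s : nonneg1 (p s). Proof. exact: p0. Qed.
Let mps s : measurable_fun setT (p s). Proof. by mfun. Qed.

Let kd n x y := `|k n x y - ks x y|.
Let gd n x y := `|g n x y - gs x y|.
Let ad n x := `|a n x - as_ x|.
Let mkd n : jointly_measurable (kd n).
Proof. by have := mk n => ?; rewrite /jointly_measurable /kd; mfun. Qed.
Let mgd n : jointly_measurable (gd n).
Proof. by have := mg n => ?; rewrite /jointly_measurable /gd; mfun. Qed.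
Let mad n : measurable_fun setT (ad n). Proof. by have := ma n => ?; rewrite /ad; mfun. Qed.
Let kd0 n : nonneg2 (kd n). Proof. by move=> x y; exact: normr_ge0. Qed.
Let gd0 n : nonneg2 (gd n). Proof. by move=> x y; exact: normr_ge0. Qed.
Let ad0 n : nonneg1 (ad n). Proof. by move=> x; exact: normr_ge0. Qed.

Lemma ler_dist_ge0 (x y c : R) : 0 <= x -> 0 <= y -> x <= c -> y <= c -> `|x - y| <= c.
Proof. by move=> *; rewrite ler_norml; apply/andP; split; lra. Qed.

Lemma cvg_dist0 (x_ : nat -> R) (x : R) : x_ n @[n --> \oo] --> x -> `|x_ n - x| @[n --> \oo] --> 0.
Proof.
move=> xx; rewrite -(normr0 R); apply: cvg_norm.
by rewrite -(subrr x); apply: cvgB => //; exact: cvg_cst.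
Qed.

Lemma mom_dominated_cvg0 (w : nat -> R -> R) (c s : R) : 0 <= s <= T -> 0 <= c ->
  (forall n, measurable_fun setT (w n)) -> (forall n, nonneg1 (w n)) ->
  (forall n x, w n x <= c * (1 + pos x)) -> (forall x, w n x @[n --> \oo] --> 0) ->
  mom (w n) (p s) @[n --> \oo] --> 0%E.
Proof.
move=> sT c0 mw w0 wle w_cvg.
have mF n : measurable_fun setT (fun x => (w n x * p s x)%:E) by have := mw n => ?; mfun.
have mG : measurable_fun setT (fun x => (c * (1 + pos x) * p s x)%:E) by mfun.
apply: (dominated_cvg0 measurableT mF mG).
- by move=> n x; rewrite lee_fin; apply: mulr_ge0; [exact: w0|exact: ps0].
- by move=> n x _; rewrite lee_fin; apply: ler_wpM2r; [exact: ps0|exact: wle].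
- rewrite -/(mom _ _) (momZ c0 mp1 (mps s) p10 (ps0 s)).
  apply: (@le_lt_trans _ _ (c%:E * W%:E)%E); last by rewrite -EFinM ltry.
  by apply: lee_wpmul2l; rewrite ?lee_fin// p_mom.
- apply: aeW => x _; rewrite -[X in _ --> X%:E](mul0r (p s x)).
  by apply: cvg_EFin; [exact: nearW|apply: cvgMl; exact: w_cvg].
Qed.

Lemma bil_dist_le n (s : R) : 0 <= s <= T -> (bil (kd n) (p s) (p s) <= (K * (W * W))%:E)%E.
Proof.
move=> sT.
have kle x y : kd n x y <= K * ((1 + pos x) * (1 + pos y)).
  by apply: ler_dist_ge0; [exact: k0|exact: ks0|exact: k_le|exact: ks_le].
apply: le_trans (bil_le_mom K_ge0 (mkd n) mp1 mp1 (mps s) (mps s) (kd0 n) p10 p10 (ps0 s) (ps0 s) kle) _.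
rewrite (EFinM K) (EFinM W); apply: lee_wpmul2l; first by rewrite lee_fin.
by apply: lee_pmul; [exact: mom_ge0|exact: mom_ge0|exact: p_mom|exact: p_mom].
Qed.

Lemma bil_dist_cvg0 (s : R) : 0 <= s <= T -> bil (kd n) (p s) (p s) @[n --> \oo] --> 0%E.
Proof.
move=> sT.
have inner n x : (\int[mu]_y (kd n x y * (p s x * p s y))%:E =
    mom (fun y => p s x * kd n x y)%R (p s))%E.
  by apply: eq_integral => y _; congr (_%:E); ring.
have mF n : measurable_fun setT (fun x => \int[mu]_y (kd n x y * (p s x * p s y))%:E)%E.
  by apply: bil_measurable_inner => //; exact: ps0.
have c0 x : 0 <= K * (1 + pos x) * p s x.
  by apply: mulr_ge0; [apply: mulr_ge0 => //; exact: p10|exact: ps0].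
have wle n x y : p s x * kd n x y <= K * (1 + pos x) * p s x * (1 + pos y).
  have := ler_dist_ge0 (k0 n x y) (ks0 x y) (k_le n x y) (ks_le x y).
  by move=> /(ler_wpM2l (ps0 s x)); congr (_ <= _); rewrite /kd; ring.
have mG : measurable_fun setT (fun x => (K * (1 + pos x) * p s x)%:E * W%:E)%E by mfun.
apply: (dominated_cvg0 measurableT mF mG).
- move=> n x; apply: integral_ge0 => y _; rewrite lee_fin; apply: mulr_ge0; first exact: kd0.
  by apply: mulr_ge0; exact: ps0.
- move=> n x _; rewrite inner.
  apply: (@le_trans _ _ (mom (fun y => K * (1 + pos x) * p s x * (1 + pos y))%R (p s))).
    apply: mom_le => //; [by have := mkd n => ?; mfun|by mfun| |].
    + by move=> y; apply: mulr_ge0; [exact: ps0|exact: kd0].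
    + by move=> y; apply: ler_wpM2r; [exact: ps0|exact: wle].
  rewrite (momZ (c0 x) mp1 (mps s) p10 (ps0 s)).
  by apply: lee_wpmul2l; rewrite ?lee_fin// p_mom.
- rewrite ge0_integralZr//; last 2 first.
  + by mfun.
  + by move=> x _; rewrite lee_fin.
  rewrite muleC; apply: lte_mul_pinfty; [by rewrite lee_fin|by []|].
  have mK : measurable_fun setT (fun x => K * (1 + pos x)) by mfun.
  rewrite -/(mom (fun x => K * (1 + pos x))%R (p s)) (momZ K_ge0 mp1 (mps s) p10 (ps0 s)).
  apply: (@le_lt_trans _ _ (K%:E * W%:E)%E); last by rewrite -EFinM ltry.
  by apply: lee_wpmul2l; rewrite ?lee_fin// p_mom.
- apply: aeW => x _; rewrite (funext (fun n => inner n x)).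
  apply: (mom_dominated_cvg0 sT (c0 x)).
  + by move=> n; have := mkd n => ?; mfun.
  + by move=> n y; apply: mulr_ge0; [exact: ps0|exact: kd0].
  + by move=> n y; exact: wle.
  + move=> y; rewrite -[X in _ --> X](mulr0 (p s x)); apply: cvgMr.
    exact: cvg_dist0.
Qed.

Let L n y := lin (flip (gd n)) (fun=> 1%R) y.
Let mL n : measurable_fun setT (L n).
Proof.
have := mgd n => mgdn; rewrite /L /lin /flip; mfun => //.
by move=> x y; rewrite lee_fin mulr1; exact: gd0.
Qed.
Let L0 n y : (0 <= L n y)%E.
Proof. by apply: lin_ge0 => // ? ?; exact: gd0. Qed.

Lemma frag_dist_le n y : (L n y <= (2 * N * A * (1 + pos y))%:E)%E.
Proof.
have := mg n => mgn.
have one0 : nonneg1 (fun=> 1 : R) by move=> ?; exact: ler01.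
have mone : measurable_fun (@setT R) (fun=> 1 : R) by mfun.
apply: (@le_trans _ _ (lin (flip (g n)) (fun=> 1%R) y + lin (flip gs) (fun=> 1%R) y)%E).
  apply: lin_leD => //.
  - by have := mgd n => ?; rewrite /jointly_measurable /flip; mfun.
  - by rewrite /jointly_measurable /flip; mfun.
  - by rewrite /jointly_measurable /flip; mfun.
  - by move=> ? ?; exact: gd0.
  - by move=> ? ?; exact: g0.
  - by move=> ? ?; exact: gs0.
  - move=> x; rewrite !mulr1 /flip /gd; apply: le_trans (ler_normB _ _) _.
    by rewrite (ger0_norm (g0 n x y)) (ger0_norm (gs0 x y)).
apply: le_trans (leeD (g_le n y) (gs_le y)) _; rewrite -EFinD lee_fin.
have := ler_wpM2r N_ge0 (a_le n y); have := ler_wpM2r N_ge0 (as_le y).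
by move: (a n y * N) (as_ y * N) => x1 x2; lra.
Qed.

Let D s := (0 <= s <= T).

Lemma frag_dist_cvg0 (s : R) : D s ->
  (\int[mu]_y ((p s y)%:E * L n y))%E @[n --> \oo] --> 0%E.
Proof.
move=> sT.
have mF n : measurable_fun setT (fun y => (p s y)%:E * L n y)%E by mfun.
have mG : measurable_fun setT (fun y => ((2 * N * A * (1 + pos y)) * p s y)%:E) by mfun.
have NA0 : 0 <= 2 * N * A by apply: mulr_ge0 => //; exact: mulr_ge0.
apply: (dominated_cvg0 measurableT mF mG).
- by move=> n y; apply: mule_ge0; rewrite ?lee_fin//; exact: ps0.
- move=> n y _; rewrite (EFinM (2 * N * A * _)) muleC; apply: lee_wpmul2r.
    by rewrite lee_fin; exact: ps0.
  exact: frag_dist_le.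
- rewrite -/(mom (fun y => 2 * N * A * (1 + pos y))%R (p s)).
  rewrite (momZ NA0 mp1 (mps s) p10 (ps0 s)).
  apply: (@le_lt_trans _ _ ((2 * N * A)%:E * W%:E)%E); last by rewrite -EFinM ltry.
  by apply: lee_wpmul2l; rewrite ?lee_fin// p_mom.
- apply: aeW => y _; rewrite -(mule0 (p s y)%:E).
  by apply: cvgeZl => //; exact: g_cvg.
Qed.

Lemma rate_dist_cvg0 (s : R) : D s -> mom (ad n) (p s) @[n --> \oo] --> 0%E.
Proof.
move=> sT; apply: (mom_dominated_cvg0 sT A_ge0 mad ad0).
- by move=> n x; apply: ler_dist_ge0; [exact: a0|exact: as0|exact: a_le|exact: as_le].
- by move=> x; exact: cvg_dist0.
Qed.

Lemma err_measurable n :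
  measurable_fun setT (fun s => err B (k n) ks (g n) gs (a n) as_ p s).
Proof.
have := mkd n => mkdn; have := mgd n => mgdn; have := mad n => madn.
rewrite /err -/(kd n) -/(gd n) -/(ad n) /bil /lin /flip /mom; mfun => //.
- move=> x y; rewrite lee_fin; apply: mulr_ge0; first exact: kd0.
  by apply: mulr_ge0; exact: p0.
- move=> x y; apply: integral_ge0 => z _; rewrite lee_fin; apply: mulr_ge0; first exact: kd0.
  by apply: mulr_ge0; exact: p0.
- by move=> x y; rewrite lee_fin mulr1//; exact: gd0.
- move=> x y; apply: mule_ge0; first by rewrite lee_fin; exact: p0.
  by apply: integral_ge0 => z _; rewrite lee_fin mulr1//; exact: gd0.
- by move=> x y; rewrite lee_fin; apply: mulr_ge0; [exact: ad0|exact: p0].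
Qed.

Lemma rate_dist_le_err n s : (mom (ad n) (p s) <= err B (k n) ks (g n) gs (a n) as_ p s)%E.
Proof.
rewrite /err; apply: leeDr; apply: adde_ge0.
  apply: mule_ge0; first by rewrite lee_fin mulr_ge0.
  by apply: bil_ge0; [exact: kd0|exact: ps0|exact: ps0].
by apply: integral_ge0 => y _; apply: mule_ge0; [rewrite lee_fin; exact: ps0|exact: L0].
Qed.

(** Dominated convergence in the sizes at each time, then in time with a constant majorant that
    comes from the bound on number and mass. *)
Lemma err_cvg0 :
  (\int[mu]_(s in `]0%R, T]) err B (k n) ks (g n) gs (a n) as_ p s)%E @[n --> \oo] --> 0%E.
Proof.
have B20 : 0 <= 2 * B by exact: mulr_ge0.
have n1 n s : (0 <= bil (kd n) (p s) (p s))%E by apply: bil_ge0 => //; exact: ps0.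
have n2 n s : (0 <= \int[mu]_y ((p s y)%:E * L n y))%E.
  by apply: integral_ge0 => y _; apply: mule_ge0; rewrite ?lee_fin//; exact: ps0.
have n3 n s : (0 <= mom (ad n) (p s))%E by apply: mom_ge0 => //; exact: ps0.
pose C := 2 * B * (K * (W * W)) + 2 * N * A * W + A * W.
have NA0 : 0 <= 2 * N * A by apply: mulr_ge0 => //; exact: mulr_ge0.
apply: (dominated_cvg0 (measurable_itv `]0, T]) err_measurable (measurable_cst C%:E)).
- move=> n s; apply: adde_ge0; last exact: n3.
  by apply: adde_ge0; [apply: mule_ge0; rewrite ?lee_fin//; exact: n1|exact: n2].
- move=> n s; rewrite /= in_itv/= => /andP[s0 sT].
  have sD : 0 <= s <= T by rewrite (ltW s0).
  rewrite /err -/(kd n) -/(gd n) -/(ad n) /C !EFinD; apply: leeD; first apply: leeD.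
  + by rewrite (EFinM (2 * B)); apply: lee_wpmul2l; [rewrite lee_fin|exact: bil_dist_le].
  + apply: (@le_trans _ _ (mom (fun y => 2 * N * A * (1 + pos y))%R (p s))).
      apply: ge0_le_integralT => //; [|by mfun| |].
      * by have := mL n => mLn; mfun.
      * by move=> y; apply: mule_ge0; [rewrite lee_fin; exact: p0|exact: L0].
      * move=> y _; rewrite (EFinM (2 * N * A * _)) muleC; apply: lee_wpmul2r.
          by rewrite lee_fin; exact: ps0.
        exact: frag_dist_le.
    rewrite (momZ NA0 mp1 (mps s) p10 (ps0 s)) (EFinM (2 * N * A)).
    by apply: lee_wpmul2l; rewrite ?lee_fin// p_mom.
  + apply: (@le_trans _ _ (mom (fun y => A * (1 + pos y))%R (p s))).
      have mA : measurable_fun setT (fun y => A * (1 + pos y)) by mfun.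
      apply: (mom_le (mad n) (mps s) mA (mps s) (ad0 n) (ps0 s)) => x.
      apply: ler_wpM2r; first exact: ps0.
      by apply: ler_dist_ge0; [exact: a0|exact: as0|exact: a_le|exact: as_le].
    rewrite (momZ A_ge0 mp1 (mps s) p10 (ps0 s)) (EFinM A).
    by apply: lee_wpmul2l; rewrite ?lee_fin// p_mom.
- rewrite integral_cst//= lebesgue_measure_itv/= lte_fin.
  by case: ifP => _; rewrite -?EFinB -?EFinM ?ltry// mule0 ltry.
- apply: aeW => s; rewrite /= in_itv/= => /andP[s0 sT].
  have sD : 0 <= s <= T by rewrite (ltW s0).
  have c1 : ((2 * B)%:E * bil (kd n) (p s) (p s))%E @[n --> \oo] --> 0%E.
    by rewrite -(mule0 (2 * B)%:E); apply: cvgeZl => //; exact: bil_dist_cvg0.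
  rewrite -[X in _ --> X]adde0 -[X in _ --> (X + _)%E]adde0.
  by apply: cvgeD => //; [apply: cvgeD => //; exact: frag_dist_cvg0|exact: rate_dist_cvg0].
Qed.

End ErrorConvergence.

(** * Convergence of the fragment distributions *)

Section DaughterConvergence.
Context {R : realType}.
Local Notation mu := (@lebesgue_measure R).

Lemma powR_exponent_cvg (x s : R) (s_ : nat -> R) : 0 < x -> s_ n @[n --> \oo] --> s ->
  x `^ s_ n @[n --> \oo] --> x `^ s.
Proof.
move=> x0 ss; rewrite /powR gt_eqF//; apply: continuous_cvg; first exact: continuous_expR.
exact: cvgMl.
Qed.

Variables (alpha lambda nu : nat -> R) (alphas lambdas nus A nl : R).
Hypotheses (alpha_cvg : alpha n @[n --> \oo] --> alphas).
Hypotheses (lambda_cvg : lambda n @[n --> \oo] --> lambdas).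
Hypotheses (nu_cvg : nu n @[n --> \oo] --> nus).
Hypothesis lambda_gt0 : forall n, 0 < lambda n.
Hypothesis lambdas_gt0 : 0 < lambdas.

Lemma rate_cvg y : rate (alpha n) (lambda n) y @[n --> \oo] --> rate alphas lambdas y.
Proof.
have [y0|y0] := leP y 0.
  rewrite rate_le0 ?gt_eqF//; rewrite (_ : (fun n => _) = (fun=> 0)); first exact: cvg_cst.
  by apply/funext => n; rewrite rate_le0 ?gt_eqF.
rewrite /rate; apply: cvgM => //; apply: powR_exponent_cvg => //.
by rewrite pos_id// ltW.
Qed.

Hypothesis A_ge0 : 0 <= A.
Hypothesis rate_leA : forall n y, rate (alpha n) (lambda n) y <= A * (1 + pos y).
Hypothesis alpha_ge0 : forall n, 0 <= alpha n.
Hypotheses (nl_gt : -1 < nl) (nl_le : forall n, nl <= nu n) (nu_le0 : forall n, nu n <= 0).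

(** Since x / y < 1, its powers decrease in the exponent, so the smallest exponent [nl] dominates.
    It is still larger than -1, which keeps the majorant integrable. *)
Lemma daughter_le n x y : 0 < y -> daughter (nu n) x y <= 2 / (2 + nl) * daughter nl x y.
Proof.
move=> y0; rewrite /daughter indicE; case: (boolP (x \in _)) => [|_]; last by rewrite !mulr0.
rewrite inE /= in_itv/= => /andP[x0 xy]; rewrite !mulr1.
have nl2 : 0 < 2 + nl by have := nl_gt; lra.
rewrite [leRHS](_ : _ = 2 / y * (x / y) `^ nl); last by field; rewrite !gt_eqF.
apply: ler_pM; rewrite ?powR_ge0//.
- by rewrite divr_ge0 ?(ltW y0)//; have := nl_le n; lra.
- by rewrite ler_wpM2r ?invr_ge0 ?(ltW y0)//; have := nu_le0 n; lra.
- by apply: ger_powR => //; rewrite divr_gt0//= ler_pdivrMr// mul1r ltW.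
Qed.

Lemma frag_kernel_dist_cvg0 y :
  (lin (flip (fun x y => `|frag_kernel (alpha n) (lambda n) (nu n) x y -
      frag_kernel alphas lambdas nus x y|%R)) (fun=> 1%R) y)%E @[n --> \oo] --> 0%E.
Proof.
pose fn n x := frag_kernel (alpha n) (lambda n) (nu n) x y.
pose fs x := frag_kernel alphas lambdas nus x y.
have d_cvg x : daughter (nu n) x y @[n --> \oo] --> daughter nus x y.
  have [xy|nxy] := pselect (0 < x < y); last first.
    have dz (v : R) : daughter v x y = 0.
      rewrite /daughter indicE; case: (boolP (x \in _)) => [|_]; last by rewrite mulr0.
      by rewrite inE /= in_itv/= => /nxy.
    rewrite dz (_ : (fun n => _) = (fun=> 0)); first exact: cvg_cst.
    by apply/funext => n; exact: dz.
  rewrite /daughter; apply: cvgMl; apply: cvgM.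
    by apply: cvgMl; apply: cvgD => //; exact: cvg_cst.
  apply: powR_exponent_cvg => //; move: xy => /andP[x0 xy].
  by rewrite divr_gt0// (lt_trans x0).
have f_cvg x : fn n x @[n --> \oo] --> fs x by apply: cvgM => //; exact: rate_cvg.
have [y0|y0] := leP y 0.
  rewrite (_ : (fun n => _) = (fun=> 0%E)); first exact: cvg_cst.
  apply/funext => n; apply: integral0_eq => x _.
  by rewrite /flip /frag_kernel !rate_le0 ?gt_eqF// !mul0r subrr normr0 mul0r.
have nl2 : 0 < 2 + nl by have := nl_gt; lra.
pose c := A * (1 + pos y) * (2 / (2 + nl)).
have p0 : 0 <= 1 + pos y by rewrite addr_ge0// pos_ge0.
have c0 : 0 <= c by apply: mulr_ge0; [exact: mulr_ge0|rewrite divr_ge0// ltW].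
have md := daughter_jm nl.
have fn_le n x : fn n x <= c * daughter nl x y.
  rewrite /fn /frag_kernel /c -[X in _ <= X]mulrA; apply: ler_pM => //.
  - exact: rate_nonneg.
  - by apply: daughter_ge0; have := nl_gt; have := nl_le n; lra.
  - exact: daughter_le.
have fn0 n x : 0 <= fn n x.
  by apply: frag_kernel_ge0 => //; have := nl_gt; have := nl_le n; lra.
have fs_le x : fs x <= c * daughter nl x y.
  by apply: cvgr_to_le (f_cvg x) _; exact: nearW.
have fs0 x : 0 <= fs x by apply: cvgr_to_ge (f_cvg x) _; exact: nearW.
have mfn n : measurable_fun setT (fn n).
  by have := frag_kernel_jm (alpha n) (lambda n) (nu n) => ?; rewrite /fn; mfun.
have mfs : measurable_fun setT fs.
  by have := frag_kernel_jm alphas lambdas nus => ?; rewrite /fs; mfun.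
have mF n : measurable_fun setT (fun x => (`|fn n x - fs x| * 1)%:E) by have := mfn n => ?; mfun.
have mG : measurable_fun setT (fun x => (c * daughter nl x y)%:E) by mfun.
apply: (dominated_cvg0 measurableT mF mG).
- by move=> n x; rewrite lee_fin mulr1.
- by move=> n x _; rewrite lee_fin mulr1; apply: ler_dist_ge0.
- have dn x : (0 <= (daughter nl x y)%:E)%E by rewrite lee_fin daughter_ge0.
  have md' : measurable_fun setT (fun x => (daughter nl x y)%:E) by mfun.
  have E : (\int[mu]_x (daughter nl x y)%:E = ((2 + nl) / (1 + nl + 0))%:E)%E.
    rewrite -(integral_daughter_powR nl_gt (lexx 0) y0).
    by apply: eq_integral => x _; rewrite powRr0 mulr1.
  under eq_integral => x _ do rewrite EFinM.
  by rewrite (ge0_integralZlT measurableT c0 md' dn) E -EFinM ltry.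
- apply: aeW => x _; apply: cvg_EFin; first exact: nearW.
  by rewrite -[X in _ --> X](mul0r 1); apply: cvgMl; exact: cvg_dist0.
Qed.

End DaughterConvergence.

(** * Solutions as evolutions *)

Section Support.
Context {R : realType}.
Local Notation mu := (@lebesgue_measure R).

Lemma integral_support (D : set R) (F G : R -> \bar R) :
  (forall x, D x -> F x = G x) -> (forall x, ~ D x -> G x = 0%E) ->
  (\int[mu]_(x in D) F x = \int[mu]_x G x)%E.
Proof.
move=> FG G0; rewrite integral_mkcond; apply: eq_integral => x _.
rewrite patchE; case: ifPn => [|/negP]; rewrite inE; first exact: FG.
by move=> nD; rewrite G0.
Qed.

(** Reflections and translations preserve null sets. This is needed to change a function on a null
    set inside [conv]. *)
Lemma ae_refl_shift (P : R -> Prop) (x : R) :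
  {ae mu, forall y, P y} -> {ae mu, forall y, P (x - y)}.
Proof.
move=> [N [mN N0 nPN]]; exists ((fun y => x - y) @^-1` N); split.
- have mf : measurable_fun setT (fun y : R => x - y) by mfun.
  by rewrite -[X in measurable X]setTI; exact: mf.
- have mM : measurable ((fun y : R => y + x) @^-1` N).
    have mf : measurable_fun setT (fun y : R => y + x) by mfun.
    by rewrite -[X in measurable X]setTI; exact: mf.
  have M0 : mu ((fun y : R => y + x) @^-1` N) = 0%E.
    have mi : measurable_fun setT (fun y : R => (\1_N y : R)%:E).
      by apply/measurable_EFinP; exact: measurable_indic.
    rewrite -N0 -[N in RHS]setIT -integral_indic// -[X in mu X = _]setIT -integral_indic//.
    rewrite -(@integral_translate _ x _ mi); last by move=> y; rewrite lee_fin.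
    by apply: eq_integral => y _; rewrite !indicE.
  rewrite -M0 -(lebesgue_measureN mM) /pushforward; congr (mu _).
  by apply/funext => y /=; rewrite addrC.
- by move=> y /= nP; exact: nPN.
Qed.

(** The set of sizes at which [P] holds need not be measurable; [D] removes a measurable null set
    instead. *)
Lemma ae_pos (P : R -> Prop) : {ae mu, forall x, 0 < x -> P x} ->
  exists D : set R, [/\ measurable D, D `<=` Rpos, forall x, D x -> P x &
    {ae mu, forall x, 0 < x -> D x}].
Proof.
move=> [N [mN N0 nPN]]; exists (Rpos `\` N); split.
- by apply: measurableD => //; exact: measurable_itv.
- by move=> x [].
- move=> x []; rewrite /Rpos /= in_itv/= andbT => x0 nN; apply: contrapT => nP.
  by apply: nN; apply: nPN => /= /(_ x0).
- exists N; split => // x /= nx; apply: contrapT => nN; apply: nx => x0.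
  by split => //; rewrite /Rpos /= in_itv/= x0.
Qed.

Lemma conv_ae (k : R -> R -> R) (p q : R -> R) (x : R) : jointly_measurable k ->
  measurable_fun setT p -> measurable_fun setT q -> {ae mu, forall y, p y = q y} ->
  conv k p p x = conv k q q x.
Proof.
move=> mk mp mq pq; apply: ae_eq_integral; [by []|by mfun|by mfun|].
by apply: aeS (aeI pq (ae_refl_shift x pq)) => y [-> ->].
Qed.

Lemma lin_ae (k : R -> R -> R) (p q : R -> R) (x : R) : jointly_measurable k ->
  measurable_fun setT p -> measurable_fun setT q -> {ae mu, forall y, p y = q y} ->
  lin k p x = lin k q x.
Proof.
move=> mk mp mq pq; apply: ae_eq_integral; [by []|by mfun|by mfun|].
by apply: aeS pq => y ->.
Qed.

Lemma mom_ae (w p q : R -> R) : measurable_fun setT w ->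
  measurable_fun setT p -> measurable_fun setT q -> {ae mu, forall y, p y = q y} ->
  mom w p = mom w q.
Proof.
move=> mw mp mq pq; apply: ae_eq_integral; [by []|by mfun|by mfun|].
by apply: aeS pq => y ->.
Qed.

Definition clip (T t : R) : R := Num.max 0 (Num.min T t).

Lemma clip_itv (T t : R) : 0 <= T -> 0 <= clip T t <= T.
Proof. by move=> T0; rewrite /clip le_max lexx/= ge_max T0 ge_min lexx. Qed.

Lemma clip_id (T t : R) : 0 <= t <= T -> clip T t = t.
Proof. by move=> /andP[t0 tT]; rewrite /clip min_r// max_r. Qed.

Lemma clip_lipschitz (T s t : R) : 0 <= T -> `|clip T s - clip T t| <= `|s - t|.
Proof.
move=> T0; rewrite /clip /Num.max /Num.min.
have := ler_norm (s - t); have := ler_norm (t - s); rewrite (distrC t) => h1 h2.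
have h3 := normr_ge0 (s - t); rewrite ler_norml.
case: (ltP T s) => ?; case: (ltP T t) => ?.
all: by repeat (case: ifPn; rewrite -?leNgt => ?); apply/andP; split; lra.
Qed.

Lemma continuous_clip (T : R) (h : R -> R) : 0 <= T ->
  {within `[0, T], continuous h} -> continuous (fun t => h (clip T t)).
Proof.
move=> T0 /within_itv_continuousP H t; apply/cvgrPdist_lt => e e0.
have [d d0 dh] := H _ e (clip_itv t T0) e0.
near=> s; rewrite distrC; apply: dh; first exact: clip_itv.
apply: le_lt_trans (clip_lipschitz _ _ T0) _; rewrite distrC; near: s.
by move/cvgrPdist_lt: (@cvg_id _ (nbhs t)); apply.
Unshelve. all: by end_near.
Qed.

End Support.

Section PositiveKernels.
Context {R : realType}.
Local Notation mu := (@lebesgue_measure R).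

Definition pos_kernel (K : R * R -> R) (x y : R) : R :=
  K (x, y) * (\1_(@Rpos R) x * \1_(@Rpos R) y).

Lemma indic_Rpos (x : R) : \1_(@Rpos R) x = (0 < x)%R%:R :> R.
Proof. by rewrite indicE; congr (nat_of_bool _)%:R; apply/idP/idP; rewrite inE /Rpos /= in_itv/= andbT. Qed.

Lemma pos_kernelE K x y : 0 < x -> 0 < y -> pos_kernel K x y = K (x, y).
Proof. by move=> x0 y0; rewrite /pos_kernel !indic_Rpos x0 y0 !mulr1. Qed.

Lemma pos_kernel_out K x y : ~ (0 < x /\ 0 < y) -> pos_kernel K x y = 0.
Proof.
move=> nxy; rewrite /pos_kernel !indic_Rpos.
by case: (ltP 0 x) => x0; case: (ltP 0 y) => y0; rewrite ?mul0r ?mulr0//; case: nxy.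
Qed.

Lemma pos_kernel_jm K : measurable_fun (Rpos `*` Rpos) K -> jointly_measurable (pos_kernel K).
Proof.
move=> mK; have mD : measurable (@Rpos R `*` @Rpos R).
  by apply: measurableX; exact: measurable_itv.
have : measurable_fun setT (K \_ (Rpos `*` Rpos)).
  by apply/(measurable_restrict _ mD measurableT); rewrite setTI.
apply: eq_measurable_fun => -[x y] _; rewrite patchE /pos_kernel /=.
case: ifPn => [|/negP]; rewrite inE /Rpos /= !in_itv/= !andbT.
  by move=> [x0 y0]; rewrite !indic_Rpos x0 y0 !mulr1.
by move=> nxy; apply/esym/pos_kernel_out.
Qed.

(** Zero at the exceptional sizes and frozen in time outside [0, T]: sign and continuity then hold
    at every size and time, as [evolution] demands. *)
Definition extend (T : R) (D : set R) (f : R -> R -> R) (t x : R) : R :=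
  \1_D x * f (clip T t) x.

(** The bounds, which a control satisfies almost everywhere, are enforced at every time. *)
Definition truncate_control (T B : R) (u : R -> R) (t : R) : R :=
  \1_(`]0%R, T[ : set R) t * Num.max 0 (Num.min B (u t)).

End PositiveKernels.

Section SplitBalance.
Context {R : realType}.
Local Notation mu := (@lebesgue_measure R).

(** A finite loss excludes oo - oo. The case v = 0 is separate because 0 * oo = 0 then hides a
    possibly infinite coagulation loss. *)
Lemma gain_minus_loss (v cv p lk a lg : \bar R) :
  v \is a fin_num -> (0 <= v)%E -> a \is a fin_num -> (0 <= cv)%E -> (0 <= lg)%E -> (0 <= p * lk)%E ->
  (v * (p * lk) + a < +oo)%E ->
  (v * ((2^-1)%:E * cv - p * lk) + (- a + lg) =
   ((v * (2^-1)%:E) * cv + lg) - (v * (p * lk) + a))%E.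
Proof.
move: v a (p * lk)%E => [v||] [a||] z // _; rewrite lee_fin => v0 _ cv0 lg0 z0.
have [->|vn0] := eqVneq v 0.
  by rewrite !mul0e !add0e ?mul0e ?add0e => _; rewrite addeC.
have {v0}v0 : 0 < v by rewrite lt_neqAle eq_sym vn0.
case: z z0 => [z||] //; last by rewrite gt0_muley ?lte_fin.
move=> _ _; case: cv cv0 => [cv||] //; case: lg lg0 => [lg||] //= _ _.
- by rewrite -?EFinM -?EFinN -?EFinD -?EFinM; congr (_%:E); ring.
- by rewrite -EFinM !gt0_muley ?lte_fin ?mulr_gt0//= ?gt0_muley ?lte_fin.
- by rewrite -EFinM !gt0_muley ?lte_fin ?mulr_gt0//= ?gt0_muley ?lte_fin.
Qed.

(** Where [L] is finite, the negative part of [H] is at most [L], hence integrable; the integral of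
    [H] is finite, so the positive part is integrable as well. Therefore [H] is integrable and can
    be added to [L]. This recovers separate gain and loss integrals from the equation of a
    solution. *)
Lemma split_balance (D : set R) (L G H : R -> \bar R) (c : R) : measurable D ->
  measurable_fun setT L -> measurable_fun setT G -> measurable_fun setT H ->
  (forall s, 0 <= L s)%E -> (forall s, 0 <= G s)%E ->
  (forall s, D s -> L s < +oo -> H s = G s - L s)%E ->
  (\int[mu]_(s in D) L s < +oo)%E -> (\int[mu]_(s in D) H s = c%:E)%E ->
  (\int[mu]_(s in D) G s = c%:E + \int[mu]_(s in D) L s)%E.
Proof.
move=> mD mL mG mH L0 G0 HE Loo Hc.
have SD (F : R -> \bar R) : measurable_fun setT F -> measurable_fun D F.
  by move=> mF; exact: measurable_funS mF.
have iL : mu.-integrable D L.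
  apply/integrableP; split; first exact: SD.
  by under eq_integral do rewrite gee0_abs//.
have aeL : {ae mu, forall s, D s -> (L s < +oo)%E}.
  have := @integrable_ae _ _ _ mu D mD L iL; apply: filterS => s H1 Ds.
  by rewrite -ge0_fin_numE//; exact: H1.
have negH : (\int[mu]_(s in D) H^\- s < +oo)%E.
  apply: le_lt_trans Loo; apply: ae_ge0_le_integral => //.
  - by apply: SD; exact: measurable_funeneg.
  - exact: SD.
  - apply: aeS aeL => s Ls Ds; have {}Ls := Ls Ds.
    rewrite funenegE HE//; move: (L0 s) Ls (G0 s).
    case: (L s) => [l||] //; rewrite lee_fin => l0 _; case: (G s) => [r||] //; last first.
      by move=> _; rewrite /= ge_max !lee_fin leNye.
    rewrite lee_fin => r0; rewrite -EFinB -EFinN /maxe; case: ifP => _; rewrite lee_fin//.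
    by rewrite opprB lerBlDr lerDl.
have iH : mu.-integrable D H.
  apply/integrableP; split; first exact: SD.
  have posH : (\int[mu]_(s in D) H^\+ s < +oo)%E.
    have n0 : (0 <= \int[mu]_(s in D) H^\- s)%E by apply: integral_ge0 => *; exact: funeneg_ge0.
    move: Hc; rewrite integralE; move: n0 negH.
    case: (\int[mu]_(s in D) H^\- s)%E => [r||] //= _ _.
    by case: (\int[mu]_(s in D) H^\+ s)%E => [q||] // _; rewrite ltry.
  rewrite -[X in (\int[mu]_(x in D) X x)%E]/(abse \o H) fune_abse.
  rewrite ge0_integralD//=; [by apply: lte_add_pinfty|apply: SD|apply: SD].
  - exact: measurable_funepos.
  - exact: measurable_funeneg.
rewrite -Hc -integralD//; apply: ae_eq_integral => //; [exact: SD| |].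
  by apply: emeasurable_funD; exact: SD.
apply: aeS aeL => s Ls Ds; have {}Ls := Ls Ds; rewrite HE//.
by move: (L0 s) Ls; case: (L s) => [l||] // _ _; rewrite subeK.
Qed.

End SplitBalance.

Section Solution.
Context {R : realType}.
Local Notation mu := (@lebesgue_measure R).
Variables (T B K0 al lam nu : R) (K : R * R -> R) (u fin : R -> R) (f : R -> R -> R).
Hypotheses (T_gt0 : 0 < T) (B_ge0 : 0 <= B) (K0_ge0 : 0 <= K0).
Hypothesis mK : measurable_fun (Rpos `*` Rpos) K.
Hypothesis K_sym : forall x y, 0 < x -> 0 < y -> K (x, y) = K (y, x).
Hypothesis K_ge0 : forall x y, 0 < x -> 0 < y -> 0 <= K (x, y).
Hypothesis K_le : forall x y, 0 < x -> 0 < y -> K (x, y) <= K0 * ((1 + x) * (1 + y)).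
Hypotheses (al_ge0 : 0 <= al) (nu_gt : -1 < nu).
Hypotheses (mu_ : measurable_fun `]0, T[ u).
Hypotheses (u_itv : {ae mu, forall t, 0 < t < T -> 0 <= u t <= B}).
Hypothesis sol : the_solution T u K (frag_rate al lam) (daughter nu) fin f.

Let k := pos_kernel K.
Let g := frag_kernel al lam nu.
Let a := rate al lam.
Let v := truncate_control T B u.

Let mk : jointly_measurable k. Proof. exact: pos_kernel_jm. Qed.
Let k0 : nonneg2 k.
Proof.
move=> x y; have [[x0 y0]|nxy] := pselect (0 < x /\ 0 < y).
  by rewrite /k pos_kernelE//; exact: K_ge0.
by rewrite /k pos_kernel_out.
Qed.
Let mg : jointly_measurable g. Proof. exact: frag_kernel_jm. Qed.
Let g0 : nonneg2 g. Proof. exact: frag_kernel_ge0. Qed.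
Let ma : measurable_fun setT a. Proof. exact: rate_measurable. Qed.
Let mv : measurable_fun setT v.
Proof.
have m1 : measurable_fun setT (\1_(`]0%R, T[ : set R) : R -> R) by exact: measurable_indic.
have -> : v = (fun t => Num.max 0 (Num.min B ((u \_ `]0, T[) t)) * \1_(`]0%R, T[ : set R) t).
  apply/funext => t; rewrite /v /truncate_control mulrC patchE indicE.
  by case: ifP => _; rewrite ?mulr0.
have m2 : measurable_fun setT (u \_ `]0, T[).
  by apply/(measurable_restrict _ (measurable_itv _) measurableT); rewrite setTI.
by mfun.
Qed.

Lemma solution_coefficients : coefficients B K0 k g a v.
Proof.
split => //.
- move=> x y; have [[x0 y0]|nxy] := pselect (0 < x /\ 0 < y).
    by rewrite /k !pos_kernelE// K_sym.
  by rewrite /k pos_kernel_out// pos_kernel_out// => -[y0 x0]; exact: nxy.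
- move=> x y; have [[x0 y0]|nxy] := pselect (0 < x /\ 0 < y).
    by rewrite /k pos_kernelE// (pos_id (ltW x0)) (pos_id (ltW y0)); exact: K_le.
  by rewrite /k pos_kernel_out// !mulr_ge0// addr_ge0// pos_ge0.
- exact: rate_nonneg.
- by move=> t; rewrite mulr_ge0// le_max lexx.
- move=> t; rewrite /v /truncate_control indicE; case: (_ \in _); last by rewrite mul0r.
  by rewrite mul1r ge_max B_ge0 ge_min lexx.
Qed.

Let P x := [/\ f 0 x = fin x,
        (forall t, 0 <= t <= T -> 0 <= f t x),
        {within `[0, T], continuous (fun t => f t x)},
        (forall t, 0 <= t <= T ->
          (\int[mu]_(tau in `]0%R, t[)
             \int[mu]_(y in Rpos) (K (x, y) * f tau y)%:E < +oo)%E /\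
          (\int[mu]_(tau in `]0%R, t[)
             \int[mu]_(y in `]x, +oo[)
               (daughter nu x y * frag_rate al lam y * f tau y)%:E < +oo)%E) &
        (forall t, 0 <= t <= T ->
          ((f t x)%:E = (fin x)%:E
            + \int[mu]_(tau in `]0%R, t[)
                ((u tau)%:E * coag K (f tau) x + frag (frag_rate al lam) (daughter nu) (f tau) x))%E)].

Variable D : set R.
Hypotheses (mD : measurable D) (D_pos : D `<=` Rpos) (DP : forall x, D x -> P x).
Hypothesis D_ae : {ae mu, forall x, 0 < x -> D x}.

Let p := extend T D f.

Let T0 : 0 <= T. Proof. exact: ltW. Qed.
Let in01 c : 0 <= c <= T -> in_X01 (f c). Proof. by case: sol => -[H _] _; exact: H. Qed.
Let f0 c := f c \_ (@Rpos R).
Let mf0 c : 0 <= c <= T -> measurable_fun setT (f0 c).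
Proof.
move=> cT; have [mfc _] := in01 cT.
by apply/(measurable_restrict _ (measurable_itv _) measurableT); rewrite setTI.
Qed.
Let f0E c x : 0 < x -> f0 c x = f c x.
Proof. by move=> x0; rewrite /f0 patchE mem_set// /Rpos /= in_itv/= x0. Qed.
Let f0_out c x : ~ 0 < x -> f0 c x = 0.
Proof. by move=> x0; rewrite /f0 patchE memNset// /Rpos /= in_itv/= andbT. Qed.

Let pE c x : 0 <= c <= T -> D x -> p c x = f c x.
Proof. by move=> cT Dx; rewrite /p /extend clip_id// indicE mem_set// mul1r. Qed.
Let p_out c x : ~ D x -> p c x = 0.
Proof. by move=> Dx; rewrite /p /extend indicE memNset// mul0r. Qed.
Let p_clip c : p c = p (clip T c).
Proof. by rewrite /p /extend (clip_id (clip_itv c T0)). Qed.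
Let D_gt0 x : D x -> 0 < x.
Proof. by move/D_pos; rewrite /Rpos /= in_itv/= andbT. Qed.

Lemma extend_ae c : 0 <= c <= T -> {ae mu, forall x, f0 c x = p c x}.
Proof.
move=> cT; apply: aeS D_ae => x Dx; have [x0|x0] := pselect (0 < x).
  by rewrite f0E// pE//; exact: Dx.
by rewrite f0_out// p_out// => /D_gt0.
Qed.

Let mpc c : measurable_fun setT (p c).
Proof.
rewrite p_clip; have mf := mf0 (clip_itv c T0).
have mi : measurable_fun setT (\1_D : R -> R) by exact: measurable_indic.
rewrite (_ : p _ = fun x => \1_D x * f0 (clip T c) x); first by mfun.
apply/funext => x; have [Dx|nDx] := pselect (D x).
  by rewrite pE ?clip_itv// f0E ?D_gt0// indicE mem_set// mul1r.
by rewrite p_out// indicE memNset// mul0r.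
Qed.

Let p0 : nonneg2 p.
Proof.
move=> c x; have [Dx|nDx] := pselect (D x); last by rewrite p_out.
rewrite p_clip pE ?clip_itv//.
by have [_ H _ _ _] := DP Dx; apply: H; exact: clip_itv.
Qed.

Let p_cont x : continuous (p^~ x).
Proof.
have [Dx|nDx] := pselect (D x); last first.
  by rewrite (_ : p^~ x = fun=> 0); [exact: cst_continuous|apply/funext => t; exact: p_out].
have [_ _ H _ _] := DP Dx.
rewrite (_ : p^~ x = fun t => f (clip T t) x); first exact: continuous_clip H.
by apply/funext => t; rewrite p_clip pE ?clip_itv.
Qed.

(** Joint measurability is not part of [is_solution]; it follows from measurability in the size and
    continuity in time. *)
Lemma extend_jm : jointly_measurable p.
Proof.
apply: caratheodory_measurable => // t x t0.
rewrite (p_clip t) (p_clip 0); congr (p _ _).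
by rewrite /clip !min_r ?(le_trans t0)// !max_l.
Qed.
Let mp := extend_jm.
Let mpos := @measurable_pos R.

Let mom_pE w c : measurable_fun setT w -> 0 <= c <= T ->
  mom w (p c) = (\int[mu]_(x in Rpos) (w x * f c x)%:E)%E.
Proof.
move=> mw cT; rewrite -(mom_ae mw (mf0 cT) (mpc c) (extend_ae cT)).
symmetry; apply: integral_support => x.
  by rewrite /Rpos /= in_itv/= andbT => x0; rewrite f0E.
by rewrite /Rpos /= in_itv/= andbT => x0; rewrite f0_out// mulr0.
Qed.

Lemma extend_mom c : (mom (fun x => 1 + pos x)%R (p c) < +oo)%E.
Proof.
have mp1 : measurable_fun setT (fun x : R => 1 + pos x) by mfun.
rewrite p_clip mom_pE ?clip_itv//; have [_ /integrableP[_ +]] := in01 (clip_itv c T0).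
apply: le_lt_trans; have -> : (\int[mu]_(x in Rpos) ((1 + pos x) * f (clip T c) x)%:E =
    \int[mu]_(x in Rpos) ((1 + x) * f (clip T c) x)%:E)%E.
  apply: eq_integral => x; rewrite inE /Rpos /= in_itv/= andbT => x0.
  by rewrite pos_id// ltW.
by apply: le_trans (lee_abs _) (le_abse_integral _ _ _) => //; 
   [exact: measurable_itv|have [_ /integrableP[]] := in01 (clip_itv c T0)].
Qed.

Let mass := \int[mu]_(x in Rpos) (x * fin x).

Lemma extend_mass c : mom pos (p c) = mass%:E.
Proof.
have mp1 : measurable_fun setT (fun x : R => 1 + pos x) by mfun.
have fin_mass : mom pos (p c) \is a fin_num.
  rewrite ge0_fin_numE; last by apply: mom_ge0; [exact: pos_ge0|exact: p0].
  apply: le_lt_trans (extend_mom c); apply: (mom_le mpos (mpc c) mp1 (mpc c)).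
  - exact: pos_ge0.
  - exact: p0.
  - by move=> x; rewrite ler_wpM2r ?p0// lerDr.
move: fin_mass; rewrite p_clip mom_pE ?clip_itv// => fin_mass.
have [_ cons] := sol; rewrite /mass -(cons _ (clip_itv c T0)) /Rintegral.
rewrite -[LHS]fineK//; congr ((fine _)%:E); apply: eq_integral => x.
by rewrite inE /Rpos /= in_itv/= andbT => x0; rewrite pos_id// ltW.
Qed.

Lemma extend_coag c x : D x -> 0 <= c <= T ->
  coag K (f c) x = ((2^-1)%:E * conv k (p c) (p c) x - (p c x)%:E * lin k (p c) x)%E.
Proof.
move=> Dx cT; have x0 := D_gt0 Dx; rewrite /coag; congr (_ * _ - _ * _)%E.
- rewrite -(conv_ae x mk (mf0 cT) (mpc c) (extend_ae cT)); apply: integral_support => y /=.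
    rewrite in_itv/= => /andP[y0 yx]; have yx0 : 0 < x - y by rewrite subr_gt0.
    by rewrite !f0E// /k pos_kernelE// mulrA.
  move=> nyx; rewrite /k pos_kernel_out ?mul0r// => -[y0].
  by rewrite subr_gt0 => yx; apply: nyx; rewrite in_itv/= y0.
- by rewrite pE.
- rewrite -(lin_ae x mk (mf0 cT) (mpc c) (extend_ae cT)); apply: integral_support => y.
    by rewrite /Rpos /= in_itv/= andbT => y0; rewrite f0E// /k pos_kernelE.
  by rewrite /Rpos /= in_itv/= andbT => y0; rewrite f0_out// mulr0.
Qed.

Lemma extend_frag c x : D x -> 0 <= c <= T ->
  frag (frag_rate al lam) (daughter nu) (f c) x =
  (- (a x * p c x)%:E + lin g (p c) x)%E.
Proof.
move=> Dx cT; have x0 := D_gt0 Dx; rewrite /frag; congr (- _%:E + _)%E.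
  by rewrite pE// /a /rate /frag_rate pos_id// ltW.
rewrite -(lin_ae x mg (mf0 cT) (mpc c) (extend_ae cT)); apply: integral_support => y /=.
  rewrite in_itv/= andbT => xy; have y0 : 0 < y by exact: lt_trans xy.
  by rewrite f0E// /g /frag_kernel /rate pos_id// ltW.
rewrite in_itv/= andbT => nxy; rewrite /g /frag_kernel /daughter indicE memNset ?mulr0 ?mul0r//=.
by rewrite in_itv/= => /andP[_ /nxy].
Qed.

Let lossx x s := loss k a (v s) (p s) x.
Let gainx x s := gain k g (v s) (p s) x.
Let netx x s := ((v s)%:E * ((2^-1)%:E * conv k (p s) (p s) x - (p s x)%:E * lin k (p s) x) +
  (- (a x * p s x)%:E + lin g (p s) x))%E.

Let u_eq : {ae mu, forall s, 0 < s < T -> v s = u s}.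
Proof.
apply: aeS u_itv => s us sT; have /andP[u0 uB] := us sT.
by rewrite /v /truncate_control indicE mem_set /= ?in_itv//= mul1r min_r// max_r.
Qed.

Let ml x : measurable_fun setT (fun s => lin k (p s) x).
Proof. by rewrite /lin; mfun => // s y; rewrite lee_fin mulr_ge0. Qed.
Let mlg x : measurable_fun setT (fun s => lin g (p s) x).
Proof. by rewrite /lin; mfun => // s y; rewrite lee_fin mulr_ge0. Qed.
Let mc x : measurable_fun setT (fun s => conv k (p s) (p s) x).
Proof.
rewrite /conv; mfun => //; move=> s y; rewrite lee_fin; apply: mulr_ge0; first exact: k0.
by apply: mulr_ge0; exact: p0.
Qed.
Let mpx x : measurable_fun setT (p^~ x). Proof. by mfun. Qed.

(** At a fixed size, continuity on [0, T] gives a maximum in time. The loss is then bounded by a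
    constant times the integral of the kernel against the solution, whose time integral is finite by
    definition of a solution, plus a constant. *)
Let loss_fin x : D x -> (\int[mu]_(s in `]0%R, T]) lossx x s < +oo)%E.
Proof.
move=> Dx; have lin_fin : (\int[mu]_(s in `]0%R, T]) lin k (p s) x < +oo)%E.
  have [_ _ _ /(_ T) + _] := DP Dx; rewrite T0 lexx => /(_ isT)[+ _].
  rewrite -integral_itv_bndo_bndc; last exact: measurable_funS (ml x).
  have -> : (\int[mu]_(s in `]0%R, T[) lin k (p s) x =
      \int[mu]_(s in `]0%R, T[) \int[mu]_(y in Rpos) (K (x, y) * f s y)%:E)%E; last by [].
  apply: eq_integral => s; rewrite inE /= in_itv/= => /andP[s0 sT].
  have sT' : 0 <= s <= T by rewrite !ltW.
  rewrite -(lin_ae x mk (mf0 sT') (mpc s) (extend_ae sT')).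
  symmetry; apply: integral_support => y; rewrite /Rpos /= in_itv/= andbT => y0.
    by rewrite f0E// /k pos_kernelE// D_gt0.
  by rewrite f0_out// mulr0.
have [c cT pmax] : exists2 c, c \in `[0, T] & forall s, s \in `[0, T] -> p s x <= p c x.
  by apply: EVT_max => //; exact: continuous_subspaceT.
have pC s : p s x <= p c x.
  by rewrite p_clip; apply: pmax; rewrite in_itv/=; exact: clip_itv.
have a0 : 0 <= a x by exact: rate_nonneg.
have v0 s : 0 <= v s <= B.
  rewrite /v /truncate_control indicE; case: (_ \in _); rewrite ?mul0r ?mul1r ?lexx//.
  by rewrite le_max lexx ge_max B_ge0 ge_min lexx.
have lin0 s : (0 <= lin k (p s) x)%E by apply: lin_ge0.
have mI : measurable_fun setT (fun s => (B * p c x)%:E * lin k (p s) x + (a x * p c x)%:E)%E.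
  by have := ml x => ?; mfun.
apply: le_lt_trans (_ : \int[mu]_(s in `]0%R, T])
    ((B * p c x)%:E * lin k (p s) x + (a x * p c x)%:E) < +oo)%E.
  apply: ge0_le_integralT => //.
  - by have := ml x => ?; have := mpx x => ?; rewrite /lossx /loss; mfun.
  - move=> s; apply: adde_ge0; last by rewrite lee_fin mulr_ge0.
    apply: mule_ge0; first by rewrite lee_fin; case/andP: (v0 s).
    by apply: mule_ge0; rewrite ?lee_fin.
  - move=> s _; apply: leeD; last by rewrite lee_fin ler_wpM2l.
    rewrite muleA -EFinM; apply: lee_wpmul2r => //; rewrite lee_fin.
    by case/andP: (v0 s) => ? ?; apply: ler_pM.
have c0 : 0 <= B * p c x by rewrite mulr_ge0.
rewrite (ge0_integralDT (measurable_itv _)).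
- rewrite (ge0_integralZlT (measurable_itv _) c0 (ml x) lin0).
  apply: lte_add_pinfty; first exact: lte_mul_pinfty.
  rewrite integral_cst//= lebesgue_measure_itv/= lte_fin T_gt0.
  by rewrite -EFinB -EFinM ltry.
- by have := ml x => ?; mfun.
- by mfun.
- by move=> s; rewrite mule_ge0// lee_fin.
- by move=> s; rewrite lee_fin mulr_ge0.
Qed.

Lemma extend_balance x : D x ->
  [/\ (\int[mu]_(s in `]0%R, T]) lossx x s < +oo)%E,
      (\int[mu]_(s in `]0%R, T]) gainx x s < +oo)%E &
      forall t : R, 0 <= t <= T ->
        ((p t x)%:E + \int[mu]_(s in `]0%R, t]) lossx x s =
         (p 0%R x)%:E + \int[mu]_(s in `]0%R, t]) gainx x s)%E].
Proof.
move=> Dx; have Loo := loss_fin Dx.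
have a0 : 0 <= a x by exact: rate_nonneg.
have v0 s : 0 <= v s.
  by rewrite /v /truncate_control mulr_ge0// le_max lexx.
have lin0 s : (0 <= lin k (p s) x)%E by apply: lin_ge0.
have ling0 s : (0 <= lin g (p s) x)%E by apply: lin_ge0.
have conv0 s : (0 <= conv k (p s) (p s) x)%E by apply: conv_ge0.
have L0 s : (0 <= lossx x s)%E.
  apply: adde_ge0; last by rewrite lee_fin mulr_ge0.
  by apply: mule_ge0; [rewrite lee_fin|apply: mule_ge0; rewrite ?lee_fin].
have G0 s : (0 <= gainx x s)%E.
  by apply: adde_ge0 => //; apply: mule_ge0; rewrite // lee_fin divr_ge0.
have := ml x => mlx; have := mlg x => mlgx; have := mc x => mcx; have := mpx x => mpxx.
have mL : measurable_fun setT (lossx x) by rewrite /lossx /loss; mfun.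
have mG : measurable_fun setT (gainx x) by rewrite /gainx /gain; mfun.
have mF : measurable_fun setT (fun s => (- (a x * p s x))%:E + lin g (p s) x)%E by mfun.
have mN : measurable_fun setT (netx x).
  rewrite /netx; apply: emeasurable_funD.
    apply: emeasurable_funM; first by mfun.
    by apply: emeasurable_funB; mfun.
  exact: mF.
have key (t : R) : 0 <= t <= T ->
    (\int[mu]_(s in `]0%R, t]) gainx x s = (p t x - p 0 x)%:E + \int[mu]_(s in `]0%R, t]) lossx x s)%E.
  move=> tT; apply: (split_balance (measurable_itv _) mL mG mN L0 G0).
  - move=> s _ Ls; rewrite /netx /lossx /gainx /loss /gain (EFinM (v s) (2^-1)).
    apply: gain_minus_loss => //; rewrite ?lee_fin//.
    by apply: mule_ge0; rewrite ?lee_fin.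
  - apply: le_lt_trans Loo; apply: ge0_integral_oc_mono => //.
    by case/andP: tT.
  - have [fin_x _ _ _ /(_ t tT) fE] := DP Dx.
    rewrite pE// pE ?lexx// fin_x EFinB fE addeAC subee// add0e.
    rewrite -integral_itv_bndo_bndc; last exact: measurable_funS mN.
    apply: ae_eq_integral => //.
    + exact: measurable_funS mN.
    + apply: (@eq_measurable_fun _ _ _ _ _ (fun s => (u s)%:E * ((2^-1)%:E * conv k (p s) (p s) x -
        (p s x)%:E * lin k (p s) x) + (- (a x * p s x)%:E + lin g (p s) x))%E).
        move=> s; rewrite inE /= in_itv/= => /andP[s0 st].
        have sT : 0 <= s <= T by rewrite ltW//= (le_trans (ltW st))//; case/andP: tT.
        by rewrite extend_coag// extend_frag.
      have SS (F : R -> \bar R) : measurable_fun setT F -> measurable_fun `]0, t[ F.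
        by move=> mF'; exact: measurable_funS mF'.
      apply: emeasurable_funD.
        apply: emeasurable_funM.
          apply/measurable_EFinP; apply: measurable_funS mu_ => //.
          by apply: subset_itv; rewrite bnd_simp//; case/andP: tT.
        by apply: SS; apply: emeasurable_funB; mfun.
      by apply: SS; exact: mF.
    + apply: aeS u_eq => s us; rewrite /= in_itv/= => /andP[s0 st].
      have sT : 0 < s < T by rewrite s0 (lt_le_trans st)//; case/andP: tT.
      have sT' : 0 <= s <= T by case/andP: sT => *; rewrite !ltW.
      by rewrite /netx extend_coag// extend_frag// us.
split => //.
- rewrite key ?T0 ?lexx//; exact: lte_add_pinfty (ltry _) Loo.
- move=> t tT; rewrite key// [RHS]addeA -EFinD; congr (_%:E + _)%E.
  by rewrite addrC subrK.
Qed.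

Lemma extend_evolution : evolution T mass k g a v p.
Proof.
split => //.
- by move=> t x x0; apply: p_out => /D_gt0; rewrite ltNge x0.
- move=> t; apply: le_lt_trans (extend_mom t).
  have m1 : measurable_fun (@setT R) (fun=> 1 : R) by mfun.
  have mp1 : measurable_fun setT (fun x : R => 1 + pos x) by mfun.
  apply: (mom_le m1 (mpc t) mp1 (mpc t)); [by move=> ?; exact: ler01|exact: p0|].
  by move=> x; rewrite ler_wpM2r ?p0// lerDl pos_ge0.
- exact: extend_mass.
- apply: aeS D_ae => x Dx; have [/Dx|nx] := pselect (0 < x); first exact: extend_balance.
  have p0x s : p s x = 0 by apply: p_out => /D_gt0.
  have L0 s : lossx x s = 0%E by rewrite /lossx /loss p0x mul0e mule0 mulr0 adde0.
  have k0x (y z : R) : ~ 0 < y -> k y z = 0 by move=> ny; rewrite /k pos_kernel_out// => -[].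
  have G0 s : gainx x s = 0%E.
    rewrite /gainx /gain /conv /lin !integral0_eq ?mule0 ?adde0// => y _.
      by rewrite /g /frag_kernel /daughter indicE memNset ?mulr0 ?mul0r//= in_itv/= => /andP[].
    have [y0|ny] := pselect (0 < y); last by rewrite k0x// mul0r.
    rewrite /k pos_kernel_out ?mul0r// => -[_]; rewrite subr_gt0 => yx.
    by apply: nx; exact: lt_trans yx.
  have LI (E : set R) : (\int[mu]_(s in E) lossx x s = 0)%E by apply: integral0_eq => s _.
  have GI (E : set R) : (\int[mu]_(s in E) gainx x s = 0)%E by apply: integral0_eq => s _.
  rewrite -/(lossx x) -/(gainx x); split; [by rewrite LI|by rewrite GI|].
  by move=> t tT; rewrite LI GI !p0x.
Qed.

End Solution.

Section SolutionEvolution.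
Context {R : realType}.
Local Notation mu := (@lebesgue_measure R).
Variables (T B K0 al lam nu : R) (K : R * R -> R) (u fin : R -> R) (f : R -> R -> R).
Hypotheses (T_gt0 : 0 < T) (B_ge0 : 0 <= B).
Hypothesis mK : measurable_fun (Rpos `*` Rpos) K.
Hypothesis K_sym : forall x y, 0 < x -> 0 < y -> K (x, y) = K (y, x).
Hypothesis K_ge0 : forall x y, 0 < x -> 0 < y -> 0 <= K (x, y).
Hypothesis K_le : forall x y, 0 < x -> 0 < y -> K (x, y) <= K0 * ((1 + x) * (1 + y)).
Hypotheses (al_ge0 : 0 <= al) (nu_gt : -1 < nu).
Hypotheses (mu_ : measurable_fun `]0, T[ u).
Hypotheses (u_itv : {ae mu, forall t, 0 < t < T -> 0 <= u t <= B}).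
Hypothesis sol : the_solution T u K (frag_rate al lam) (daughter nu) fin f.

Lemma solution_evolution : exists2 p,
  evolution T (\int[mu]_(x in Rpos) (x * fin x)) (pos_kernel K) (frag_kernel al lam nu)
    (rate al lam) (truncate_control T B u) p &
  {ae mu, forall x, (p 0 x = if 0 < x then fin x else 0) /\
    forall t, 0 <= t <= T -> p t x = if 0 < x then f t x else 0}.
Proof.
have [D [mD D_pos DP D_ae]] := ae_pos sol.1.2; exists (extend T D f).
  eapply extend_evolution; eassumption.
apply: aeS D_ae => x Dx; have nD : ~ 0 < x -> ~ D x.
  by move=> nx /D_pos; rewrite /Rpos /= in_itv/= andbT.
rewrite /extend indicE; case: ltP => x0; last first.
  by rewrite memNset ?mul0r; [split=> *; rewrite ?mul0r|apply: nD; rewrite ltNge x0].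
have {}Dx := Dx x0; rewrite mem_set// !mul1r clip_id ?lexx ?ltW//; split.
  by have [] := DP x Dx.
by move=> t tT; rewrite mul1r clip_id.
Qed.

End SolutionEvolution.

(** * Weak topology *)

Section WeakTopology.
Context {R : realType}.
Local Notation mu := (@lebesgue_measure R).

Lemma mRpos : measurable (@Rpos R). Proof. exact: measurable_itv. Qed.

Lemma integral_fin_num (D : set R) (F : R -> \bar R) : measurable D ->
  mu.-integrable D F -> (\int[mu]_(x in D) F x)%E \is a fin_num.
Proof. by move=> mD iF; exact: (@integrable_fin_num _ _ _ mu D mD F iF). Qed.

Lemma integral_test_le (h q phi : R -> R) (M c : R) : 0 <= M ->
  measurable_fun Rpos h -> measurable_fun Rpos phi -> measurable_fun setT q ->
  {ae mu, forall x, 0 < x -> `|phi x| <= M} ->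
  {ae mu, forall x, q x = if 0 < x then h x else 0} ->
  (mom (fun=> 1%R) (fun x => `|q x|%R) <= c%:E)%E ->
  (\int[mu]_(x in Rpos) (`|h x * phi x|%R)%:E <= (M * c)%:E)%E.
Proof.
move=> M0 mh mphi mq phiM qh qc.
have mn : measurable_fun setT (fun x => `|q x|) by mfun.
have mo : measurable_fun setT (fun=> 1 : R) by mfun.
have n0 : nonneg1 (fun x => `|q x|) by move=> x; exact: normr_ge0.
have o0 : nonneg1 (fun=> 1 : R) by move=> ?; exact: ler01.
rewrite EFinM; apply: le_trans (lee_wpmul2l _ qc); last by rewrite lee_fin.
rewrite -(momZ M0 (mo _ _) mn o0 n0) /mom.
have mM : measurable_fun setT (fun x => (M * 1 * `|q x|)%:E) by mfun.
apply: (@le_trans _ _ (\int[mu]_(x in Rpos) (M * 1 * `|q x|)%:E)%E); last first.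
  apply: ge0_subset_integral => //; first exact: mRpos.
  by move=> x _; rewrite lee_fin mulr1 mulr_ge0.
apply: ae_ge0_le_integral => //.
- exact: mRpos.
- by apply/measurable_EFinP; apply: measurableT_comp => //; exact: measurable_funM.
- by move=> x _; rewrite lee_fin mulr1 mulr_ge0.
- exact: measurable_funS mM.
- apply: aeS (aeI phiM qh) => x [pM qx]; rewrite /Rpos /= in_itv/= andbT => x0.
  by rewrite qx x0 lee_fin mulr1 normrM mulrC ler_wpM2r// pM.
Qed.

Lemma integrable_test (h q phi : R -> R) : measurable_fun Rpos h ->
  measurable_fun setT q -> in_Linfty phi ->
  {ae mu, forall x, q x = if 0 < x then h x else 0} ->
  (mom (fun=> 1%R) (fun x => `|q x|%R) < +oo)%E ->
  mu.-integrable Rpos (fun x => (h x * phi x)%:E).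
Proof.
move=> mh mq [mphi [M0 phiM]] qh qoo; apply/integrableP; split.
  by apply/measurable_EFinP; exact: measurable_funM.
have phiM' : {ae mu, forall x, 0 < x -> `|phi x| <= Num.max M0 0}.
  by apply: aeS phiM => x H x0; rewrite le_max H.
have Mge0 : 0 <= Num.max M0 0 by rewrite le_max lexx orbT.
have q0 : (0 <= mom (fun=> 1%R) (fun x => `|q x|%R))%E.
  by apply: mom_ge0 => x; [exact: ler01|exact: normr_ge0].
have qfin : mom (fun=> 1%R) (fun x => `|q x|%R) \is a fin_num by rewrite ge0_fin_numE.
have := @integral_test_le h q phi _ (fine (mom (fun=> 1%R) (fun x => `|q x|%R))) Mge0 mh mphi mq phiM' qh.
by rewrite fineK// lexx => /(_ isT) H; apply: le_lt_trans H (ltry _).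
Qed.

Lemma test_gap_le (h1 h2 q1 q2 phi : R -> R) (M c : R) : 0 <= M ->
  measurable_fun Rpos h1 -> measurable_fun Rpos h2 -> measurable_fun Rpos phi ->
  measurable_fun setT q1 -> measurable_fun setT q2 ->
  {ae mu, forall x, 0 < x -> `|phi x| <= M} ->
  {ae mu, forall x, q1 x = if 0 < x then h1 x else 0} ->
  {ae mu, forall x, q2 x = if 0 < x then h2 x else 0} ->
  (mom (fun=> 1%R) (fun x => `|q1 x - q2 x|%R) <= c%:E)%E ->
  (`| \int[mu]_(x in Rpos) ((h1 x - h2 x) * phi x)%:E |%E <= (M * c)%:E)%E.
Proof.
move=> M0 m1 m2 mphi mq1 mq2 phiM q1E q2E gap_le.
have mh : measurable_fun Rpos (fun x => h1 x - h2 x) by exact: measurable_funB.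
have mq : measurable_fun setT (fun x => q1 x - q2 x) by mfun.
apply: le_trans (@integral_test_le _ _ phi M c M0 mh mphi mq phiM _ gap_le).
  apply: le_abse_integral; first exact: mRpos.
  by apply/measurable_EFinP; exact: measurable_funM.
by apply: aeS (aeI q1E q2E) => x [-> ->]; case: ifP => _; rewrite ?subrr.
Qed.

Lemma lipschitz_in_C_X0w (T c : R) (f p : R -> R -> R) :
  (forall t, 0 <= t <= T -> in_X01 (f t)) -> jointly_measurable p ->
  (forall t, 0 <= t <= T -> {ae mu, forall x, p t x = if 0 < x then f t x else 0}) ->
  (forall t, mom (fun=> 1%R) (fun x => `|p t x|%R) < +oo)%E ->
  (forall s t, 0 <= s -> s <= t -> t <= T ->
    (mom (fun=> 1%R) (fun x => `|p t x - p s x|%R) <= (c * (t - s))%:E)%E) ->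
  in_C_X0w T f.
Proof.
move=> fX mp pf pnum lip; split=> [t tT|phi phi_].
  have [mf /integrableP[mf1 fin1]] := fX t tT.
  apply: (@le_integrable _ _ _ mu _ mRpos (EFin \o f t) _ _ _ (fX t tT).2).
    exact/measurable_EFinP.
  move=> x; rewrite /Rpos /= in_itv/= andbT => x0; rewrite lee_fin normrM.
  by rewrite ler_peMl// ger0_norm ?addr_ge0 ?ltW// ltrDl.
have [mphi [M0 phiM0]] := phi_; pose M := Num.max M0 0.
have M_ge0 : 0 <= M by rewrite le_max lexx orbT.
have phiM : {ae mu, forall x, 0 < x -> `|phi x| <= M}.
  by apply: aeS phiM0 => x H x0; rewrite le_max H.
have mps t : measurable_fun setT (p t) by mfun.
have fphi t : 0 <= t <= T -> mu.-integrable Rpos (fun x => (f t x * phi x)%:E).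
  by move=> tT; apply: (@integrable_test _ (p t)) => //; [exact: (fX t tT).1|exact: pf].
have gap_le s t : 0 <= s <= T -> 0 <= t <= T -> s <= t ->
    `|\int[mu]_(x in Rpos) (f t x * phi x) - \int[mu]_(x in Rpos) (f s x * phi x)| <= M * (c * (t - s)).
  move=> sT tT st; rewrite -(@RintegralB _ _ _ mu) ?fphi//; last exact: mRpos.
  have lip' := lip s t (proj1 (andP sT)) st (proj2 (andP tT)).
  have := test_gap_le M_ge0 (fX t tT).1 (fX s sT).1 mphi (mps t) (mps s) phiM (pf t tT) (pf s sT) lip'.
  have -> : (\int[mu]_(x in Rpos) ((f t x - f s x) * phi x)%:E =
      \int[mu]_(x in Rpos) (f t x * phi x - f s x * phi x)%:E)%E.
    by apply: eq_integral => x _; rewrite mulrBl.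
  have ifin : mu.-integrable Rpos (fun x => (f t x * phi x - f s x * phi x)%:E).
    exact: (@integrableB _ _ _ mu _ mRpos _ _ (fphi t tT) (fphi s sT)).
  rewrite /Rintegral -(fineK (integral_fin_num mRpos ifin)).
  by rewrite abse_EFin lee_fin.
apply/within_itv_continuousP => s e sT e0.
pose C := M * `|c| + 1; have C0 : 0 < C by rewrite ltr_wpDl// mulr_ge0.
exists (e / C); first by rewrite divr_gt0.
have main x y : 0 <= x <= T -> 0 <= y <= T -> x <= y -> `|y - x| < e / C ->
    `|\int[mu]_(z in Rpos) (f y z * phi z) - \int[mu]_(z in Rpos) (f x z * phi z)| < e.
  move=> xT yT xy; rewrite ltr_pdivlMr// => yx; apply: le_lt_trans (gap_le x y xT yT xy) _.
  apply: le_lt_trans yx; rewrite ger0_norm ?subr_ge0// /C.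
  have d0 : 0 <= y - x by rewrite subr_ge0.
  have : M * (c * (y - x)) <= M * (`|c| * (y - x)).
    by rewrite ler_wpM2l// ler_wpM2r// ler_norm.
  by move: (y - x) d0 => d d0; move: `|c| => c'; nra.
move=> s' s'T d; have [ss'|s's] := leP s s'; first exact: main.
by rewrite distrC; apply: main => //; [exact: ltW|rewrite distrC].
Qed.

Lemma cvg_ereal_sup_test (T : R) (f : nat -> R -> R -> R) (g : R -> R -> R)
    (p : nat -> R -> R -> R) (q : R -> R -> R) : 0 <= T ->
  (forall n t, 0 <= t <= T -> in_X01 (f n t)) -> (forall t, 0 <= t <= T -> in_X01 (g t)) ->
  (forall n, jointly_measurable (p n)) -> jointly_measurable q ->
  (forall n t, 0 <= t <= T -> {ae mu, forall x, p n t x = if 0 < x then f n t x else 0}) ->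
  (forall t, 0 <= t <= T -> {ae mu, forall x, q t x = if 0 < x then g t x else 0}) ->
  (forall e : R, 0 < e -> \forall n \near \oo, forall t, 0 <= t <= T ->
    (mom (fun=> 1%R) (fun x => `|p n t x - q t x|%R) <= e%:E)%E) ->
  forall phi, in_Linfty phi ->
    ereal_sup [set `| \int[mu]_(x in Rpos) ((f n t x - g t x) * phi x)%:E |%E
      | t in `[0, T]] @[n --> \oo] --> 0%E.
Proof.
move=> T0 fX gX mp mq pf qg cvg phi [mphi [M0 phiM0]]; pose M := Num.max M0 0.
have M_ge0 : 0 <= M by rewrite le_max lexx orbT.
have phiM : {ae mu, forall x, 0 < x -> `|phi x| <= M}.
  by apply: aeS phiM0 => x H x0; rewrite le_max H.
have mps n t : measurable_fun setT (p n t) by exact: measurable_slice (mp n).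
have mqs t : measurable_fun setT (q t) by mfun.
pose S n := ereal_sup [set `| \int[mu]_(x in Rpos) ((f n t x - g t x) * phi x)%:E |%E
      | t in `[0, T]%classic].
have S0 n : (0 <= S n)%E.
  apply: (@le_trans _ _ (`| \int[mu]_(x in Rpos) ((f n 0 x - g 0 x) * phi x)%:E |)%E); first exact: abse_ge0.
  by apply: ereal_sup_ubound; exists 0 => //=; rewrite in_itv/= lexx.
have SM (e : R) : 0 < e -> \forall n \near \oo, (S n <= e%:E)%E.
  move=> e0; have e1 : 0 < e / (M + 1) by rewrite divr_gt0// ltr_wpDl.
  apply: filterS (cvg _ e1) => n H; apply: ge_ereal_sup => z [t]; rewrite /= in_itv/= => tT <-.
  have := test_gap_le M_ge0 (fX n t tT).1 (gX t tT).1 mphi (mps n t) (mqs t) phiM (pf n t tT) (qg t tT) (H t tT).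
  move=> /le_trans; apply; rewrite lee_fin mulrA ler_pdivrMr ?ltr_wpDl//.
  by rewrite mulrC ler_wpM2l ?lerDl// ltW.
apply/fine_cvgP; split.
  apply: filterS (SM 1 ltr01) => n Sn; rewrite ge0_fin_numE ?S0//.
  exact: le_lt_trans Sn (ltry _).
apply/cvgrPdist_le => e e0; apply: filterS (SM e e0) => n Sn /=.
rewrite sub0r normrN ger0_norm ?fine_ge0 ?S0//.
by rewrite -lee_fin fineK// ge0_fin_numE ?S0// (le_lt_trans Sn (ltry _)).
Qed.

End WeakTopology.

(** * Bounds and truncation for weak limits of controls *)

Section WeakControls.
Context {R : realType}.
Local Notation mu := (@lebesgue_measure R).
Variable T : R.

(** From |u| <= u^2 + 1, the interval being bounded. *)
Lemma in_L2_integrable (u k : R -> R) (c : R) : 0 <= c -> in_L2 T u ->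
  measurable_fun `]0, T[ k -> (forall t, `|k t| <= c) ->
  mu.-integrable `]0, T[ (fun t => (u t * k t)%:E).
Proof.
move=> c0 [mu_ iu] mk kc; have mD : measurable `]0, T[%classic by exact: measurable_itv.
have i1 : mu.-integrable `]0, T[ (fun t => c%:E).
  apply/integrableP; split; first exact: measurable_cst.
  rewrite integral_cst//= lebesgue_measure_itv/= lte_fin.
  by case: ifP => _; rewrite -?EFinB -?EFinM ?ltry// mule0 ltry.
have i2 : mu.-integrable `]0, T[ (fun t => c%:E * ((u t) ^+ 2)%:E + c%:E)%E.
  by apply: integrableD => //; apply: integrableZl.
apply: (@le_integrable _ _ _ mu _ mD (fun t => (u t * k t)%:E) _ _ _ i2).
  by apply/measurable_EFinP; exact: measurable_funM.
move=> t _; rewrite -EFinM -EFinD lee_fin normrM.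
rewrite [leRHS]ger0_norm; last by rewrite addr_ge0// mulr_ge0// sqr_ge0.
apply: (@le_trans _ _ (`|u t| * c)); first by rewrite ler_wpM2l.
rewrite -(normr_id (u t)) -[in leRHS]real_normK ?num_real// normr_id.
move: `|u t| (normr_ge0 (u t)) => v v0; have := sqr_ge0 (v - 1).
by rewrite !expr2; nra.
Qed.

(** Tested with the indicator [h] of the set where [us] exceeds [B]: the limit gives that the
    integral of (us - B) h is at most 0, while the integrand is nonnegative, so it vanishes almost
    everywhere. *)
Lemma weak_limit_le (B : R) (u : nat -> R -> R) (us : R -> R) :
  weakly_cvg_L2 T u us -> (forall n, {ae mu, forall t, 0 < t < T -> u n t <= B}) ->
  {ae mu, forall t, 0 < t < T -> us t <= B}.
Proof.
move=> [uL usL weak] uB; have mD : measurable `]0, T[%classic by exact: measurable_itv.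
pose S := `]0, T[%classic `&` us @^-1` `]B, +oo[%classic.
have mS : measurable S by apply: usL.1 => //; exact: measurable_itv.
pose h t : R := \1_S t.
have mh : measurable_fun setT h by exact: measurable_indic.
have mhD : measurable_fun `]0, T[ h by exact: measurable_funS mh.
have h01 t : 0 <= h t <= 1 by rewrite /h indicE; case: (_ \in _); rewrite /= ?lexx ler01.
have h1 t : `|h t| <= 1 by rewrite ger0_norm; case/andP: (h01 t).
have cst2 (b : R) : in_L2 T (fun=> b).
  split; first exact: measurable_cst.
  apply/integrableP; split; first exact: measurable_cst.
  rewrite integral_cst//= lebesgue_measure_itv/= lte_fin.
  by case: ifP => _; rewrite -?EFinB -?EFinM ?ltry// mule0 ltry.
have hL : in_L2 T h.
  split => //; apply: (@le_integrable _ _ _ mu _ mD (fun t => ((h t) ^+ 2)%:E) _ _ _ (cst2 1).2).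
    by apply/measurable_EFinP; exact: measurable_funX.
  by move=> t _; rewrite lee_fin expr1n normr1 normrX exprn_ile1.
have iB := in_L2_integrable ler01 (cst2 B) mhD h1.
have iu n := in_L2_integrable ler01 (uL n) mhD h1.
have ius := in_L2_integrable ler01 usL mhD h1.
have lim_le : \int[mu]_(t in `]0, T[) (us t * h t) <= \int[mu]_(t in `]0, T[) (B * h t).
  apply: cvgr_to_le (weak h hL) _; apply: nearW => n.
  rewrite /Rintegral fine_le ?integral_fin_num//.
  have uBn : {ae mu, forall t, `]0, T[%classic t -> ((u n t * h t)%:E <= (B * h t)%:E)%E}.
    apply: aeS (uB n) => t H; rewrite /= in_itv/= => tT.
    by rewrite lee_fin; apply: ler_wpM2r; [case/andP: (h01 t)|exact: H].
  rewrite -sube_ge0 ?integral_fin_num// -integralB//.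
  have mF : measurable_fun `]0, T[ (fun t => (B * h t)%:E - (u n t * h t)%:E)%E.
    by apply: emeasurable_funB; [case/integrableP: iB|case/integrableP: (iu n)].
  rewrite -(@ae_eq_integral _ _ _ mu _ (fun t => (B * h t)%:E - (u n t * h t)%:E)%E
    (fun t => `|(B * h t)%:E - (u n t * h t)%:E|%E)) //.
  - by apply: integral_ge0 => t _; exact: abse_ge0.
  - exact: measurableT_comp.
  - apply: aeS uBn => t H tT; have := H tT; rewrite lee_fin => Ht.
    by rewrite -EFinB abse_EFin ger0_norm ?subr_ge0.
have z0 : (\int[mu]_(t in `]0%R, T[) `|((us t - B) * h t)%:E| = 0)%E.
  apply/eqP; rewrite eq_le; apply/andP; split; last by apply: integral_ge0 => *; exact: abse_ge0.
  have -> : (\int[mu]_(t in `]0%R, T[) `|((us t - B) * h t)%:E| =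
     \int[mu]_(t in `]0%R, T[) ((us t * h t)%:E - (B * h t)%:E))%E.
    apply: eq_integral => t _; rewrite -EFinB -mulrBl abse_EFin ger0_norm//.
    rewrite /h indicE; case: (boolP (t \in S)) => [|_]; last by rewrite mulr0.
    by rewrite inE => -[_ /=]; rewrite in_itv/= andbT mulr1 subr_ge0 => /ltW.
  rewrite integralB// sube_le0 ?integral_fin_num//.
  by rewrite -(fineK (integral_fin_num mD ius)) -(fineK (integral_fin_num mD iB)) lee_fin.
have mz : measurable_fun `]0, T[ (fun t => ((us t - B) * h t)%:E).
  apply/measurable_EFinP; apply: measurable_funM => //; apply: measurable_funB => //.
  exact: usL.1.
have [/(_ z0) H _] := ae_eq_integral_abs mu mD mz.
apply: aeS H => t H tT; have /H : `]0, T[%classic t by rewrite /= in_itv.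
move=> [] /eqP; rewrite /= mulf_eq0 => /orP[/eqP e|/eqP e]; first by lra.
rewrite leNgt; apply/negP => Bu; move: e; rewrite /h indicE mem_set ?oner_eq0//.
  by move/eqP; rewrite oner_eq0.
by split; rewrite /= in_itv/= ?tT// Bu.
Qed.

Lemma weakly_cvg_L2N (u : nat -> R -> R) (us : R -> R) :
  weakly_cvg_L2 T u us -> weakly_cvg_L2 T (fun n t => - u n t) (fun t => - us t).
Proof.
have LN h : in_L2 T h -> in_L2 T (fun t => - h t).
  move=> [mh ih]; split; first exact: measurableT_comp.
  by apply: eq_integrable ih => // t _; rewrite sqrrN.
move=> [uL usL weak]; split=> [n||h hL]; [exact: LN|exact: LN|].
have := weak _ (LN h hL).
have E (w : R -> R) : \int[mu]_(t in `]0, T[) (w t * - h t) = \int[mu]_(t in `]0, T[) (- w t * h t).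
  by apply: eq_Rintegral => t _; rewrite mulrN mulNr.
by rewrite E; under eq_fun do rewrite E.
Qed.

Lemma weak_limit_itv (b B : R) (u : nat -> R -> R) (us : R -> R) :
  weakly_cvg_L2 T u us -> (forall n, {ae mu, forall t, 0 < t < T -> b <= u n t <= B}) ->
  {ae mu, forall t, 0 < t < T -> b <= us t <= B}.
Proof.
move=> weak ub.
have up : {ae mu, forall t, 0 < t < T -> us t <= B}.
  by apply: weak_limit_le weak _ => n; apply: aeS (ub n) => t H /H/andP[].
have lo : {ae mu, forall t, 0 < t < T -> - us t <= - b}.
  apply: weak_limit_le (weakly_cvg_L2N weak) _ => n.
  by apply: aeS (ub n) => t H /H/andP[]; rewrite lerN2.
by apply: aeS (aeI up lo) => t [H1 H2] tT; rewrite H1// -lerN2 H2.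
Qed.

Lemma truncate_control_cvg (B : R) (u : nat -> R -> R) (us : R -> R) :
  weakly_cvg_L2 T u us -> (forall n, {ae mu, forall t, 0 < t < T -> 0 <= u n t <= B}) ->
  weakly_cvg_bounded T (fun n => truncate_control T B (u n)) (truncate_control T B us).
Proof.
move=> weak ub k mk [c kc]; have usb := weak_limit_itv weak ub.
have [uL usL cvg] := weak; have mD : measurable `]0, T[%classic by exact: measurable_itv.
have c0 : 0 <= c by exact: le_trans (kc 0).
have mkD : measurable_fun `]0, T[ k by exact: measurable_funS mk.
have kL : in_L2 T k.
  split => //; apply: (@le_integrable _ _ _ mu _ mD _ (fun t => (1 * (c ^+ 2))%:E)).
  - by apply/measurable_EFinP; exact: measurable_funX.
  - move=> t _; rewrite mul1r lee_fin !normrX lerXn2r ?nnegrE//.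
    by rewrite (ger0_norm c0).
  - apply/integrableP; split; first exact: measurable_cst.
    rewrite integral_cst//= lebesgue_measure_itv/= lte_fin.
    by case: ifP => _; rewrite -?EFinB -?EFinM ?ltry// mule0 ltry.
have E (w : R -> R) : in_L2 T w -> {ae mu, forall t, 0 < t < T -> 0 <= w t <= B} ->
    \int[mu]_(t in `]0, T]) (truncate_control T B w t * k t) = \int[mu]_(t in `]0, T[) (w t * k t).
  move=> wL wb; have iw := in_L2_integrable c0 wL mkD kc.
  have ae : ae_eq mu `]0, T[%classic (fun t => (truncate_control T B w t * k t)%:E)
      (fun t => (w t * k t)%:E).
    apply: aeS wb => t H; rewrite /= in_itv/= => tT; have /andP[w0 wB] := H tT.
    by rewrite /truncate_control indicE mem_set /= ?in_itv//= mul1r min_r// max_r.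
  have mt : measurable_fun `]0, T[ (fun t => (truncate_control T B w t * k t)%:E).
    apply/measurable_EFinP; apply: measurable_funM => //; rewrite /truncate_control.
    apply: measurable_funM; first exact: measurable_indic.
    by apply: measurable_maxr; [exact: measurable_cst|apply: measurable_minr; [exact: measurable_cst|exact: wL.1]].
  have mw : measurable_fun `]0, T[ (fun t => (w t * k t)%:E) by case/integrableP: iw.
  rewrite /Rintegral -(integral_itv_bndo_bndc mt); congr (fine _).
  exact: ae_eq_integral.
rewrite (E us usL usb) (_ : (fun n => _) = (fun n => \int[mu]_(t in `]0, T[) (u n t * k t))).
  exact: cvg.
by apply/funext => n; exact: E.
Qed.

End WeakControls.

(** * Convergence *)

Section Convergence.
Context {R : realType}.
Local Notation mu := (@lebesgue_measure R).

Lemma nat_upper_bound (x : R) : exists n : nat, x <= n%:R.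
Proof.
by exists (Num.truncn x).+1; exact/ltW/truncnS_gt.
Qed.

Lemma decay_cvg0 (s c d : R) : s < 1 -> 0 < c -> 0 < d ->
  \forall j \near \oo, decay s (c * j.+1%:R) <= d.
Proof.
move=> s1 c0 d0; have s0 : 0 < 1 - s by rewrite subr_gt0.
have [n0 n0P] := nat_upper_bound ((d^-1) `^ (1 - s)^-1 / c).
exists n0 => // j /= nj; have X0 : 0 <= (d^-1) `^ (1 - s)^-1 by exact: powR_ge0.
have H : (d^-1) `^ (1 - s)^-1 <= 1 + c * j.+1%:R.
  apply: (@le_trans _ _ (c * j.+1%:R)); last by rewrite lerDr.
  rewrite -ler_pdivrMl// mulrC; apply: le_trans n0P _.
  by rewrite ler_nat leqW.
rewrite /decay -[leRHS]invrK lef_pV2 ?posrE ?invr_gt0//; last first.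
  by rewrite powR_gt0// ltr_wpDr// mulr_ge0// ltW.
rewrite -[leLHS](_ : ((d^-1) `^ (1 - s)^-1) `^ (1 - s) = _); last first.
  by rewrite -powRrM mulVf ?gt_eqF// powRr1// invr_ge0 ltW.
by apply: ge0_ler_powR; rewrite ?nnegrE ?(ltW s0)// (le_trans X0).
Qed.

Lemma excess_cvg0 (p : R -> R) (m d : R) : measurable_fun setT p -> nonneg1 p ->
  mom pos p = m%:E -> 0 < d ->
  \forall j \near \oo, (mom (fun x => pos x - trunc j.+1%:R x)%R p <= d%:E)%E.
Proof.
move=> mp p0 pm d0; have mpos := @measurable_pos R.
have mt (j : nat) : measurable_fun setT (trunc (j.+1%:R : R)) by exact: trunc_measurable.
suff H : mom (fun x => pos x - trunc j.+1%:R x)%R p @[j --> \oo] --> 0%E.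
  have /fine_cvgP[ffin /cvgrPdist_le fcvg] := H.
  apply: filterS2 ffin (fcvg d d0) => j fj /= dj; rewrite -(fineK fj) lee_fin.
  by move: dj; rewrite sub0r normrN => /(le_trans (ler_norm _)).
apply: (dominated_cvg0 measurableT (G := fun x => (pos x * p x)%:E)).
- by move=> j; have := mt j => ?; mfun.
- by mfun.
- by move=> j x; rewrite lee_fin mulr_ge0// subr_ge0 trunc_le_pos.
- move=> j x _; rewrite lee_fin ler_wpM2r// gerBl.
  by rewrite trunc_ge0.
- by rewrite -/(mom pos p) pm ltry.
- apply: aeW => x _; apply: cvg_near_cst; have [n nP] := nat_upper_bound (pos x).
  exists n => // j /= nj; rewrite /trunc min_l ?subrr ?mul0r//.
  by apply: le_trans nP _; rewrite ler_nat leqW.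
Qed.

Variables (T m B Kh muh am A lm nl : R).
Variables (k : nat -> R -> R -> R) (al lam nu : nat -> R) (v : nat -> R -> R).
Variables (ks : R -> R -> R) (als lams nus : R) (vs : R -> R).
Variables (p : nat -> R -> R -> R) (q : R -> R -> R).
Hypotheses (T_ge0 : 0 <= T) (Kh_ge0 : 0 <= Kh) (am_gt0 : 0 < am).
Hypotheses (muh_ge0 : 0 <= muh) (muh_lt : muh < lm) (nl_gt : -1 < nl).
Hypothesis C : forall n, coefficients B Kh (k n) (frag_kernel (al n) (lam n) (nu n))
  (rate (al n) (lam n)) (v n).
Hypothesis Cs : coefficients B Kh ks (frag_kernel als lams nus) (rate als lams) vs.
Hypothesis E : forall n, evolution T m (k n) (frag_kernel (al n) (lam n) (nu n))
  (rate (al n) (lam n)) (v n) (p n).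
Hypothesis Es : evolution T m ks (frag_kernel als lams nus) (rate als lams) vs q.
Hypothesis init : forall n, {ae mu, forall x, p n 0 x = q 0 x}.
Hypothesis al_itv : forall n, am <= al n <= A.
Hypothesis als_itv : am <= als <= A.
Hypothesis lam_itv : forall n, lm <= lam n <= 1.
Hypothesis lams_itv : lm <= lams <= 1.
Hypothesis nu_itv : forall n, nl <= nu n <= 0.
Hypothesis nus_itv : nl <= nus <= 0.
Hypothesis k_le : forall n x y, k n x y <= Kh * ((1 + pos x) `^ muh * (1 + pos y) `^ muh).
Hypothesis ks_le : forall x y, ks x y <= Kh * ((1 + pos x) `^ muh * (1 + pos y) `^ muh).
Hypothesis k_cvg : forall x y, k n x y @[n --> \oo] --> ks x y.
Hypothesis al_cvg : al n @[n --> \oo] --> als.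
Hypothesis lam_cvg : lam n @[n --> \oo] --> lams.
Hypothesis nu_cvg : nu n @[n --> \oo] --> nus.
Hypothesis v_cvg : weakly_cvg_bounded T v vs.

Let N := (2 + nl) / (1 + nl).
Let N_ge0 : 0 <= N. Proof. exact: fragment_number_ge0. Qed.
Let A_ge0 : 0 <= A.
Proof. by have /andP[H1 H2] := als_itv; exact: le_trans (le_trans (ltW am_gt0) H1) H2. Qed.
Let lm_le1 : lm <= 1. Proof. by have /andP[H1 H2] := lams_itv; exact: le_trans H1 H2. Qed.
Let muh_lt1 : muh < 1. Proof. exact: lt_le_trans lm_le1. Qed.
Let m_ge0 : 0 <= m. Proof. exact: mass_ge0 Es. Qed.
Let B_ge0 : 0 <= B. Proof. exact: ctrl_bound_ge0 Cs. Qed.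
Let mpos := @measurable_pos R.
Let mp n : jointly_measurable (p n). Proof. exact: evo_meas (E n). Qed.
Let mq : jointly_measurable q. Proof. exact: evo_meas Es. Qed.
Let p0 n : nonneg2 (p n). Proof. exact: evo_ge0 (E n). Qed.
Let q0 : nonneg2 q. Proof. exact: evo_ge0 Es. Qed.
Let mps n t : measurable_fun setT (p n t). Proof. exact: measurable_slice (mp n). Qed.
Let mqs t : measurable_fun setT (q t). Proof. exact: measurable_slice mq. Qed.
Let mone : measurable_fun (@setT R) (fun=> 1 : R). Proof. by mfun. Qed.
Let one0 : nonneg1 (fun=> 1 : R). Proof. by move=> x; exact: ler01. Qed.

Let rate_leA (a l : R) y : am <= a <= A -> lm <= l <= 1 -> rate a l y <= A * (1 + pos y).
Proof.
move=> /andP[a1 a2] /andP[l1 l2].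
have l01 : 0 < l <= 1 by rewrite l2 andbT (lt_le_trans _ l1)// (le_lt_trans muh_ge0).
apply: le_trans (rate_le (le_trans (ltW am_gt0) a1) y l01) _.
by rewrite ler_wpM2r// addr_ge0// pos_ge0.
Qed.

(** The number of fragments (2 + nu) / (1 + nu) = 1 + 1 / (1 + nu) decreases in nu, so its value [N]
    at the lower bound [nl] serves for all n. *)
Let lin_leN (a l n : R) : am <= a <= A -> nl <= n <= 0 ->
  forall (w : R -> R) (c1 c2 y : R), measurable_fun setT w ->
  nonneg1 w -> 0 <= c1 -> 0 <= c2 -> (forall x, w x <= c1 + c2 * pos x) ->
  (lin (flip (frag_kernel a l n)) w y <= (rate a l y * (c1 * N + c2 * pos y))%:E)%E.
Proof.
move=> /andP[a1 a2] /andP[n1 n2] w c1 c2 y mw w0 c10 c20 wc.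
have a0 : 0 <= a by exact: le_trans (ltW am_gt0) a1.
have n0 : -1 < n by exact: lt_le_trans nl_gt n1.
apply: le_trans (lin_frag_le l a0 n0 y mw w0 c10 c20 wc) _; rewrite lee_fin.
apply: ler_wpM2l; first exact: rate_nonneg.
rewrite lerD2r ler_wpM2l// /N.
have e1 (z : R) : -1 < z -> (2 + z) / (1 + z) = 1 + (1 + z)^-1.
  by move=> z1; field; rewrite gt_eqF//; move: z1; lra.
rewrite !e1// lerD2l lef_pV2 ?posrE; first by rewrite lerD2l.
- by move: n0; lra.
- by have := nl_gt; lra.
Qed.

Let num0 := fine (mom (fun=> 1%R) (q 0)).
Let mom_p0 n : mom (fun=> 1%R) (p n 0) = mom (fun=> 1%R) (q 0).
Proof. exact: mom_ae (init n). Qed.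

(** The factor from Gronwall's inequality depends only on [A], [N] and [T], and all evolutions start
    with the same number of particles; so [M] is uniform in n. *)
Let num_bound : exists2 M : R, 0 <= M &
  (forall n t, 0 <= t <= T -> (mom (fun=> 1%R) (p n t) <= M%:E)%E) /\
  (forall t, 0 <= t <= T -> (mom (fun=> 1%R) (q t) <= M%:E)%E).
Proof.
have [j jP] := nat_upper_bound (2 * (A * N * T)).
have ANT : A * N * T <= j%:R / 2 by rewrite ler_pdivlMr// mulrC.
have num00 : 0 <= num0 by rewrite fine_ge0// mom_ge0.
exists (2 ^+ j * (num0 + m)); first by rewrite mulr_ge0// addr_ge0.
have up (h : R -> R -> R) : (forall t, mom (fun=> 1%R) (h t) < +oo)%E -> nonneg2 h ->
    (forall t, 0 <= t <= T -> fine (mom (fun=> 1%R) (h t)) + m <= 2 ^+ j * (num0 + m)) ->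
    forall t, 0 <= t <= T -> (mom (fun=> 1%R) (h t) <= (2 ^+ j * (num0 + m))%:E)%E.
  move=> hfin h0 H t tT; have hf : mom (fun=> 1%R) (h t) \is a fin_num.
    by rewrite ge0_fin_numE// mom_ge0.
  rewrite -(fineK hf) lee_fin; apply: le_trans (H t tT).
  by rewrite lerDl.
split=> [n|].
- apply: up => // [t|t tT]; first exact: evo_num (E n) t.
  have := num_le (C n) (E n) A_ge0 N_ge0 (fun y => rate_leA y (al_itv n) (lam_itv n))
    (@lin_leN _ (lam n) _ (al_itv n) (nu_itv n)) ANT tT.
  by rewrite /= mom_p0.
- apply: up => // [t|t tT]; first exact: evo_num Es t.
  exact: (num_le Cs Es A_ge0 N_ge0 (fun y => rate_leA y als_itv lams_itv)
    (@lin_leN _ lams _ als_itv nus_itv) ANT tT).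
Qed.

(* The cutoff L = 2 r of the weight is fixed first, to absorb the tails; the
   remaining errors then vanish as n grows. *)
Theorem evolution_cvg (e : R) : 0 < e -> \forall n \near \oo, forall t, 0 <= t <= T ->
  (mom (fun=> 1%R) (fun x => `|p n t x - q t x|%R) <= e%:E)%E.
Proof.
move=> e0; have [M M0 [numf nump]] := num_bound.
pose c1 := (lm - muh) / 4; have c10 : 0 < c1 by rewrite divr_gt0// subr_gt0.
have P0 : 0 <= 2 * B * Kh * (M + m) by rewrite !mulr_ge0// addr_ge0.
have [C1 C10 absorb] := growth_absorb P0 am_gt0 muh_ge0 (ltW muh_lt1) muh_lt c10.
pose Q := 4 * M * T + 4 / am * (4 / (lm - muh) * ((M + m) * (1 + C1 * T))).
have Q0 : 0 <= Q.
  have d0 : 0 <= lm - muh by rewrite subr_ge0 ltW.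
  apply: addr_ge0; first by rewrite !mulr_ge0.
  apply: mulr_ge0; first by rewrite divr_ge0// ltW.
  apply: mulr_ge0; first by rewrite divr_ge0.
  by rewrite mulr_ge0 ?addr_ge0// mulr_ge0.
pose q4 x : R := (1 + pos x) `^ (1 + muh).
have mq4 : measurable_fun setT q4 by rewrite /q4; mfun.
have q40 : nonneg1 q4 by move=> x; exact: powR_ge0.
have highf n : (\int[mu]_(s in `]0%R, T]) mom q4 (p n s) <= Q%:E)%E.
  have /andP[a1 _] := al_itv n; have /andP[l1 l2] := lam_itv n.
  have /andP[n1 n2] := nu_itv n.
  exact: (moment_bound (C n) (E n) T_ge0 M0 Kh_ge0 am_gt0 a1 l1 l2 muh_ge0 muh_lt
    (lt_le_trans nl_gt n1) n2 (k_le n) (numf n) C10 (fun x => absorb _ _ x a1 l1)).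
have /andP[as1 as2] := als_itv; have /andP[ls1 ls2] := lams_itv.
have /andP[ns1 ns2] := nus_itv; have ns0 := lt_le_trans nl_gt ns1.
have highq : (\int[mu]_(s in `]0%R, T]) mom q4 (q s) <= Q%:E)%E.
  exact: (moment_bound Cs Es T_ge0 M0 Kh_ge0 am_gt0 as1 ls1 ls2 muh_ge0 muh_lt
    ns0 ns2 ks_le nump C10 (fun x => absorb _ _ x as1 ls1)).
pose a n := rate (al n) (lam n); pose as_ := rate als lams.
pose W := 2 * (M + m); have W0 : 0 <= W by rewrite mulr_ge0// addr_ge0.
pose Z r := fine (mom (fun x => pos x - trunc r x)%R (q 0)).
pose c := 2 * B * Kh * (M + m) * Q; have c0 : 0 <= c by exact: mulr_ge0.
(* The bound of [tail_bound] divided by r / 3. Both [Z r], the part of the initial mass removed by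
   truncation at [r], and the decay tend to 0, so [tau r] is o(1 / r). *)
pose tau r := 3 / r * (Z r + c * decay muh (r / 2)).
have mz r : measurable_fun setT (fun x => pos x - trunc r x : R).
  by have := trunc_measurable r => ?; mfun.
have z0 r : nonneg1 (fun x => pos x - trunc r x : R) by move=> x; rewrite subr_ge0 trunc_le_pos.
have Zfin r : 0 <= r -> mom (fun x => pos x - trunc r x)%R (q 0) \is a fin_num.
  move=> r0; rewrite ge0_fin_numE; last exact: mom_ge0.
  apply: (@le_lt_trans _ _ (mom pos (q 0))); last by rewrite (evo_mass Es) ltry.
  apply: (mom_le (mz r) (mqs 0) mpos (mqs 0) (z0 r) (q0 0)) => x.
  by rewrite ler_wpM2r ?q0// gerBl trunc_ge0.
have tail_le (h : R -> R -> R) (al' lam' : R) r : 0 < r ->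
    mom (fun x => pos x - trunc r x)%R (h 0) = mom (fun x => pos x - trunc r x)%R (q 0) ->
    ((r / 3)%:E * \int[mu]_(s in `]0%R, T]) mom (fun x => beyond (2 * r) x * rate al' lam' x)%R (h s)
     <= mom (fun x => pos x - trunc r x)%R (h 0%R) +
        (2 * B * Kh * (decay muh (r / 2) * (M + m)) * Q)%:E)%E ->
    (\int[mu]_(s in `]0%R, T]) mom (fun x => beyond (2 * r) x * rate al' lam' x)%R (h s)
     <= (tau r)%:E)%E.
  move=> r0 -> H; have r3 : 0 < r / 3 by rewrite divr_gt0.
  rewrite -(@lee_pmul2l _ (r / 3)%:E)//; apply: le_trans H _.
  rewrite -(fineK (Zfin r (ltW r0))) -EFinD -EFinM lee_fin -/(Z r) /tau /c.
  by rewrite le_eqVlt; apply/orP; left; apply/eqP; field; rewrite gt_eqF.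
have tailf n r : 0 < r ->
    (\int[mu]_(s in `]0%R, T]) mom (fun x => beyond (2 * r) x * a n x)%R (p n s) <= (tau r)%:E)%E.
  move=> r0; have /andP[a1 _] := al_itv n; have /andP[l1 l2] := lam_itv n.
  have /andP[n1 n2] := nu_itv n; apply: tail_le => //; first exact: mom_ae (init n).
  exact: (tail_bound (C n) (E n) T_ge0 M0 Kh_ge0 am_gt0 a1 l1 l2 muh_ge0 muh_lt
    (lt_le_trans nl_gt n1) n2 (k_le n) (numf n) r0 Q0 (highf n)).
have tailq r : 0 < r ->
    (\int[mu]_(s in `]0%R, T]) mom (fun x => beyond (2 * r) x * as_ x)%R (q s) <= (tau r)%:E)%E.
  move=> r0; apply: tail_le => //.
  exact: (tail_bound Cs Es T_ge0 M0 Kh_ge0 am_gt0 as1 ls1 ls2 muh_ge0 muh_lt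
    ns0 ns2 ks_le nump r0 Q0 highq).
pose Qc := 2 * Q; have Qc0 : 0 <= Qc by rewrite mulr_ge0.
(* The time integral of the Gronwall coefficient is at most j / 2 for all n, so the factor 2 ^ j is
   fixed before the cutoff is chosen. *)
have [j jP] := nat_upper_bound (2 * (B * Kh * Qc + N * A * T)).
pose E2 := 2 ^+ j : R; have E20 : 0 < E2 by rewrite exprn_gt0.
have BK0 : 0 <= B * Kh by exact: mulr_ge0.
have [r r1 rP] : exists2 r : R, 1 <= r &
    E2 * (B * Kh * (decay muh (2 * r) * W) * Qc + N * (1 + 2 * r) * (2 * tau r)) <= e / 2.
  (* The factor 1 + L = 1 + 2 r of the weight meets the 1 / r of [tau]: (1 + 2 r) * 2 * 3 / r = 6 (1
     / r + 2), which is at most 18 for r >= 1. The parameter [d] bounds the decays and the excess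
     mass, and [S * d] is e / 2. *)
  pose S := E2 * (B * Kh * W * Qc + N * 18 * (1 + c)) + 1.
  have S0 : 0 < S.
    apply: ltr_wpDl => //; apply: mulr_ge0; [exact: ltW|apply: addr_ge0].
      by apply: mulr_ge0 => //; exact: mulr_ge0.
    by apply: mulr_ge0; [exact: mulr_ge0|exact: addr_ge0].
  pose d := e / 2 / S; have d0 : 0 < d by rewrite !divr_gt0.
  have n1 := decay_cvg0 muh_lt1 (ltr0n _ 2) d0.
  have half0 : 0 < 2^-1 :> R by [].
  have n2 := decay_cvg0 muh_lt1 half0 d0.
  have n3 := excess_cvg0 (mqs 0) (q0 0) (evo_mass Es 0) d0.
  have [i [[d1 d2] d3]] := filter_ex (filterI (filterI n1 n2) n3).
  have i1 : 1 <= i.+1%:R :> R by rewrite ler1n.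
  exists i.+1%:R => //; move: (i.+1%:R : R) i1 d1 d2 d3 => r r1 d1 d2 d3.
  have r0 : 0 < r by exact: lt_le_trans r1.
  have Zd : Z r <= d by rewrite -lee_fin fineK// Zfin// ltW.
  have taud : (1 + 2 * r) * (2 * tau r) <= 18 * (1 + c) * d.
    rewrite /tau; rewrite mulrC in d2; move: (decay muh _) (decay_ge0 muh (r / 2)) d2 => D D0 d2.
    have Z0 : 0 <= Z r by rewrite fine_ge0// mom_ge0.
    have -> : (1 + 2 * r) * (2 * (3 / r * (Z r + c * D))) =
        (6 * (r^-1 + 2)) * (Z r + c * D) by field; rewrite gt_eqF.
    have ri : r^-1 <= 1 by rewrite invf_le1.
    have ri0 : 0 <= r^-1 by rewrite invr_ge0 ltW.
    apply: (@le_trans _ _ (18 * (Z r + c * D))).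
      by apply: ler_wpM2r; [rewrite addr_ge0// mulr_ge0|lra].
    rewrite -mulrA ler_wpM2l// mulrDl mul1r lerD// ler_wpM2l//.
  have -> : e / 2 = S * d by rewrite /d [RHS]mulrC divfK// gt_eqF.
  apply: (@le_trans _ _ (E2 * (B * Kh * W * Qc + N * 18 * (1 + c)) * d)); last first.
    by rewrite ler_wpM2r ?(ltW d0)// /S lerDl.
  rewrite -[leRHS]mulrA; apply: ler_wpM2l; [exact: ltW|rewrite [leRHS]mulrDl; apply: lerD].
    have -> : B * Kh * (decay muh (2 * r) * W) * Qc = B * Kh * W * Qc * decay muh (2 * r) by ring.
    by apply: ler_wpM2l => //; apply: mulr_ge0 => //; exact: mulr_ge0.
  have -> : N * 18 * (1 + c) * d = N * (18 * (1 + c) * d) by ring.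
  by rewrite -[leLHS]mulrA; apply: ler_wpM2l.
have r0 : 0 < r by exact: lt_le_trans r1.
pose L := 2 * r; have L0 : 0 < L by rewrite mulr_gt0.
(* With [L] fixed, the errors that vanish with n are all required to be at most [d]. The sum
   collects the factors with which they enter the stability bound; the last summand makes room for
   the remainder itself. *)
pose S := E2 * (j%:R / 2 + N * (1 + L) + (1 + L) * (B * Kh * W + 2 * A) * T + (1 + L)) + 2.
have S0 : 0 < S.
  have L10 : 0 <= 1 + L by rewrite addr_ge0// ltW.
  have NL : 0 <= N * (1 + L) by exact: mulr_ge0.
  have BKW : 0 <= B * Kh * W + 2 * A by apply: addr_ge0; exact: mulr_ge0.
  have T3 : 0 <= (1 + L) * (B * Kh * W + 2 * A) * T by apply: mulr_ge0 => //; exact: mulr_ge0.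
  have j2 : 0 <= j%:R / 2 :> R by exact: divr_ge0.
  apply: ltr_wpDl => //; apply: mulr_ge0; first exact: ltW.
  by apply: addr_ge0 => //; apply: addr_ge0 => //; exact: addr_ge0.
pose d := e / 2 / S; have d0 : 0 < d by rewrite !divr_gt0.
have q_mom s : 0 <= s <= T -> (mom (fun x => 1 + pos x)%R (q s) <= W%:E)%E.
  move=> sT; rewrite (mom_add1pos Es); apply: (@le_trans _ _ (M%:E + m%:E)%E).
    by rewrite leeD2r// nump.
  by rewrite -EFinD lee_fin /W ler_peMl ?ler1n// addr_ge0.
have mg (x y z : R) := frag_kernel_jm x y z.
have err_cvg : (\int[mu]_(s in `]0%R, T]) err B (k n) ks (frag_kernel (al n) (lam n) (nu n))
    (frag_kernel als lams nus) (a n) as_ q s)%E @[n --> \oo] --> 0%E.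
  apply: (@err_cvg0 _ T B W Kh A N) => //.
  - by move=> n; exact: coag_meas (C n).
  - by move=> n; exact: coag_ge0 (C n).
  - exact: coag_meas Cs.
  - exact: coag_ge0 Cs.
  - by move=> n; exact: frag_ge0 (C n).
  - exact: frag_ge0 Cs.
  - by move=> n; exact: rate_measurable.
  - by move=> n; exact: rate_ge0 (C n).
  - exact: rate_measurable.
  - exact: rate_ge0 Cs.
  - by move=> n x y; exact: coag_le (C n) x y.
  - by move=> x y; exact: coag_le Cs x y.
  - by move=> n y; exact: rate_leA.
  - by move=> y; exact: rate_leA.
  - by move=> y; apply: rate_cvg => //; [move=> n; have /andP[l1 _] := lam_itv n|];
      exact: lt_le_trans (le_lt_trans muh_ge0 muh_lt) _.
  - move=> n y; apply: le_trans (@lin_leN _ (lam n) _ (al_itv n) (nu_itv n) (fun=> 1) 1 0 y mone one0 ler01 (lexx 0) _) _.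
      by move=> x; rewrite mul0r addr0.
    by rewrite mul1r mul0r addr0.
  - move=> y; apply: le_trans (@lin_leN _ lams _ als_itv nus_itv (fun=> 1) 1 0 y mone one0 ler01 (lexx 0) _) _.
      by move=> x; rewrite mul0r addr0.
    by rewrite mul1r mul0r addr0.
  - move=> y; apply: (@frag_kernel_dist_cvg0 _ al lam nu als lams nus A nl) => //.
    + by move=> n; have /andP[l1 _] := lam_itv n; exact: lt_le_trans (le_lt_trans muh_ge0 muh_lt) _.
    + exact: lt_le_trans (le_lt_trans muh_ge0 muh_lt) _.
    + by move=> n x; exact: rate_leA.
    + by move=> n; have /andP[a1 _] := al_itv n; exact: le_trans (ltW am_gt0) a1.
    + by move=> n; case/andP: (nu_itv n).
    + by move=> n; case/andP: (nu_itv n).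
have near1 : \forall n \near \oo, (\int[mu]_(s in `]0%R, T]) err B (k n) ks
    (frag_kernel (al n) (lam n) (nu n)) (frag_kernel als lams nus) (a n) as_ q s <= d%:E)%E.
  have /fine_cvgP[ffin /cvgrPdist_le fcvg] := err_cvg.
  apply: filterS2 ffin (fcvg d d0) => n fn /= dn; rewrite -(fineK fn) lee_fin.
  by move: dn; rewrite sub0r normrN => /(le_trans (ler_norm _)).
have near2 := remainder_cvg T_ge0 W0 Kh_ge0 (ltW muh_lt1) (coag_meas Cs) (coag_ge0 Cs) mq q0
  ks_le q_mom highq (fun n => ctrl_meas (C n)) (fun n => ctrl_ge0 (C n)) (fun n => ctrl_le (C n))
  (ctrl_meas Cs) (ctrl_ge0 Cs) (ctrl_le Cs) v_cvg d0.
apply: filterS2 near1 near2 => n n_err n_rem t tT.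
have mT : measurable `]0, T]%classic by exact: measurable_itv.
have totalE (w : R -> R) s : measurable_fun setT w -> nonneg1 w ->
    mom w (total (p n) q s) = (mom w (p n s) + mom w (q s))%E.
  by move=> mw w0; exact: (momDr mw (mps n s) (mqs s) w0 (p0 n s) (q0 s)).
have total_int (w : R -> R) : measurable_fun setT w -> nonneg1 w ->
    (\int[mu]_(s in `]0%R, T]) mom w (total (p n) q s) =
     \int[mu]_(s in `]0%R, T]) mom w (p n s) + \int[mu]_(s in `]0%R, T]) mom w (q s))%E.
  move=> mw w0; under eq_integral => s _ do rewrite (totalE w s mw w0).
  apply: (ge0_integralDT mT (measurable_mom (E n) mw w0) (measurable_mom Es mw w0)) => s.
    exact: mom_ge0 w0 (p0 n s).
  exact: mom_ge0 w0 (q0 s).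
have int_Q4 : (\int[mu]_(s in `]0%R, T]) mom q4 (total (p n) q s) <= Qc%:E)%E.
  rewrite (total_int q4 mq4 q40) /Qc mulr2n mulrDl mul1r EFinD.
  exact: leeD (highf n) highq.
have m4 : measurable_fun setT (fun s => mom q4 (total (p n) q s)).
  rewrite (_ : (fun s => _) = (fun s => mom q4 (p n s) + mom q4 (q s))%E); last first.
    by apply/funext => s; exact: totalE.
  exact: emeasurable_funD (measurable_mom (E n) mq4 q40) (measurable_mom Es mq4 q40).
have M40 s : (0 <= mom q4 (total (p n) q s))%E.
  by apply: mom_ge0 => // x; apply: addr_ge0; [exact: p0|exact: q0].
have int_b : (\int[mu]_(s in `]0%R, T]) ((B * Kh)%:E * mom q4 (total (p n) q s) + (N * A)%:E)
    <= (j%:R / 2)%:E)%E.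
  have NA0 : 0 <= N * A by exact: mulr_ge0.
  have m4' : measurable_fun setT (fun s => (B * Kh)%:E * mom q4 (total (p n) q s))%E by mfun.
  have M40' s : (0 <= (B * Kh)%:E * mom q4 (total (p n) q s))%E.
    by apply: mule_ge0; [rewrite lee_fin|exact: M40].
  rewrite (ge0_integralDT mT m4' (measurable_cst _) M40'); last by move=> s; rewrite lee_fin.
  rewrite (ge0_integralZlT mT BK0 m4 M40) integral_cst//=.
  have -> : mu `]0, T]%classic = T%:E.
    rewrite lebesgue_measure_itv/= lte_fin; case: ltP => T0; first by rewrite -EFinB subr0.
    by congr (_%:E); apply/eqP; rewrite eq_le T_ge0 T0.
  apply: (@le_trans _ _ ((B * Kh * Qc)%:E + (N * A * T)%:E)%E).
    by rewrite (EFinM (B * Kh)) (EFinM (N * A)); apply: leeD2r; apply: lee_wpmul2l; rewrite ?lee_fin.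
  by rewrite -EFinD lee_fin ler_pdivlMr// mulrC.
have ba0 (h : R -> R) : nonneg1 h -> nonneg1 (fun x => beyond L x * h x).
  by move=> h0 x; apply: mulr_ge0; [exact: beyond_ge0|exact: h0].
have mb := @beyond_measurable R L; have man := rate_measurable (al n) (lam n).
have mas := rate_measurable als lams.
have an0 : nonneg1 (a n) := rate_ge0 (C n); have as0 : nonneg1 as_ := rate_ge0 Cs.
have mban : measurable_fun setT (fun x => beyond L x * a n x) by rewrite /a; mfun.
have mbas : measurable_fun setT (fun x => beyond L x * as_ x) by rewrite /as_; mfun.
have mad : measurable_fun setT (fun x => `|a n x - as_ x|) by rewrite /a /as_; mfun.
have ad0 : nonneg1 (fun x => `|a n x - as_ x|) by move=> x; exact: normr_ge0.
have merr : measurable_fun setT (fun s => err B (k n) ks (frag_kernel (al n) (lam n) (nu n))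
    (frag_kernel als lams nus) (a n) as_ q s).
  apply: (@err_measurable _ B k (fun n => frag_kernel (al n) (lam n) (nu n)) ks
    (frag_kernel als lams nus) a as_ q) => //.
  - by move=> i; exact: coag_meas (C i).
  - exact: coag_meas Cs.
  - by move=> i; exact: rate_measurable.
have rate_err s : (mom (fun x => `|a n x - as_ x|)%R (q s) <= err B (k n) ks
    (frag_kernel (al n) (lam n) (nu n)) (frag_kernel als lams nus) (a n) as_ q s)%E.
  exact: (@rate_dist_le_err _ B k (fun n => frag_kernel (al n) (lam n) (nu n)) ks
    (frag_kernel als lams nus) a as_ q).
have int_tail : (\int[mu]_(s in `]0%R, T]) mom (fun x => beyond L x * a n x)%R (total (p n) q s)
    <= (2 * tau r + d)%:E)%E.
  have -> : (2 * tau r + d)%:E = ((tau r)%:E + (tau r + d)%:E)%E.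
    by rewrite -EFinD mulr2n mulrDl mul1r addrA.
  rewrite (total_int _ mban (ba0 _ an0)).
  apply: leeD; first exact: tailf.
  (* For [q] the tail bound is available with its own rate [as_], not with the rate [a n] that
     occurs here; the difference of the rates is part of [err]. *)
  apply: (@le_trans _ _ (\int[mu]_(s in `]0%R, T]) (mom (fun x => beyond L x * as_ x)%R (q s) +
      err B (k n) ks (frag_kernel (al n) (lam n) (nu n)) (frag_kernel als lams nus) (a n) as_ q s))%E).
    apply: (ge0_le_integralT mT (measurable_mom Es mban (ba0 _ an0))).
    - exact: emeasurable_funD (measurable_mom Es mbas (ba0 _ as0)) merr.
    - by move=> s; exact: mom_ge0 (ba0 _ an0) (q0 s).
    move=> s _; apply: (@le_trans _ _ (mom (fun x => beyond L x * as_ x)%R (q s) +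
        mom (fun x => `|a n x - as_ x|)%R (q s))%E); last by apply: leeD2l; exact: rate_err.
    rewrite -(momD mbas (mqs s) mad (ba0 _ as0) ad0 (q0 s)).
    apply: (mom_le mban (mqs s) _ (mqs s) (ba0 _ an0) (q0 s)).
      exact: measurable_funD mbas mad.
    move=> x; apply: ler_wpM2r; first exact: q0.
    have H := ler_norm (a n x - as_ x); rewrite beyondP; case: ifP => _.
      by rewrite !mul1r -lerBlDl.
    by rewrite !mul0r add0r.
  rewrite (ge0_integralDT mT (measurable_mom Es mbas (ba0 _ as0)) merr).
  - by rewrite EFinD; apply: leeD; [exact: tailq|exact: n_err].
  - by move=> s; exact: mom_ge0 (ba0 _ as0) (q0 s).
  - by move=> s; apply: le_trans (rate_err s); exact: mom_ge0 ad0 (q0 s).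
have tau0 : 0 <= 2 * tau r + d.
  rewrite -lee_fin; apply: le_trans int_tail; apply: integral_ge0 => s _; apply: mom_ge0.
    exact: ba0.
  by move=> x; apply: addr_ge0; [exact: p0|exact: q0].
have := stability (C n) Cs (E n) Es (init n) T_ge0 A_ge0 N_ge0 Kh_ge0 M0 (ltW muh_lt1)
  (k_le n) ks_le (fun y => rate_leA y (al_itv n) (lam_itv n)) (fun y => rate_leA y als_itv lams_itv)
  (@lin_leN _ (lam n) _ (al_itv n) (nu_itv n)) (@lin_leN _ lams _ als_itv nus_itv)
  (numf n) nump L0 (ltW d0) Qc0 tau0 (ltW d0) n_rem int_b int_Q4 int_tail n_err tT.
move=> /le_trans; apply; rewrite lee_fin -/E2 -/W.
have -> : e = e / 2 + S * d.
  by rewrite /d [S * _]mulrC divfK ?gt_eqF// -splitr.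
have := rP; rewrite /S -/L; move: (decay muh L) (tau r) => D ta H.
apply: (@le_trans _ _ (E2 * (B * Kh * (D * W) * Qc + N * (1 + L) * (2 * ta)) +
   (E2 * (j%:R / 2 + N * (1 + L) + (1 + L) * (B * Kh * W + 2 * A) * T + (1 + L)) + 2) * d)).
  apply: (@le_trans _ _ (E2 * (B * Kh * (D * W) * Qc + N * (1 + L) * (2 * ta)) +
   (E2 * (j%:R / 2 + N * (1 + L) + (1 + L) * (B * Kh * W + 2 * A) * T + (1 + L)) + 1) * d)).
    by rewrite le_eqVlt; apply/orP; left; apply/eqP; ring.
  by rewrite lerD2l ler_wpM2r ?(ltW d0)// lerD2l; lra.
by rewrite lerD2r.
Qed.

End Convergence.

(** * Continuity in time and proof of the convergence theorem *)

Section Regularity.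
Context {R : realType}.
Local Notation mu := (@lebesgue_measure R).

Lemma evolution_in_C_X0w (T m B K0 al lam nu : R) (k : R -> R -> R) (v : R -> R)
    (f p : R -> R -> R) : 0 <= T ->
  coefficients B K0 k (frag_kernel al lam nu) (rate al lam) v ->
  evolution T m k (frag_kernel al lam nu) (rate al lam) v p ->
  0 <= al -> 0 < lam <= 1 -> -1 < nu -> (forall t, 0 <= t <= T -> in_X01 (f t)) ->
  (forall t, 0 <= t <= T -> {ae mu, forall x, p t x = if 0 < x then f t x else 0}) ->
  in_C_X0w T f.
Proof.
move=> T0 C E al0 lam01 nu1 fX pf; pose N := (2 + nu) / (1 + nu).
have N0 : 0 <= N by exact: fragment_number_ge0.
have gN := lin_frag_le lam al0 nu1.
have [j jP] := nat_upper_bound (2 * (al * N * T)).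
have ANT : al * N * T <= j%:R / 2 by rewrite ler_pdivlMr// mulrC.
have aA y := rate_le al0 y lam01.
have [M M0 num] := num_bounded C E al0 N0 aA gN ANT T0.
apply: (lipschitz_in_C_X0w fX (evo_meas E) pf).
  move=> t; rewrite (_ : (fun x => `|p t x|) = p t); first exact: evo_num E t.
  by apply/funext => x; rewrite ger0_norm//; exact: evo_ge0 E t x.
by move=> s t s0 st tT; exact: (evolution_lipschitz C E al0 N0 aA gN M0 num s0 st tT).
Qed.

Lemma pos_kernel_le (K : R * R -> R) (c muh : R) : 0 <= c ->
  (forall x y, 0 < x -> 0 < y -> K (x, y) <= c * (1 + x) `^ muh * (1 + y) `^ muh) ->
  forall x y, pos_kernel K x y <= c * ((1 + pos x) `^ muh * (1 + pos y) `^ muh).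
Proof.
move=> c0 Kle x y; have [[x0 y0]|nxy] := pselect (0 < x /\ 0 < y).
  by rewrite pos_kernelE// (pos_id (ltW x0)) (pos_id (ltW y0)) mulrA; exact: Kle.
by rewrite pos_kernel_out// mulr_ge0// mulr_ge0// powR_ge0.
Qed.

Lemma pos_kernel_cvg (K : nat -> R * R -> R) (Ks : R * R -> R) :
  (forall x y, 0 < x -> 0 < y -> K n (x, y) @[n --> \oo] --> Ks (x, y)) ->
  forall x y, pos_kernel (K n) x y @[n --> \oo] --> pos_kernel Ks x y.
Proof.
move=> KK x y; have [[x0 y0]|nxy] := pselect (0 < x /\ 0 < y).
  rewrite pos_kernelE//; under eq_fun do rewrite pos_kernelE//.
  exact: KK.
rewrite pos_kernel_out//; under eq_fun do rewrite pos_kernel_out//.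
exact: cvg_cst.
Qed.

End Regularity.

Unset Implicit Arguments.

Theorem theorem3p3 (R : realType) (T umin umax : R)
  (T_gt0 : 0 < T) (umin_gt0 : 0 < umin) (umin_le1 : umin <= 1)
  (umax_ge1 : 1 <= umax)
  (fin : R -> R) (fin_X01 : in_X01 fin)
  (fin_ge0 : {ae leb, forall x, 0 < x -> 0 <= fin x})
  (u : nat -> R -> R) (K : nat -> R * R -> R) (alpha0 lambda nu : nat -> R)
  (f : nat -> R -> R -> R)
  (u_control : forall n, control T umin umax (u n))
  (coef_structural : forall n, structural (K n) (alpha0 n) (lambda n) (nu n))
  (f_sol : forall n, the_solution T (u n) (K n)
     (frag_rate (alpha0 n) (lambda n)) (daughter (nu n)) fin (f n))
  (ustar : R -> R) (Kstar : R * R -> R) (alpha0star lambdastar nustar : R)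
  (C1 : weakly_cvg_L2 T u ustar)
  (C2_cvg : forall A : set (R * R), compact A -> A `<=` Rpos `*` Rpos ->
     {uniform A, K n @[n --> \oo] --> Kstar})
  (muhat K0hat : R) (muhat_gt0 : 0 < muhat) (K0hat_gt0 : 0 < K0hat)
  (C2_bound : forall n x y, 0 < x -> 0 < y ->
     K n (x, y) <= K0hat * (1 + x) `^ muhat * (1 + y) `^ muhat)
  (C2_bound_star : forall x y, 0 < x -> 0 < y ->
     Kstar (x, y) <= K0hat * (1 + x) `^ muhat * (1 + y) `^ muhat)
  (C3_alpha0 : alpha0 n @[n --> \oo] --> alpha0star)
  (alpha0star_gt0 : 0 < alpha0star)
  (C3_lambda : lambda n @[n --> \oo] --> lambdastar)
  (lambdastar_itv : 0 < lambdastar < 1)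
  (muhat_lt_lambdastar : muhat < lambdastar)
  (C4 : nu n @[n --> \oo] --> nustar) (nustar_itv : -1 < nustar <= 0)
  (fstar : R -> R -> R)
  (fstar_sol : the_solution T ustar Kstar
     (frag_rate alpha0star lambdastar) (daughter nustar) fin fstar) :
  cvg_C_X0w T f fstar.
Proof.
have T_ge0 := ltW T_gt0; have umax0 : 0 <= umax by exact: le_trans ler01 umax_ge1.
have muh1 : muhat < 1 by case/andP: lambdastar_itv => _; exact: lt_trans.
have muh0 := ltW muhat_gt0; have Kh0 := ltW K0hat_gt0.
have lam01 n : 0 < lambda n <= 1.
  (* The structural assumptions give the positivity of [lambda n] through 0 <= mu < lambda. *)
  have [_ _ _ [K0 [mu_ [_ /andP[mu0 _] _ mul]]] _ l1 _] := coef_structural n.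
  by rewrite (le_lt_trans mu0 mul) ltW.
have K_cvg x y : 0 < x -> 0 < y -> K n (x, y) @[n --> \oo] --> Kstar (x, y).
  move=> x0 y0; have sub : [set (x, y)] `<=` @Rpos R `*` @Rpos R.
    by move=> _ -> /=; rewrite /Rpos /= !in_itv/= x0 y0.
  have := C2_cvg _ (@compact_set1 _ (x, y)) sub; rewrite uniform_set1 => H.
  exact: H.
have K_ge0 n := structural_ge0 (coef_structural n).
have K_sym n := structural_sym (coef_structural n).
(* The limit coefficients are not assumed to be structural: sign, symmetry and measurability of
   [Kstar] are inherited from the pointwise limit. *)
have Ks_ge0 x y : 0 < x -> 0 < y -> 0 <= Kstar (x, y).
  by move=> x0 y0; apply: cvgr_to_ge (K_cvg x y x0 y0) _; apply: nearW => n; exact: K_ge0.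
have Ks_sym x y : 0 < x -> 0 < y -> Kstar (x, y) = Kstar (y, x).
  move=> x0 y0; apply: (cvg_unique _ (K_cvg x y x0 y0)); first exact: Rhausdorff.
  rewrite (_ : (fun n => K n (x, y)) = (fun n => K n (y, x))); first exact: K_cvg.
  by apply/funext => n; exact: K_sym.
have mKs : measurable_fun (Rpos `*` Rpos) Kstar.
  apply: (measurable_fun_cvg (fun n => structural_meas (coef_structural n))).
  by move=> [x y]; rewrite /Rpos /= !in_itv/= !andbT => -[x0 y0]; exact: K_cvg.
have quad (k : R * R -> R) :
    (forall x y, 0 < x -> 0 < y -> k (x, y) <= K0hat * (1 + x) `^ muhat * (1 + y) `^ muhat) ->
    forall x y, 0 < x -> 0 < y -> k (x, y) <= K0hat * ((1 + x) * (1 + y)).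
  move=> H x y x0 y0; apply: le_trans (H x y x0 y0) _; rewrite -mulrA ler_wpM2l//.
  by apply: ler_pM; rewrite ?powR_ge0//; apply: powR1D_le; exact: ltW.
have K_le n := quad (K n) (C2_bound n); have Ks_le := quad Kstar C2_bound_star.
have u_itv n : {ae leb, forall t, 0 < t < T -> 0 <= u n t <= umax}.
  by apply: aeS (u_control n).2 => t H /H/andP[H1 ->]; rewrite (le_trans (ltW umin_gt0)).
have us_itv := weak_limit_itv C1 u_itv; have [uL usL _] := C1.
have al_ge0 n := structural_alpha0 (coef_structural n).
have nu_gt n : -1 < nu n by case/andP: (structural_nu (coef_structural n)).
have nus_gt : -1 < nustar by case/andP: nustar_itv.
have als_ge0 := ltW alpha0star_gt0.
have Cn n := solution_coefficients (lambda n) umax0 Kh0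
  (structural_meas (coef_structural n)) (K_sym n) (K_ge0 n) (K_le n) (al_ge0 n) (nu_gt n) (uL n).1.
have Cs := solution_coefficients lambdastar umax0 Kh0 mKs Ks_sym Ks_ge0 Ks_le als_ge0 nus_gt usL.1.
have /choice[p /all_and2[E pf]] n : exists p,
    evolution T (\int[leb]_(x in Rpos) (x * fin x)) (pos_kernel (K n))
      (frag_kernel (alpha0 n) (lambda n) (nu n)) (rate (alpha0 n) (lambda n))
      (truncate_control T umax (u n)) p /\
    {ae leb, forall x, (p 0 x = if 0 < x then fin x else 0) /\
      forall t, 0 <= t <= T -> p t x = if 0 < x then f n t x else 0}.
  have [p H1 H2] := solution_evolution T_gt0 umax0 (structural_meas (coef_structural n))
    (K_ge0 n) (al_ge0 n) (nu_gt n) (uL n).1 (u_itv n) (f_sol n).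
  by exists p.
have [q Es qf] := solution_evolution T_gt0 umax0 mKs Ks_ge0 als_ge0 nus_gt usL.1 us_itv fstar_sol.
have fX n t : 0 <= t <= T -> in_X01 (f n t) by case: (f_sol n) => -[H _] _; exact: H.
have gX t : 0 <= t <= T -> in_X01 (fstar t) by case: fstar_sol => -[H _] _; exact: H.
have pf' n t : 0 <= t <= T -> {ae leb, forall x, p n t x = if 0 < x then f n t x else 0}.
  by move=> tT; apply: aeS (pf n) => x [_ H]; exact: H.
have qf' t : 0 <= t <= T -> {ae leb, forall x, q t x = if 0 < x then fstar t x else 0}.
  by move=> tT; apply: aeS qf => x [_ H]; exact: H.
have lams01 : 0 < lambdastar <= 1 by case/andP: lambdastar_itv => -> /ltW.
split=> [n||phi phi_].
- exact: evolution_in_C_X0w T_ge0 (Cn n) (E n) (al_ge0 n) (lam01 n) (nu_gt n) (fX n) (pf' n).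
- exact: evolution_in_C_X0w T_ge0 Cs Es als_ge0 lams01 nus_gt gX qf'.
apply: (cvg_ereal_sup_test T_ge0 fX gX (fun n => evo_meas (E n)) (evo_meas Es) pf' qf' _ phi_).
(* Margins around the limits: [lm] is halfway between [muhat] and [lambdastar], [nl] halfway between
   -1 and [nustar], and [am] halfway between 0 and [alpha0star]. The coefficients respect them from
   some index on. *)
move=> e e0; pose am := alpha0star / 2; pose A := alpha0star + 1.
pose lm := (muhat + lambdastar) / 2; pose nl := (-1 + nustar) / 2.
have am0 : 0 < am by rewrite divr_gt0.
have lt1 : muhat < lm by rewrite /lm ltr_pdivlMr//; lra.
have lt2 : lm < lambdastar by rewrite /lm ltr_pdivrMr//; lra.
have lt3 : -1 < nl by rewrite /nl ltr_pdivlMr//; lra.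
have lt4 : nl < nustar by rewrite /nl ltr_pdivrMr//; lra.
have lt5 : am < alpha0star by rewrite /am ltr_pdivrMr//; lra.
have lt6 : alpha0star < A by rewrite /A; lra.
have near1 : \forall n \near \oo, [/\ am <= alpha0 n <= A, lm <= lambda n & nl <= nu n].
  near=> n; split; last 2 first.
  - by near: n; exact: cvgr_ge C3_lambda _ lt2.
  - by near: n; exact: cvgr_ge C4 _ lt4.
  - by apply/andP; split; near: n; [exact: cvgr_ge C3_alpha0 _ lt5|exact: cvgr_le C3_alpha0 _ lt6].
(* [evolution_cvg] asks for the margins at every index, so the sequence is started at [n0];
   convergence is insensitive to the shift. *)
have [n0 _ Hn0] := near1; pose sh n := (n + n0)%N.
have Hsh n : [/\ am <= alpha0 (sh n) <= A, lm <= lambda (sh n) & nl <= nu (sh n)].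
  by apply: Hn0; rewrite /= leq_addl.
have shift (V : ptopologicalType) (w : nat -> V) (l : V) :
    w n @[n --> \oo] --> l -> w (sh n) @[n --> \oo] --> l.
  by move=> wl; have := wl; rewrite -[X in X -> _](cvg_shiftn n0).
have init n : {ae leb, forall x, p (sh n) 0 x = q 0 x}.
  by apply: aeS (aeI (pf (sh n)) qf) => x [[-> _] [-> _]].
have weak := truncate_control_cvg C1 u_itv.
have near2 : \forall n \near \oo, forall t, 0 <= t <= T ->
    (mom (fun=> 1%R) (fun x => `|p (sh n) t x - q t x|%R) <= e%:E)%E.
  apply: (@evolution_cvg R T (\int[leb]_(x in Rpos) (x * fin x)) umax K0hat muhat am A lm nl
    (fun n => pos_kernel (K (sh n))) (fun n => alpha0 (sh n)) (fun n => lambda (sh n))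
    (fun n => nu (sh n)) (fun n => truncate_control T umax (u (sh n)))
    (pos_kernel Kstar) alpha0star lambdastar nustar (truncate_control T umax ustar)
    (fun n => p (sh n)) q T_ge0 Kh0 am0 muh0 lt1 lt3 (fun n => Cn (sh n)) Cs
    (fun n => E (sh n)) Es init) => //.
  - by move=> n; case: (Hsh n).
  - by rewrite !ltW.
  - by move=> n; have [_ -> _] := Hsh n; case/andP: (lam01 (sh n)).
  - by case/andP: lams01 => _ ->; rewrite ltW.
  - move=> n; have [_ _ ->] := Hsh n.
    by case/andP: (structural_nu (coef_structural (sh n))).
  - by case/andP: nustar_itv => _ ->; rewrite ltW.
  - by move=> n; exact: (pos_kernel_le Kh0 (C2_bound (sh n))).
  - exact: (pos_kernel_le Kh0 C2_bound_star).
  - by move=> x y; apply: (shift _ (fun n => pos_kernel (K n) x y)); exact: pos_kernel_cvg.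
  - exact: shift.
  - exact: shift.
  - exact: shift.
  - by move=> k mk kb; exact: (shift R (fun n => \int[leb]_(t in `]0, T]) (truncate_control T umax (u n) t * k t)) _ (weak k mk kb)).
have [n1 _ Hn1] := near2; exists (n1 + n0)%N => // n /= nn t tT.
have n0n : (n0 <= n)%N by apply: leq_trans nn; exact: leq_addl.
have := Hn1 (n - n0)%N; rewrite /= leq_subRL// addnC => /(_ nn t tT).
by rewrite /sh subnK.
Unshelve. all: by end_near. Qed.
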